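(* Assume Continuity, Strong convexity, Stochastic noise and Unbiased compression (all stated in the context). Let the iterates be generated by EF-SOBA-MSC with $\rho\ge C_f/\mu_g$, $\beta<\min\{\frac2{\mu_g+L_g},\frac{\mu_gn}{96\tilde\omega_\ell\tilde\omega_1L_g^2}\}$, $\gamma\le\min\{\frac1{L_g},\frac{\mu_gn}{432\tilde\omega_\ell\tilde\omega_1L_g^2}\}$, $\delta_\ell=(1+\tilde\omega_\ell)^{-1}$, $\delta_u=(1+\tilde\omega_u)^{-1}$, $m_{x,i}^0=h_{x,i}^0$ for $i=1,\dots,n$, and $\alpha\le\min\{\frac1{2L_{\nabla\Phi}},C_4\}$, where $$C_4^{-2}=2\Big[\frac{4L_{\nabla\Phi}^2}{\theta^2}+72\tilde\omega_u(1+\tilde\omega_u)L_5^2+12\tilde\omega_2(L_2^2+25\kappa_g^2L_1^2)\Big(\frac{4L_{y^\star}^2}{\beta^2\mu_g^2}+\frac{16\tilde\omega_\ell\tilde\omega_1L_3^2\beta}{\mu_gn}\Big)+12\tilde\omega_2L_g^2\Big(\frac{12L_{z^\star}^2}{\gamma^2\mu_g^2}+\frac{72\tilde\omega_\ell\tilde\omega_1L_4^2\gamma}{\mu_gn}\Big)\Big].$$ Then \begin{align*} \frac1K\sum_{k=0}^{K-1}\mathbb E\|\nabla\Phi(x^k)\|_2^2\le{}&\frac{2\Delta_\Phi^0}{K\alpha}+\frac{2\Delta_x^0}{K\theta}+\frac{12\tilde\omega_u(1+\tilde\omega_u)\theta\Delta_h^0}{K}+\frac{24\tilde\omega_2(L_2^2+25\kappa_g^2L_1^2)\Delta_y^0}{\mu_gK\beta}+\frac{48\tilde\omega_2L_g^2\Delta_z^0}{\mu_gK\gamma}\\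 &+\frac{48\tilde\omega_2(1+6\tilde\omega_\ell\tilde\omega_1)(L_2^2+25\kappa_g^2L_1^2)\beta}{\mu_gn}\tilde\sigma^2+\Big(\frac{2\theta}n+36\tilde\omega_u(1+\tilde\omega_u)\theta^2+\frac{72\tilde\omega_2(1+6\tilde\omega_\ell\tilde\omega_1)L_g^2\gamma}{\mu_gn}\Big)\tilde\sigma_1^2\\ &+\frac{48\tilde\omega_2\tilde\omega_\ell(1+4\tilde\omega_\ell)(L_2^2+25\kappa_g^2L_1^2)\beta}{\mu_gKn^2}\sum_{i=1}^n\|\mathbb E(D_{y,i}^0)-m_{y,i}^0\|_2^2\\ &+\frac{72\tilde\omega_2\tilde\omega_\ell(1+4\tilde\omega_\ell)L_g^2\gamma}{\mu_gKn^2}\sum_{i=1}^n\|\mathbb E(D_{z,i}^0)-m_{z,i}^0\|_2^2 . \end{align*} If one further chooses $$R=\Big\lceil4(1+\omega_u+\omega_\ell)\ln\Big(4(1+\omega_u+\omega_\ell)+\tfrac{(1+\omega_u)^2\Delta n^3}{\sigma^2}\Big)\Big\rceil,$$ $$\alpha=(2L_{\nabla\Phi}+C_4^{-1})^{-1},\qquad\rho=C_f/\mu_g,\qquad\delta_\ell=\tfrac1{1+\tilde\omega_\ell},\qquad\delta_u=\tfrac1{1+\tilde\omega_u},$$ $$\beta=\Big(\tfrac{\mu_g+L_g}2+\tfrac{96\tilde\omega_\ell\tilde\omega_1L_g^2}{\mu_gn}+\sqrt{\tfrac{2\tilde\omega_\ell(1+4\tilde\omega_\ell)\Delta_{m_y}^0}{n\Delta_y^0}}+\sqrt{\tfrac{2K\tilde\sigma^2(1+6\tilde\omega_\ell\tilde\omega_1)}{n\Delta_y^0}}\Big)^{-1},$$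 $$\gamma=\Big(L_g+\tfrac{432\tilde\omega_\ell\tilde\omega_1L_g^2}{\mu_gn}+\sqrt{\tfrac{3\tilde\omega_\ell(1+4\tilde\omega_\ell)\Delta_{m_z}^0}{2n\Delta_z^0}}+\sqrt{\tfrac{K\tilde\sigma_1^2(1+6\tilde\omega_\ell\tilde\omega_1)}{n\Delta_z^0}}\Big)^{-1},$$ $$\theta=\Big(1+\sqrt{\tfrac{6\tilde\omega_u(1+\tilde\omega_u)\Delta_h^0}{\Delta_x^0}}+\sqrt{\tfrac{K\tilde\sigma_1^2}{n\Delta_x^0}}+\sqrt[3]{\tfrac{18\tilde\omega_u(1+\tilde\omega_u)K\tilde\sigma_1^2}{\Delta_x^0}}\Big)^{-1},$$ then EF-SOBA-MSC converges as order $$\frac1K\sum_{k=0}^{K-1}\mathbb E\|\nabla\Phi(x^k)\|_2^2=\mathcal O\Big(\frac{\sqrt\Delta\,\sigma}{\sqrt{nT}}+\frac{(1+\omega_u+\omega_\ell)\Delta\,\tilde\Theta(1)}{T}\Big),$$ where $T=KR$ is the total number of iterations of EF-SOBA-MSC and $\tilde\Theta$ hides logarithmic terms independent of $T$.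
   Context: Setting. $n\ge1$ workers; $f_i,g_i:\mathbb R^{d_x}\times\mathbb R^{d_y}\to\mathbb R$ with $f_i(x,y)=\mathbb E_{\phi\sim\mathcal D_{f_i}}[F(x,y;\phi)]$, $g_i(x,y)=\mathbb E_{\xi\sim\mathcal D_{g_i}}[G(x,y;\xi)]$; $f=\frac1n\sum_if_i$, $g=\frac1n\sum_ig_i$; $y^\star(x)=\arg\min_yg(x,y)$; $\Phi(x)=f(x,y^\star(x))$; $z^\star(x)=-[\nabla^2_{yy}g(x,y^\star(x))]^{-1}\nabla_yf(x,y^\star(x))$. $\nabla^2_{xy}g\in\mathbb R^{d_x\times d_y}$; $\|\cdot\|_2$ is the Euclidean norm of vectors and the spectral norm of matrices. $K\ge1$ is the number of outer iterations. Continuity: for all $i$, $f_i$ is $C_f$-Lipschitz in $y$, and $\nabla f_i,\nabla g_i,\nabla^2_{xy}g_i,\nabla^2_{yy}g_i$ are Lipschitz in $(x,y)$ with constants $L_f,L_g,L_{g_{xy}},L_{g_{yy}}$. Strong convexity: every $g_i$ is $\mu_g$-strongly convex in $y$. Stochastic noise: at every $(x,y)$, for every $i$, $\nabla F(x,y;\phi)$, $\nabla_yG(x,y;\xi)$, $\nabla^2_{xy}G(x,y;\xi)$, $\nabla^2_{yy}G(x,y;\xi)$ are unbiased estimates of $\nabla f_i,\nabla_yg_i,\nabla^2_{xy}g_i,\nabla^2_{yy}g_i$, each with mean squared error (in $\|\cdot\|_2$) at most $\sigma^2$. Unbiased compression: a random map $\mathcal C$ is $\omega$-unbiased ($\omega\ge0$)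 if $\mathbb E[\mathcal C(v)]=v$ and $\mathbb E\|\mathcal C(v)-v\|_2^2\le\omega\|v\|_2^2$ for all $v$. The upper-level compressors $\mathcal C_i^u$ are $\omega_u$-unbiased, the lower-level compressors $\mathcal C_i^\ell$ are $\omega_\ell$-unbiased; fresh randomness is used at each call, and outputs of different workers are mutually independent conditioned on the inputs. Multi-step compression. For an $\omega$-unbiased compressor $\mathcal C$ and $R\ge1$, $\mathrm{MSC}(v;\mathcal C,R)=v^R/(1-(\omega/(1+\omega))^R)$, where $v^0=0$ and $v^r=v^{r-1}+(1+\omega)^{-1}\mathcal C(v-v^{r-1})$ for $r=1,\dots,R$. EF-SOBA-MSC. Positive parameters $\alpha,\beta,\gamma,\theta,\rho,\delta_u,\delta_\ell$ and integer $R\ge1$; initial $x^0,y^0,z^0$ ($\|z^0\|_2\le\rho$), $m_{x,i}^0,m_{y,i}^0,m_{z,i}^0,h_{x,i}^0$; $\hat h_x^0=\frac1n\sum_im_{x,i}^0$, $m_y^0=\frac1n\sum_im_{y,i}^0$, $m_z^0=\frac1n\sum_im_{z,i}^0$. At iteration $k$, worker $i$ draws fresh independent samples $\phi_i^{k,r}\sim\mathcal D_{f_i},\xi_i^{k,r}\sim\mathcal D_{g_i}$, $r=1,\dots,R$, and forms $D_{x,i}^k=\frac1R\sum_r[\nabla_{xy}^2G(x^k,y^k;\xi_i^{k,r})z^k+\nabla_xF(x^k,y^k;\phi_i^{k,r})]$, $D_{y,i}^k=\frac1R\sum_r\nabla_yG(x^k,y^k;\xi_i^{k,r})$, $D_{z,i}^k=\frac1R\sum_r[\nabla_{yy}^2G(x^k,y^k;\xi_i^{k,r})z^k+\nabla_yF(x^k,y^k;\phi_i^{k,r})]$;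 sets $h_{x,i}^{k+1}=(1-\theta)h_{x,i}^k+\theta D_{x,i}^k$; computes $c_{x,i}^k=\mathrm{MSC}(h_{x,i}^{k+1}-m_{x,i}^k;\mathcal C_i^u,R)$, $c_{y,i}^k=\mathrm{MSC}(D_{y,i}^k-m_{y,i}^k;\mathcal C_i^\ell,R)$, $c_{z,i}^k=\mathrm{MSC}(D_{z,i}^k-m_{z,i}^k;\mathcal C_i^\ell,R)$; and sets $m_{x,i}^{k+1}=m_{x,i}^k+\delta_uc_{x,i}^k$, $m_{y,i}^{k+1}=m_{y,i}^k+\delta_\ell c_{y,i}^k$, $m_{z,i}^{k+1}=m_{z,i}^k+\delta_\ell c_{z,i}^k$. The server sets $\hat D_y^k=m_y^k+\frac1n\sum_ic_{y,i}^k$, $\hat D_z^k=m_z^k+\frac1n\sum_ic_{z,i}^k$, $x^{k+1}=x^k-\alpha\hat h_x^k$, $y^{k+1}=y^k-\beta\hat D_y^k$, $\tilde z^{k+1}=z^k-\gamma\hat D_z^k$, $z^{k+1}=\min\{1,\rho/\|\tilde z^{k+1}\|_2\}\tilde z^{k+1}$, $\hat h_x^{k+1}=\hat h_x^k+\frac{\delta_u}n\sum_ic_{x,i}^k$, $m_y^{k+1}=m_y^k+\frac{\delta_\ell}n\sum_ic_{y,i}^k$, $m_z^{k+1}=m_z^k+\frac{\delta_\ell}n\sum_ic_{z,i}^k$. Constants. $L_{\nabla\Phi},L_{y^\star},L_{z^\star}>0$ are Lipschitz constants of $\nabla\Phi,y^\star,z^\star$ (they exist under Continuity and Strong convexity).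 $\kappa_g=L_g/\mu_g$, $L_1^2=L_f^2+L_{g_{yy}}^2\rho^2$, $L_2^2=L_f^2+L_{g_{xy}}^2\rho^2$, $L_3^2=L_g^2(1+3L_{y^\star}^2)$, $L_4^2=L_1^2(1+3L_{y^\star}^2)+3L_g^2L_{z^\star}^2$, $L_5^2=L_2^2(1+3L_{y^\star}^2)+3L_g^2L_{z^\star}^2$, $\tilde\sigma^2=\sigma^2/R$, $\tilde\sigma_1^2=\sigma^2(1+\rho^2)/R$, $\tilde\omega_\ell=\omega_\ell(\omega_\ell/(1+\omega_\ell))^R$, $\tilde\omega_u=\omega_u(\omega_u/(1+\omega_u))^R$, $\tilde\omega_1=1+6\tilde\omega_\ell(1+\tilde\omega_\ell)$, $\tilde\omega_2=1+36\tilde\omega_u(1+\tilde\omega_u)$. With $h_x^0=\frac1n\sum_ih_{x,i}^0$: $\Delta_\Phi^0=\Phi(x^0)$, $\Delta_x^0=\|h_x^0-\nabla\Phi(x^0)\|_2^2$, $\Delta_h^0=\frac1n\sum_i\|h_{x,i}^0-\mathbb E(D_{x,i}^0)\|_2^2$, $\Delta_y^0=\|y^0-y^\star(x^0)\|_2^2$, $\Delta_z^0=\|z^0-z^\star(x^0)\|_2^2$, $\Delta_{m_y}^0=\frac1n\sum_i\|\mathbb E(D_{y,i}^0)-m_{y,i}^0\|_2^2$, $\Delta_{m_z}^0=\frac1n\sum_i\|\mathbb E(D_{z,i}^0)-m_{z,i}^0\|_2^2$; $\Delta$ is the maximum of these seven quantities. Parameter upper bounds with a zero denominator are read as $+\i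nfty$.
   Formalization: ω̃ is corrected to max(ωq^R, q^R/(1−q^R)), q=ω/(1+ω), wherever it occurs; θ≤1 and Φ≥0 are assumed; for the rate, σ, Δx⁰, Δy⁰, Δz⁰ are positive and the O-constant may depend on the problem constants and on bounds for Δ/Δx⁰, Δ/Δy⁰, Δ/Δz⁰. *)

(* Defs.v *)
From HB Require Import structures.
From mathcomp Require Import all_boot all_order all_algebra finmap.
From mathcomp Require Import all_classical all_reals all_analysis.

Set Implicit Arguments.
Unset Strict Implicit.
Unset Printing Implicit Defensive.

Import Order.TTheory GRing.Theory Num.Theory.
Import numFieldNormedType.Exports.

Local Open Scope classical_set_scope.
Local Open Scope ring_scope.

(* The library norm on matrices is the sup norm, hence [enorm] and [opnorm]. *)
Definition enorm (R : realType) (d : nat) (v : 'cV[R]_d) : R :=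
  Num.sqrt (\sum_j v j 0 ^+ 2).

Definition opnorm (R : realType) (m d : nat) (A : 'M[R]_(m, d)) : R :=
  sup [set enorm (A *m v) | v in [set v : 'cV[R]_d | enorm v <= 1]].

Definition grad (R : realType) (d : nat) (h : 'cV[R]_d -> R) (x : 'cV[R]_d) :
    'cV[R]_d :=
  \col_j 'D_(delta_mx j 0) h x.

Section TwoBlocks.
Context (R : realType) (dx dy : nat).
Implicit Types (h : 'cV[R]_dx -> 'cV[R]_dy -> R).

Definition gradx h x y : 'cV[R]_dx := grad (fun x' => h x' y) x.
Definition grady h x y : 'cV[R]_dy := grad (h x) y.
Definition grad2 h x y : 'cV[R]_(dx + dy) := col_mx (gradx h x y) (grady h x y).

(* entry (i, j) is d/dx_i d/dy_j h *)
Definition hess_xy h x y : 'M[R]_(dx, dy) :=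
  \matrix_(i, j) 'D_(delta_mx i 0) (fun x' => grady h x' y j 0) x.
Definition hess_yy h x y : 'M[R]_dy :=
  \matrix_(i, j) 'D_(delta_mx i 0) (fun y' => grady h x y' j 0) y.

(* Without differentiability ['D_v] is a junk value; this is what makes all the
   gradients and second derivatives above genuine. *)
Definition smooth1 h :=
  forall p : 'cV[R]_dx * 'cV[R]_dy,
    differentiable (fun q : 'cV[R]_dx * 'cV[R]_dy => h q.1 q.2) p.
Definition smooth2 h :=
  smooth1 h /\
  forall p : 'cV[R]_dx * 'cV[R]_dy,
    differentiable (fun q : 'cV[R]_dx * 'cV[R]_dy => grady h q.1 q.2) p.

Definition lip_grad2 (L : R) h := forall x y x' y',
  enorm (grad2 h x y - grad2 h x' y') <= L * enorm (col_mx (x - x') (y - y')).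
Definition lip_mx (m p : nat) (L : R)
    (H : 'cV[R]_dx -> 'cV[R]_dy -> 'M[R]_(m, p)) := forall x y x' y',
  opnorm (H x y - H x' y') <= L * enorm (col_mx (x - x') (y - y')).
Definition lip_in_y (L : R) h := forall x y y',
  `|h x y - h x y'| <= L * enorm (y - y').

End TwoBlocks.

Definition lip_vec (R : realType) (d e : nat) (L : R)
    (u : 'cV[R]_d -> 'cV[R]_e) := forall x x',
  enorm (u x - u x') <= L * enorm (x - x').

Definition strongly_convex (R : realType) (d : nat) (mu : R)
    (h : 'cV[R]_d -> R) := forall u v (t : R), 0 <= t <= 1 ->
  h (t *: u + (1 - t) *: v) <=
    t * h u + (1 - t) * h v - mu / 2 * t * (1 - t) * enorm (u - v) ^+ 2.

Definition borel (R : realType) (d : nat) :=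
  g_sigma_algebraType (@open 'cV[R]_d).

(* The samples phi ~ D_{f_i} (resp. xi ~ D_{g_i}) live in one measurable space,
   on which each worker has its own distribution. *)
Record problem (R : realType) (n dx dy : nat) := Problem {
  dispF : measure_display;
  dispG : measure_display;
  sampF : measurableType dispF;
  sampG : measurableType dispG;
  lawF : 'I_n -> probability sampF R;
  lawG : 'I_n -> probability sampG R;
  lossF : 'cV[R]_dx -> 'cV[R]_dy -> sampF -> R;
  lossG : 'cV[R]_dx -> 'cV[R]_dy -> sampG -> R }.

(* A random map on R^d is a map that also reads a random seed; a fresh call is
   an evaluation at a fresh independent seed. *)
Record compressors (R : realType) (n d : nat) := Compressors {
  dispS : measure_display;
  seed : measurableType dispS;
  lawS : 'I_n -> probability seed R;
  compress : 'I_n -> seed -> 'cV[R]_d -> 'cV[R]_d }.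

Arguments lossF {R n dx dy} p.
Arguments lossG {R n dx dy} p.
Arguments lawF {R n dx dy} p.
Arguments lawG {R n dx dy} p.
Arguments seed {R n d} c.
Arguments lawS {R n d} c.
Arguments compress {R n d} c.

Section Objective.
Context (R : realType) (n dx dy : nat) (pb : problem R n dx dy).

Definition f_ (i : 'I_n) x y : R := fine 'E_(lawF pb i)[lossF pb x y].
Definition g_ (i : 'I_n) x y : R := fine 'E_(lawG pb i)[lossG pb x y].
Definition fbar x y : R := n%:R^-1 * \sum_i f_ i x y.
Definition gbar x y : R := n%:R^-1 * \sum_i g_ i x y.

Definition ystar (x : 'cV[R]_dx) : 'cV[R]_dy :=
  xget 0 [set y | forall y', gbar x y <= gbar x y'].
Definition Phi (x : 'cV[R]_dx) : R := fbar x (ystar x).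
Definition zstar (x : 'cV[R]_dx) : 'cV[R]_dy :=
  - (invmx (hess_yy gbar x (ystar x)) *m grady fbar x (ystar x)).

Definition sampleF (s : sampF pb) x y : R := lossF pb x y s.
Definition sampleG (s : sampG pb) x y : R := lossG pb x y s.

End Objective.

Record constants (R : realType) := Constants {
  cf : R; Lf : R; Lg : R; Lgxy : R; Lgyy : R; mug : R;
  LPhi : R; Lys : R; Lzs : R }.

Section Assumptions.
Context (R : realType) (n dx dy : nat) (pb : problem R n dx dy).
Context (c : constants R).

Definition continuity := forall i : 'I_n,
  [/\ smooth1 (f_ pb i), smooth2 (g_ pb i), lip_in_y (cf c) (f_ pb i),
      lip_grad2 (Lf c) (f_ pb i) & lip_grad2 (Lg c) (g_ pb i)] /\
  lip_mx (Lgxy c) (hess_xy (g_ pb i)) /\ lip_mx (Lgyy c) (hess_yy (g_ pb i)).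

Definition strong_convexity :=
  0 < mug c /\ forall (i : 'I_n) x, strongly_convex (mug c) (g_ pb i x).

(* f_i and g_i are expectations of F and G, which are measurable, and smooth
   enough for the stochastic derivatives to exist. *)
Definition sampled_losses :=
  [/\ measurable_fun setT
        (fun p : borel R dx * borel R dy * sampF pb => lossF pb p.1.1 p.1.2 p.2),
      measurable_fun setT
        (fun p : borel R dx * borel R dy * sampG pb => lossG pb p.1.1 p.1.2 p.2),
      (forall s, smooth1 (@sampleF R n dx dy pb s)) /\
      (forall s, smooth2 (@sampleG R n dx dy pb s)),
      (forall i x y, (lawF pb i).-integrable setT (EFin \o lossF pb x y)) &
      (forall i x y, (lawG pb i).-integrable setT (EFin \o lossG pb x y))].

(* [X] is an unbiased estimate of [M] with mean squared error at most [v] in the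
   norm [nm].  The expectations are extended reals, so that finiteness is part
   of the assumption. *)
Definition estimates d (T : measurableType d) (P : probability T R) (m q : nat)
    (nm : 'M[R]_(m, q) -> R) (X : T -> 'M[R]_(m, q)) (M : 'M[R]_(m, q)) (v : R) :=
  (forall a b, 'E_P[fun s => X s a b]%E = (M a b)%:E) /\
  ('E_P[(fun s => nm (X s - M) ^+ 2)%R] <= v%:E)%E.

Definition stochastic_noise (sigma : R) := forall (i : 'I_n) x y,
  [/\ estimates (lawF pb i) (@enorm R (dx + dy))
        (fun s => grad2 (sampleF s) x y) (grad2 (f_ pb i) x y) (sigma ^+ 2),
      estimates (lawG pb i) (@enorm R dy)
        (fun s => grady (sampleG s) x y) (grady (g_ pb i) x y) (sigma ^+ 2),
      estimates (lawG pb i) (@opnorm R dx dy)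
        (fun s => hess_xy (sampleG s) x y) (hess_xy (g_ pb i) x y) (sigma ^+ 2) &
      estimates (lawG pb i) (@opnorm R dy dy)
        (fun s => hess_yy (sampleG s) x y) (hess_yy (g_ pb i) x y) (sigma ^+ 2)].

Definition unbiased_compression (d : nat) (cc : compressors R n d) (omega : R) :=
  0 <= omega /\
  forall i : 'I_n,
    (forall j, measurable_fun setT
       (fun p : seed cc * borel R d => compress cc i p.1 p.2 j 0)) /\
    forall v : 'cV[R]_d,
      estimates (lawS cc i) (@enorm R d) (fun s => compress cc i s v) v
                (omega * enorm v ^+ 2).

Definition lipschitz_constants :=
  [/\ 0 < LPhi c, 0 < Lys c & 0 < Lzs c] /\
  [/\ lip_vec (LPhi c) (grad (Phi pb)),
      lip_vec (Lys c) (ystar pb) & lip_vec (Lzs c) (zstar pb)].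

End Assumptions.

Definition indep_systems (R : realType) d (T : measurableType d)
    (P : probability T R) (I : choiceType) (S : I -> set_system T) :=
  forall (J : {fset I}) (E : I -> set T), (forall i, i \in J -> S i (E i)) ->
  P (\bigcap_(i in [set` J]) E i) = (\prod_(i <- J) P (E i))%E.

Definition sigma_of d d' (T : measurableType d) (T' : measurableType d')
    (X : T -> T') : set_system T :=
  preimage_set_system setT X measurable.

Section Algorithm.
Context (R : realType) (n dx dy : nat) (pb : problem R n dx dy).
Context (cu : compressors R n dx) (cl : compressors R n dy).

(* [phi (i, k, r)] and [xi (i, k, r)] are the data samples number r (from 0) of
   worker i at iteration k; [seedx], [seedy], [seedz] are the seeds of the r-th
   compressor call in the multi-step compressions of c_x, c_y, c_z. *)
Definition call := ('I_n * nat * nat)%type.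
Record draws := Draws {
  dispO : measure_display;
  Omega : measurableType dispO;
  Pr : probability Omega R;
  phi : call -> Omega -> sampF pb;
  xi : call -> Omega -> sampG pb;
  seedx : call -> Omega -> seed cu;
  seedy : call -> Omega -> seed cl;
  seedz : call -> Omega -> seed cl }.
Arguments phi d : clear implicits.
Arguments xi d : clear implicits.
Arguments seedx d : clear implicits.
Arguments seedy d : clear implicits.
Arguments seedz d : clear implicits.

Definition draw_system (D : draws) (s : call + call + (call + call + call)) :
    set_system (Omega D) :=
  match s with
  | inl (inl j) => sigma_of (phi D j)
  | inl (inr j) => sigma_of (xi D j)
  | inr (inl (inl j)) => sigma_of (seedx D j)
  | inr (inl (inr j)) => sigma_of (seedy D j)
  | inr (inr j) => sigma_of (seedz D j)
  end.

Definition has_law d d' (T : measurableType d) (T' : measurableType d')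
    (P : probability T R) (X : T -> T') (Q : probability T' R) :=
  measurable_fun setT X /\
  forall B, measurable B -> P (X @^-1` B) = Q B.

Definition fresh_draws (D : draws) :=
  [/\ forall j : call, has_law (Pr D) (phi D j) (lawF pb j.1.1)
                     /\ has_law (Pr D) (xi D j) (lawG pb j.1.1),
      forall j : call, has_law (Pr D) (seedx D j) (lawS cu j.1.1),
      forall j : call, has_law (Pr D) (seedy D j) (lawS cl j.1.1),
      forall j : call, has_law (Pr D) (seedz D j) (lawS cl j.1.1) &
      indep_systems (Pr D) (@draw_system D)].

Record params := Params {
  alpha : R; beta : R; gamma : R; theta : R; rho : R; delta_u : R; delta_l : R;
  omega_u : R; omega_l : R; rounds : nat }.

Record inits := Inits {
  x0 : 'cV[R]_dx; y0 : 'cV[R]_dy; z0 : 'cV[R]_dy;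
  mx0 : 'I_n -> 'cV[R]_dx; my0 : 'I_n -> 'cV[R]_dy; mz0 : 'I_n -> 'cV[R]_dy;
  hx0 : 'I_n -> 'cV[R]_dx }.

Definition vavg (d : nat) (v : 'I_n -> 'cV[R]_d) : 'cV[R]_d :=
  n%:R^-1 *: \sum_i v i.

(* [C r] is the compressor call of round r, counted from 0 *)
Fixpoint msc_iter (d : nat) (omega : R) (C : nat -> 'cV[R]_d -> 'cV[R]_d)
    (v : 'cV[R]_d) (r : nat) : 'cV[R]_d :=
  if r is r'.+1 then
    let w := msc_iter omega C v r' in w + (1 + omega)^-1 *: C r' (v - w)
  else 0.
Definition msc (d : nat) (omega : R) (C : nat -> 'cV[R]_d -> 'cV[R]_d)
    (rd : nat) (v : 'cV[R]_d) : 'cV[R]_d :=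
  (1 - (omega / (1 + omega)) ^+ rd)^-1 *: msc_iter omega C v rd.

(* [hhat], [smy], [smz] are the server's \hat h_x, m_y, m_z *)
Record state := State {
  stx : 'cV[R]_dx; sty : 'cV[R]_dy; stz : 'cV[R]_dy;
  mx : 'I_n -> 'cV[R]_dx; my : 'I_n -> 'cV[R]_dy; mz : 'I_n -> 'cV[R]_dy;
  hx : 'I_n -> 'cV[R]_dx;
  hhat : 'cV[R]_dx; smy : 'cV[R]_dy; smz : 'cV[R]_dy }.

Section Iterates.
Context (D : draws) (p : params) (ini : inits).

Definition init_state : state :=
  State (x0 ini) (y0 ini) (z0 ini) (mx0 ini) (my0 ini) (mz0 ini) (hx0 ini)
        (vavg (mx0 ini)) (vavg (my0 ini)) (vavg (mz0 ini)).

Definition Dx (w : Omega D) (k : nat) (s : state) (i : 'I_n) : 'cV[R]_dx :=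
  (rounds p)%:R^-1 *: \sum_(r < rounds p)
    (hess_xy (sampleG (xi D (i, k, val r) w)) (stx s) (sty s) *m stz s
     + gradx (sampleF (phi D (i, k, val r) w)) (stx s) (sty s)).
Definition Dy (w : Omega D) (k : nat) (s : state) (i : 'I_n) : 'cV[R]_dy :=
  (rounds p)%:R^-1 *: \sum_(r < rounds p)
    grady (sampleG (xi D (i, k, val r) w)) (stx s) (sty s).
Definition Dz (w : Omega D) (k : nat) (s : state) (i : 'I_n) : 'cV[R]_dy :=
  (rounds p)%:R^-1 *: \sum_(r < rounds p)
    (hess_yy (sampleG (xi D (i, k, val r) w)) (stx s) (sty s) *m stz s
     + grady (sampleF (phi D (i, k, val r) w)) (stx s) (sty s)).

Definition step (w : Omega D) (k : nat) (s : state) : state :=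
  let hx' i := (1 - theta p) *: hx s i + theta p *: Dx w k s i in
  let cx i := msc (omega_u p) (fun r => compress cu i (seedx D (i, k, r) w))
                  (rounds p) (hx' i - mx s i) in
  let cy i := msc (omega_l p) (fun r => compress cl i (seedy D (i, k, r) w))
                  (rounds p) (Dy w k s i - my s i) in
  let cz i := msc (omega_l p) (fun r => compress cl i (seedz D (i, k, r) w))
                  (rounds p) (Dz w k s i - mz s i) in
  let Dyhat := smy s + vavg cy in
  let Dzhat := smz s + vavg cz in
  let ztilde := stz s - gamma p *: Dzhat in
  State (stx s - alpha p *: hhat s)
        (sty s - beta p *: Dyhat)
        (Num.min 1 (rho p / enorm ztilde) *: ztilde)
        (fun i => mx s i + delta_u p *: cx i)
        (fun i => my s i + delta_l p *: cy i)
        (fun i => mz s i + delta_l p *: cz i)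
        hx'
        (hhat s + delta_u p *: vavg cx)
        (smy s + delta_l p *: vavg cy)
        (smz s + delta_l p *: vavg cz).

Fixpoint iterate (w : Omega D) (k : nat) : state :=
  if k is k'.+1 then step w k' (iterate w k') else init_state.

Definition xk (k : nat) (w : Omega D) : 'cV[R]_dx := stx (iterate w k).

Definition mean_vec (d : nat) (X : Omega D -> 'cV[R]_d) : 'cV[R]_d :=
  \col_j fine 'E_(Pr D)[fun w => X w j 0].
Definition EDx0 (i : 'I_n) := mean_vec (fun w => Dx w 0 init_state i).
Definition EDy0 (i : 'I_n) := mean_vec (fun w => Dy w 0 init_state i).
Definition EDz0 (i : 'I_n) := mean_vec (fun w => Dz w 0 init_state i).

(* (1/K) sum_{k<K} E |grad Phi(x^k)|^2, in the extended reals *)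
Definition avg_sq_grad (K : nat) : \bar R :=
  ((K%:R^-1)%:E *
   \sum_(k < K) 'E_(Pr D)[(fun w => enorm (grad (Phi pb) (xk k w)) ^+ 2)%R])%E.

Definition DelPhi : R := Phi pb (x0 ini).
Definition Delx : R :=
  enorm (vavg (hx0 ini) - grad (Phi pb) (x0 ini)) ^+ 2.
Definition Delh : R := n%:R^-1 * \sum_i enorm (hx0 ini i - EDx0 i) ^+ 2.
Definition Dely : R := enorm (y0 ini - ystar pb (x0 ini)) ^+ 2.
Definition Delz : R := enorm (z0 ini - zstar pb (x0 ini)) ^+ 2.
Definition Delmy : R := n%:R^-1 * \sum_i enorm (EDy0 i - my0 ini i) ^+ 2.
Definition Delmz : R := n%:R^-1 * \sum_i enorm (EDz0 i - mz0 ini i) ^+ 2.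
Definition Del : R :=
  \big[Num.max/DelPhi]_(v <- [:: Delx; Delh; Dely; Delz; Delmy; Delmz]) v.

End Iterates.

(* The value omega (omega / (1 + omega))^r alone is not an unbiasedness constant
   of MSC(.; C, r) for every omega-unbiased C: MSC(.; C, 1) = C.  The sharp
   constant is q^r / (1 - q^r) with q = omega / (1 + omega); it is at most
   omega q^r exactly when omega = 0 or omega (1 - q^r) >= 1.  Taking the
   larger of the two keeps omega q^r whenever it is valid. *)
Definition tomega (omega : R) (r : nat) : R :=
  let q := omega / (1 + omega) in
  Num.max (omega * q ^+ r) (q ^+ r / (1 - q ^+ r)).

(* a / b as an upper bound, +oo when b = 0 *)
Definition bound_div (a b : R) : \bar R :=
  if b == 0 then +oo%E else (a / b)%:E.

Section DerivedConstants.
Context (c : constants R) (sigma : R) (p : params).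

Definition kappa : R := Lg c / mug c.
Definition L1sq : R := Lf c ^+ 2 + Lgyy c ^+ 2 * rho p ^+ 2.
Definition L2sq : R := Lf c ^+ 2 + Lgxy c ^+ 2 * rho p ^+ 2.
Definition L3sq : R := Lg c ^+ 2 * (1 + 3 * Lys c ^+ 2).
Definition L4sq : R :=
  L1sq * (1 + 3 * Lys c ^+ 2) + 3 * Lg c ^+ 2 * Lzs c ^+ 2.
Definition L5sq : R :=
  L2sq * (1 + 3 * Lys c ^+ 2) + 3 * Lg c ^+ 2 * Lzs c ^+ 2.
Definition tsigsq : R := sigma ^+ 2 / (rounds p)%:R.
Definition tsig1sq : R := sigma ^+ 2 * (1 + rho p ^+ 2) / (rounds p)%:R.
Definition tom_l : R := tomega (omega_l p) (rounds p).
Definition tom_u : R := tomega (omega_u p) (rounds p).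
Definition tom1 : R := 1 + 6 * tom_l * (1 + tom_l).
Definition tom2 : R := 1 + 36 * tom_u * (1 + tom_u).

Definition C4_inv_sq : R :=
  2 * (4 * LPhi c ^+ 2 / theta p ^+ 2
       + 72 * tom_u * (1 + tom_u) * L5sq
       + 12 * tom2 * (L2sq + 25 * kappa ^+ 2 * L1sq)
         * (4 * Lys c ^+ 2 / (beta p ^+ 2 * mug c ^+ 2)
            + 16 * tom_l * tom1 * L3sq * beta p / (mug c * n%:R))
       + 12 * tom2 * Lg c ^+ 2
         * (12 * Lzs c ^+ 2 / (gamma p ^+ 2 * mug c ^+ 2)
            + 72 * tom_l * tom1 * L4sq * gamma p / (mug c * n%:R))).
Definition C4 : R := (Num.sqrt C4_inv_sq)^-1.

End DerivedConstants.

(* Standing hypotheses on an execution.  [theta <= 1]: h_x is a moving average.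
   [0 <= Phi]: Phi(x^0) can only stand for the initial suboptimality if Phi is
   normalised to be nonnegative. *)
Definition standing (c : constants R) (sigma : R) (D : draws) (p : params)
    (ini : inits) :=
  [/\ (0 < n)%N, (0 < dx)%N, (0 < dy)%N & (0 < rounds p)%N] /\
  [/\ continuity pb c, strong_convexity pb c, sampled_losses pb,
      0 <= sigma & stochastic_noise pb sigma] /\
  [/\ unbiased_compression cu (omega_u p), unbiased_compression cl (omega_l p)
    & fresh_draws D] /\
  lipschitz_constants pb c /\ (forall x, 0 <= Phi pb x) /\
  [/\ 0 < alpha p, 0 < beta p, 0 < gamma p, 0 < theta p <= 1 & 0 < rho p] /\
  enorm (z0 ini) <= rho p /\ (forall i, mx0 ini i = hx0 ini i).

(* argument of the logarithm in the number of rounds *)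
Definition log_arg (sigma : R) (D : draws) (p : params) (ini : inits) : R :=
  4 * (1 + omega_u p + omega_l p)
  + (1 + omega_u p) ^+ 2 * Del D p ini * n%:R ^+ 3 / sigma ^+ 2.

End Algorithm.

(* Main.v *)
Require Import Defs.
From HB Require Import structures.
From mathcomp Require Import all_boot all_order all_algebra finmap.
From mathcomp Require Import all_classical all_reals all_analysis.
From mathcomp Require Import measurable_realfun ring lra.

(** At a fixed state, the expectation over the fresh draws of one iteration obeys closed
    one-step inequalities: the exact gradient steps contract y towards y^*(x) and z towards
    z^*(x), multi-step compression is an unbiased compressor of constant tomega, so compression
    only adds variance proportional to the distance between a gradient and its memory, and that
    distance contracts up to the motion of the iterates.  Since the draws of a round are
    independent of the state they act on, these inequalities hold in expectation along the
    iterates.  Summed over k and combined with the descent of Phi, they close because the step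
    size restrictions absorb the memory terms.

    For the rate, the choice of R makes tomega_l and tomega_u at most a^-3, a being the argument
    of the logarithm.  With u = sqrt (K sigma^2 / (n R Delta)), every inverse step size is
    O(1 + u) and every term of the bound O((Delta / K) (1 + u)); the cube root in theta fits
    because n tomega_u = O(u). *)

Set Implicit Arguments.
Unset Strict Implicit.
Unset Printing Implicit Defensive.

Import Order.TTheory GRing.Theory Num.Theory.
Import numFieldNormedType.Exports.

Local Open Scope classical_set_scope.
Local Open Scope ring_scope.

(** * Euclidean norms *)

Section Euclid.
Context {R : realType} {d : nat}.
Implicit Types (u v w : 'cV[R]_d) (a t : R).

(** No conditional expectation is formed. Every random quantity carries the set J of draws it is
    measurable in ([past S J]); for disjoint sets the diagonal map sends P to a product measure, and
    conditioning on the past becomes Fubini with the iterate frozen. The price is measurability: the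
    gradients and Hessians of the sampled losses are known only as derivatives, so they are obtained
    as limits of difference quotients, jointly in the point and the sample.

    [ystar] is known to be Lipschitz, and this alone gives the gradient of Phi, by comparing the
    optimality conditions at two nearby points.

    A memory is compared with gradients that move once the state is updated. Hence each memory step
    is split: the new memory against the gradients of the old state, where the draws are fresh, then
    a drift controlled by Young's inequality.

    There is no Lyapunov function. Each recursion is summed on its own and the sums are substituted
    into one another. The motion alpha^2 |h|^2 of x returns in all of them; it is absorbed by the
    multiple of |h|^2 that the descent of Phi leaves over, and C4 is the coefficient that makes this
    possible. *)

Definition dot u v : R := \sum_j u j 0 * v j 0.

Lemma dotC u v : dot u v = dot v u.
Proof. by apply: eq_bigr => j _; rewrite mulrC. Qed.

Lemma dotDl u v w : dot (u + v) w = dot u w + dot v w.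
Proof. by rewrite -big_split; apply: eq_bigr => j _ /=; rewrite mxE mulrDl. Qed.

Lemma dotZl a u v : dot (a *: u) v = a * dot u v.
Proof. by rewrite big_distrr; apply: eq_bigr => j _ /=; rewrite mxE mulrA. Qed.

Lemma dotDr u v w : dot w (u + v) = dot w u + dot w v.
Proof. by rewrite dotC dotDl !(dotC w). Qed.

Lemma dotZr a u v : dot u (a *: v) = a * dot u v.
Proof. by rewrite dotC dotZl dotC. Qed.

Lemma dotNl u v : dot (- u) v = - dot u v.
Proof. by rewrite -scaleN1r dotZl mulN1r. Qed.

Lemma dotNr u v : dot u (- v) = - dot u v.
Proof. by rewrite dotC dotNl dotC. Qed.

Lemma dot0l u : dot 0 u = 0.
Proof. by rewrite -(scale0r 0) dotZl mul0r. Qed.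

Lemma dotBl u v w : dot (u - v) w = dot u w - dot v w.
Proof. by rewrite dotDl dotNl. Qed.

Lemma dotBr u v w : dot w (u - v) = dot w u - dot w v.
Proof. by rewrite dotDr dotNr. Qed.

Lemma enorm_ge0 u : 0 <= enorm u.
Proof. exact: sqrtr_ge0. Qed.

Lemma enorm_sq u : enorm u ^+ 2 = dot u u.
Proof.
rewrite /enorm sqr_sqrtr; last by apply: sumr_ge0 => j _; exact: sqr_ge0.
by apply: eq_bigr => j _; rewrite expr2.
Qed.

Lemma enorm_sqE u : enorm u ^+ 2 = \sum_j u j 0 ^+ 2.
Proof. by rewrite enorm_sq; apply: eq_bigr => j _; rewrite expr2. Qed.

Lemma enorm0 : enorm (0 : 'cV[R]_d) = 0.
Proof. by apply/eqP; rewrite -sqrf_eq0 enorm_sq dot0l. Qed.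

Lemma enorm_eq0 u : enorm u = 0 -> u = 0.
Proof.
move=> /eqP; rewrite -sqrf_eq0 enorm_sqE psumr_eq0 => [/allP h|j _]; last exact: sqr_ge0.
apply/matrixP => i j; rewrite ord1 mxE.
by have := h i (mem_index_enum i); rewrite sqrf_eq0 => /eqP.
Qed.

Lemma enormZ a u : enorm (a *: u) = `|a| * enorm u.
Proof.
apply/eqP; rewrite -(eqrXn2 (n := 2)) ?enorm_ge0 ?mulr_ge0 ?enorm_ge0 //.
by rewrite exprMn !enorm_sq dotZl dotZr mulrA -expr2 real_normK // num_real.
Qed.

Lemma enormN u : enorm (- u) = enorm u.
Proof. by rewrite -scaleN1r enormZ normrN1 mul1r. Qed.

Lemma enormBC u v : enorm (u - v) = enorm (v - u).
Proof. by rewrite -enormN opprB. Qed.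

Lemma enorm_sqD u v : enorm (u + v) ^+ 2 = enorm u ^+ 2 + 2 * dot u v + enorm v ^+ 2.
Proof. by rewrite !enorm_sq dotDl !dotDr (dotC v u); ring. Qed.

Lemma enorm_sqB u v : enorm (u - v) ^+ 2 = enorm u ^+ 2 - 2 * dot u v + enorm v ^+ 2.
Proof. by rewrite enorm_sqD dotNr enormN; ring. Qed.

Lemma enorm_sqZ a u : enorm (a *: u) ^+ 2 = a ^+ 2 * enorm u ^+ 2.
Proof. by rewrite enormZ exprMn real_normK // num_real. Qed.

(** Cauchy-Schwarz: the square of the norm of |v| u - |u| v is nonnegative and equals 2 |u| |v| (|u|
    |v| - <u, v>). *)
Lemma dot_le u v : dot u v <= enorm u * enorm v.
Proof.
have [u0|u0] := eqVneq (enorm u) 0.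
  by rewrite u0 mul0r (enorm_eq0 u0) dot0l.
have [v0|v0] := eqVneq (enorm v) 0.
  by rewrite v0 mulr0 (enorm_eq0 v0) dotC dot0l.
have {}u0 : 0 < enorm u by rewrite lt_neqAle eq_sym u0 enorm_ge0.
have {}v0 : 0 < enorm v by rewrite lt_neqAle eq_sym v0 enorm_ge0.
have := sqr_ge0 (enorm (enorm v *: u - enorm u *: v)).
rewrite enorm_sqB !enorm_sqZ dotZl dotZr => h.
have : 0 <= 2 * (enorm u * enorm v) * (enorm u * enorm v - dot u v) by nra.
by rewrite pmulr_rge0 ?subr_ge0 // !mulr_gt0.
Qed.

Lemma norm_dot_le u v : `|dot u v| <= enorm u * enorm v.
Proof. by rewrite ler_norml dot_le andbT lerNl -dotNl -(enormN u) dot_le. Qed.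

Lemma enormD u v : enorm (u + v) <= enorm u + enorm v.
Proof.
have hu := enorm_ge0 u; have hv := enorm_ge0 v.
rewrite -(@ler_pXn2r _ 2) ?nnegrE ?addr_ge0 ?enorm_ge0 // enorm_sqD.
by have := dot_le u v; nra.
Qed.

Lemma enorm_sqD2 u v : enorm (u + v) ^+ 2 <= 2 * enorm u ^+ 2 + 2 * enorm v ^+ 2.
Proof. by have := sqr_ge0 (enorm (u - v)); rewrite enorm_sqB enorm_sqD; lra. Qed.

Lemma enorm_sqD3 u v w :
  enorm (u + v + w) ^+ 2 <= 3 * enorm u ^+ 2 + 3 * enorm v ^+ 2 + 3 * enorm w ^+ 2.
Proof.
have := sqr_ge0 (enorm (u - v)); have := sqr_ge0 (enorm (u - w)).
by have := sqr_ge0 (enorm (v - w)); rewrite !enorm_sqB !enorm_sqD dotDl; lra.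
Qed.

(** Convexity of the square: with |v| = t z, the norm of the sum is at most the convex combination
    (1 - t) c + t z. It turns a contraction followed by a small displacement v into a recursion on
    squares, as needed in [y_move], [z_move] and [x_move]. *)
Lemma enorm_young t u v c : 0 < t <= 1 -> enorm u <= (1 - t) * c ->
  enorm (u + v) ^+ 2 <= (1 - t) * c ^+ 2 + t^-1 * enorm v ^+ 2.
Proof.
move=> /andP[t0 t1] uc; have hu := enorm_ge0 u; have hv := enorm_ge0 v.
have le1 : enorm (u + v) ^+ 2 <= ((1 - t) * c + enorm v) ^+ 2.
  rewrite ler_pXn2r ?nnegrE ?enorm_ge0 //; last by rewrite addr_ge0 // (le_trans hu).
  by rewrite (le_trans (enormD _ _)) // lerD2r.
apply: (le_trans le1).
have [z ->] : exists z, enorm v = t * z.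
  by exists (enorm v / t); rewrite mulrC divfK // gt_eqF.
have -> : t^-1 * (t * z) ^+ 2 = t * z ^+ 2 by rewrite exprMn expr2 !mulrA mulVf ?mul1r // gt_eqF.
have : 0 <= t * (1 - t) * (c - z) ^+ 2 by rewrite mulr_ge0 ?sqr_ge0 // mulr_ge0; lra.
by nra.
Qed.

Lemma le_enorm_coord u j : `|u j 0| <= enorm u.
Proof.
rewrite -(@ler_pXn2r _ 2) ?nnegrE ?enorm_ge0 // enorm_sqE real_normK ?num_real //.
by rewrite (bigD1 j) //= lerDl sumr_ge0 // => i _; exact: sqr_ge0.
Qed.

Lemma enorm_le_sum u : enorm u <= \sum_j `|u j 0|.
Proof.
rewrite -(@ler_pXn2r _ 2) ?nnegrE ?enorm_ge0 ?sumr_ge0 //.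
rewrite enorm_sqE expr2 mulr_suml; apply: ler_sum => i _.
rewrite (bigD1 i) //= mulrDr -expr2 real_normK ?num_real // lerDl mulr_ge0 //.
exact: sumr_ge0.
Qed.

Lemma coord_le_mxnorm u j : `|u j 0| <= `|u|.
Proof.
rewrite [leRHS]/Num.Def.normr /= mx_normrE; apply/bigmax_geP; right => /=.
by exists (j, 0).
Qed.

Lemma mxnorm_le_enorm u : `|u| <= enorm u.
Proof.
rewrite [leLHS]/Num.Def.normr /= mx_normrE; apply/bigmax_leP; split => [|[i j] _ /=].
  exact: enorm_ge0.
by rewrite ord1 le_enorm_coord.
Qed.

Lemma enorm_le_mxnorm u : enorm u <= d%:R * `|u|.
Proof.
rewrite (le_trans (enorm_le_sum u)) //.
rewrite (@le_trans _ _ (\sum_(j < d) `|u|)) //.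
  by apply: ler_sum => j _; exact: coord_le_mxnorm.
by rewrite sumr_const card_ord mulr_natl.
Qed.

Lemma dot_delta u j : dot u (delta_mx j 0) = u j 0.
Proof.
rewrite /dot (bigD1 j) //= mxE !eqxx mulr1 big1 ?addr0 // => i ij.
by rewrite mxE (negbTE ij) mulr0.
Qed.

Lemma col_sum_delta u : u = \sum_j u j 0 *: delta_mx j 0.
Proof.
apply/matrixP => i k; rewrite ord1 summxE (bigD1 i) //= !mxE !eqxx mulr1 big1 ?addr0 // => j ji.
by rewrite !mxE eq_sym (negbTE ji) mulr0.
Qed.

Lemma dot_sumr (I : Type) (r : seq I) (P : pred I) (F : I -> 'cV[R]_d) u :
  dot u (\sum_(i <- r | P i) F i) = \sum_(i <- r | P i) dot u (F i).
Proof.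
elim/big_rec2 : _ => [|i y x _ <-]; first by rewrite dotC dot0l.
by rewrite dotDr.
Qed.

End Euclid.

(** * Block vectors and the operator norm *)

Section EuclidMatrix.
Context {R : realType}.

Lemma enorm_col_mx_sq (m p : nat) (u : 'cV[R]_m) (v : 'cV[R]_p) :
  enorm (col_mx u v) ^+ 2 = enorm u ^+ 2 + enorm v ^+ 2.
Proof.
rewrite !enorm_sqE big_split_ord /=; congr (_ + _); apply: eq_bigr => j _.
  by rewrite col_mxEu.
by rewrite col_mxEd.
Qed.

Lemma enorm_le_col_mxl (m p : nat) (u : 'cV[R]_m) (v : 'cV[R]_p) :
  enorm u <= enorm (col_mx u v).
Proof.
rewrite -(@ler_pXn2r _ 2) ?nnegrE ?enorm_ge0 // enorm_col_mx_sq lerDl.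
exact: sqr_ge0.
Qed.

Lemma enorm_le_col_mxr (m p : nat) (u : 'cV[R]_m) (v : 'cV[R]_p) :
  enorm v <= enorm (col_mx u v).
Proof.
rewrite -(@ler_pXn2r _ 2) ?nnegrE ?enorm_ge0 // enorm_col_mx_sq lerDr.
exact: sqr_ge0.
Qed.

Lemma enorm_col_mx0 (m p : nat) (u : 'cV[R]_p) : enorm (col_mx (0 : 'cV[R]_m) u) = enorm u.
Proof.
apply/eqP; rewrite -(eqrXn2 (n := 2)) ?enorm_ge0 //.
by rewrite enorm_col_mx_sq enorm0 expr0n add0r.
Qed.

Lemma enorm_col_mx_le (m p : nat) (u : 'cV[R]_m) (v : 'cV[R]_p) :
  enorm (col_mx u v) <= enorm u + enorm v.
Proof.
have hu := enorm_ge0 u; have hv := enorm_ge0 v.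
rewrite -(@ler_pXn2r _ 2) ?nnegrE ?addr_ge0 ?enorm_ge0 // enorm_col_mx_sq.
by nra.
Qed.

Lemma dot_mulmx (m p : nat) (A : 'M[R]_(m, p)) u v : dot (A *m u) v = dot u (A^T *m v).
Proof.
rewrite /dot; under eq_bigr do rewrite mxE mulr_suml.
rewrite exchange_big /=; apply: eq_bigr => j _.
by rewrite mxE mulr_sumr; apply: eq_bigr => i _; rewrite mxE; ring.
Qed.

(** |A u|^2 = <u, A^T A u> <= |u| c |A u|. Differentiating a gradient along a line produces a
    transposed Hessian, and this carries the bound back to the Hessian itself. *)
Lemma enorm_mulmx_tr (m p : nat) (A : 'M[R]_(m, p)) (c : R) : 0 <= c ->
  (forall v, enorm (A^T *m v) <= c * enorm v) -> forall u, enorm (A *m u) <= c * enorm u.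
Proof.
move=> c0 h u; have [n0|n0] := eqVneq (enorm (A *m u)) 0.
  by rewrite n0 mulr_ge0 ?enorm_ge0.
have {}n0 : 0 < enorm (A *m u) by rewrite lt_neqAle eq_sym n0 enorm_ge0.
rewrite -(ler_pM2r n0) -expr2 enorm_sq dot_mulmx (le_trans (dot_le _ _)) //.
rewrite mulrAC mulrC ler_wpM2r ?enorm_ge0 //; exact: h.
Qed.

(** Makes the set in [opnorm] bounded above, so that its supremum is a genuine one. *)
Lemma mulmx_bounded (m p : nat) (A : 'M[R]_(m, p)) :
  exists2 c, 0 <= c & forall v, enorm (A *m v) <= c * enorm v.
Proof.
exists (\sum_i \sum_j `|A i j|) => [|v].
  by do 2!apply: sumr_ge0 => ? _.
rewrite (le_trans (enorm_le_sum _)) // mulr_suml; apply: ler_sum => i _.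
rewrite mxE (le_trans (ler_norm_sum _ _ _)) // mulr_suml; apply: ler_sum => j _.
by rewrite normrM ler_wpM2l // le_enorm_coord.
Qed.

Lemma enorm_mulmx_le (m p : nat) (A : 'M[R]_(m, p)) v :
  enorm (A *m v) <= opnorm A * enorm v.
Proof.
have [c c0 hc] := mulmx_bounded A.
have ubA : has_ubound [set enorm (A *m v) | v in [set v : 'cV[R]_p | enorm v <= 1]].
  exists c => _ [w w1 <-]; rewrite (le_trans (hc w)) //.
  by rewrite -[leRHS]mulr1 ler_wpM2l.
have [v0|v0] := eqVneq (enorm v) 0.
  by rewrite v0 mulr0 (enorm_eq0 v0) mulmx0 enorm0.
have {}v0 : 0 < enorm v by rewrite lt_neqAle eq_sym v0 enorm_ge0.
have vE : v = enorm v *: ((enorm v)^-1 *: v) by rewrite scalerA divff ?scale1r // gt_eqF.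
rewrite {1}vE -scalemxAr enormZ (ger0_norm (ltW v0)) mulrC.
rewrite ler_wpM2r ?(ltW v0) //; apply: ub_le_sup => //=.
exists ((enorm v)^-1 *: v) => //=.
by rewrite enormZ normfV (ger0_norm (ltW v0)) mulVf ?gt_eqF.
Qed.

Lemma opnorm_ge0 (m p : nat) (A : 'M[R]_(m, p)) : 0 <= opnorm A.
Proof.
have [c c0 hc] := mulmx_bounded A.
apply: ub_le_sup; last by exists 0 => /=; rewrite ?mulmx0 enorm0.
exists c => _ [w w1 <-]; rewrite (le_trans (hc w)) //.
by rewrite -[leRHS]mulr1 ler_wpM2l.
Qed.

End EuclidMatrix.

Section Average.
Context {R : realType} {n d : nat} (n_gt0 : (0 < n)%N).

Lemma vavgD (u v : 'I_n -> 'cV[R]_d) : vavg (fun i => u i + v i) = vavg u + vavg v.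
Proof. by rewrite /vavg big_split scalerDr. Qed.

Lemma vavgZ (a : R) (u : 'I_n -> 'cV[R]_d) : vavg (fun i => a *: u i) = a *: vavg u.
Proof. by rewrite /vavg -scaler_sumr !scalerA mulrC. Qed.

Lemma vavgB (u v : 'I_n -> 'cV[R]_d) : vavg (fun i => u i - v i) = vavg u - vavg v.
Proof. by rewrite /vavg sumrB scalerBr. Qed.

Lemma enorm_sum_le (u : 'I_n -> 'cV[R]_d) : enorm (\sum_i u i) <= \sum_i enorm (u i).
Proof.
elim/big_ind2 : _ => [|a b x y ha hb|//]; first by rewrite enorm0.
by rewrite (le_trans (enormD _ _)) // lerD.
Qed.

Lemma enorm_vavg_le (u : 'I_n -> 'cV[R]_d) : enorm (vavg u) <= n%:R^-1 * \sum_i enorm (u i).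
Proof. by rewrite enormZ ger0_norm // ler_wpM2l // enorm_sum_le. Qed.

(** The gap between the two sides is the average of |u i - m|^2, m being the mean of the u i. *)
Lemma vavg_sq_le (u : 'I_n -> 'cV[R]_d) :
  enorm (vavg u) ^+ 2 <= n%:R^-1 * \sum_i enorm (u i) ^+ 2.
Proof.
set m := vavg u; have n0 : (n%:R : R) != 0 by rewrite pnatr_eq0 -lt0n.
have : 0 <= n%:R^-1 * \sum_i enorm (u i - m) ^+ 2.
  by rewrite mulr_ge0 // sumr_ge0 // => i _; exact: sqr_ge0.
under eq_bigr do rewrite enorm_sqB dotC.
rewrite big_split sumrB /= -mulr_sumr -dot_sumr sumr_const card_ord.
have -> : \sum_i u i = n%:R *: m by rewrite /m /vavg scalerA divff // scale1r.
rewrite dotZr -enorm_sq -mulr_natl.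
set S := \sum_i _; rewrite (_ : _ * _ = n%:R^-1 * S - enorm m ^+ 2); last by field.
by move=> h; rewrite -subr_ge0 mulr1.
Qed.

End Average.

(** * Measurability and independence *)

Section VectorMeasurability.
Context {d : measure_display} {T : measurableType d} {R : realType}.

(** Coordinatewise, the form in which derivatives and compressor outputs come; [vmeas_borel]
    recovers measurability into the Borel structure of R^k. *)
Definition vmeas (k : nat) (X : T -> 'cV[R]_k) :=
  forall j, measurable_fun setT (fun w => X w j 0).

Lemma vmeas_cst k (a : 'cV[R]_k) : vmeas (fun _ => a).
Proof. by move=> j; exact: measurable_cst. Qed.

Lemma vmeasD k (X Y : T -> 'cV[R]_k) : vmeas X -> vmeas Y -> vmeas (fun w => X w + Y w).
Proof.
move=> mX mY j; under eq_fun do rewrite mxE.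
by apply: measurable_funD.
Qed.

Lemma vmeasZ k (a : R) (X : T -> 'cV[R]_k) : vmeas X -> vmeas (fun w => a *: X w).
Proof.
move=> mX j; under eq_fun do rewrite mxE.
exact: measurable_funM.
Qed.

Lemma vmeasZf k (a : T -> R) (X : T -> 'cV[R]_k) :
  measurable_fun setT a -> vmeas X -> vmeas (fun w => a w *: X w).
Proof.
move=> ma mX j; under eq_fun do rewrite mxE.
exact: measurable_funM.
Qed.

Lemma vmeasN k (X : T -> 'cV[R]_k) : vmeas X -> vmeas (fun w => - X w).
Proof. by move=> mX; under [X in vmeas X]eq_fun do rewrite -scaleN1r; exact: vmeasZ. Qed.

Lemma vmeasB k (X Y : T -> 'cV[R]_k) : vmeas X -> vmeas Y -> vmeas (fun w => X w - Y w).
Proof. by move=> mX mY; apply: vmeasD => //; exact: vmeasN. Qed.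

Lemma vmeas_sum k (I : Type) (r : seq I) (X : I -> T -> 'cV[R]_k) :
  (forall i, vmeas (X i)) -> vmeas (fun w => \sum_(i <- r) X i w).
Proof.
move=> mX j; under eq_fun do rewrite summxE.
by apply: measurable_sum => i; exact: mX.
Qed.

Lemma vmeas_vavg n k (X : 'I_n -> T -> 'cV[R]_k) :
  (forall i, vmeas (X i)) -> vmeas (fun w => vavg (fun i => X i w)).
Proof. by move=> mX; apply: vmeasZ; exact: vmeas_sum. Qed.

Lemma vmeas_mulmx k l (A : T -> 'M[R]_(k, l)) (X : T -> 'cV[R]_l) :
  (forall i j, measurable_fun setT (fun w => A w i j)) -> vmeas X ->
  vmeas (fun w => A w *m X w).
Proof.
move=> mA mX j; under eq_fun do rewrite mxE.
by apply: measurable_sum => i; exact: measurable_funM.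
Qed.

Lemma vmeas_col k (f : 'I_k -> T -> R) :
  (forall i, measurable_fun setT (f i)) -> vmeas (fun w => \col_i f i w).
Proof.
move=> mf j; rewrite (_ : (fun _ => _) = f j); first exact: mf.
by apply/funext => w; rewrite mxE.
Qed.

Lemma vmeas_col_mx k l (X : T -> 'cV[R]_k) (Y : T -> 'cV[R]_l) :
  vmeas X -> vmeas Y -> vmeas (fun w => col_mx (X w) (Y w)).
Proof.
move=> mX mY j; case: (split_ordP j) => i ->.
  rewrite (_ : (fun _ => _) = (fun w => X w i 0)); first exact: mX.
  by apply/funext => w; rewrite col_mxEu.
rewrite (_ : (fun _ => _) = (fun w => Y w i 0)); first exact: mY.
by apply/funext => w; rewrite col_mxEd.
Qed.

Lemma measurable_dot k (X Y : T -> 'cV[R]_k) :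
  vmeas X -> vmeas Y -> measurable_fun setT (fun w => dot (X w) (Y w)).
Proof. by move=> mX mY; apply: measurable_sum => j; exact: measurable_funM. Qed.

Lemma measurable_enorm_sq k (X : T -> 'cV[R]_k) :
  vmeas X -> measurable_fun setT (fun w => enorm (X w) ^+ 2).
Proof. by move=> mX; under eq_fun do rewrite enorm_sq; exact: measurable_dot. Qed.

Lemma measurable_enorm k (X : T -> 'cV[R]_k) :
  vmeas X -> measurable_fun setT (fun w => enorm (X w)).
Proof.
move=> /measurable_enorm_sq mX.
rewrite (_ : (fun _ => _) = Num.sqrt \o (fun w => enorm (X w) ^+ 2)); last first.
  by apply/funext => w /=; rewrite sqrtr_sqr ger0_norm // enorm_ge0.
apply: measurableT_comp => //; apply: continuous_measurable_fun.
exact: sqrt_continuous.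
Qed.

(** Serves the factor rho / |z| of the projection. On each sign the inverse is a power with exponent
    -1, and at 0 it takes its default value 0. *)
Lemma measurable_finv (h : T -> R) :
  measurable_fun setT h -> measurable_fun setT (fun w => (h w)^-1).
Proof.
move=> mh; rewrite (_ : (fun _ => _) = (fun w => if 0 < h w then h w `^ (-1) else
   if h w < 0 then - ((- h w) `^ (-1)) else 0)); last first.
  apply/funext => w; case: ltgtP => h0.
  - by rewrite powR_inv1 // ltW.
  - by rewrite powR_inv1 ?oppr_ge0 ?ltW // invrN opprK.
  - by rewrite -h0 invr0.
have mp (g : T -> R) : measurable_fun setT g -> measurable_fun setT (fun w => g w `^ (-1)).
  by move=> mg; apply: (measurableT_comp (measurable_powR _)).
apply: measurable_fun_ifT.
- by apply: measurable_fun_ltr.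
- exact: mp.
- apply: measurable_fun_ifT.
  + by apply: measurable_fun_ltr.
  + by apply: measurable_funN; apply: mp; exact: measurable_funN.
  + exact: measurable_cst.
Qed.

(* Rational Euclidean balls form a countable base of the topology of R^k. *)
Lemma vmeas_borel k (X : T -> 'cV[R]_k) :
  vmeas X -> measurable_fun setT (X : T -> borel R k).
Proof.
move=> mX; apply: (@measurability _ _ T (borel R k) setT X (@open 'cV[R]_k)) => //.
move=> _ [U oU <-]; rewrite setTI.
pose q2r (q : 'cV[rat]_k) : 'cV[R]_k := map_mx ratr q.
pose B (p : 'cV[rat]_k * nat) := [set v : 'cV[R]_k | enorm (v - q2r p.1) < p.2.+1%:R^-1].
pose I := [set p | B p `<=` U].
have -> : X @^-1` U = \bigcup_p (if p \in I then X @^-1` B p else set0).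
  apply/seteqP; split => w /=; last first.
    by move=> [p _]; case: ifPn => // /[!inE] pI; exact: pI.
  move=> UXw; have /nbhs_ballP[e /= e0 eU] : nbhs (X w) U by exact: open_nbhs_nbhs.
  (* Twice the radius 1 / (m + 1) stays below e, so a ball of that radius which contains [X w] lies
     inside U. *)
  have [m me] : exists m : nat, 2 * m.+1%:R^-1 < e.
    exists (Num.truncn (2 / e)); rewrite ltr_pdivrMr // mulrC -ltr_pdivrMr //.
    exact: truncnS_gt.
  have [q qX] : exists q : 'cV[rat]_k, enorm (X w - q2r q) < m.+1%:R^-1.
    have hq j : exists q, `|X w j 0 - ratr q| < m.+1%:R^-1 / k.+1%:R.
      have [|q] := @rat_in_itvoo R (X w j 0 - m.+1%:R^-1 / k.+1%:R) (X w j 0 + m.+1%:R^-1 / k.+1%:R).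
        by rewrite ltrBlDr -addrA ltrDl -mulr2n pmulrn_lgt0 // divr_gt0.
      by rewrite in_itv /= => h; exists q; rewrite ltr_distlC.
    have [f hf] := choice hq; exists (\col_j f j).
    apply: (le_lt_trans (enorm_le_sum _)).
    apply: (@le_lt_trans _ _ (\sum_(j < k) m.+1%:R^-1 / k.+1%:R)).
      by apply: ler_sum => j _; rewrite !mxE ltW // hf.
    rewrite sumr_const card_ord -[_ *+ k]mulr_natr -mulrA gtr_pMr ?invr_gt0 //.
    by rewrite mulrC ltr_pdivrMr // mul1r ltr_nat.
  exists (q, m) => //; rewrite ifT /B //= inE /I => v /= vq; apply: eU.
  rewrite -ball_normE /= (le_lt_trans (mxnorm_le_enorm _)) //.
  rewrite -(subrK (q2r q) (X w)) -addrA (le_lt_trans (enormD _ _)) //.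
  rewrite (lt_trans _ me) // mulr_natl mulr2n ltrD //.
  by rewrite enormBC.
apply: countable_bigcupT_measurable => [|p]; first exact: countableP.
case: ifPn => // _.
rewrite -[_ @^-1` _]setTI.
have mc : measurable_fun setT (fun w => enorm (X w - q2r p.1)).
  by apply: measurable_enorm; apply: vmeasB => //; exact: vmeas_cst.
rewrite (_ : X @^-1` B p = (fun w => enorm (X w - q2r p.1)) @^-1` `]-oo, p.2.+1%:R^-1[%classic).
  exact: (mc measurableT _ (measurable_itv _)).
by apply/seteqP; split => w; rewrite /B /= in_itv.
Qed.

End VectorMeasurability.

Section BorelMaps.
Context {R : realType}.

Lemma continuous_borel_measurable k (h : 'cV[R]_k -> R) :
  continuous h -> measurable_fun setT (h : borel R k -> R).
Proof.
move=> ch; apply: (measurability (@RGenOInfty.G R)); first exact: RGenOInfty.measurableE.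
move=> _ [_ [x ->] <-]; rewrite setTI; apply: sub_sigma_algebra => /=.
apply: open_comp; last exact: interval_open.
by move=> v _; exact: ch.
Qed.

Context {d : measure_display} {T : measurableType d}.

Lemma measurable_continuous_vmeas k (h : 'cV[R]_k -> R) (X : T -> 'cV[R]_k) :
  continuous h -> vmeas X -> measurable_fun setT (fun w => h (X w)).
Proof.
move=> /continuous_borel_measurable ch /vmeas_borel mX.
exact: (measurableT_comp ch mX).
Qed.

(** The topology is that of the sup norm, and the Euclidean norm is at most k times it; the 1 added
    in [c'] keeps the modulus positive. *)
Lemma continuous_of_le_enorm k (h : 'cV[R]_k -> R) (c : R) :
  (forall u v, `|h u - h v| <= c * enorm (u - v)) -> continuous h.
Proof.
move=> hc v; apply/(@cvgrPdist_lt _ R^o _ (nbhs v) (nbhs_filter v)) => e e0.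
pose c' := `|c| * k%:R + 1.
have c'0 : 0 < c' by rewrite ltr_wpDl // mulr_ge0.
have ec : 0 < e / c' by rewrite divr_gt0.
apply/nbhs_ballP; exists (e / c') => //= u; rewrite -ball_normE /= ltr_pdivlMr // => vu.
rewrite (le_lt_trans (hc _ _)) // (le_lt_trans _ vu) // mulrC.
rewrite (@le_trans _ _ ((k%:R * `|v - u|) * `|c|)) //.
  by rewrite (le_trans (ler_wpM2l (enorm_ge0 _) (ler_norm c))) // ler_wpM2r ?enorm_le_mxnorm.
by rewrite /c' mulrC mulrA mulrC ler_wpM2l // lerDl.
Qed.

Lemma measurable_borel_coord k (j : 'I_k) :
  measurable_fun setT (fun v : borel R k => v j 0).
Proof.
apply: continuous_borel_measurable; apply: (@continuous_of_le_enorm _ _ 1) => u v.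
by rewrite mul1r; have := le_enorm_coord (u - v) j; rewrite !mxE.
Qed.

End BorelMaps.

(** * Independence of disjoint groups of draws *)

Section Independence.
Context {R : realType} {d : measure_display} {T : measurableType d} {I : choiceType}.
Context (S : I -> set_system T).

Definition sub_events (J : set I) : set_system T := \bigcup_(i in J) S i.

(* [T] with the sub-sigma-algebra generated by the sources of randomness in [J] *)
Definition past (J : set I) := g_sigma_algebraType (sub_events J).

(** The pi-system generating the events of J: finite intersections with one event per source.
    Indexing by a finite set makes intersections correspond to unions of index sets. *)
Definition cyl (J : set I) : set_system T :=
  [set A | exists (F : {fset I}) (E : I -> set T),
     [/\ [set` F] `<=` J, forall i, S i (E i) & A = \bigcap_(i in [set` F]) E i]].

Context {P : probability T R}.
Context (SI : forall i, setI_closed (S i)) (ST : forall i, S i setT).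
Context (Sm : forall i, S i `<=` measurable) (indepS : indep_systems P S).

Lemma cyl_setI J : setI_closed (cyl J).
Proof.
move=> _ _ [F [E [FJ SE ->]]] [F' [E' [FJ' SE' ->]]].
exists (F `|` F')%fset, (fun i => (if i \in F then E i else setT) `&`
  (if i \in F' then E' i else setT)); split.
- by move=> i /=; rewrite inE => /orP[/FJ|/FJ'].
- by move=> i; apply: SI; case: ifP.
- apply/seteqP; split => w /=.
    by move=> [h h'] i _; split; case: ifPn => // iF; [exact: h|exact: h'].
  move=> h; split => i /= iF.
    have [] := h i; rewrite /= ?inE ?iF //.
  have [] := h i; rewrite /= ?inE ?iF ?orbT //.
Qed.

Lemma cyl_setT J : cyl J setT.
Proof.
exists fset0, (fun _ => setT); split => //.
by apply/seteqP; split.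
Qed.

Lemma cyl_measurable J : cyl J `<=` measurable.
Proof.
move=> _ [F [E [_ SE ->]]]; apply: fin_bigcap_measurable => // i _.
exact: Sm (SE i).
Qed.

Lemma sub_events_cyl J : sub_events J `<=` cyl J.
Proof.
move=> A [i Ji SA].
exists [fset i]%fset, (fun j => if j == i then A else setT); split.
- by move=> j /=; rewrite inE => /eqP ->.
- by move=> j; case: eqP => [->|].
- apply/seteqP; split => w /=.
    by move=> Aw j /=; rewrite inE => ji; rewrite ji.
  by move=> /(_ i); rewrite /= inE eqxx; apply.
Qed.

Lemma sub_events_measurable J : sub_events J `<=` measurable.
Proof. by move=> A /sub_events_cyl /cyl_measurable. Qed.

Lemma cyl_indep J1 J2 A B : J1 `&` J2 = set0 -> cyl J1 A -> cyl J2 B ->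
  (P (A `&` B) = P A * P B)%E.
Proof.
move=> J12 [F [E [FJ SE ->]]] [F' [E' [FJ' SE' ->]]].
have dis i : i \in F -> i \in F' -> False.
  by move=> /FJ i1 /FJ' i2; have : (J1 `&` J2) i by []; rewrite J12.
pose E2 i := if i \in F then E i else E' i.
have -> : \bigcap_(i in [set` F]) E i `&` \bigcap_(i in [set` F']) E' i =
    \bigcap_(i in [set` (F `|` F')%fset]) E2 i.
  apply/seteqP; split => w /=.
    move=> [h h'] i /=; rewrite inE /E2 => /orP[iF|iF'].
      by rewrite iF; exact: h.
    by case: ifPn => iF; [exact: h|exact: h'].
  move=> h; split => i /= iF.
    by have := h i; rewrite /= inE /E2 iF; apply.
  have := h i; rewrite /= inE iF orbT /E2 => /(_ isT).
  by case: ifPn => // iF'; case: (dis i).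
rewrite !indepS //; last by move=> i _; rewrite /E2; case: ifP.
rewrite (perm_big (F ++ F')) /=; last first.
  apply: uniq_perm; rewrite ?cat_uniq ?fset_uniq //= ?andbT.
    by apply/hasPn => i iF'; apply/negP => /= iF; exact: (dis i).
  by move=> i; rewrite mem_cat inE.
rewrite big_cat /=; congr (_ * _)%E; apply: eq_big_seq => i iF.
  by rewrite /E2 iF.
by rewrite /E2; case: ifPn => // iF'; case: (dis i).
Qed.

(** Uniqueness of finite measures, one argument at a time. For a fixed C, the measure of the
    intersection of X with C and the product P C * P X are both measures in X; [half] passes from
    their agreement on the cylinders to the generated sigma-algebra. It is used once for each of the
    two events. *)
Lemma past_indep J1 J2 A B : J1 `&` J2 = set0 ->
  measurable (A : set (past J1)) -> measurable (B : set (past J2)) ->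
  (P (A `&` B) = P A * P B)%E.
Proof.
move=> J12 mA mB.
have sub J : <<s sub_events J >> `<=` <<s cyl J >>.
  apply: smallest_sub; first exact: smallest_sigma_algebra.
  by move=> X /sub_events_cyl; exact: sub_sigma_algebra.
have subm J : <<s cyl J >> `<=` measurable.
  apply: smallest_sub; first exact: sigma_algebra_measurable.
  exact: cyl_measurable.
have cov : \bigcup_(k : nat) (setT : set T) = setT.
  by apply/seteqP; split => // w _; exists 0%N.
have half J (C : set T) : measurable C ->
    (forall X, cyl J X -> (P (X `&` C) = P X * P C)%E) ->
    forall X, <<s cyl J >> X -> (P (X `&` C) = P X * P C)%E.
  move=> mC hC X sX.
  pose r : {nonneg R} := NngNum (fine_ge0 (measure_ge0 P C)).
  have rE : (r%:num%:E = P C)%E by rewrite /= fineK // fin_num_measure.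
  transitivity (mscale r P X); last by rewrite /mscale /= muleC; congr (_ * _)%E.
  apply: (@g_sigma_algebra_measure_unique _ R T (cyl J) (@cyl_measurable J)
    (fun _ => setT) _ cov (mrestr P mC) (mscale r P)) => //.
  - by move=> _; exact: cyl_setT.
  - exact: cyl_setI.
  - by move=> Y cY; rewrite /= /mrestr /mscale hC // muleC; congr (_ * _)%E.
  - move=> _; rewrite /= /mrestr setTI; by rewrite ltey_eq fin_num_measure.
apply: (half J1) => //; last exact: sub.
  exact: (subm J2 _ (sub J2 _ mB)).
move=> X cX; rewrite setIC muleC.
apply: (half J2) => //; last exact: sub.
  exact: cyl_measurable cX.
by move=> Y cY; rewrite setIC muleC; exact: cyl_indep J12 cX cY.
Qed.

Lemma measurable_id_past J : measurable_fun setT (id : T -> past J).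
Proof.
apply: (@measurability _ _ T (past J) setT id (sub_events J)) => //.
by move=> _ [A sA <-]; rewrite setTI; exact: sub_events_measurable sA.
Qed.

Lemma measurable_of_past J d' (T' : measurableType d') (f : T -> T') :
  measurable_fun setT (f : past J -> T') -> measurable_fun setT f.
Proof.
move=> mf mT Y mY; have := measurable_id_past (J:=J) measurableT (mf measurableT Y mY).
by rewrite !setTI.
Qed.

(** * Freezing the past: integrals along the diagonal *)

Section Freeze.
Context (J1 J2 : set I) (J12 : J1 `&` J2 = set0).

HB.instance Definition _ J :=
  isMeasurableFun.Build _ _ T (past J) (idfun : T -> past J) (measurable_id_past (J:=J)).

(** P restricted to the events of J1, realised as the law of the identity into [past J1]. *)
Let P1 : probability (past J1) R := distribution P (idfun : T -> past J1).
Let P2 : probability (past J2) R := distribution P (idfun : T -> past J2).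

Let diag (w : T) : past J1 * past J2 := (w, w).

Let mdiag : measurable_fun setT diag.
Proof. by apply: measurable_fun_pair; exact: measurable_id_past. Qed.

HB.instance Definition _ := isMeasurableFun.Build _ _ T _ diag mdiag.

(** Independence in the form used below: the diagonal carries P to the product of the two
    restrictions, so an integral of psi (w, w) can be iterated with w frozen in the past and w'
    ranging over the fresh draws. *)
Let diagE X : measurable X -> (P1 \x P2)%E X = distribution P diag X.
Proof.
apply: product_measure_unique => A B mA mB.
rewrite /= /distribution /pushforward -(past_indep J12 mA mB).
by congr (P _); apply/seteqP; split.
Qed.

Lemma integral_freeze (psi : past J1 * past J2 -> \bar R) :
  measurable_fun setT psi -> (forall x, 0 <= psi x)%E ->
  (\int[P]_w psi (w, w) = \int[P]_w \int[P]_w' psi (w, w'))%E.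
Proof.
move=> mpsi psi0.
transitivity (\int[distribution P diag]_x psi x)%E.
  by rewrite ge0_integral_distribution.
transitivity (\int[(P1 \x P2)%E]_x psi x)%E.
  apply: eq_measure_integral => A mA _; apply: esym; exact: diagE mA.
rewrite fubini_tonelli1 // /fubini_F ge0_integral_distribution /=; last 2 first.
- exact: measurable_fun_fubini_tonelli_F.
- by move=> x; exact: integral_ge0.
apply: eq_integral => w _; rewrite ge0_integral_distribution //.
exact: measurableT_comp.
Qed.

Lemma measurable_integral_freeze (psi : past J1 * past J2 -> \bar R) :
  measurable_fun setT psi -> (forall x, 0 <= psi x)%E ->
  measurable_fun setT (fun w : T => \int[P]_w' psi (w, w'))%E.
Proof.
move=> mpsi psi0; apply: (@measurable_of_past J1).
rewrite (_ : (fun _ => _) = fubini_F P2 psi); last first.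
  apply/funext => w; rewrite /fubini_F ge0_integral_distribution //.
  exact: measurableT_comp.
exact: measurable_fun_fubini_tonelli_F.
Qed.

Lemma integral_freeze_le (psi : past J1 * past J2 -> \bar R) (g : T -> \bar R) :
  measurable_fun setT psi -> (forall x, 0 <= psi x)%E ->
  measurable_fun setT g -> (forall w, \int[P]_w' psi (w, w') <= g w)%E ->
  (\int[P]_w psi (w, w) <= \int[P]_w g w)%E.
Proof.
move=> mpsi psi0 mg le_g; rewrite integral_freeze //; apply: ge0_le_integral => //.
- by move=> w _; exact: integral_ge0.
- exact: measurable_integral_freeze.
Qed.

(** A signed integrand needs integrability on the diagonal before Fubini; then the inner integral
    vanishes for every frozen w. This is how the cross terms of independent noises disappear. *)
Lemma integral_freeze0 (psi : past J1 * past J2 -> R) :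
  measurable_fun setT psi ->
  (\int[P]_w `|psi (w, w)|%:E < +oo)%E ->
  (forall w, \int[P]_w' (psi (w, w'))%:E = 0)%E ->
  (\int[P]_w (psi (w, w))%:E = 0)%E.
Proof.
move=> mpsi ipsi psi0.
have mE : measurable_fun setT (EFin \o psi) by exact/measurable_EFinP.
have id : P.-integrable setT ((EFin \o psi) \o diag).
  apply/integrableP; split => //=; first exact: (measurableT_comp mE mdiag).
have iprod : (P1 \x P2)%E.-integrable setT (EFin \o psi).
  apply/integrableP; split => //.
  rewrite (eq_measure_integral (distribution P diag)); last first.
    by move=> A mA _; exact: diagE.
  rewrite ge0_integral_distribution; [exact: ipsi|exact: measurableT_comp|by []].
transitivity (\int[distribution P diag]_x (psi x)%:E)%E.
  by rewrite (integral_pushforward mdiag mE) //.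
transitivity (\int[(P1 \x P2)%E]_x (psi x)%:E)%E.
  apply: eq_measure_integral => A mA _; apply: esym; exact: diagE mA.
rewrite -integral12_prod_meas1 // /fubini_F.
rewrite -[RHS](@integral0 _ _ _ P1 setT); apply: eq_integral => w _.
have m2 : measurable_fun setT (fun w' : past J2 => (psi (w, w'))%:E).
  by apply/measurable_EFinP; exact: measurableT_comp.
rewrite -[RHS](psi0 w) [LHS]integralE [RHS]integralE; congr (_ - _)%E.
  by rewrite ge0_integral_distribution //; exact: measurable_funepos.
by rewrite ge0_integral_distribution //; exact: measurable_funeneg.
Qed.

End Freeze.
End Independence.

(** * Noise and compression *)

Section SquareIntegrable.
Context {R : realType} {d : measure_display} {T : measurableType d}.
Context (P : probability T R).

Definition sqint k (X : T -> 'cV[R]_k) : \bar R := (\int[P]_w (enorm (X w) ^+ 2)%:E)%E.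

Definition mean0 k (X : T -> 'cV[R]_k) := forall j, (\int[P]_w (X w j 0)%:E = 0)%E.

Lemma sqint_ge0 k (X : T -> 'cV[R]_k) : (0 <= sqint X)%E.
Proof. by apply: integral_ge0 => w _; rewrite lee_fin sqr_ge0. Qed.

Lemma eq_sqint k (X Y : T -> 'cV[R]_k) : X =1 Y -> sqint X = sqint Y.
Proof. by move=> XY; apply: eq_integral => w _; rewrite XY. Qed.

Lemma integral_EFin_cst (a : R) : (\int[P]_w a%:E = a%:E)%E.
Proof.
rewrite integral_cst // -[RHS]mule1; congr (_ * _)%E; exact: probability_setT.
Qed.

Lemma sqint_cst k (a : 'cV[R]_k) : sqint (fun _ => a) = (enorm a ^+ 2)%:E.
Proof. exact: integral_EFin_cst. Qed.

Lemma le_sqint k l (X : T -> 'cV[R]_k) (Y : T -> 'cV[R]_l) : vmeas X -> vmeas Y ->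
  (forall w, enorm (X w) <= enorm (Y w)) -> (sqint X <= sqint Y)%E.
Proof.
move=> mX mY XY; apply: ge0_le_integral => //.
- by move=> w _; rewrite lee_fin sqr_ge0.
- by apply/measurable_EFinP; exact: measurable_enorm_sq.
- by apply/measurable_EFinP; exact: measurable_enorm_sq.
- by move=> w _; rewrite lee_fin ler_pXn2r ?nnegrE ?enorm_ge0.
Qed.

Lemma sqintZ k (a : R) (X : T -> 'cV[R]_k) : vmeas X ->
  (sqint (fun w => a *: X w) = (a ^+ 2)%:E * sqint X)%E.
Proof.
move=> mX; rewrite /sqint; under eq_integral do rewrite enorm_sqZ EFinM.
rewrite ge0_integralZl_EFin ?sqr_ge0 //.
- by move=> w _; rewrite lee_fin sqr_ge0.
- by apply/measurable_EFinP; exact: measurable_enorm_sq.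
Qed.

Lemma integrable_sq k (X : T -> 'cV[R]_k) : vmeas X -> (sqint X < +oo)%E ->
  P.-integrable setT (fun w => (enorm (X w) ^+ 2)%:E).
Proof.
move=> mX fX; apply/integrableP; split.
  by apply/measurable_EFinP; exact: measurable_enorm_sq.
apply: le_lt_trans fX; rewrite le_eqVlt; apply/orP; left; apply/eqP.
by apply: eq_integral => w _; rewrite /= ger0_norm // sqr_ge0.
Qed.

Lemma integrable_dot k (X Y : T -> 'cV[R]_k) : vmeas X -> vmeas Y ->
  (sqint X < +oo)%E -> (sqint Y < +oo)%E ->
  P.-integrable setT (fun w => (dot (X w) (Y w))%:E).
Proof.
move=> mX mY fX fY.
apply: (@le_integrable _ _ _ P setT measurableT _
  (fun w => (enorm (X w) ^+ 2)%:E + (enorm (Y w) ^+ 2)%:E)%E).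
- by apply/measurable_EFinP; exact: measurable_dot.
- move=> w _; rewrite -EFinD /= lee_fin [leRHS]ger0_norm ?addr_ge0 ?sqr_ge0 //.
  rewrite (le_trans (norm_dot_le _ _)) //.
  by have := enorm_ge0 (X w); have := enorm_ge0 (Y w); nra.
- by apply: integrableD => //; exact: integrable_sq.
Qed.

Lemma integrable_coord k (X : T -> 'cV[R]_k) j : vmeas X -> (sqint X < +oo)%E ->
  P.-integrable setT (fun w => (X w j 0)%:E).
Proof.
move=> mX fX; have := @integrable_dot k X (fun _ => delta_mx j 0) mX.
move=> /(_ (vmeas_cst _) fX); rewrite sqint_cst ltry => /(_ isT).
by under [X in integrable _ _ X -> _]eq_fun do rewrite dot_delta.
Qed.

Lemma integral_dotl k (a : 'cV[R]_k) (Y : T -> 'cV[R]_k) : vmeas Y -> (sqint Y < +oo)%E ->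
  mean0 Y -> (\int[P]_w (dot a (Y w))%:E = 0)%E.
Proof.
move=> mY fY mY0; rewrite /dot; under eq_integral do rewrite -sumEFin.
rewrite integral_sum //; last first.
  move=> j; under eq_fun do rewrite EFinM.
  by apply: integrableZl => //; exact: integrable_coord.
rewrite big1 // => j _; under eq_integral do rewrite EFinM.
by rewrite integralZl ?mY0 ?mule0 //; exact: integrable_coord.
Qed.

Lemma sqint_orth k (X Y : T -> 'cV[R]_k) : vmeas X -> vmeas Y ->
  (sqint X < +oo)%E -> (sqint Y < +oo)%E -> (\int[P]_w (dot (X w) (Y w))%:E = 0)%E ->
  sqint (fun w => X w + Y w) = (sqint X + sqint Y)%E.
Proof.
move=> mX mY fX fY XY0; rewrite /sqint.
under eq_integral do rewrite enorm_sqD !EFinD (EFinM 2).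
have iX := integrable_sq mX fX; have iY := integrable_sq mY fY.
have iXY := integrable_dot mX mY fX fY.
have i2 : P.-integrable setT (fun w => (2%:E * (dot (X w) (Y w))%:E)%E) by exact: integrableZl.
rewrite integralD //; last exact: integrableD.
by rewrite integralD // integralZl // XY0 mule0 adde0.
Qed.

Lemma sqint_shift k (a : 'cV[R]_k) (Y : T -> 'cV[R]_k) : vmeas Y -> (sqint Y < +oo)%E ->
  mean0 Y -> sqint (fun w => a + Y w) = ((enorm a ^+ 2)%:E + sqint Y)%E.
Proof.
move=> mY fY mY0; rewrite (sqint_orth (X := fun _ => a)) ?sqint_cst ?ltry //.
exact: integral_dotl.
Qed.

Lemma sqintD_lty k (X Y : T -> 'cV[R]_k) : vmeas X -> vmeas Y ->
  (sqint X < +oo)%E -> (sqint Y < +oo)%E -> (sqint (fun w => X w + Y w)%R < +oo)%E.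
Proof.
move=> mX mY fX fY.
apply: (@le_lt_trans _ _ (\int[P]_w ((2 * enorm (X w) ^+ 2)%R%:E + (2 * enorm (Y w) ^+ 2)%R%:E))%E).
  apply: ge0_le_integral => //.
  - by move=> w _; rewrite lee_fin sqr_ge0.
  - by apply/measurable_EFinP/measurable_enorm_sq/vmeasD.
  - apply/measurable_EFinP; apply: measurable_funD; apply: measurable_funM => //;
      exact: measurable_enorm_sq.
  - by move=> w _; rewrite -EFinD lee_fin enorm_sqD2.
under eq_integral do rewrite !(EFinM 2).
have iX := integrable_sq mX fX; have iY := integrable_sq mY fY.
rewrite integralD //; try exact: integrableZl.
rewrite !integralZl // lte_add_pinfty //; rewrite lte_mul_pinfty //; exact: lee_fin.
Qed.

Lemma mean0D k (X Y : T -> 'cV[R]_k) : vmeas X -> vmeas Y ->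
  (sqint X < +oo)%E -> (sqint Y < +oo)%E -> mean0 X -> mean0 Y ->
  mean0 (fun w => X w + Y w).
Proof.
move=> mX mY fX fY X0 Y0 j; under eq_integral do rewrite mxE EFinD.
by rewrite integralD ?X0 ?Y0 ?adde0 //; exact: integrable_coord.
Qed.

Lemma mean0Z k (a : R) (X : T -> 'cV[R]_k) : vmeas X -> (sqint X < +oo)%E -> mean0 X ->
  mean0 (fun w => a *: X w).
Proof.
move=> mX fX X0 j; under eq_integral do rewrite mxE EFinM.
by rewrite integralZl ?X0 ?mule0 //; exact: integrable_coord.
Qed.

End SquareIntegrable.

(** * Centred noise and unbiased compressors attached to sets of draws *)

Section Noise.
Context {R : realType} {d : measure_display} {T : measurableType d} {I : choiceType}.
Context (S : I -> set_system T) (P : probability T R).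
Context (SI : forall i, setI_closed (S i)) (ST : forall i, S i setT).
Context (Sm : forall i, S i `<=` measurable) (indepS : indep_systems P S).

Definition jmeas (J : set I) k (X : T -> 'cV[R]_k) := @vmeas _ (past S J) R k X.

(** The set J is recorded along with the mean and the second moment: variances then add over
    disjoint sets of draws, without a new independence argument each time. *)
Definition noise (J : set I) k (X : T -> 'cV[R]_k) (v : R) :=
  [/\ jmeas J X, mean0 P X & (sqint P X <= v%:E)%E].

(** The randomness of the compressor lies in the draws J. Measurability is joint in the draw and the
    input, so that a random input may be substituted. *)
Definition ucomp (J : set I) k (C : T -> 'cV[R]_k -> 'cV[R]_k) (omega : R) :=
  [/\ forall j, measurable_fun setT (fun p : past S J * borel R k => C p.1 p.2 j 0),
      forall v, mean0 P (fun w => C w v - v) &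
      forall v, (sqint P (fun w => C w v - v)%R <= (omega * enorm v ^+ 2)%:E)%E].

Lemma measurable_past_mono (J J' : set I) d' (T' : measurableType d') (f : T -> T') :
  J `<=` J' -> measurable_fun setT (f : past S J -> T') ->
  measurable_fun setT (f : past S J' -> T').
Proof.
move=> JJ' mf _ Y mY; have := mf measurableT Y mY; rewrite !setTI.
apply: smallest_sub; first exact: smallest_sigma_algebra.
by move=> A [i Ji SA]; apply: sub_sigma_algebra; exists i => //; exact: JJ'.
Qed.

Lemma jmeas_mono (J J' : set I) k (X : T -> 'cV[R]_k) : J `<=` J' -> jmeas J X -> jmeas J' X.
Proof. by move=> JJ' mX j; apply: measurable_past_mono JJ' _; exact: mX. Qed.

Lemma jmeas_vmeas (J : set I) k (X : T -> 'cV[R]_k) : jmeas J X -> vmeas X.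
Proof. by move=> mX j; apply: (measurable_of_past ST Sm (J := J)); exact: mX. Qed.

Lemma noise_vmeas (J : set I) k (X : T -> 'cV[R]_k) v : noise J X v -> vmeas X.
Proof. by case=> /jmeas_vmeas. Qed.

Lemma noise_lty (J : set I) k (X : T -> 'cV[R]_k) v : noise J X v -> (sqint P X < +oo)%E.
Proof. by case=> _ _ h; apply: le_lt_trans h _; exact: ltry. Qed.

Lemma noise_mono (J J' : set I) k (X : T -> 'cV[R]_k) v v' :
  J `<=` J' -> v <= v' -> noise J X v -> noise J' X v'.
Proof.
move=> JJ' vv' [mX X0 X2]; split => //; first exact: jmeas_mono mX.
by rewrite (le_trans X2) // lee_fin.
Qed.

Lemma noise0 (J : set I) k : noise J (fun _ => 0 : 'cV[R]_k) 0.
Proof.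
split; first exact: vmeas_cst.
  by move=> j; rewrite integral0_eq // => w _; rewrite mxE.
by rewrite sqint_cst enorm0 expr0n.
Qed.

Lemma noiseZ (J : set I) k (a : R) (X : T -> 'cV[R]_k) v :
  noise J X v -> noise J (fun w => a *: X w) (a ^+ 2 * v).
Proof.
move=> nX; have mX := noise_vmeas nX; have fX := noise_lty nX; case: nX => jX X0 X2.
split; first exact: vmeasZ.
  exact: mean0Z.
by rewrite sqintZ // (EFinM (a ^+ 2)) lee_wpmul2l // lee_fin sqr_ge0.
Qed.

(** With X frozen the inner product is linear in Y, whose mean is zero. *)
Lemma indep_dot0 (J1 J2 : set I) k (X Y : T -> 'cV[R]_k) : J1 `&` J2 = set0 ->
  jmeas J1 X -> (sqint P X < +oo)%E -> jmeas J2 Y -> (sqint P Y < +oo)%E -> mean0 P Y ->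
  (\int[P]_w (dot (X w) (Y w))%:E = 0)%E.
Proof.
move=> J12 mX fX mY fY Y0.
have vX := jmeas_vmeas mX; have vY := jmeas_vmeas mY.
apply: (integral_freeze0 SI ST Sm indepS J12 (psi := fun p => dot (X p.1) (Y p.2))).
- apply: measurable_dot => j.
    exact: (measurableT_comp (mX j)).
  exact: (measurableT_comp (mY j)).
- by have /integrableP[] := integrable_dot vX vY fX fY.
- by move=> w; exact: (integral_dotl (X w) vY fY Y0).
Qed.

Lemma noiseD (J1 J2 : set I) k (X Y : T -> 'cV[R]_k) v1 v2 : J1 `&` J2 = set0 ->
  noise J1 X v1 -> noise J2 Y v2 -> noise (J1 `|` J2) (fun w => X w + Y w) (v1 + v2).
Proof.
move=> J12 nX nY; have mX := noise_vmeas nX; have fX := noise_lty nX.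
have mY := noise_vmeas nY; have fY := noise_lty nY.
case: nX nY => jX X0 X2 [jY Y0 Y2]; split.
- by apply: vmeasD; [apply: jmeas_mono jX; exact: subsetUl|apply: jmeas_mono jY; exact: subsetUr].
- exact: mean0D.
- have h0 := indep_dot0 J12 jX fX jY fY Y0.
  by rewrite (sqint_orth mX mY fX fY h0) EFinD leeD.
Qed.

Lemma noise_sum (A : eqType) (r : seq A) (J : A -> set I) k (X : A -> T -> 'cV[R]_k) v :
  uniq r -> (forall a b, a != b -> J a `&` J b = set0) ->
  (forall a, noise (J a) (X a) (v a)) ->
  noise (\bigcup_(a in [set` r]) J a) (fun w => \sum_(a <- r) X a w) (\sum_(a <- r) v a).
Proof.
move=> + Jdis nX; elim: r => [_|a r IH /= /andP[ar ur]].
  rewrite big_nil; under [X in noise _ X _]eq_fun do rewrite big_nil.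
  exact: noise0.
rewrite big_cons; under [X in noise _ X _]eq_fun do rewrite big_cons.
apply: noise_mono (noiseD _ (nX a) (IH ur)) => //.
- move=> i [Ji|[b br Jb]]; first by exists a => //=; rewrite mem_head.
  by exists b => //=; rewrite inE br orbT.
- rewrite setI_bigcupr bigcup0 // => b /= br; apply: Jdis.
  by apply: contraNneq ar => ->.
Qed.

Lemma ucomp_vmeas (J : set I) k (C : T -> 'cV[R]_k -> 'cV[R]_k) omega
    d' (U : measurableType d') (W : U -> past S J) (V : U -> 'cV[R]_k) :
  ucomp J C omega -> measurable_fun setT W -> vmeas V ->
  vmeas (fun u => C (W u) (V u)).
Proof.
move=> [mC _ _] mW mV j.
exact: (measurableT_comp (mC j) (measurable_fun_pair mW (vmeas_borel mV))).
Qed.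

Section Compress.
Context (J1 J2 : set I) (J12 : J1 `&` J2 = set0) (k : nat).
Context (C : T -> 'cV[R]_k -> 'cV[R]_k) (omega : R) (o0 : 0 <= omega) (uC : ucomp J2 C omega).
Context (V : T -> 'cV[R]_k) (mV : jmeas J1 V) (fV : (sqint P V < +oo)%E).

Lemma compress_jmeas : jmeas (J1 `|` J2) (fun w => C w (V w)).
Proof.
apply: (ucomp_vmeas (W := fun w : past S (J1 `|` J2) => w : past S J2) uC).
  apply: (@measurable_past_mono J2 _ _ _ (id : T -> past S J2)) => //; exact: subsetUr.
apply: jmeas_mono mV; exact: subsetUl.
Qed.

Let jD : jmeas (J1 `|` J2) (fun w => C w (V w) - V w).
Proof.
apply: vmeasB; first exact: compress_jmeas.
apply: jmeas_mono mV; exact: subsetUl.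
Qed.

Let mpsi : vmeas (fun p : past S J1 * past S J2 => C p.2 (V p.1) - V p.1).
Proof.
have mVp : vmeas (fun p : past S J1 * past S J2 => V p.1).
  by move=> j; exact: (measurableT_comp (mV j)).
by apply: vmeasB => //; apply: (ucomp_vmeas uC).
Qed.

Lemma compress_sqint : (sqint P (fun w => (C w (V w) - V w)%R) <= omega%:E * sqint P V)%E.
Proof.
have [_ _ C2] := uC; have mVT := jmeas_vmeas mV.
apply: (@le_trans _ _ (\int[P]_w (omega * enorm (V w) ^+ 2)%:E)%E).
  apply: (integral_freeze_le SI ST Sm indepS J12
    (psi := fun p => (enorm (C p.2 (V p.1) - V p.1) ^+ 2)%:E)).
  - by apply/measurable_EFinP; exact: measurable_enorm_sq.
  - by move=> p; rewrite lee_fin sqr_ge0.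
  - by apply/measurable_EFinP; apply: measurable_funM => //; exact: measurable_enorm_sq.
  - by move=> w; exact: (C2 (V w)).
rewrite /sqint -ge0_integralZl_EFin //.
- by move=> w _; rewrite lee_fin sqr_ge0.
- by apply/measurable_EFinP; exact: measurable_enorm_sq.
Qed.

Lemma compress_lty : (sqint P (fun w => (C w (V w) - V w)%R) < +oo)%E.
Proof.
apply: le_lt_trans compress_sqint _; rewrite lte_mul_pinfty //; exact: lee_fin.
Qed.

Lemma compress_mean0 : mean0 P (fun w => C w (V w) - V w).
Proof.
move=> j; have [_ C0 _] := uC.
apply: (integral_freeze0 SI ST Sm indepS J12
  (psi := fun p => (C p.2 (V p.1) - V p.1) j 0)) => [|| w].
- exact: mpsi.
- by have /integrableP[] := integrable_coord j (jmeas_vmeas jD) compress_lty.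
- exact: (C0 (V w) j).
Qed.

Lemma compress_dot0 (X : T -> 'cV[R]_k) : jmeas J1 X -> (sqint P X < +oo)%E ->
  (\int[P]_w (dot (X w) (C w (V w) - V w))%:E = 0)%E.
Proof.
move=> mX fX; have [_ C0 C2] := uC.
apply: (integral_freeze0 SI ST Sm indepS J12
  (psi := fun p => dot (X p.1) (C p.2 (V p.1) - V p.1))) => [|| w].
- apply: measurable_dot mpsi; move=> j; exact: (measurableT_comp (mX j)).
- by have /integrableP[] := integrable_dot (jmeas_vmeas mX) (jmeas_vmeas jD) fX compress_lty.
- have mCw : vmeas (fun w' => C w' (V w) - V w).
    apply: vmeasB => //; apply: (@jmeas_vmeas J2).
    exact: (ucomp_vmeas uC).
  apply: (integral_dotl (X w) mCw _ (C0 (V w))).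
  by apply: le_lt_trans (C2 _) _; exact: ltry.
Qed.

Lemma noise_compress (X : T -> 'cV[R]_k) v s : noise J1 X v -> (sqint P V <= s%:E)%E ->
  noise (J1 `|` J2) (fun w => X w + (C w (V w) - V w)) (v + omega * s).
Proof.
move=> nX Vs; have mX := noise_vmeas nX; have fX := noise_lty nX.
case: nX => jX X0 X2; have mD := jmeas_vmeas jD; have fD := compress_lty; split.
- by apply: vmeasD; [apply: jmeas_mono jX; exact: subsetUl|exact: jD].
- apply: mean0D => //; exact: compress_mean0.
- rewrite sqint_orth //; last exact: compress_dot0.
  rewrite EFinD leeD // (le_trans compress_sqint) // EFinM.
  by rewrite lee_wpmul2l // lee_fin.
Qed.

(** The compression error is orthogonal to every square integrable function of the draws J1, in
    particular to its input V, so no cross term remains. *)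
Lemma sqint_compress (a b : R) :
  (sqint P (fun w => (a *: V w + b *: (C w (V w) - V w))%R)
    <= (a ^+ 2 + b ^+ 2 * omega)%:E * sqint P V)%E.
Proof.
have mVT := jmeas_vmeas mV; have mD := jmeas_vmeas jD; have fD := compress_lty.
have fin c (Y : T -> 'cV[R]_k) : vmeas Y -> (sqint P Y < +oo)%E ->
    (sqint P (fun w => c *: Y w)%R < +oo)%E.
  by move=> mY fY; rewrite sqintZ // lte_mul_pinfty // lee_fin sqr_ge0.
rewrite sqint_orth //; last 5 first.
- exact: vmeasZ.
- exact: vmeasZ.
- exact: fin.
- exact: fin.
- under eq_integral do rewrite dotZl dotZr mulrA EFinM.
  rewrite integralZl //; last exact: integrable_dot.
  by rewrite compress_dot0 ?mule0.
have b0 : 0 <= b ^+ 2 * omega by rewrite mulr_ge0 // sqr_ge0.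
rewrite !sqintZ // EFinD ge0_muleDl ?lee_fin ?sqr_ge0 //.
rewrite leeD2l // (EFinM (b ^+ 2)) -muleA lee_wpmul2l ?lee_fin ?sqr_ge0 //.
exact: compress_sqint.
Qed.

End Compress.
End Noise.

Section ContractionFactor.
Context {R : realType} (omega : R) (o0 : 0 <= omega).
Let q := omega / (1 + omega).

Lemma msc_q_ge0 : 0 <= q.
Proof. by rewrite divr_ge0 // addr_ge0. Qed.

Lemma msc_q_lt1 : q < 1.
Proof.
have o1 : 0 < 1 + omega by rewrite ltr_wpDr.
by rewrite /q ltr_pdivrMr // mul1r ltrDr.
Qed.

Lemma msc_qX_lt1 rd : (0 < rd)%N -> q ^+ rd < 1.
Proof. by move=> r0; rewrite exprn_ilt1 ?msc_q_ge0 ?msc_q_lt1 // -lt0n. Qed.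

Lemma tomega_ge rd : q ^+ rd / (1 - q ^+ rd) <= tomega omega rd.
Proof. by rewrite /tomega le_max lexx orbT. Qed.

Lemma tomega_ge0 rd : 0 <= tomega omega rd.
Proof.
by rewrite /tomega le_max mulr_ge0 // exprn_ge0 // divr_ge0 // addr_ge0.
Qed.

End ContractionFactor.

(** * Multi-step compression *)

Section MultiStep.
Context {R : realType} {d : measure_display} {T : measurableType d} {I : choiceType}.
Context (S : I -> set_system T) (P : probability T R).
Context (SI : forall i, setI_closed (S i)) (ST : forall i, S i setT).
Context (Sm : forall i, S i `<=` measurable) (indepS : indep_systems P S).
Context (k : nat) (omega : R) (o0 : 0 <= omega).
Context (J : nat -> set I) (Jdis : forall r s, r != s -> J r `&` J s = set0).
Context (C : nat -> T -> 'cV[R]_k -> 'cV[R]_k).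
Context (uC : forall r, ucomp S P (J r) (C r) omega).

Let JJ r : set I := \bigcup_(s in `I_r) J s.
Let q := omega / (1 + omega).
Let E r (v : 'cV[R]_k) w := v - msc_iter omega (fun s => C s w) v r.

Let q0 : 0 <= q. Proof. exact: msc_q_ge0. Qed.

Lemma msc_iter_vmeas r r' d' (U : measurableType d') (W : U -> past S (JJ r'))
    (V : U -> 'cV[R]_k) : (r <= r')%N -> measurable_fun setT W -> vmeas V ->
  vmeas (fun u => msc_iter omega (fun s => C s (W u)) (V u) r).
Proof.
move=> + mW mV; elim: r => [_|r IH rr' /=]; first exact: vmeas_cst.
have mr := IH (ltnW rr'); apply: vmeasD => //; apply: vmeasZ.
apply: (ucomp_vmeas (W := fun u => W u : past S (J r)) (uC r)); last exact: vmeasB.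
have mid : measurable_fun setT (id : past S (JJ r') -> past S (J r)).
  apply: (@measurable_past_mono _ _ _ _ (J r) (JJ r') _ (past S (J r)) id) => //.
  by move=> i Ji; exists r.
exact: (measurableT_comp mid mW).
Qed.

Let jE r v : jmeas S (JJ r) (E r v).
Proof.
apply: vmeasB; first exact: vmeas_cst.
apply: (msc_iter_vmeas (W := fun w : past S (JJ r) => w) (r' := r)) => //.
Qed.

(** One more round replaces the residual v - v^r by q times itself plus a centred error of the fresh
    compressor call, because 1 - 1 / (1 + omega) = q. *)
Let ES r v w : E r.+1 v w = q *: E r v w + (- (1 + omega)^-1) *: (C r w (E r v w) - E r v w).
Proof.
have -> : q = 1 - (1 + omega)^-1 by rewrite /q; field; have := o0; lra.
rewrite /E /=; set W := msc_iter _ _ _ _; set D := C _ _ _.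
by apply/matrixP => i j; rewrite !mxE; ring.
Qed.

Let JJdis r : JJ r `&` J r = set0.
Proof.
rewrite setI_bigcupl bigcup0 // => s /= sr; apply: Jdis.
by rewrite neq_ltn sr.
Qed.

(** The two parts of the new residual are orthogonal and q^2 + omega / (1 + omega)^2 = q, so each
    round contributes one factor q to the second moment. *)
Let E2 r v : (sqint P (E r v) <= (q ^+ r * enorm v ^+ 2)%:E)%E.
Proof.
elim: r => [|r IH].
  rewrite expr0 mul1r (eq_sqint _ (Y := fun _ => v)) ?sqint_cst // => w.
  by rewrite /E /= subr0.
have fE : (sqint P (E r v) < +oo)%E by apply: le_lt_trans IH _; exact: ltry.
rewrite (eq_sqint _ (ES r v)).
have := sqint_compress SI ST Sm indepS (@JJdis r) o0 (uC r) (@jE r v) fE q (- (1 + omega)^-1).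
move=> /le_trans; apply.
have -> : q ^+ 2 + (- (1 + omega)^-1) ^+ 2 * omega = q by rewrite /q; field; have := o0; lra.
by rewrite (exprS q) -mulrA (EFinM q) lee_wpmul2l // lee_fin.
Qed.

Let fE r v : (sqint P (E r v) < +oo)%E.
Proof. by apply: le_lt_trans (E2 r v) _; exact: ltry. Qed.

Let vE r v : vmeas (E r v).
Proof. exact: (jmeas_vmeas ST Sm (@jE r v)). Qed.

(** The residual has mean q^r v; this is its centred part. *)
Let Y r v w := E r v w - q ^+ r *: v.

Let vY r v : vmeas (Y r v).
Proof. by apply: vmeasB => //; exact: vmeas_cst. Qed.

Let fY r v : (sqint P (Y r v) < +oo)%E.
Proof.
apply: sqintD_lty => //.
by rewrite sqint_cst ltry.
Qed.

Let Y0 r v : mean0 P (Y r v).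
Proof.
elim: r => [|r IH].
  move=> j; rewrite integral0_eq // => w _.
  by rewrite /Y /E /= expr0 scale1r subr0 subrr mxE.
rewrite (_ : Y r.+1 v = fun w => q *: Y r v w +
    (- (1 + omega)^-1) *: (C r w (E r v w) - E r v w)); last first.
  apply/funext => w; rewrite /Y ES exprS.
  by apply/matrixP => i j; rewrite !mxE; ring.
have vD : vmeas (fun w => C r w (E r v w) - E r v w).
  apply: vmeasB => //; apply: (jmeas_vmeas ST Sm (J := JJ r `|` J r)).
  exact: (compress_jmeas (uC r) (@jE r v)).
have fD := compress_lty SI ST Sm indepS (@JJdis r) o0 (uC r) (@jE r v) (@fE r v).
have D0 := compress_mean0 SI ST Sm indepS (@JJdis r) o0 (uC r) (@jE r v) (@fE r v).
have fZ c (X : T -> 'cV[R]_k) : vmeas X -> (sqint P X < +oo)%E ->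
    (sqint P (fun w => c *: X w)%R < +oo)%E.
  by move=> mX fX; rewrite (sqintZ P c mX) lte_mul_pinfty // lee_fin sqr_ge0.
exact: (mean0D (vmeasZ q (@vY r v)) (vmeasZ (- (1 + omega)^-1) vD) (fZ _ _ (@vY r v) (@fY r v))
  (fZ _ _ vD fD) (mean0Z q (@vY r v) (@fY r v) IH) (mean0Z (- (1 + omega)^-1) vD fD D0)).
Qed.

(** The final rescaling removes the bias q^R v. The error left is the centred residual divided by 1
    - q^R, up to sign, and its second moment is at most (q^R - q^(2R)) |v|^2 / (1 - q^R)^2 = q^R /
    (1 - q^R) |v|^2, the second entry of the maximum in [tomega]. *)
Lemma ucomp_msc rd : (0 < rd)%N ->
  ucomp S P (JJ rd) (fun w v => msc omega (fun s => C s w) rd v) (tomega omega rd).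
Proof.
move=> rd0; have q1 : q ^+ rd < 1 by exact: msc_qX_lt1.
pose a := (1 - q ^+ rd)^-1.
have a0 : 1 - q ^+ rd != 0 by rewrite gt_eqF // subr_gt0.
have mscE v w : msc omega (fun s => C s w) rd v - v = (- a) *: Y rd v w.
  rewrite /msc -/q -/a /Y /E; set W := msc_iter _ _ _ _.
  apply/matrixP => i j; rewrite !mxE; rewrite /a; field.
  by [].
split.
- apply: vmeasZ.
  apply: (msc_iter_vmeas (W := fun p : past S (JJ rd) * borel R k => p.1)
    (V := fun p => p.2) (leqnn rd)); first exact: measurable_fst.
  move=> j; apply: (measurableT_comp (f := fun v : borel R k => v j 0)); last exact: measurable_snd.
  exact: measurable_borel_coord.
- move=> v; rewrite (_ : (fun _ => _) = (fun w => (- a) *: Y rd v w)); last exact/funext.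
  exact: mean0Z.
- move=> v; rewrite (eq_sqint _ (mscE v)) sqintZ // sqrrN.
  have hE : (sqint P (E rd v) = ((enorm (q ^+ rd *: v)) ^+ 2)%:E + sqint P (Y rd v))%E.
    rewrite -(sqint_shift _ (@vY rd v) (@fY rd v) (@Y0 rd v)); apply: eq_sqint => w.
    by rewrite /Y addrC subrK.
  have := E2 rd v; rewrite hE; have := fY rd v; have := sqint_ge0 P (Y rd v).
  case: (sqint P (Y rd v)) => [y||] //; rewrite -EFinD !lee_fin => y0 _ yle.
  apply: (@le_trans _ _ (q ^+ rd / (1 - q ^+ rd) * enorm v ^+ 2)); last first.
    by rewrite ler_wpM2r ?sqr_ge0 // tomega_ge.
  rewrite enorm_sqZ in yle.
  apply: (@le_trans _ _ (a ^+ 2 * (q ^+ rd * enorm v ^+ 2 - (q ^+ rd) ^+ 2 * enorm v ^+ 2))).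
    by rewrite ler_wpM2l ?sqr_ge0 //; lra.
  by rewrite le_eqVlt; apply/orP; left; apply/eqP; rewrite /a; field.
Qed.

End MultiStep.

(** * Calculus of the bilevel problem *)

Section LineDerivative.
Context {R : realType}.

(** The derivative at 0 with explicit epsilon and delta: sums, scalings and one-sided bounds become
    plain inequalities, and t = 0 needs no exclusion. *)
Definition eps_deriv (phi : R -> R) (D : R) := forall e : R, 0 < e ->
  exists2 del : R, 0 < del & forall t : R, `|t| < del -> `|phi t - phi 0 - t * D| <= e * `|t|.

Lemma is_derive_eps (V : normedModType R) (f : V -> R) (a v : V) (D : R) :
  is_derive a v f D <-> eps_deriv (fun t => f (t *: v + a)) D.
Proof.
split=> [[df Df] e e0|h].
  have : (fun s : R => s^-1 *: ((f \o shift a) (s *: v) - f a)) @ 0^' --> D.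
    by rewrite -Df; exact: df.
  move=> /cvgrPdist_lt /(_ _ e0); rewrite near_withinE => /nbhs_ballP[del /= del0 hdel].
  exists del => // t tdel; have [->|t0] := eqVneq t 0.
    by rewrite subrr mul0r subr0 normr0 mulr0.
  have := hdel t; rewrite -ball_normE /= sub0r normrN => /(_ tdel t0) /ltW.
  rewrite distrC scale0r add0r -[X in _ -> X <= _]mulr1 => hq.
  have -> : f (t *: v + a) - f a - t * D = t * (t^-1 *: (f (t *: v + a) - f a) - D).
    by rewrite mulrBr /GRing.scale /= mulrA divff // mul1r.
  by rewrite mulr1 normrM mulrC ler_wpM2r.
have cv : (fun s : R => s^-1 *: ((f \o shift a) (s *: v) - f a)) @ 0^' --> D.
  apply/cvgrPdist_le => e e0; have [del del0 hdel] := h e e0.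
  rewrite near_withinE; apply/nbhs_ballP; exists del => //= t.
  rewrite -ball_normE /= sub0r normrN => tdel t0.
  have := hdel t tdel; rewrite scale0r add0r.
  have -> : f (t *: v + a) - f a - t * D = t * (t^-1 *: (f (t *: v + a) - f a) - D).
    by rewrite mulrBr /GRing.scale /= mulrA divff // mul1r.
  by rewrite normrM mulrC ler_pM2r ?normr_gt0 // distrC.
split; first by apply/cvg_ex; exists D.
exact: cvg_lim.
Qed.

Lemma eps_derivD phi psi D E : eps_deriv phi D -> eps_deriv psi E ->
  eps_deriv (fun t => phi t + psi t) (D + E).
Proof.
move=> h1 h2 e e0; have e2 : 0 < e / 2 by rewrite divr_gt0.
have [d1 d10 hd1] := h1 _ e2; have [d2 d20 hd2] := h2 _ e2.
exists (Num.min d1 d2); first by rewrite lt_min d10.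
move=> t; rewrite lt_min => /andP[/hd1 t1 /hd2 t2].
have -> : phi t + psi t - (phi 0 + psi 0) - t * (D + E) =
  (phi t - phi 0 - t * D) + (psi t - psi 0 - t * E) by ring.
by rewrite (le_trans (ler_normD _ _)) //; lra.
Qed.

Lemma eps_derivZ a phi D : eps_deriv phi D -> eps_deriv (fun t => a * phi t) (a * D).
Proof.
move=> h e e0; have a0 : 0 < `|a| + 1 by rewrite ltr_wpDl.
have [d1 d10 hd] := h (e / (`|a| + 1)) (divr_gt0 e0 a0).
exists d1 => // t /hd ht.
have -> : a * phi t - a * phi 0 - t * (a * D) = a * (phi t - phi 0 - t * D) by ring.
rewrite normrM (le_trans (ler_wpM2l _ ht)) // mulrA ler_wpM2r //.
rewrite mulrCA; apply: ler_piMr; first exact: ltW.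
by rewrite ler_pdivrMr // mul1r lerDl.
Qed.

Lemma eps_deriv_linear c D : eps_deriv (fun t => c + t * D) D.
Proof.
move=> e e0; exists 1 => // t _.
have -> : c + t * D - (c + 0 * D) - t * D = 0 by ring.
by rewrite normr0 mulr_ge0 // ltW.
Qed.

Lemma eps_deriv_sq c : eps_deriv (fun t => c * t ^+ 2) 0.
Proof.
move=> e e0; have c0 : 0 < `|c| + 1 by rewrite ltr_wpDl.
exists (e / (`|c| + 1)); first by rewrite divr_gt0.
move=> t te; rewrite expr0n /= !mulr0 !subr0 expr2 mulrA normrM ler_wpM2r //.
move: te; rewrite ltr_pdivlMr // => /ltW te; rewrite normrM (le_trans _ te) //.
by rewrite mulrC ler_wpM2l // lerDl.
Qed.

Lemma eps_deriv_sum (I : Type) (r : seq I) (phi : I -> R -> R) (D : I -> R) :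
  (forall i, eps_deriv (phi i) (D i)) ->
  eps_deriv (fun t => \sum_(i <- r) phi i t) (\sum_(i <- r) D i).
Proof.
move=> h; elim: r => [|i r IH].
  move=> e e0; exists 1 => // t _.
  by rewrite !big_nil mulr0 !subr0 normr0 mulr_ge0 // ltW.
rewrite big_cons.
rewrite (_ : (fun _ => _) = (fun t => phi i t + \sum_(i <- r) phi i t)); last first.
  by apply/funext => t; rewrite big_cons.
exact: eps_derivD.
Qed.

(** Divide by t and let t tend to 0; the slack e' t accommodates the quadratic term of strong
    convexity. *)
Lemma eps_deriv_le phi (D c e' : R) : eps_deriv phi D ->
  (forall t : R, 0 < t < 1 -> phi t - phi 0 <= t * (c + e' * t)) -> D <= c.
Proof.
move=> h hle; apply/ler_addgt0Pr => e e0; have e2 : 0 < e / 2 by rewrite divr_gt0.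
have [del del0 hdel] := h _ e2; have a0 : 0 < `|e'| + 1 by rewrite ltr_wpDl.
(* Small enough to enter the radius of differentiability, to stay below 1 and to make the slack |e'|
   t at most e / 2. *)
pose t := Num.min (Num.min (del / 2) (1 / 2)) (e / 2 / (`|e'| + 1)).
have t0 : 0 < t by rewrite !lt_min !divr_gt0.
have td : t < del by rewrite gt_min gt_min ltr_pdivrMr // mulr2n mulrDr mulr1 ltrDl del0.
have t1 : t < 1 by rewrite !gt_min; apply/orP; left; apply/orP; right; lra.
have te : `|e'| * t <= e / 2.
  apply: (@le_trans _ _ ((`|e'| + 1) * t)); first by apply: ler_wpM2r; [exact: ltW|rewrite lerDl].
  by rewrite mulrC -ler_pdivlMr // ge_min lexx orbT.
have := hdel t; rewrite gtr0_norm // => /(_ td); rewrite ler_norml => /andP[h1 _].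
have h2 := hle t; rewrite t0 t1 in h2; have {}h2 := h2 isT.
have : t * D <= t * (c + e) by have := ler_norm e'; nra.
by rewrite ler_pM2l.
Qed.

Lemma eps_deriv_ge phi (D c e' : R) : eps_deriv phi D ->
  (forall t : R, 0 < t < 1 -> t * (c + e' * t) <= phi t - phi 0) -> c <= D.
Proof.
move=> /(eps_derivZ (-1)) h hle; rewrite -lerN2 -mulN1r.
apply: (eps_deriv_le (e' := - e') h) => t /hle; nra.
Qed.

Lemma eps_deriv_is_derive (phi : R -> R) (t D : R) :
  eps_deriv (fun s => phi (s + t)) D -> is_derive t 1 phi D.
Proof.
move=> h; apply/is_derive_eps; move: h.
by rewrite (_ : (fun s => phi (s *: 1 + t)) = (fun s => phi (s + t))) //;
  apply/funext => s; rewrite /GRing.scale /= mulr1.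
Qed.

Lemma eps_deriv_monotone (phi D : R -> R) :
  (forall t : R, 0 <= t <= 1 -> eps_deriv (fun s => phi (s + t)) (D t)) ->
  (forall t : R, 0 < t < 1 -> D t <= 0) -> phi 1 <= phi 0.
Proof.
move=> h D0; have [||c c01] := @MVT R phi D 0 1 ltr01.
- move=> t; rewrite in_itv /= => /andP[t0 t1].
  by apply: eps_deriv_is_derive; apply: h; rewrite !ltW.
- apply: derivable_within_continuous => t; rewrite in_itv /= => t01.
  by have [] := eps_deriv_is_derive (h t t01).
rewrite subr0 mulr1 => E; rewrite -subr_le0 E; apply: D0.
by move: c01; rewrite in_itv.
Qed.

Lemma differentiable_eps (V W : normedModType R) (F : V -> W) (p : V) :
  differentiable F p -> forall e : R, 0 < e ->
  exists2 del : R, 0 < del & forall h, `|h| < del -> `|F (h + p) - F p - 'd F p h| <= e * `|h|.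
Proof.
move=> /diff_locally /eqaddoP hF e e0.
have /nbhs_ballP[del /= del0 hdel] := hF e e0.
exists del => // h hd; have := hdel h; rewrite -ball_normE /= sub0r normrN => /(_ hd).
by rewrite !fctE /= opprD addrA.
Qed.

End LineDerivative.

(** * Gradients, smoothness and strong convexity *)

Section Gradient.
Context {R : realType}.

Definition gateaux d (h : 'cV[R]_d -> R) :=
  forall x v, eps_deriv (fun t => h (t *: v + x)) (dot (grad h x) v).

Lemma gateaux_is_derive d (h : 'cV[R]_d -> R) x v : gateaux h ->
  is_derive x v h (dot (grad h x) v).
Proof. by move=> gh; apply/is_derive_eps; exact: gh. Qed.

Lemma gateaux_line d (h : 'cV[R]_d -> R) x v t : gateaux h ->
  eps_deriv (fun s => h ((s + t) *: v + x)) (dot (grad h (t *: v + x)) v).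
Proof.
move=> /(_ (t *: v + x) v); rewrite (_ : (fun s => _) = (fun s => h ((s + t) *: v + x))) //.
by apply/funext => s; rewrite scalerDl addrA.
Qed.

Lemma differentiable_gateaux d (h : 'cV[R]_d -> R) :
  (forall x, differentiable h x) -> gateaux h.
Proof.
move=> dh x v; apply/is_derive_eps; split; first exact: diff_derivable.
rewrite deriveE // {1}(col_sum_delta v) linear_sum /dot /=; apply: eq_bigr => j _.
by rewrite linearZ mxE -deriveE // mulrC.
Qed.

(** Along the segment from u to v, h minus its quadratic upper model is nonincreasing: t times its
    derivative is nonpositive by the assumed one-sided bound. *)
Lemma gateaux_ub d (h : 'cV[R]_d -> R) (L : R) u v : gateaux h ->
  (forall x y, dot (grad h x - grad h y) (x - y) <= L * enorm (x - y) ^+ 2) ->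
  h v <= h u + dot (grad h u) (v - u) + L / 2 * enorm (v - u) ^+ 2.
Proof.
move=> gh hL; pose dd := v - u.
pose phi t := h (t *: dd + u) - (t * dot (grad h u) dd + L / 2 * enorm dd ^+ 2 * t ^+ 2).
suff : phi 1 <= phi 0.
  by rewrite /phi scale1r scale0r add0r /dd subrK expr1n expr0n /=; lra.
apply: (@eps_deriv_monotone _ phi
  (fun t => dot (grad h (t *: dd + u)) dd - (dot (grad h u) dd + L * enorm dd ^+ 2 * t))).
  move=> t _; have h1 := gateaux_line u dd t gh.
  have h2 := eps_derivD (eps_deriv_linear (t * dot (grad h u) dd + L / 2 * enorm dd ^+ 2 * t ^+ 2)
    (dot (grad h u) dd + L * enorm dd ^+ 2 * t)) (eps_deriv_sq (L / 2 * enorm dd ^+ 2)).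
  have := eps_derivD h1 (eps_derivZ (-1) h2).
  rewrite addr0 mulN1r; set f1 := (fun _ => _); set f2 := (fun _ => phi _).
  by rewrite (_ : f1 = f2) //; apply/funext => s; rewrite /f1 /f2 /phi; field.
move=> t /andP[t0 t1]; have := hL (t *: dd + u) u.
rewrite addrK dotZr dotBl enorm_sqZ => h3.
suff : t * (dot (grad h (t *: dd + u)) dd - (dot (grad h u) dd + L * enorm dd ^+ 2 * t)) <= 0.
  by rewrite pmulr_rle0.
nra.
Qed.

Lemma lip_grad_dot d (h : 'cV[R]_d -> R) (L : R) :
  lip_vec L (grad h) ->
  forall x y, dot (grad h x - grad h y) (x - y) <= L * enorm (x - y) ^+ 2.
Proof.
move=> hL x y; rewrite (le_trans (dot_le _ _)) // expr2 mulrA ler_wpM2r ?enorm_ge0 //.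
Qed.

Lemma strongly_convex_lb d (h : 'cV[R]_d -> R) (mu : R) u v : gateaux h ->
  strongly_convex mu h ->
  h u + dot (grad h u) (v - u) + mu / 2 * enorm (v - u) ^+ 2 <= h v.
Proof.
move=> gh sc; pose E := enorm (v - u) ^+ 2.
suff : dot (grad h u) (v - u) <= h v - h u - mu / 2 * E by rewrite /E; lra.
apply: (eps_deriv_le (e' := mu / 2 * E) (gh u (v - u))) => t /andP[t0 t1].
have t01 : 0 <= t <= 1 by rewrite (ltW t0) (ltW t1).
have := sc v u t t01.
have -> : t *: v + (1 - t) *: u = t *: (v - u) + u.
  by rewrite scalerBr scalerBl scale1r addrAC addrA.
by rewrite scale0r add0r -/E; lra.
Qed.

(* Cocoercivity of the gradient of [h - mu/2 |.|^2], in integrated form. *)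
Lemma gradient_step_contraction d (h : 'cV[R]_d -> R) (mu L b : R) : gateaux h ->
  strongly_convex mu h -> lip_vec L (grad h) -> 0 <= mu <= L -> 0 < mu + L ->
  0 <= b <= 2 / (mu + L) ->
  forall u v : 'cV[R]_d, enorm ((u - b *: grad h u) - (v - b *: grad h v)) <= (1 - b * mu) * enorm (u - v).
Proof.
move=> gh sc hL /andP[mu0 muL] muL0 /andP[b0]; rewrite ler_pdivlMr // => bL u v.
have bm : 0 <= 1 - b * mu by nra.
pose D : 'cV[R]_d := u - v; have DE : D = u - v by [].
pose G : 'cV[R]_d := grad h u - grad h v - mu *: D.
have GE : G = grad h u - grad h v - mu *: D by [].
rewrite -DE; move: G GE => G GE; move: D DE GE => D DE GE.
(* A strong convexity bound at one point and a smoothness bound at the other, evaluated at a common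
   point shifted by t G, are added over both orders of u and v. Keeping t free avoids a division by
   L - mu, which may vanish. *)
have key t : (2 * t - (L - mu) * t ^+ 2) * enorm G ^+ 2 <= dot G D.
  have A (p q s : 'cV[R]_d) : h p + dot (grad h p) (q + s - p) + mu / 2 * enorm (q + s - p) ^+ 2 <=
      h q + dot (grad h q) s + L / 2 * enorm s ^+ 2.
    apply: (le_trans (strongly_convex_lb p (q + s) gh sc)).
    by have := gateaux_ub q (q + s) gh (lip_grad_dot hL); rewrite (_ : q + s - q = s) // addrC addKr.
  have := A u v (t *: G); have := A v u (- (t *: G)).
  have -> : u - t *: G - v = D - t *: G by rewrite DE; apply/matrixP => i j; rewrite !mxE; ring.
  have -> : v + t *: G - u = t *: G - D by rewrite DE; apply/matrixP => i j; rewrite !mxE; ring.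
  rewrite !enorm_sqB enormN enorm_sqZ !dotDr !dotNr !dotZr dotZl.
  have gE w : dot (grad h u) w = dot G w + mu * dot D w + dot (grad h v) w.
    by rewrite GE !dotBl dotZl; ring.
  rewrite !gE -!enorm_sq (dotC D G); lra.
have -> : u - b *: grad h u - (v - b *: grad h v) = (1 - b * mu) *: D - b *: G.
  by rewrite GE DE; apply/matrixP => i j; rewrite !mxE; ring.
rewrite -(@ler_pXn2r _ 2) ?nnegrE ?mulr_ge0 ?enorm_ge0 // exprMn.
rewrite enorm_sqB !enorm_sqZ dotZl dotZr (dotC D G).
(* In the degenerate case b mu = 1 the bound on b forces L <= mu, so [key] loses its quadratic term
   and a large t excludes a nonzero G. *)
have [c0|c0] := eqVneq (1 - b * mu) 0.
  have L0 : b * (L - mu) <= 0 by lra.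
  have bpos : 0 < b by rewrite lt_neqAle b0 andbT; apply: contra_eq_neq c0 => <-; rewrite mul0r subr0 oner_eq0.
  have Lmu : L - mu <= 0 by rewrite pmulr_rle0 in L0.
  rewrite c0; have [->|Gn0] := eqVneq (enorm G ^+ 2) 0; first lra.
  have G0 : 0 < enorm G ^+ 2 by rewrite lt_neqAle eq_sym Gn0 sqr_ge0.
  pose t := (`|dot G D| + 1) / enorm G ^+ 2.
  have t0 : 0 <= t by rewrite divr_ge0 ?addr_ge0 ?sqr_ge0.
  have tG : t * enorm G ^+ 2 = `|dot G D| + 1 by rewrite /t divfK.
  have := key t; have := ler_norm (dot G D).
  have Lmu' : 0 <= mu - L by rewrite subr_ge0 -subr_le0.
  have := mulr_ge0 (mulr_ge0 Lmu' (sqr_ge0 t)) (sqr_ge0 (enorm G)).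
  move: (enorm G ^+ 2) tG => g tG h1 h2 h3.
  have : 2 * (t * g) <= dot G D by lra.
  by rewrite tG; have := normr_ge0 (dot G D); lra.
have cpos : 0 < 1 - b * mu by rewrite lt_neqAle eq_sym c0.
(* This t turns [key] into b |G|^2 <= 2 (1 - b mu) <G, D>, which cancels the G terms of the expanded
   square; t (L - mu) <= 1 is the condition b <= 2 / (mu + L). *)
pose t := b / (2 * (1 - b * mu)); have := key t.
have tE : b = 2 * t * (1 - b * mu) by rewrite /t; field.
have t0 : 0 <= t by rewrite divr_ge0 // mulr_ge0.
have tL : t * (L - mu) <= 1.
  have : (1 - b * mu) * (t * (L - mu)) <= (1 - b * mu) * 1 by nra.
  by rewrite ler_pM2l.
have G0 := sqr_ge0 (enorm G) => hk.
have h1 : t * enorm G ^+ 2 <= dot G D.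
  apply: le_trans hk; apply: ler_wpM2r => //; nra.
have h2 : b * enorm G ^+ 2 <= 2 * (1 - b * mu) * dot G D.
  by rewrite {1}tE; nra.
have := ler_wpM2l b0 h2; nra.
Qed.

End Gradient.

(** * Functions of two blocks and their Hessians *)

Section TwoBlockCalculus.
Context {R : realType} {dx dy : nat}.
Implicit Types (h : 'cV[R]_dx -> 'cV[R]_dy -> R).

Definition uncurry2 (W : Type) (h : 'cV[R]_dx -> 'cV[R]_dy -> W) :=
  fun q : 'cV[R]_dx * 'cV[R]_dy => h q.1 q.2.

Lemma differentiable_blockx (W : normedModType R) (h : 'cV[R]_dx -> 'cV[R]_dy -> W) x y :
  differentiable (uncurry2 h) (x, y) -> differentiable (h^~ y) x.
Proof.
move=> dh; rewrite (_ : h^~ y = uncurry2 h \o (fun x' => (x', y))) //.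
by apply: differentiable_comp => //; apply: differentiable_pair => //; exact: differentiable_cst.
Qed.

Lemma differentiable_blocky (W : normedModType R) (h : 'cV[R]_dx -> 'cV[R]_dy -> W) x y :
  differentiable (uncurry2 h) (x, y) -> differentiable (h x) y.
Proof.
move=> dh; rewrite (_ : h x = uncurry2 h \o (fun y' => (x, y'))) //.
by apply: differentiable_comp => //; apply: differentiable_pair => //; exact: differentiable_cst.
Qed.

Lemma smooth1_gateauxx h y : smooth1 h -> gateaux (h^~ y).
Proof.
move=> sh; apply: differentiable_gateaux => x.
exact: (@differentiable_blockx _ h x y (sh (x, y))).
Qed.

Lemma smooth1_gateauxy h x : smooth1 h -> gateaux (h x).
Proof.
move=> sh; apply: differentiable_gateaux => y.
exact: (@differentiable_blocky _ h x y (sh (x, y))).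
Qed.

(** Only the restriction to a line enters a directional derivative; this identifies the derivatives
    of a joint function with those of its blocks. *)
Lemma derive_line (V V' : normedModType R) (f : V -> R) (g : V' -> R) a v a' v' :
  (forall t : R, f (t *: v + a) = g (t *: v' + a')) -> 'D_v f a = 'D_v' g a'.
Proof.
move=> fg; have fa : f a = g a' by have := fg 0; rewrite !scale0r !add0r.
by rewrite /derive; under eq_fun do rewrite /= fg fa.
Qed.

Lemma smooth1_diff h x y u v : smooth1 h ->
  'd (uncurry2 h) (x, y) (u, v) = dot (gradx h x y) u + dot (grady h x y) v.
Proof.
move=> sh; have dh : differentiable (uncurry2 h) (x, y) := sh (x, y).
have -> : (u, v) = (u, 0) + (0, v) :> 'cV[R]_dx * 'cV[R]_dy.
  by rewrite /GRing.add /= /add_pair /= addr0 add0r.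
rewrite linearD /=; congr (_ + _); rewrite -deriveE //.
  have [_ <-] := gateaux_is_derive x u (smooth1_gateauxx y sh).
  apply: derive_line => t; rewrite /uncurry2 /= scaler0 add0r //.
have [_ <-] := gateaux_is_derive y v (smooth1_gateauxy x sh).
apply: derive_line => t; rewrite /uncurry2 /= scaler0 add0r //.
Qed.

Lemma mxnorm_pair_le (u : 'cV[R]_dx) (v : 'cV[R]_dy) : `|(u, v)| <= enorm u + enorm v.
Proof.
rewrite prod_normE /= ge_max; apply/andP; split.
  by rewrite (le_trans (mxnorm_le_enorm u)) // lerDl enorm_ge0.
by rewrite (le_trans (mxnorm_le_enorm v)) // lerDr enorm_ge0.
Qed.

Lemma smooth1_eps h x y : smooth1 h -> forall e : R, 0 < e ->
  exists2 del : R, 0 < del & forall u v, enorm u + enorm v < del ->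
    `|h (u + x) (v + y) - h x y - (dot (gradx h x y) u + dot (grady h x y) v)|
      <= e * (enorm u + enorm v).
Proof.
move=> sh e e0; have [del del0 hd] := differentiable_eps (sh (x, y)) e0.
exists del => // u v uv; have := hd (u, v) (le_lt_trans (mxnorm_pair_le u v) uv).
rewrite -/(uncurry2 h) smooth1_diff // => /le_trans; apply.
by rewrite ler_wpM2l ?mxnorm_pair_le // ltW.
Qed.

Lemma smooth2_coord h j : smooth2 h -> smooth1 (fun x y => grady h x y j 0).
Proof.
move=> [_ sh] p.
rewrite (_ : (fun q => _) = (fun M : 'cV[R]_dy => M j 0) \o (uncurry2 (grady h))) //.
apply: differentiable_comp; first exact: sh.
exact: differentiable_coord.
Qed.

(** The Hessian blocks have the differentiating variable as row index, so the Jacobian of the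
    y-gradient consists of their transposes. The factor dy + 1 in the proof pays for the passage
    from the sup norm to the Euclidean norm. *)
Lemma smooth2_eps h x y : smooth2 h -> forall e : R, 0 < e ->
  exists2 del : R, 0 < del & forall u v, enorm u + enorm v < del ->
    enorm (grady h (u + x) (v + y) - grady h x y -
      ((hess_xy h x y)^T *m u + (hess_yy h x y)^T *m v)) <= e * (enorm u + enorm v).
Proof.
move=> sh e e0; have d0 : (0 : R) < dy%:R + 1 by rewrite ltr_wpDl.
have df : differentiable (uncurry2 (grady h)) (x, y) := sh.2 (x, y).
have [del del0 hd] := differentiable_eps df (divr_gt0 e0 d0).
exists del => // u v uv; have := hd (u, v) (le_lt_trans (mxnorm_pair_le u v) uv).
rewrite [in X in `|X|](_ : 'd _ _ _ = (hess_xy h x y)^T *m u + (hess_yy h x y)^T *m v); last first.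
  rewrite -deriveE // derive_mx; last exact: diff_derivable.
  apply/matrixP => j k; rewrite ord1 !mxE.
  have sj := smooth2_coord j sh.
  rewrite (deriveE _ (sj (x, y))) -/(uncurry2 (fun x y => grady h x y j 0)) smooth1_diff //.
  by congr (_ + _); apply: eq_bigr => i _; rewrite !mxE.
move=> hle; rewrite (le_trans (enorm_le_mxnorm _)) //.
rewrite (le_trans (ler_wpM2l _ hle)) // mulrA.
apply: (@le_trans _ _ (e * `|(u, v)|)); last by rewrite ler_wpM2l ?mxnorm_pair_le // ltW.
rewrite ler_wpM2r // mulrCA; apply: ler_piMr; first exact: ltW.
by rewrite ler_pdivrMr // mul1r lerDl.
Qed.

Lemma hess_line h x y u v : smooth2 h -> forall j,
  eps_deriv (fun t => grady h (t *: u + x) (t *: v + y) j 0)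
    (((hess_xy h x y)^T *m u + (hess_yy h x y)^T *m v) j 0).
Proof.
move=> sh j; set M : 'cV[R]_dy := _ + _ => e e0; pose c := enorm u + enorm v + 1.
have c0 : 0 < c by rewrite ltr_wpDl // addr_ge0 ?enorm_ge0.
have [del del0 hd] := smooth2_eps x y sh (divr_gt0 e0 c0).
exists (del / c); first by rewrite divr_gt0.
move=> t; rewrite ltr_pdivlMr // => tdel.
have le1 : enorm (t *: u) + enorm (t *: v) <= `|t| * c.
  by rewrite !enormZ -mulrDr ler_wpM2l // lerDl.
have := hd _ _ (le_lt_trans le1 tdel); rewrite !scale0r !add0r => h1.
have := le_trans (le_enorm_coord _ j) h1; rewrite -!scalemxAr -scalerDr -/M => h2.
have -> : grady h (t *: u + x) (t *: v + y) j 0 - grady h x y j 0 - t * M j 0 =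
  (grady h (t *: u + x) (t *: v + y) - grady h x y - t *: M) j 0 by rewrite !mxE.
rewrite (le_trans h2) // (le_trans (ler_wpM2l _ le1)) ?divr_ge0 ?(ltW e0) ?(ltW c0) //.
by rewrite mulrCA divfK ?gt_eqF // mulrC.
Qed.

(** Tested against D itself: t -> <D, F t> has derivative |D|^2 and increments at most |D| t c. *)
Lemma eps_deriv_enorm_le d (F : R -> 'cV[R]_d) (D : 'cV[R]_d) (c : R) :
  (forall j, eps_deriv (fun t => F t j 0) (D j 0)) ->
  (forall t : R, 0 < t < 1 -> enorm (F t - F 0) <= t * c) -> enorm D <= c.
Proof.
move=> hF hc; have c0 : 0 <= c.
  have [h0 h1] : (0 : R) < 1 / 2 /\ (1 / 2 : R) < 1 by split; lra.
  have := hc (1 / 2); rewrite h0 h1 => /(_ isT) /(le_trans (enorm_ge0 _)).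
  by rewrite pmulr_rge0.
have [D0|D0] := eqVneq (enorm D) 0; first by rewrite D0.
have {}D0 : 0 < enorm D by rewrite lt_neqAle eq_sym D0 enorm_ge0.
have hd : eps_deriv (fun t => \sum_j D j 0 * F t j 0) (\sum_j D j 0 * D j 0).
  by apply: eps_deriv_sum => j; exact: eps_derivZ.
have : \sum_j D j 0 * D j 0 <= enorm D * c.
  apply: (eps_deriv_le (e' := 0) hd) => t /[dup] t01 /andP[t0 _].
  rewrite -/(dot D (F t)) -/(dot D (F 0)) -dotBr (le_trans (dot_le _ _)) //.
  by rewrite mul0r addr0 mulrCA ler_wpM2l ?enorm_ge0 ?hc.
by rewrite -/(dot D D) -enorm_sq expr2 ler_pM2l.
Qed.

Lemma hess_xy_bound h x y (L : R) : smooth2 h ->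
  (forall x x' y, enorm (grady h x y - grady h x' y) <= L * enorm (x - x')) -> 0 <= L ->
  forall v, enorm (hess_xy h x y *m v) <= L * enorm v.
Proof.
move=> sh hL L0; apply: enorm_mulmx_tr => // u.
have := @eps_deriv_enorm_le _ (fun t => grady h (t *: u + x) (t *: 0 + y)) _ (L * enorm u)
  (hess_line x y u 0 sh).
rewrite mulmx0 addr0; apply => t /andP[t0 _]; rewrite !scaler0.
by rewrite (le_trans (hL _ _ _)) // scale0r add0r addrK enormZ gtr0_norm // mulrCA.
Qed.

Lemma hess_yy_bound h x y (L : R) : smooth2 h ->
  (forall x y y', enorm (grady h x y - grady h x y') <= L * enorm (y - y')) -> 0 <= L ->
  forall v, enorm (hess_yy h x y *m v) <= L * enorm v.
Proof.
move=> sh hL L0; apply: enorm_mulmx_tr => // u.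
have := @eps_deriv_enorm_le _ (fun t => grady h (t *: 0 + x) (t *: u + y)) _ (L * enorm u)
  (hess_line x y 0 u sh).
rewrite mulmx0 add0r; apply => t /andP[t0 _]; rewrite !scaler0.
by rewrite (le_trans (hL _ _ _)) // scale0r add0r addrK enormZ gtr0_norm // mulrCA.
Qed.

(** The gradient step is a q-contraction in y, so its derivative, the transpose of I - b H, has norm
    at most q; [enorm_mulmx_tr] removes the transpose. *)
Lemma hess_yy_contraction h x y (b q : R) : smooth2 h -> 0 <= q ->
  (forall y y', enorm ((y - b *: grady h x y) - (y' - b *: grady h x y')) <= q * enorm (y - y')) ->
  forall v, enorm (v - b *: (hess_yy h x y *m v)) <= q * enorm v.
Proof.
move=> sh q0 hq v; pose M := 1%:M - b *: hess_yy h x y.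
have ME u : M *m u = u - b *: (hess_yy h x y *m u).
  by rewrite /M mulmxBl mul1mx scalemxAl.
rewrite -ME; apply: enorm_mulmx_tr => // u.
apply: (@eps_deriv_enorm_le _ (fun t => (t *: u + y) - b *: grady h (t *: 0 + x) (t *: u + y))).
  move=> j; have h1 := hess_line x y 0 u sh j.
  have := eps_derivD (eps_deriv_linear (y j 0) (u j 0)) (eps_derivZ (- b) h1).
  rewrite (_ : (fun _ => _) = (fun t => (t *: u + y - b *: grady h (t *: 0 + x) (t *: u + y)) j 0)).
    rewrite (_ : u j 0 + _ = (M^T *m u) j 0) //.
    rewrite /M linearB /= linearZ /= trmx1 mulmxBl mul1mx mulmx0 add0r -scalemxAl !mxE.
    by ring.
  by apply/funext => t; rewrite !mxE; ring.
move=> t /andP[t0 _]; rewrite !scaler0 scale0r !add0r (le_trans (hq _ _)) //.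
by rewrite addrK enormZ gtr0_norm // mulrCA.
Qed.

Context (n : nat) (H : 'I_n -> 'cV[R]_dx -> 'cV[R]_dy -> R).
Let Hbar x y := n%:R^-1 * \sum_i H i x y.

Lemma derive_avg (V : normedModType R) (f : 'I_n -> V -> R) a v :
  (forall i, derivable (f i) a v) ->
  'D_v (fun t => n%:R^-1 * \sum_i f i t) a = n%:R^-1 * \sum_i 'D_v (f i) a.
Proof.
move=> df; have [|_ //] := (is_derive_eps (fun t => n%:R^-1 * \sum_i f i t) a v
  (n%:R^-1 * \sum_i 'D_v (f i) a)).2.
apply: eps_derivZ; apply: eps_deriv_sum => i; apply/is_derive_eps; exact: derivableP.
Qed.

Lemma smooth1_avg : (forall i, smooth1 (H i)) -> smooth1 Hbar.
Proof.
move=> sH p; rewrite (_ : (fun q => _) =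
  (n%:R^-1 : R) \*: (\sum_i (uncurry2 (H i)))); last first.
  by apply/funext => q; rewrite /Hbar /= fct_sumE.
by apply: differentiableZ; apply: differentiable_sum => i; exact: sH.
Qed.

Lemma gradx_avg x y : (forall i, smooth1 (H i)) ->
  gradx Hbar x y = vavg (fun i => gradx (H i) x y).
Proof.
move=> sH; apply/matrixP => j k; rewrite ord1 !mxE derive_avg.
  by rewrite summxE; congr (_ * _); apply: eq_bigr => i _; rewrite !mxE.
move=> i; apply: diff_derivable; exact: (@differentiable_blockx _ (H i) x y (sH i (x, y))).
Qed.

Lemma grady_avg x y : (forall i, smooth1 (H i)) ->
  grady Hbar x y = vavg (fun i => grady (H i) x y).
Proof.
move=> sH; apply/matrixP => j k; rewrite ord1 !mxE derive_avg.
  by rewrite summxE; congr (_ * _); apply: eq_bigr => i _; rewrite !mxE.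
move=> i; apply: diff_derivable; exact: (@differentiable_blocky _ (H i) x y (sH i (x, y))).
Qed.

Lemma smooth2_avg : (forall i, smooth2 (H i)) -> smooth2 Hbar.
Proof.
move=> sH; have s1 i : smooth1 (H i) by case: (sH i).
split=> [|p]; first exact: smooth1_avg.
rewrite (_ : (fun q => _) = (n%:R^-1 : R) \*: (\sum_i (uncurry2 (grady (H i))))); last first.
  by apply/funext => q; rewrite grady_avg //= fct_sumE.
by apply: differentiableZ; apply: differentiable_sum => i; have [_] := sH i; apply.
Qed.

Lemma hess_xy_avg x y z : (forall i, smooth2 (H i)) ->
  hess_xy Hbar x y *m z = vavg (fun i => hess_xy (H i) x y *m z).
Proof.
move=> sH; have s1 i : smooth1 (H i) by case: (sH i).
rewrite /vavg -mulmx_suml scalemxAl; congr (_ *m _).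
apply/matrixP => i j; rewrite !mxE summxE.
transitivity ('D_(delta_mx i 0) (fun x' => n%:R^-1 * \sum_k grady (H k) x' y j 0) x).
  by congr ('D__ _ _); apply/funext => x'; rewrite grady_avg // !mxE summxE.
rewrite derive_avg; first by congr (_ * _); apply: eq_bigr => k _; rewrite mxE.
move=> k; apply: diff_derivable.
exact: (@differentiable_blockx _ (fun x y => grady (H k) x y j 0) x y (smooth2_coord j (sH k) (x, y))).
Qed.

Lemma hess_yy_avg x y z : (forall i, smooth2 (H i)) ->
  hess_yy Hbar x y *m z = vavg (fun i => hess_yy (H i) x y *m z).
Proof.
move=> sH; have s1 i : smooth1 (H i) by case: (sH i).
rewrite /vavg -mulmx_suml scalemxAl; congr (_ *m _).
apply/matrixP => i j; rewrite !mxE summxE.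
transitivity ('D_(delta_mx i 0) (fun y' => n%:R^-1 * \sum_k grady (H k) x y' j 0) y).
  by congr ('D__ _ _); apply/funext => y'; rewrite grady_avg // !mxE summxE.
rewrite derive_avg; first by congr (_ * _); apply: eq_bigr => k _; rewrite mxE.
move=> k; apply: diff_derivable.
exact: (@differentiable_blocky _ (fun x y => grady (H k) x y j 0) x y (smooth2_coord j (sH k) (x, y))).
Qed.

End TwoBlockCalculus.

(** * Existence and first-order properties of minimizers *)

Section Minimizer.
Context {R : realType} {d : nat}.
Implicit Types (h : 'cV[R]_d -> R).

Lemma enorm_grad_le h (c : R) y : 0 <= c -> gateaux h ->
  (forall u v, `|h u - h v| <= c * enorm (u - v)) -> enorm (grad h y) <= c.
Proof.
move=> c0 gh hc; set g := grad h y.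
have [g0|g0] := eqVneq (enorm g) 0; first by rewrite g0.
have {}g0 : 0 < enorm g by rewrite lt_neqAle eq_sym g0 enorm_ge0.
have : dot g g <= c * enorm g.
  apply: (eps_deriv_le (e' := 0) (gh y g)) => t /andP[t0 _].
  rewrite (le_trans (ler_norm _)) // (le_trans (hc _ _)) //.
  by rewrite scale0r add0r addrK enormZ gtr0_norm // mul0r addr0 mulrCA.
by rewrite -enorm_sq expr2 ler_pM2r.
Qed.

Lemma grad_minimizer h y : gateaux h -> (forall y', h y <= h y') -> grad h y = 0.
Proof.
move=> gh hmin; apply: enorm_eq0; apply/eqP; rewrite -sqrf_eq0 eq_le sqr_ge0 andbT.
rewrite enorm_sq -oppr_ge0 -dotNr.
apply: (eps_deriv_ge (e' := 0) (gh y (- grad h y))) => t /andP[t0 _].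
by rewrite mul0r !addr0 mulr0 scale0r add0r subr_ge0.
Qed.

(** Outside the radius r = 2 |grad h 0| / mu the quadratic lower model at 0 is at least h 0, so a
    minimum over a compact ball is global. The ball is a sup norm ball of row vectors; since the
    Euclidean norm dominates the sup norm, the points outside it are far enough. *)
Lemma strongly_convex_minimizer h (mu : R) : 0 < mu -> gateaux h -> continuous h ->
  strongly_convex mu h -> exists y, forall y', h y <= h y'.
Proof.
move=> mu0 gh ch sc; pose r := 2 / mu * enorm (grad h 0).
have r0 : 0 <= r by rewrite mulr_ge0 ?enorm_ge0 // divr_ge0 // ltW.
have far y : r <= enorm y -> h 0 <= h y.
  move=> ry; have := strongly_convex_lb 0 y gh sc; rewrite subr0.
  have := norm_dot_le (grad h 0) y; rewrite ler_norml => /andP[h1 _].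
  suff : enorm (grad h 0) * enorm y <= mu / 2 * enorm y ^+ 2 by lra.
  rewrite expr2 mulrA ler_wpM2r ?enorm_ge0 //.
  by move: ry; rewrite /r mulrAC ler_pdivrMr // => ?; lra.
pose A := [set v : 'rV[R]_d | `|v| <= r].
have cA : compact A.
  apply: bounded_closed_compact.
    exists r; split; first exact: num_real.
    by move=> M rM v /= /le_trans; apply; exact: ltW.
  rewrite (_ : A = (fun v : 'rV[R]_d => `|v|) @^-1` [set x | x <= r]) //.
  apply: closed_comp; last exact: closed_le.
  by move=> v _; exact: norm_continuous.
have A0 : A !=set0 by exists 0; rewrite /A /= normr0.
have ctr : continuous (fun v : 'rV[R]_d => v^T).
  move=> v; apply/(@cvgrPdist_lt _ 'cV[R]_d _ (nbhs v) (nbhs_filter v)) => e e0; apply/nbhs_ballP; exists e => //= w.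
  rewrite -ball_normE /= -linearB /= => /le_lt_trans; apply.
  rewrite [leLHS]/Num.Def.normr /= mx_normrE; apply/bigmax_leP; split => // -[i j] _ /=.
  rewrite mxE [leRHS]/Num.Def.normr /= mx_normrE; apply/bigmax_geP; right => /=.
  by exists (j, i).
have cont : {within A, continuous (fun v : 'rV[R]_d => h v^T)}.
  by apply: continuous_subspaceT => v; apply: continuous_comp; [exact: ctr|exact: ch].
have [v vA hv] := compact_EVT_min A0 cA cont.
have rT (y : 'cV[R]_d) : `|y^T| <= r -> h v^T <= h y.
  by move=> yr; have := hv y^T; rewrite trmxK; apply; rewrite inE.
exists v^T => y'; case: (lerP `|y'^T| r) => [/rT //|yr].
apply: (@le_trans _ _ (h 0)); first by apply: rT; rewrite trmx0 normr0.
apply: far; apply: (le_trans (ltW yr)); apply: le_trans (mxnorm_le_enorm y').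
rewrite [leLHS]/Num.Def.normr /= mx_normrE; apply/bigmax_leP; split => // -[i j] _ /=.
rewrite mxE [leRHS]/Num.Def.normr /= mx_normrE; apply/bigmax_geP; right => /=.
by exists (j, i).
Qed.

End Minimizer.

(** * The lower-level solution and the gradient of Phi *)

Section Bilevel.
Context {R : realType} {n dx dy : nat} (pb : problem R n dx dy) (c : constants R).
Context (n0 : (0 < n)%N) (dx0 : (0 < dx)%N) (dy0 : (0 < dy)%N).
Context (Hc : continuity pb c) (Hs : strong_convexity pb c) (Hl : lipschitz_constants pb c).

Notation gb := (gbar pb).
Notation fb := (fbar pb).

Lemma g_smooth2 i : smooth2 (g_ pb i). Proof. by have [[]] := Hc i. Qed.
Lemma g_smooth1 i : smooth1 (g_ pb i). Proof. by have [] := g_smooth2 i. Qed.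
Lemma f_smooth1 i : smooth1 (f_ pb i). Proof. by have [[]] := Hc i. Qed.

Lemma gb_smooth2 : smooth2 gb. Proof. by apply: smooth2_avg; exact: g_smooth2. Qed.
Lemma gb_smooth1 : smooth1 gb. Proof. by have [] := gb_smooth2. Qed.
Lemma fb_smooth1 : smooth1 fb. Proof. by apply: smooth1_avg; exact: f_smooth1. Qed.

Lemma enorm_vavg_le_cst (d : nat) (u : 'I_n -> 'cV[R]_d) (a : R) :
  (forall i, enorm (u i) <= a) -> enorm (vavg u) <= a.
Proof.
move=> ua; rewrite (le_trans (enorm_vavg_le u)) //.
rewrite ler_pdivrMl ?ltr0n // -[X in X * a](mulr1 n%:R) mulr1 mulr_natl.
by rewrite -[X in _ *+ X]card_ord -sumr_const; apply: ler_sum.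
Qed.

Lemma g_lip i x y x' y' : enorm (grady (g_ pb i) x y - grady (g_ pb i) x' y')
  <= Lg c * enorm (col_mx (x - x') (y - y')).
Proof.
have [[_ _ _ _ /(_ x y x' y') h] _] := Hc i; apply: le_trans h.
by rewrite /grad2 opp_col_mx add_col_mx enorm_le_col_mxr.
Qed.

Lemma f_lipx i x y x' y' : enorm (gradx (f_ pb i) x y - gradx (f_ pb i) x' y')
  <= Lf c * enorm (col_mx (x - x') (y - y')).
Proof.
have [[_ _ _ /(_ x y x' y') h _] _] := Hc i; apply: le_trans h.
by rewrite /grad2 opp_col_mx add_col_mx enorm_le_col_mxl.
Qed.

Lemma f_lipy i x y x' y' : enorm (grady (f_ pb i) x y - grady (f_ pb i) x' y')
  <= Lf c * enorm (col_mx (x - x') (y - y')).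
Proof.
have [[_ _ _ /(_ x y x' y') h _] _] := Hc i; apply: le_trans h.
by rewrite /grad2 opp_col_mx add_col_mx enorm_le_col_mxr.
Qed.

Lemma hxy_lip i x y x' y' z : enorm ((hess_xy (g_ pb i) x y - hess_xy (g_ pb i) x' y') *m z)
  <= Lgxy c * enorm (col_mx (x - x') (y - y')) * enorm z.
Proof.
have [_ [/(_ x y x' y') h _]] := Hc i.
by rewrite (le_trans (enorm_mulmx_le _ _)) // ler_wpM2r ?enorm_ge0.
Qed.

Lemma hyy_lip i x y x' y' z : enorm ((hess_yy (g_ pb i) x y - hess_yy (g_ pb i) x' y') *m z)
  <= Lgyy c * enorm (col_mx (x - x') (y - y')) * enorm z.
Proof.
have [_ [_ /(_ x y x' y') h]] := Hc i.
by rewrite (le_trans (enorm_mulmx_le _ _)) // ler_wpM2r ?enorm_ge0.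
Qed.

Let i0 : 'I_n := Ordinal n0.
Let ey : 'cV[R]_dy := delta_mx (Ordinal dy0) 0.

Let ey1 : enorm ey = 1.
Proof.
apply/eqP; rewrite -(eqrXn2 (n := 2)) ?enorm_ge0 // enorm_sq dot_delta mxE !eqxx.
by rewrite expr1n.
Qed.

Lemma Lg_ge0 : 0 <= Lg c.
Proof.
have := le_trans (enorm_ge0 _) (g_lip i0 0 ey 0 0).
by rewrite subrr subr0 enorm_col_mx0 ey1 mulr1.
Qed.

Lemma cf_ge0 : 0 <= cf c.
Proof.
have [[_ _ /(_ 0 ey 0) h _ _] _] := Hc i0.
by have := le_trans (normr_ge0 _) h; rewrite subr0 ey1 mulr1.
Qed.

Lemma hxy_bound i x y z : enorm (hess_xy (g_ pb i) x y *m z) <= Lg c * enorm z.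
Proof.
apply: hess_xy_bound; [exact: g_smooth2| |exact: Lg_ge0] => x1 x2 y1.
rewrite (le_trans (g_lip _ _ _ _ _)) // subrr ler_wpM2l ?Lg_ge0 //.
by rewrite (le_trans (enorm_col_mx_le _ _)) // enorm0 addr0.
Qed.

Lemma hyy_bound i x y z : enorm (hess_yy (g_ pb i) x y *m z) <= Lg c * enorm z.
Proof.
apply: hess_yy_bound; [exact: g_smooth2| |exact: Lg_ge0] => x1 y1 y2.
by rewrite (le_trans (g_lip _ _ _ _ _)) // subrr enorm_col_mx0.
Qed.

Lemma gb_lip_y x : lip_vec (Lg c) (grad (gb x)).
Proof.
move=> y y'; rewrite -/(grady gb x y) -/(grady gb x y') !(grady_avg _ _ g_smooth1) -vavgB.
apply: enorm_vavg_le_cst => i; rewrite (le_trans (g_lip _ _ _ _ _)) //.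
by rewrite subrr enorm_col_mx0.
Qed.

Lemma mug_gt0 : 0 < mug c. Proof. by case: Hs. Qed.

Lemma gb_strongly_convex x : strongly_convex (mug c) (gb x).
Proof.
move=> u v t t01; rewrite /gbar !(mulrCA _ n%:R^-1).
have n1 : (0 : R) < n%:R by rewrite ltr0n.
rewrite -!mulrDr -ler_pdivlMl ?invr_gt0 // invrK.
have -> : n%:R * (n%:R^-1 * (t * \sum_i g_ pb i x u + (1 - t) * \sum_i g_ pb i x v) -
   mug c / 2 * t * (1 - t) * enorm (u - v) ^+ 2) =
   \sum_i (t * g_ pb i x u + (1 - t) * g_ pb i x v - mug c / 2 * t * (1 - t) * enorm (u - v) ^+ 2).
  have n1' : (n%:R : R) != 0 by rewrite gt_eqF.
  rewrite sumrB sumr_const card_ord -(mulr_natl (mug c / 2 * t * (1 - t) * enorm (u - v) ^+ 2) n).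
  by rewrite big_split /= -!mulr_sumr; field.
by apply: ler_sum => i _; have [_ /(_ i x u v t t01)] := Hs.
Qed.

Lemma gb_gateaux x : gateaux (gb x). Proof. exact: smooth1_gateauxy gb_smooth1. Qed.

(** The quadratic lower and upper models at 0 are compared at the unit vector [ey], which exists
    because dy > 0. *)
Lemma mug_le_Lg : mug c <= Lg c.
Proof.
have h1 := strongly_convex_lb 0 ey (@gb_gateaux 0) (@gb_strongly_convex 0).
have h2 := gateaux_ub 0 ey (@gb_gateaux 0) (lip_grad_dot (@gb_lip_y 0)).
by move: (le_trans h1 h2); rewrite subr0 ey1; lra.
Qed.

Lemma Lg_gt0 : 0 < Lg c. Proof. exact: lt_le_trans mug_gt0 mug_le_Lg. Qed.

Lemma gb_contraction x b : 0 <= b <= 2 / (mug c + Lg c) -> forall y y',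
  enorm ((y - b *: grady gb x y) - (y' - b *: grady gb x y')) <= (1 - b * mug c) * enorm (y - y').
Proof.
move=> hb; apply: gradient_step_contraction hb; first exact: gb_gateaux.
- exact: gb_strongly_convex.
- exact: gb_lip_y.
- by rewrite (ltW mug_gt0) mug_le_Lg.
- by rewrite addr_gt0 ?mug_gt0 ?Lg_gt0.
Qed.

Lemma step_le1 b : 0 <= b <= 2 / (mug c + Lg c) -> b * mug c <= 1.
Proof.
move=> /andP[b0]; rewrite ler_pdivlMr ?addr_gt0 ?mug_gt0 ?Lg_gt0 // => h.
have := mug_le_Lg; nra.
Qed.

Lemma hyy_contraction x y b : 0 <= b <= 2 / (mug c + Lg c) -> forall v,
  enorm (v - b *: (hess_yy gb x y *m v)) <= (1 - b * mug c) * enorm v.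
Proof.
move=> hb; apply: hess_yy_contraction; first exact: gb_smooth2.
  by rewrite subr_ge0 step_le1.
exact: gb_contraction.
Qed.

(** Follows from the contraction with the largest admissible b: |v| <= |v - b H v| + b |H v| leaves
    b mu |v| <= b |H v|. *)
Lemma hyy_coercive x y v : mug c * enorm v <= enorm (hess_yy gb x y *m v).
Proof.
pose b := 2 / (mug c + Lg c); have s0 : 0 < mug c + Lg c by rewrite addr_gt0 ?mug_gt0 ?Lg_gt0.
have b0 : 0 < b by rewrite divr_gt0.
have := @hyy_contraction x y b; rewrite lexx (ltW b0) => /(_ isT v) h.
set w := hess_yy gb x y *m v in h *.
have : enorm v <= enorm (v - b *: w) + b * enorm w.
  by rewrite -{1}(subrK (b *: w) v) (le_trans (enormD _ _)) // enormZ gtr0_norm.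
move=> h2; rewrite -(ler_pM2l b0); lra.
Qed.

Lemma hyy_unit x y : hess_yy gb x y \in unitmx.
Proof.
rewrite -unitmx_tr -row_free_unit; apply/inj_row_free => v hv.
apply: trmx_inj; rewrite trmx0; apply: enorm_eq0; apply/eqP; rewrite eq_le enorm_ge0 andbT.
rewrite -(pmulr_rle0 _ mug_gt0) (le_trans (hyy_coercive x y _)) //.
by rewrite -(trmxK (hess_yy gb x y)) -trmx_mul hv trmx0 enorm0.
Qed.

Lemma gb_continuous x : continuous (gb x).
Proof.
move=> y; apply: differentiable_continuous.
exact: (@differentiable_blocky _ _ _ _ gb x y (gb_smooth1 (x, y))).
Qed.

Lemma ystar_min x y : gb x (ystar pb x) <= gb x y.
Proof.
have [ym hm] := strongly_convex_minimizer mug_gt0 (@gb_gateaux x) (@gb_continuous x)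
  (@gb_strongly_convex x).
by rewrite /ystar; apply: (xgetPex 0 (P := [set y | forall y', gb x y <= gb x y'])); exists ym.
Qed.

Lemma grady_ystar x : grady gb x (ystar pb x) = 0.
Proof. by apply: grad_minimizer; [exact: gb_gateaux|exact: ystar_min]. Qed.

Lemma zstar_eq x : hess_yy gb x (ystar pb x) *m zstar pb x = - grady fb x (ystar pb x).
Proof. by rewrite /zstar mulmxN mulKVmx // hyy_unit. Qed.

Lemma grady_fb_le x y : enorm (grady fb x y) <= cf c.
Proof.
rewrite grady_avg; last exact: f_smooth1.
apply: enorm_vavg_le_cst => i; apply: enorm_grad_le; first exact: cf_ge0.
  exact: smooth1_gateauxy (@f_smooth1 i).
by move=> u v; have [[_ _ h _ _] _] := Hc i; exact: h.
Qed.

Lemma zstar_le x : enorm (zstar pb x) <= cf c / mug c.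
Proof.
rewrite ler_pdivlMr ?mug_gt0 // mulrC (le_trans (hyy_coercive x (ystar pb x) _)) //.
by rewrite zstar_eq enormN grady_fb_le.
Qed.

(** No chain rule through [ystar], which is only Lipschitz. Let D be its displacement. The
    y-gradient of g vanishes at both minimizers, so its expansion says that w = t H_xy^T v + H_yy^T
    D is of higher order. As H_yy z = - grad_y f for z = [zstar pb x], the term <grad_y f, D> in the
    expansion of f equals t <H_xy z, v> - <z, w>. *)
Lemma Phi_eps_deriv x v : eps_deriv (fun t => Phi pb (t *: v + x))
  (dot (gradx fb x (ystar pb x) + hess_xy gb x (ystar pb x) *m zstar pb x) v).
Proof.
move=> e e0; set y := ystar pb x; set z := zstar pb x.
have [[_ Lys0 _] [_ Lysl _]] := Hl.
(* Collects the factors lost below: 1 + |z| from adding the two expansions, and (1 + Lys) (|v| + 1)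
   from bounding |t v| + |D| by a multiple of |t|. *)
pose C := (1 + enorm z) * ((1 + Lys c) * (enorm v + 1)).
have v1 : 0 < enorm v + 1 by rewrite ltr_wpDl ?enorm_ge0.
have L1 : 0 < 1 + Lys c by rewrite addr_gt0.
have C0 : 0 < C by rewrite !mulr_gt0 // ltr_pwDl // enorm_ge0.
have [d1 d10 hd1] := smooth1_eps x y fb_smooth1 (divr_gt0 e0 C0).
have [d2 d20 hd2] := smooth2_eps x y gb_smooth2 (divr_gt0 e0 C0).
exists (Num.min d1 d2 / ((1 + Lys c) * (enorm v + 1))).
  by rewrite divr_gt0 ?mulr_gt0 // lt_min d10.
move=> t; rewrite ltr_pdivlMr ?mulr_gt0 // => tdel.
pose D := ystar pb (t *: v + x) - y.
have DE : D + y = ystar pb (t *: v + x) by rewrite subrK.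
have le1 : enorm (t *: v) + enorm D <= `|t| * ((1 + Lys c) * (enorm v + 1)).
  have := Lysl (t *: v + x) x; rewrite -/y -/D addrK enormZ => hD.
  have := enorm_ge0 v; have := normr_ge0 t => t0 v0.
  have : 0 <= `|t| * Lys c by rewrite mulr_ge0 // ltW.
  nra.
move: tdel; move=> /(le_lt_trans le1); rewrite lt_min => /andP[/hd1 hf /hd2].
rewrite DE !grady_ystar subrr sub0r enormN => hg.
move: hf; rewrite DE -/(Phi pb (t *: v + x)) -/(Phi pb x) scale0r add0r dotZr => hf.
set w := _ *m _ + _ in hg.
have fyE : dot (grady fb x y) D = t * dot (hess_xy gb x y *m z) v - dot z w.
  rewrite -[grady fb x y]opprK -zstar_eq dotNl dot_mulmx /w dotDr dot_mulmx -!scalemxAr dotZr.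
  by rewrite opprD addrA subrr sub0r.
have hzw : `|dot z w| <= enorm z * (e / C * (enorm (t *: v) + enorm D)).
  by rewrite (le_trans (norm_dot_le _ _)) // ler_wpM2l ?enorm_ge0.
have -> : Phi pb (t *: v + x) - Phi pb x -
   t * dot (gradx fb x y + hess_xy gb x y *m z) v =
  (Phi pb (t *: v + x) - Phi pb x - (t * dot (gradx fb x y) v + dot (grady fb x y) D)) - dot z w.
  by rewrite fyE dotDl; ring.
rewrite (le_trans (ler_normB _ _)) // (le_trans (lerD hf hzw)) //.
apply: (@le_trans _ _ (e / C * ((1 + enorm z) * (enorm (t *: v) + enorm D)))).
  by rewrite le_eqVlt; apply/orP; left; apply/eqP; ring.
have z0 : 0 <= 1 + enorm z by rewrite addr_ge0 // enorm_ge0.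
apply: (@le_trans _ _ (e / C * ((1 + enorm z) * (`|t| * ((1 + Lys c) * (enorm v + 1)))))).
  by rewrite ler_wpM2l ?divr_ge0 ?(ltW e0) ?(ltW C0) // ler_wpM2l.
rewrite (_ : (1 + enorm z) * _ = C * `|t|); last by rewrite /C; ring.
by rewrite mulrA divfK // gt_eqF.
Qed.

Lemma grad_Phi x : grad (Phi pb) x =
  gradx fb x (ystar pb x) + hess_xy gb x (ystar pb x) *m zstar pb x.
Proof.
apply/matrixP => j k; rewrite ord1 mxE.
have [_ ->] := (is_derive_eps (Phi pb) x (delta_mx j 0) _).2 (Phi_eps_deriv x (delta_mx j 0)).
by rewrite dot_delta.
Qed.

Lemma Phi_gateaux : gateaux (Phi pb).
Proof. by move=> x v; rewrite grad_Phi; exact: Phi_eps_deriv. Qed.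

Lemma Phi_descent x u : Phi pb (x - u) <=
  Phi pb x - dot (grad (Phi pb) x) u + LPhi c / 2 * enorm u ^+ 2.
Proof.
have [_ [LPhil _ _]] := Hl.
have := gateaux_ub x (x - u) Phi_gateaux (lip_grad_dot LPhil).
by rewrite (_ : x - u - x = - u) ?dotNr ?enormN // addrC addKr.
Qed.

End Bilevel.

(** * Compressed estimates *)

Section LawTransfer.
Context {R : realType} {d d' : measure_display} {T : measurableType d} {T' : measurableType d'}.
Context (P : probability T R) (Q : probability T' R) (X : T -> T') (lX : has_law P X Q).

Let mX : measurable_fun setT X. Proof. by case: lX. Qed.

HB.instance Definition _ := isMeasurableFun.Build _ _ T T' X mX.

Lemma ge0_integral_law (f : T' -> \bar R) : measurable_fun setT f -> (forall s, 0 <= f s)%E ->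
  (\int[P]_w f (X w) = \int[Q]_s f s)%E.
Proof.
move=> mf f0; transitivity (\int[distribution P X]_s f s)%E.
  by rewrite ge0_integral_distribution.
by apply: eq_measure_integral => A mA _; exact: (lX.2 A mA).
Qed.

Lemma integral_law (f : T' -> \bar R) : measurable_fun setT f ->
  (\int[P]_w f (X w) = \int[Q]_s f s)%E.
Proof.
move=> mf; rewrite [LHS]integralE [RHS]integralE; congr (_ - _)%E.
  rewrite -(ge0_integral_law (measurable_funepos mf)); last by move=> s; exact: funepos_ge0.
  by apply: eq_integral => w _; rewrite !funeposE.
rewrite -(ge0_integral_law (measurable_funeneg mf)); last by move=> s; exact: funeneg_ge0.
by apply: eq_integral => w _; rewrite !funenegE.
Qed.

End LawTransfer.

Section Estimates.
Context {R : realType} {d : measure_display} {T : measurableType d} (Q : probability T R).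

(** The mean square bound makes X - M integrable; only then can the finite mean of M be cancelled in
    the extended reals. *)
Lemma estimates_enorm k (X : T -> 'cV[R]_k) M v : vmeas X ->
  estimates Q (@enorm R k) X M v ->
  mean0 Q (fun s => X s - M) /\ (sqint Q (fun s => (X s - M)%R) <= v%:E)%E.
Proof.
move=> mX [EX VX]; have VX' : (sqint Q (fun s => (X s - M)%R) <= v%:E)%E.
  by move: VX; rewrite unlock.
split=> // j; have mY : vmeas (fun s => X s - M) by apply: vmeasB.
have fY : (sqint Q (fun s => (X s - M)%R) < +oo)%E by apply: le_lt_trans VX' _; exact: ltry.
have iY := integrable_coord j mY fY.
have iM : Q.-integrable setT (fun _ => (M j 0)%:E) by exact: finite_measure_integrable_cst.
have := EX j 0; rewrite unlock => EXj.
have : (\int[Q]_s (((X s - M)%R j 0)%:E + (M j 0)%:E) = (M j 0)%:E)%E.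
  by rewrite -[RHS]EXj; apply: eq_integral => s _; rewrite -EFinD !mxE subrK.
rewrite integralD // integral_EFin_cst.
case: (integral _ _ _) => [r||] // [] /eqP.
by rewrite addrC -subr_eq0 addrAC subrr add0r => /eqP ->.
Qed.

Lemma vmeas_sub_mulmx k l (X : T -> 'M[R]_(k, l)) M z :
  (forall i j, measurable_fun setT (fun s => X s i j)) -> vmeas (fun s => (X s - M) *m z).
Proof.
move=> mX; apply: vmeas_mulmx => // i j; under eq_fun do rewrite !mxE.
by apply: measurable_funD => //; exact: mX.
Qed.

Lemma sub_opnorm_sqint k l (X : T -> 'M[R]_(k, l)) M (v : R) z : 0 <= v ->
  (forall i j, measurable_fun setT (fun s => X s i j)) ->
  estimates Q (@opnorm R k l) X M v ->
  (sqint Q (fun s => (X s - M) *m z)%R <= (v * enorm z ^+ 2)%:E)%E.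
Proof.
move=> v0 mX [_ VX].
have mXM := vmeas_sub_mulmx M z mX.
have [z0|z0] := eqVneq (enorm z) 0.
  rewrite (eq_sqint Q (Y := fun _ => 0)) ?sqint_cst ?enorm0 ?z0 ?expr0n ?mulr0 // => s.
  by rewrite (enorm_eq0 z0) mulmx0.
have {}z0 : 0 < enorm z by rewrite lt_neqAle eq_sym z0 enorm_ge0.
have h1 : (sqint Q (fun s => (enorm z)^-1 *: ((X s - M) *m z))%R <= v%:E)%E.
  apply: le_trans VX; rewrite unlock /sqint.
  (* Measurability of the operator norm of X - M is not established, so the integrals are compared
     as suprema over simple functions, for which a pointwise bound suffices. *)
  rewrite !ge0_integralTE; last 2 first.
  - by move=> s; rewrite lee_fin sqr_ge0.
  - by move=> s; rewrite lee_fin sqr_ge0.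
  apply: le_ereal_sup => _ [f hf <-]; exists f => // s.
  apply: le_trans (hf s) _; rewrite lee_fin ler_pXn2r ?nnegrE ?enorm_ge0 ?opnorm_ge0 //.
  rewrite enormZ normfV gtr0_norm // mulrC ler_pdivrMr //.
  exact: enorm_mulmx_le.
have zK : (fun s => (X s - M) *m z) =1 (fun s => enorm z *: ((enorm z)^-1 *: ((X s - M) *m z))).
  by move=> s; rewrite scalerA divff ?scale1r // gt_eqF.
rewrite (eq_sqint _ zK) sqintZ; last exact: vmeasZ.
by rewrite mulrC (EFinM (enorm z ^+ 2)) lee_wpmul2l // lee_fin sqr_ge0.
Qed.

(** Unbiasedness is given entrywise. An entry of X - M is a coordinate of its product with a basis
    vector, hence integrable by the second-moment bound, and the mean of (X - M) z is a finite
    combination of entry means. *)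
Lemma estimates_opnorm k l (X : T -> 'M[R]_(k, l)) M (v : R) z : 0 <= v ->
  (forall i j, measurable_fun setT (fun s => X s i j)) ->
  estimates Q (@opnorm R k l) X M v ->
  mean0 Q (fun s => (X s - M) *m z) /\
  (sqint Q (fun s => (X s - M) *m z)%R <= (v * enorm z ^+ 2)%:E)%E.
Proof.
move=> v0 mX hX; split; last exact: sub_opnorm_sqint.
have mXM u := vmeas_sub_mulmx M u mX.
have deltaE i j s : ((X s - M) *m (delta_mx j 0 : 'cV[R]_l)) i 0 = X s i j - M i j.
  rewrite mxE (bigD1 j) //= big1 ?addr0 => [|b bj]; first by rewrite !mxE !eqxx mulr1.
  by rewrite !mxE (negbTE bj) mulr0.
have iY i j : Q.-integrable setT (fun s => (X s i j - M i j)%:E).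
  have := @integrable_coord _ _ _ Q _ (fun s => (X s - M) *m (delta_mx j 0 : 'cV[R]_l)) i (mXM _).
  under [X in integrable _ _ X]eq_fun do rewrite deltaE.
  apply; apply: le_lt_trans (sub_opnorm_sqint _ v0 mX hX) _; exact: ltry.
have Y0 i j : (\int[Q]_s (X s i j - M i j)%:E = 0)%E.
  have [EX _] := hX; have := EX i j; rewrite unlock => EXij.
  have iM : Q.-integrable setT (fun _ => (M i j)%:E) by exact: finite_measure_integrable_cst.
  have : (\int[Q]_s ((X s i j - M i j)%:E + (M i j)%:E) = (M i j)%:E)%E.
    by rewrite -[RHS]EXij; apply: eq_integral => s _; rewrite -EFinD subrK.
  rewrite integralD // integral_EFin_cst.
  case: (integral _ _ _) => [r||] // [] /eqP.
  by rewrite addrC -subr_eq0 addrAC subrr add0r => /eqP ->.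
move=> i; under eq_integral.
  move=> s _; rewrite mxE -sumEFin; under eq_bigr do rewrite !mxE mulrC EFinM.
  over.
rewrite integral_sum //; last by move=> j; exact: integrableZl.
by rewrite big1 // => j _; rewrite integralZl // Y0 mule0.
Qed.

End Estimates.

(** * Measurability of the sampled derivatives *)

Section DerivativeMeasurability.
Context {R : realType} {d : measure_display} {T : measurableType d}.

Lemma measurable_eps_deriv (f : T -> R -> R) (D : T -> R) :
  (forall a : R, measurable_fun setT (fun t => f t a)) ->
  (forall t, eps_deriv (f t) (D t)) -> measurable_fun setT D.
Proof.
move=> mf hf; apply: (@measurable_fun_cvg _ _ _ setT
  (fun n t => n.+1%:R * (f t (n.+1%:R^-1) - f t 0))) => [n|t _].
  by apply: measurable_funM => //; exact: measurable_funB.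
apply/cvgrPdist_le => e e0; have [del del0 hd] := hf t e e0.
near=> n; have n0 : (0 : R) < n.+1%:R^-1 by rewrite invr_gt0.
have : `|n.+1%:R^-1 : R| < del.
  rewrite gtr0_norm //; near: n; exact: near_infty_natSinv_lt (PosNum del0).
move=> /hd; rewrite [X in _ <= _ * X]gtr0_norm // distrC => h; rewrite distrC in h; rewrite distrC.
have -> : n.+1%:R * (f t n.+1%:R^-1 - f t 0) - D t =
   n.+1%:R * (f t n.+1%:R^-1 - f t 0 - n.+1%:R^-1 * D t) by field.
rewrite normrM ger0_norm // (le_trans (ler_wpM2l _ h)) // mulrCA mulrV ?mulr1 //.
by rewrite unitfE.
Unshelve. all: by end_near.
Qed.

Section Loss.
Context {dx dy : nat} {d' : measure_display} {U : measurableType d'}.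
Context (F : U -> 'cV[R]_dx -> 'cV[R]_dy -> R).
Context (mF : measurable_fun setT (fun p : borel R dx * borel R dy * U => F p.2 p.1.1 p.1.2)).
Context (X : T -> 'cV[R]_dx) (Y : T -> 'cV[R]_dy) (s : T -> U).
Context (mX : vmeas X) (mY : vmeas Y) (ms : measurable_fun setT s).

Lemma measurable_loss (X' : T -> 'cV[R]_dx) (Y' : T -> 'cV[R]_dy) : vmeas X' -> vmeas Y' ->
  measurable_fun setT (fun t => F (s t) (X' t) (Y' t)).
Proof.
move=> /vmeas_borel mX' /vmeas_borel mY'.
exact: (measurableT_comp mF (measurable_fun_pair (measurable_fun_pair mX' mY') ms)).
Qed.

Lemma vmeas_gradx : (forall u, smooth1 (F u)) -> vmeas (fun t => gradx (F (s t)) (X t) (Y t)).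
Proof.
move=> sF; apply: vmeas_col => j.
apply: (@measurable_eps_deriv (fun t a => F (s t) (a *: delta_mx j 0 + X t) (Y t))) => [a|t].
  by apply: measurable_loss => //; exact: vmeasD.
have := smooth1_gateauxx (Y t) (sF (s t)) (X t) (delta_mx j 0).
by rewrite dot_delta mxE.
Qed.

Lemma vmeas_grady (X' : T -> 'cV[R]_dx) (Y' : T -> 'cV[R]_dy) :
  (forall u, smooth1 (F u)) -> vmeas X' -> vmeas Y' ->
  vmeas (fun t => grady (F (s t)) (X' t) (Y' t)).
Proof.
move=> sF mX' mY'; apply: vmeas_col => j.
apply: (@measurable_eps_deriv (fun t a => F (s t) (X' t) (a *: delta_mx j 0 + Y' t))) => [a|t].
  by apply: measurable_loss => //; exact: vmeasD.
have := smooth1_gateauxy (X' t) (sF (s t)) (Y' t) (delta_mx j 0).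
by rewrite dot_delta mxE.
Qed.

Lemma measurable_hess_xy i j : (forall u, smooth2 (F u)) ->
  measurable_fun setT (fun t => hess_xy (F (s t)) (X t) (Y t) i j).
Proof.
move=> sF; apply: (@measurable_eps_deriv
  (fun t a => grady (F (s t)) (a *: delta_mx i 0 + X t) (a *: 0 + Y t) j 0)) => [a|t].
  apply: vmeas_grady => //; first by move=> u; case: (sF u).
    exact: vmeasD.
  by apply: vmeasD.
have := hess_line (X t) (Y t) (delta_mx i 0) 0 (sF (s t)) j.
rewrite mulmx0 addr0 (_ : (_ *m _) j 0 = hess_xy (F (s t)) (X t) (Y t) i j) //.
rewrite mxE (bigD1 i) //= big1 ?addr0 => [|b bi]; first by rewrite !mxE !eqxx mulr1.
by rewrite [delta_mx _ _ _ _]mxE (negbTE bi) mulr0.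
Qed.

Lemma measurable_hess_yy i j : (forall u, smooth2 (F u)) ->
  measurable_fun setT (fun t => hess_yy (F (s t)) (X t) (Y t) i j).
Proof.
move=> sF; apply: (@measurable_eps_deriv
  (fun t a => grady (F (s t)) (a *: 0 + X t) (a *: delta_mx i 0 + Y t) j 0)) => [a|t].
  apply: vmeas_grady => //; first by move=> u; case: (sF u).
    by apply: vmeasD.
  exact: vmeasD.
have := hess_line (X t) (Y t) 0 (delta_mx i 0) (sF (s t)) j.
rewrite mulmx0 add0r (_ : (_ *m _) j 0 = hess_yy (F (s t)) (X t) (Y t) i j) //.
rewrite mxE (bigD1 i) //= big1 ?addr0 => [|b bi]; first by rewrite !mxE !eqxx mulr1.
by rewrite [delta_mx _ _ _ _]mxE (negbTE bi) mulr0.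
Qed.

End Loss.
End DerivativeMeasurability.

Section GenericNoise.
Context {R : realType} {d : measure_display} {T : measurableType d} {I : choiceType}.
Context (S : I -> set_system T) (P : probability T R).
Context (SI : forall i, setI_closed (S i)) (ST : forall i, S i setT).
Context (Sm : forall i, S i `<=` measurable) (indepS : indep_systems P S).

Lemma measurable_draw (J : set I) j d' (T' : measurableType d') (X : T -> T') :
  S j = sigma_of X -> J j -> measurable_fun setT (X : past S J -> T').
Proof.
move=> Sj Jj _ B mB; apply: sub_sigma_algebra; exists j => //.
by rewrite Sj; exists B.
Qed.

Lemma noise_of_law j d' (T' : measurableType d') (X : T -> T') (Q : probability T' R)
    k (f : T' -> 'cV[R]_k) v : S j = sigma_of X -> has_law P X Q -> vmeas f ->
  mean0 Q f -> (sqint Q f <= v%:E)%E -> noise S P [set j] (fun w => f (X w)) v.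
Proof.
move=> Sj lX mf f0 f2; split.
- by move=> a; apply: (measurableT_comp (mf a)); apply: measurable_draw Sj _.
- move=> a; rewrite (integral_law lX (f := fun s => (f s a 0)%:E)) ?f0 //.
  by apply/measurable_EFinP; exact: mf.
- rewrite /sqint (ge0_integral_law lX (f := fun s => (enorm (f s) ^+ 2)%:E)) //.
    by apply/measurable_EFinP; exact: measurable_enorm_sq.
  by move=> s; rewrite lee_fin sqr_ge0.
Qed.

Lemma ucomp_of_law j d' (T' : measurableType d') (X : T -> T') (Q : probability T' R)
    k (C : T' -> 'cV[R]_k -> 'cV[R]_k) omega : S j = sigma_of X -> has_law P X Q ->
  (forall a, measurable_fun setT (fun p : T' * borel R k => C p.1 p.2 a 0)) ->
  (forall v, estimates Q (@enorm R k) (fun s => C s v) v (omega * enorm v ^+ 2)) ->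
  ucomp S P [set j] (fun w => C (X w)) omega.
Proof.
move=> Sj lX mC hC.
have mCv v : vmeas (fun s => C s v).
  by move=> a; exact: (measurableT_comp (mC a) (measurable_fun_pair (@measurable_id _ _ setT)
    (measurable_cst (v : borel R k)))).
have nC v : noise S P [set j] (fun w => C (X w) v - v) (omega * enorm v ^+ 2).
  have [C0 C2] := estimates_enorm (mCv v) (hC v).
  by apply: (noise_of_law (f := fun s => C s v - v) Sj lX) => //; exact: vmeasB.
split; last 2 first.
- by move=> v; have [] := nC v.
- by move=> v; have [] := nC v.
move=> a; have mX : measurable_fun setT (X : past S [set j] -> T') by exact: measurable_draw Sj _.
have m1 : measurable_fun setT (fun p : past S [set j] * borel R k => X p.1).
  exact: (measurableT_comp mX measurable_fst).
exact: (measurableT_comp (mC a) (measurable_fun_pair m1 measurable_snd)).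
Qed.

Section CompressedEstimate.
Context (J1 J2 : set I) (J12 : J1 `&` J2 = set0) (k : nat).
Context (C : T -> 'cV[R]_k -> 'cV[R]_k) (om : R) (o0 : 0 <= om) (uC : ucomp S P J2 C om).
Context (Dw : T -> 'cV[R]_k) (mD m : 'cV[R]_k) (v : R).
Context (nD : noise S P J1 (fun w => Dw w - mD) v).

(** The error is the sampling noise Dw - mD plus the compression error of V = Dw - m, and E |V|^2 <=
    |mD - m|^2 + v. Compression is thus charged on the distance from the mean gradient to the memory
    m. *)
Lemma noise_compressed_estimate :
  noise S P (J1 `|` J2) (fun w => C w (Dw w - m) + m - mD)
    ((1 + om) * v + om * enorm (mD - m) ^+ 2).
Proof.
have [jE E0 E2] := nD.
have mE := noise_vmeas ST Sm nD; have fE := noise_lty nD.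
pose V w : 'cV[R]_k := Dw w - m.
have VE w : V w = (mD - m) + (Dw w - mD).
  by rewrite /V; apply/matrixP => a b; rewrite !mxE; ring.
have V2 : (sqint P V <= (enorm (mD - m) ^+ 2 + v)%:E)%E.
  rewrite (eq_sqint P VE) sqint_shift // EFinD leeD2l //.
have jV : jmeas S J1 V.
  move=> a; rewrite (_ : (fun w => _) = (fun w => ((mD - m) + (Dw w - mD)) a 0)).
    by move: a; apply: vmeasD => //; exact: vmeas_cst.
  by apply/funext => w; rewrite -VE.
have fV : (sqint P V < +oo)%E by apply: le_lt_trans V2 _; exact: ltry.
have := noise_compress SI ST Sm indepS J12 o0 uC jV fV nD V2.
rewrite (_ : (fun w => _) = (fun w => C w (Dw w - m) + m - mD)); last first.
  by apply/funext => w; rewrite /V; apply/matrixP => a b; rewrite !mxE; ring.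
by apply: noise_mono => //; rewrite le_eqVlt; apply/orP; left; apply/eqP; ring.
Qed.

(** With V the compressed vector, the difference splits into - om / (1 + om) V and the centred (1 +
    om)^-1 (C V - V); the weights om^2 / (1 + om)^2 and om / (1 + om)^2 add up to om / (1 + om). *)
Lemma sqint_compressed_update (a : 'cV[R]_k) (t : R) :
  (sqint P (fun w => (1 + om)^-1 *: C w (a + t *: (Dw w - mD)) - (a + t *: (Dw w - mD)))%R
    <= (om / (1 + om) * (enorm a ^+ 2 + t ^+ 2 * v))%:E)%E.
Proof.
have mE := noise_vmeas ST Sm nD; have fE := noise_lty nD.
have nT := noiseZ ST Sm t nD; have mT := noise_vmeas ST Sm nT; have fT := noise_lty nT.
have [jT T0 T2] := nT.
pose V w := a + t *: (Dw w - mD).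
have V2 : (sqint P V <= (enorm a ^+ 2 + t ^+ 2 * v)%:E)%E.
  by rewrite sqint_shift // EFinD leeD2l.
have jV : jmeas S J1 V by apply: vmeasD => //; exact: vmeas_cst.
have fV : (sqint P V < +oo)%E by apply: le_lt_trans V2 _; exact: ltry.
have o1 : 1 + om != 0 by rewrite gt_eqF // ltr_wpDr.
rewrite (eq_sqint P (Y := fun w => ((1 + om)^-1 - 1) *: V w + (1 + om)^-1 *: (C w (V w) - V w))).
  have := sqint_compress SI ST Sm indepS J12 o0 uC jV fV ((1 + om)^-1 - 1) (1 + om)^-1.
  move=> /le_trans; apply.
  have -> : ((1 + om)^-1 - 1) ^+ 2 + (1 + om)^-1 ^+ 2 * om = om / (1 + om) by field.
  by rewrite (EFinM (om / (1 + om))) lee_wpmul2l // lee_fin divr_ge0 // addr_ge0.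
by move=> w; rewrite -/(V w); apply/matrixP => b e; rewrite !mxE; ring.
Qed.

End CompressedEstimate.
End GenericNoise.

(** * Stochastic gradients and compressors of one round *)

Section Oracles.
Context {R : realType} {n dx dy : nat} {pb : problem R n dx dy}.
Context {cu : compressors R n dx} {cl : compressors R n dy} (D : draws pb cu cl).
Context (c : constants R) (sigma : R) (p : params R).
Context (n0 : (0 < n)%N) (rd0 : (0 < rounds p)%N).
Context (SL : sampled_losses pb) (sg0 : 0 <= sigma) (SN : stochastic_noise pb sigma).
Context (UCu : unbiased_compression cu (omega_u p)) (UCl : unbiased_compression cl (omega_l p)).
Context (FD : fresh_draws D).

Definition draw_index := (call n + call n + (call n + call n + call n))%type.

Definition draw_call (j : draw_index) : call n :=
  match j with
  | inl (inl j) => j | inl (inr j) => j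
  | inr (inl (inl j)) => j | inr (inl (inr j)) => j | inr (inr j) => j
  end.

Definition is_data (j : draw_index) := if j is inl _ then true else false.

Notation S := (@draw_system R n dx dy pb cu cl D).
Notation P := (Pr D).
Notation phiD := (@phi R n dx dy pb cu cl D).
Notation xiD := (@xi R n dx dy pb cu cl D).
Notation seedxD := (@seedx R n dx dy pb cu cl D).
Notation seedyD := (@seedy R n dx dy pb cu cl D).
Notation seedzD := (@seedz R n dx dy pb cu cl D).

Lemma draw_setI j : setI_closed (S j).
Proof.
have h d (T : measurableType d) (X : Omega D -> T) : setI_closed (sigma_of X).
  move=> _ _ [A mA <-] [B mB <-]; exists (A `&` B); first exact: measurableI.
  by rewrite !setTI preimage_setI.
by case: j => [[]|[[]|]] j; exact: h.
Qed.

Lemma draw_setT j : S j setT.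
Proof.
have h d (T : measurableType d) (X : Omega D -> T) : sigma_of X setT.
  by exists setT => //; rewrite preimage_setT setTI.
by case: j => [[]|[[]|]] j; exact: h.
Qed.

Lemma draw_measurable j : S j `<=` measurable.
Proof.
have h d (T : measurableType d) (X : Omega D -> T) : measurable_fun setT X ->
    sigma_of X `<=` measurable.
  by move=> mX _ [A mA <-]; exact: mX.
have [h1 h2 h3 h4 _] := FD.
case: j => [[]|[[]|]] j; apply: h.
- by have [[]] := h1 j.
- by have [_ []] := h1 j.
- by have [] := h2 j.
- by have [] := h3 j.
- by have [] := h4 j.
Qed.

Lemma draw_indep : indep_systems P S.
Proof. by case: FD. Qed.

Definition mDx i (x : 'cV[R]_dx) (y z : 'cV[R]_dy) :=
  hess_xy (g_ pb i) x y *m z + gradx (f_ pb i) x y.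
Definition mDy i (x : 'cV[R]_dx) (y : 'cV[R]_dy) := grady (g_ pb i) x y.
Definition mDz i (x : 'cV[R]_dx) (y z : 'cV[R]_dy) :=
  hess_yy (g_ pb i) x y *m z + grady (f_ pb i) x y.

Definition worker_draws i k : set draw_index := [set j | (draw_call j).1 = (i, k)].
Definition data_draws i k : set draw_index :=
  [set j | is_data j /\ (draw_call j).1 = (i, k)].

Let v2 : 0 <= sigma ^+ 2. Proof. exact: sqr_ge0. Qed.

Let lphi (j : call n) : has_law P (phiD j) (lawF pb j.1.1). Proof. by have [h _ _ _ _] := FD; have [] := h j. Qed.
Let lxi (j : call n) : has_law P (xiD j) (lawG pb j.1.1). Proof. by have [h _ _ _ _] := FD; have [] := h j. Qed.

Let mF : measurable_fun setT
   (fun q : borel R dx * borel R dy * sampF pb => sampleF q.2 q.1.1 q.1.2).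
Proof. by case: SL. Qed.
Let mG : measurable_fun setT
   (fun q : borel R dx * borel R dy * sampG pb => sampleG q.2 q.1.1 q.1.2).
Proof. by case: SL. Qed.
Let sF s : smooth1 (@sampleF R n dx dy pb s). Proof. by case: SL => _ _ []. Qed.
Let sG s : smooth2 (@sampleG R n dx dy pb s). Proof. by case: SL => _ _ []. Qed.
Let sG1 s : smooth1 (@sampleG R n dx dy pb s). Proof. by case: (sG s). Qed.

Section FixedPoint.
Context (x : 'cV[R]_dx) (y z : 'cV[R]_dy) (zrho : enorm z <= rho p) (i : 'I_n) (k : nat).

Let mgF : vmeas (fun s : sampF pb => grad2 (sampleF s) x y).
Proof.
apply: vmeas_col_mx.
  by apply: (vmeas_gradx mF (X := fun _ => x) (Y := fun _ => y) (s := id)).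
by apply: (vmeas_grady mF (s := id) _ sF).
Qed.

Let estF := estimates_enorm mgF (let: And4 h _ _ _ := SN i x y in h).

Lemma noise_gradxF r : noise S P [set inl (inl (i, k, r))]
  (fun w => gradx (sampleF (phiD (i, k, r) w)) x y - gradx (f_ pb i) x y) (sigma ^+ 2).
Proof.
have [m0 m2] := estF.
have mg : vmeas (fun s : sampF pb => gradx (sampleF s) x y - gradx (f_ pb i) x y).
  by apply: vmeasB => //; apply: (vmeas_gradx mF (X := fun _ => x) (Y := fun _ => y) (s := id)).
apply: (noise_of_law (f := fun s => gradx (sampleF s) x y - gradx (f_ pb i) x y)
  _ (lphi (i, k, r))) => //.
- move=> j; have := m0 (lshift dy j); under eq_integral do rewrite /grad2 opp_col_mx add_col_mx col_mxEu.
  by [].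
- apply: le_trans m2; apply: le_sqint => //; first by apply: vmeasB.
  by move=> s; rewrite /grad2 opp_col_mx add_col_mx enorm_le_col_mxl.
Qed.

Lemma noise_gradyF r : noise S P [set inl (inl (i, k, r))]
  (fun w => grady (sampleF (phiD (i, k, r) w)) x y - grady (f_ pb i) x y) (sigma ^+ 2).
Proof.
have [m0 m2] := estF.
have mg : vmeas (fun s : sampF pb => grady (sampleF s) x y - grady (f_ pb i) x y).
  by apply: vmeasB => //; apply: (vmeas_grady mF (s := id) _ sF).
apply: (noise_of_law (f := fun s => grady (sampleF s) x y - grady (f_ pb i) x y)
  _ (lphi (i, k, r))) => //.
- move=> j; have := m0 (rshift dx j); under eq_integral do rewrite /grad2 opp_col_mx add_col_mx col_mxEd.
  by [].
- apply: le_trans m2; apply: le_sqint => //; first by apply: vmeasB.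
  by move=> s; rewrite /grad2 opp_col_mx add_col_mx enorm_le_col_mxr.
Qed.

Lemma noise_gradyG r : noise S P [set inl (inr (i, k, r))]
  (fun w => grady (sampleG (xiD (i, k, r) w)) x y - grady (g_ pb i) x y) (sigma ^+ 2).
Proof.
have mg : vmeas (fun s : sampG pb => grady (sampleG s) x y).
  by apply: (vmeas_grady mG (s := id) _ sG1).
have [_ h _ _] := SN i x y; have [m0 m2] := estimates_enorm mg h.
apply: (noise_of_law (f := fun s => grady (sampleG s) x y - grady (g_ pb i) x y)
  _ (lxi (i, k, r))) => //.
by apply: vmeasB.
Qed.

(** The projection keeps |z| <= rho, which turns the operator norm error of the Hessian into a
    variance sigma^2 rho^2. *)
Lemma noise_hess_xyG r : noise S P [set inl (inr (i, k, r))]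
  (fun w => (hess_xy (sampleG (xiD (i, k, r) w)) x y - hess_xy (g_ pb i) x y) *m z)
  (sigma ^+ 2 * rho p ^+ 2).
Proof.
have mh a b : measurable_fun setT (fun s : sampG pb => hess_xy (sampleG s) x y a b).
  by apply: (measurable_hess_xy mG (X := fun _ => x) (Y := fun _ => y) (s := id)).
have [_ _ h _] := SN i x y; have [m0 m2] := estimates_opnorm z v2 mh h.
apply: (noise_of_law (f := fun s => (hess_xy (sampleG s) x y - hess_xy (g_ pb i) x y) *m z)
  _ (lxi (i, k, r))) => //.
  exact: vmeas_sub_mulmx.
rewrite (le_trans m2) // lee_fin ler_wpM2l // ler_pXn2r ?nnegrE ?enorm_ge0 //.
exact: le_trans (enorm_ge0 _) zrho.
Qed.

Lemma noise_hess_yyG r : noise S P [set inl (inr (i, k, r))]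
  (fun w => (hess_yy (sampleG (xiD (i, k, r) w)) x y - hess_yy (g_ pb i) x y) *m z)
  (sigma ^+ 2 * rho p ^+ 2).
Proof.
have mh a b : measurable_fun setT (fun s : sampG pb => hess_yy (sampleG s) x y a b).
  by apply: (measurable_hess_yy mG (X := fun _ => x) (Y := fun _ => y) (s := id)).
have [_ _ _ h] := SN i x y; have [m0 m2] := estimates_opnorm z v2 mh h.
apply: (noise_of_law (f := fun s => (hess_yy (sampleG s) x y - hess_yy (g_ pb i) x y) *m z)
  _ (lxi (i, k, r))) => //.
  exact: vmeas_sub_mulmx.
rewrite (le_trans m2) // lee_fin ler_wpM2l // ler_pXn2r ?nnegrE ?enorm_ge0 //.
exact: le_trans (enorm_ge0 _) zrho.
Qed.

Lemma noise_batch dd (J : 'I_(rounds p) -> set draw_index) (X : 'I_(rounds p) -> Omega D -> 'cV[R]_dd) v :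
  (forall r, noise S P (J r) (X r) v) -> (forall r s, r != s -> J r `&` J s = set0) ->
  (forall r, J r `<=` data_draws i k) ->
  noise S P (data_draws i k) (fun w => (rounds p)%:R^-1 *: \sum_r X r w) (v / (rounds p)%:R).
Proof.
move=> nX Jdis JD.
have := noise_sum draw_setI draw_setT draw_measurable draw_indep
  (index_enum_uniq 'I_(rounds p)) Jdis nX.
move=> /(noiseZ draw_setT draw_measurable (rounds p)%:R^-1).
apply: noise_mono; first by move=> j [r _]; exact: JD.
rewrite sumr_const card_ord -[v *+ _]mulr_natr le_eqVlt; apply/orP; left; apply/eqP.
by field; rewrite pnatr_eq0 -lt0n.
Qed.

Let JF r : set draw_index := [set inl (inr (i, k, r))] `|` [set inl (inl (i, k, r))].

Let JFdis (r s : 'I_(rounds p)) : r != s -> JF (val r) `&` JF (val s) = set0.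
Proof.
move=> rs; apply/seteqP; split => // j [] /= [] -> [] // [] /val_inj rs'.
  by rewrite rs' eqxx in rs.
by rewrite rs' eqxx in rs.
Qed.

Let JFD (r : 'I_(rounds p)) : JF (val r) `<=` data_draws i k.
Proof. by move=> j [] /= ->. Qed.

Let J1dis r : [set inl (inr (i, k, r))] `&` [set inl (inl (i, k, r))] = set0 :> set draw_index.
Proof. by apply/seteqP; split => // j [] /= ->. Qed.

Context (s : state R n dx dy) (sx : stx s = x) (sy : sty s = y) (sz : stz s = z).

Let rd1 : ((rounds p)%:R : R) != 0. Proof. by rewrite pnatr_eq0 -lt0n. Qed.

Lemma scale_sum_const dd (a : 'cV[R]_dd) : (rounds p)%:R^-1 *: \sum_(r < rounds p) a = a.
Proof. by rewrite sumr_const card_ord -[a *+ _]scaler_nat scalerA mulVf ?scale1r. Qed.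

(** For each r the Hessian sample and the gradient sample come from independent draws, so sigma^2
    rho^2 and sigma^2 add up to sigma^2 (1 + rho^2); the batch average divides this by the number of
    rounds. *)
Lemma noise_Dx : noise S P (data_draws i k) (fun w => Dx p w k s i - mDx i x y z)
  (tsig1sq sigma p).
Proof.
have nX (r : 'I_(rounds p)) := noiseD draw_setI draw_setT draw_measurable draw_indep (J1dis r)
  (noise_hess_xyG r) (noise_gradxF r).
have := noise_batch nX JFdis JFD.
rewrite (_ : (fun w => _) = (fun w => Dx p w k s i - mDx i x y z)).
  apply: noise_mono => //; rewrite le_eqVlt; apply/orP; left; apply/eqP.
  by rewrite /tsig1sq; congr (_ / _); ring.
apply/funext => w; rewrite /Dx sx sy sz -[X in _ - X]scale_sum_const -scalerBr -sumrB.
congr (_ *: _); apply: eq_bigr => r _.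
by rewrite /mDx mulmxBl opprD !addrA; congr (_ - _); rewrite addrAC.
Qed.

Lemma noise_Dz : noise S P (data_draws i k) (fun w => Dz p w k s i - mDz i x y z)
  (tsig1sq sigma p).
Proof.
have nX (r : 'I_(rounds p)) := noiseD draw_setI draw_setT draw_measurable draw_indep (J1dis r)
  (noise_hess_yyG r) (noise_gradyF r).
have := noise_batch nX JFdis JFD.
rewrite (_ : (fun w => _) = (fun w => Dz p w k s i - mDz i x y z)).
  apply: noise_mono => //; rewrite le_eqVlt; apply/orP; left; apply/eqP.
  by rewrite /tsig1sq; congr (_ / _); ring.
apply/funext => w; rewrite /Dz sx sy sz -[X in _ - X]scale_sum_const -scalerBr -sumrB.
congr (_ *: _); apply: eq_bigr => r _.
by rewrite /mDz mulmxBl opprD !addrA; congr (_ - _); rewrite addrAC.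
Qed.

Lemma noise_Dy : noise S P (data_draws i k) (fun w => Dy p w k s i - mDy i x y)
  (tsigsq sigma p).
Proof.
have nX (r : 'I_(rounds p)) : noise S P (JF r) _ _ := noise_mono (@subsetUl _ _ _) (lexx _) (noise_gradyG r).
have := noise_batch nX JFdis JFD.
rewrite (_ : (fun w => _) = (fun w => Dy p w k s i - mDy i x y)) //.
apply/funext => w; rewrite /Dy sx sy -[X in _ - X]scale_sum_const -scalerBr -sumrB //.
Qed.

End FixedPoint.

Section Compressors.
Context (i : 'I_n) (k : nat).

Let Jx r : set draw_index := [set inr (inl (inl (i, k, r)))].
Let Jy r : set draw_index := [set inr (inl (inr (i, k, r)))].
Let Jz r : set draw_index := [set inr (inr (i, k, r))].

Definition seed_drawsx : set draw_index := \bigcup_(r in `I_(rounds p)) Jx r.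
Definition seed_drawsy : set draw_index := \bigcup_(r in `I_(rounds p)) Jy r.
Definition seed_drawsz : set draw_index := \bigcup_(r in `I_(rounds p)) Jz r.

Lemma omega_l_ge0 : 0 <= omega_l p. Proof. by case: UCl. Qed.
Lemma omega_u_ge0 : 0 <= omega_u p. Proof. by case: UCu. Qed.

Lemma ucomp_x : ucomp S P seed_drawsx
  (fun w v => msc (omega_u p) (fun r => compress cu i (seedxD (i, k, r) w)) (rounds p) v)
  (tom_u p).
Proof.
have dis r s : r != s -> Jx r `&` Jx s = set0.
  by move=> rs; apply/seteqP; split => // j [] /= -> [] rs'; rewrite rs' eqxx in rs.
pose C r w := compress cu i (seedxD (i, k, r) w).
have uC r : ucomp S P (Jx r) (C r) (omega_u p).
  have [_ /(_ i) [mC hC]] := UCu; have [_ h _ _ _] := FD.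
  by apply: (ucomp_of_law _ (h (i, k, r)) mC hC).
exact: (ucomp_msc draw_setI draw_setT draw_measurable draw_indep omega_u_ge0 dis uC rd0).
Qed.

Lemma ucomp_y : ucomp S P seed_drawsy
  (fun w v => msc (omega_l p) (fun r => compress cl i (seedyD (i, k, r) w)) (rounds p) v)
  (tom_l p).
Proof.
have dis r s : r != s -> Jy r `&` Jy s = set0.
  by move=> rs; apply/seteqP; split => // j [] /= -> [] rs'; rewrite rs' eqxx in rs.
pose C r w := compress cl i (seedyD (i, k, r) w).
have uC r : ucomp S P (Jy r) (C r) (omega_l p).
  have [_ /(_ i) [mC hC]] := UCl; have [_ _ h _ _] := FD.
  by apply: (ucomp_of_law _ (h (i, k, r)) mC hC).
exact: (ucomp_msc draw_setI draw_setT draw_measurable draw_indep omega_l_ge0 dis uC rd0).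
Qed.

Lemma ucomp_z : ucomp S P seed_drawsz
  (fun w v => msc (omega_l p) (fun r => compress cl i (seedzD (i, k, r) w)) (rounds p) v)
  (tom_l p).
Proof.
have dis r s : r != s -> Jz r `&` Jz s = set0.
  by move=> rs; apply/seteqP; split => // j [] /= -> [] rs'; rewrite rs' eqxx in rs.
pose C r w := compress cl i (seedzD (i, k, r) w).
have uC r : ucomp S P (Jz r) (C r) (omega_l p).
  have [_ /(_ i) [mC hC]] := UCl; have [_ _ _ h _] := FD.
  by apply: (ucomp_of_law _ (h (i, k, r)) mC hC).
exact: (ucomp_msc draw_setI draw_setT draw_measurable draw_indep omega_l_ge0 dis uC rd0).
Qed.

Lemma data_seedx : data_draws i k `&` seed_drawsx = set0.
Proof. by apply/seteqP; split => // j [[dj _] [r _ /= jr]]; rewrite jr in dj. Qed.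
Lemma data_seedy : data_draws i k `&` seed_drawsy = set0.
Proof. by apply/seteqP; split => // j [[dj _] [r _ /= jr]]; rewrite jr in dj. Qed.
Lemma data_seedz : data_draws i k `&` seed_drawsz = set0.
Proof. by apply/seteqP; split => // j [[dj _] [r _ /= jr]]; rewrite jr in dj. Qed.

Lemma seedy_worker : data_draws i k `|` seed_drawsy `<=` worker_draws i k.
Proof. by move=> j [[] //|[r _ ->]]. Qed.
Lemma seedz_worker : data_draws i k `|` seed_drawsz `<=` worker_draws i k.
Proof. by move=> j [[] //|[r _ ->]]. Qed.

End Compressors.

Lemma worker_draws_disjoint k i j : i != j -> worker_draws i k `&` worker_draws j k = set0.
Proof.
move=> ij; apply/seteqP; split => // a [e1 e2].
have [e] : (i, k) = (j, k) by rewrite -e1 -e2.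
by rewrite e eqxx in ij.
Qed.

(** The draws of distinct workers are independent, so averaging divides the mean variance by n once
    more. *)
Lemma noise_vavg dd k (X : 'I_n -> Omega D -> 'cV[R]_dd) v :
  (forall i, noise S P (worker_draws i k) (X i) (v i)) ->
  noise S P (\bigcup_(i in [set` index_enum 'I_n]) worker_draws i k)
    (fun w => vavg (fun i => X i w)) (n%:R^-1 * (n%:R^-1 * \sum_i v i)).
Proof.
move=> nX; have := noise_sum draw_setI draw_setT draw_measurable draw_indep
  (index_enum_uniq 'I_n) (@worker_draws_disjoint k) nX.
by move=> /(noiseZ draw_setT draw_measurable n%:R^-1); rewrite expr2 mulrA.
Qed.

End Oracles.

Section LipschitzMeasurability.
Context {R : realType} {d : measure_display} {T : measurableType d}.

Lemma vmeas_lip k l (F : 'cV[R]_k -> 'cV[R]_l) (L : R) (X : T -> 'cV[R]_k) :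
  lip_vec L F -> vmeas X -> vmeas (fun t => F (X t)).
Proof.
move=> lF mX j; apply: (measurable_continuous_vmeas (h := fun u => F u j 0)) => //.
apply: (@continuous_of_le_enorm _ _ _ L) => u v; apply: le_trans (lF u v).
by have := le_enorm_coord (F u - F v) j; rewrite !mxE.
Qed.

Lemma measurable_lip2 k l (F : 'cV[R]_k -> 'cV[R]_l -> R) (L : R)
    (X : T -> 'cV[R]_k) (Y : T -> 'cV[R]_l) :
  (forall x y x' y', `|F x y - F x' y'| <= L * enorm (col_mx (x - x') (y - y'))) ->
  vmeas X -> vmeas Y -> measurable_fun setT (fun t => F (X t) (Y t)).
Proof.
move=> hF mX mY; pose h (q : 'cV[R]_(k + l)) := F (usubmx q) (dsubmx q).
rewrite (_ : (fun t => _) = (fun t => h (col_mx (X t) (Y t)))); last first.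
  by apply/funext => t; rewrite /h col_mxKu col_mxKd.
apply: measurable_continuous_vmeas; last exact: vmeas_col_mx.
apply: (@continuous_of_le_enorm _ _ _ L) => u v; rewrite /h (le_trans (hF _ _ _ _)) //.
by rewrite -!linearB /= vsubmxK.
Qed.

Lemma vmeas_lip2 k l m (F : 'cV[R]_k -> 'cV[R]_l -> 'cV[R]_m) (L : R)
    (X : T -> 'cV[R]_k) (Y : T -> 'cV[R]_l) :
  (forall x y x' y', enorm (F x y - F x' y') <= L * enorm (col_mx (x - x') (y - y'))) ->
  vmeas X -> vmeas Y -> vmeas (fun t => F (X t) (Y t)).
Proof.
move=> hF mX mY j; apply: (@measurable_lip2 _ _ (fun x y => F x y j 0) L) => // x y x' y'.
apply: le_trans (hF _ _ _ _).
by have := le_enorm_coord (F x y - F x' y') j; rewrite !mxE.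
Qed.

End LipschitzMeasurability.

(** The descent lemma, used from u to v and from v to u, bounds |h u - h v| by a multiple of |u - v|
    near v. Continuity of Phi is what makes it measurable along the iterates. *)
Lemma gateaux_lip_continuous (R : realType) d (h : 'cV[R]_d -> R) (L : R) :
  0 < L -> gateaux h -> lip_vec L (grad h) -> continuous h.
Proof.
move=> L0 gh hL v; have bnd u : `|h u - h v| <= (enorm (grad h v) + 2 * L * enorm (u - v)) * enorm (u - v).
  have h1 := gateaux_ub v u gh (lip_grad_dot hL).
  have h2 := gateaux_ub u v gh (lip_grad_dot hL).
  have h3 := dot_le (grad h v) (u - v); have h4 := dot_le (grad h u) (v - u).
  have h5 : enorm (grad h u) <= enorm (grad h v) + L * enorm (u - v).
    by rewrite -{1}(subrK (grad h v) (grad h u)) addrC (le_trans (enormD _ _)) // lerD2l hL.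
  rewrite (enormBC v u) in h2 h4; have e0 := enorm_ge0 (u - v).
  have h6 := ler_wpM2r e0 h5.
  have h7 : 0 <= L * enorm (u - v) ^+ 2 by rewrite mulr_ge0 ?sqr_ge0 // ltW.
  by rewrite ler_norml; apply/andP; split; lra.
apply/(@cvgrPdist_lt _ R^o _ (nbhs v) (nbhs_filter v)) => e e0.
pose M := enorm (grad h v) + 2 * L + 1.
have M0 : 0 < M by rewrite ltr_wpDl // addr_ge0 ?enorm_ge0 // mulr_ge0 // ltW.
have d1 : (0 : R) < d%:R + 1 by rewrite ltr_wpDl.
pose del := Num.min 1 (e / M) / (d%:R + 1).
have del0 : 0 < del by rewrite divr_gt0 // lt_min ltr01 divr_gt0.
apply/nbhs_ballP; exists del => //= u; rewrite -ball_normE /= => uv.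
have uv' : enorm (u - v) < Num.min 1 (e / M).
  rewrite enormBC (le_lt_trans (enorm_le_mxnorm _)) //.
  move: uv; rewrite /del ltr_pdivlMr //; apply: le_lt_trans.
  by rewrite mulrC ler_wpM2l // lerDl.
move: uv'; rewrite lt_min => /andP[u1 uM]; rewrite distrC (le_lt_trans (bnd u)) //.
have e1 := enorm_ge0 (u - v).
apply: (@le_lt_trans _ _ (M * enorm (u - v))); last by rewrite mulrC -ltr_pdivlMr.
by rewrite ler_wpM2r // /M; nra.
Qed.

(** * Error functionals and their measurability *)

Section Functionals.
Context {R : realType} {n dx dy : nat} (pb : problem R n dx dy).
Implicit Types s : state R n dx dy.

Definition mDxs i s := mDx i (pb := pb) (stx s) (sty s) (stz s).
Definition mDys i s := mDy i (pb := pb) (stx s) (sty s).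
Definition mDzs i s := mDz i (pb := pb) (stx s) (sty s) (stz s).

Definition avg_sq (d : nat) (u : 'I_n -> 'cV[R]_d) : R := n%:R^-1 * \sum_i enorm (u i) ^+ 2.

(* [gS s s'] compares the memory of [s'] with the mean gradients at [s], and so do [gMy],
   [gMz]: one step is first controlled with the gradients of the old state. *)
Definition fP s := Phi pb (stx s).
Definition fG s := enorm (grad (Phi pb) (stx s)) ^+ 2.
Definition fH s := enorm (hhat s) ^+ 2.
Definition fX s := enorm (vavg (hx s) - grad (Phi pb) (stx s)) ^+ 2.
Definition fM s := avg_sq (fun i => mx s i - hx s i).
Definition gS s s' := avg_sq (fun i => hx s' i - mDxs i s).
Definition fY s := enorm (sty s - ystar pb (stx s)) ^+ 2.
Definition fZ s := enorm (stz s - zstar pb (stx s)) ^+ 2.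
Definition gMy s s' := avg_sq (fun i => mDys i s - my s' i).
Definition gMz s s' := avg_sq (fun i => mDzs i s - mz s' i).

Lemma avg_sq_ge0 (d : nat) (u : 'I_n -> 'cV[R]_d) : 0 <= avg_sq u.
Proof. by rewrite mulr_ge0 // sumr_ge0 // => i _; exact: sqr_ge0. Qed.

Section Measurable.
Context {d : measure_display} {T : measurableType d}.

Definition mstate (s : T -> state R n dx dy) :=
  [/\ vmeas (fun t => stx (s t)), vmeas (fun t => sty (s t)), vmeas (fun t => stz (s t)),
      forall i, [/\ vmeas (fun t => mx (s t) i), vmeas (fun t => my (s t) i),
                    vmeas (fun t => mz (s t) i) & vmeas (fun t => hx (s t) i)] &
      [/\ vmeas (fun t => hhat (s t)), vmeas (fun t => smy (s t)) & vmeas (fun t => smz (s t))]].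

Lemma measurable_avg_sq k (u : 'I_n -> T -> 'cV[R]_k) : (forall i, vmeas (u i)) ->
  measurable_fun setT (fun t => avg_sq (fun i => u i t)).
Proof.
move=> mu; apply: measurable_funM => //; apply: measurable_sum => i.
exact: measurable_enorm_sq.
Qed.

Lemma mstate_cst (s : state R n dx dy) : mstate (fun _ => s).
Proof. by split=> [j|j|j|i|] //; split=> // j. Qed.

Context (c : constants R).
Context (n0 : (0 < n)%N) (dx0 : (0 < dx)%N) (dy0 : (0 < dy)%N).
Context (Hc : continuity pb c) (Hs : strong_convexity pb c) (Hl : lipschitz_constants pb c).
Context (s s' : T -> state R n dx dy) (ms : mstate s) (ms' : mstate s').

Let mx_ : vmeas (fun t => stx (s t)). Proof. by case: ms. Qed.
Let my_ : vmeas (fun t => sty (s t)). Proof. by case: ms. Qed.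
Let mz_ : vmeas (fun t => stz (s t)). Proof. by case: ms. Qed.

Lemma vmeas_gradPhi : vmeas (fun t => grad (Phi pb) (stx (s t))).
Proof. by have [_ [h _ _]] := Hl; exact: vmeas_lip h mx_. Qed.

(** Entry (a, b) is the a-th coordinate of H applied to the b-th basis vector, so it inherits the
    Lipschitz bound. *)
Let cyl_delta (m q : nat) (H : 'cV[R]_dx -> 'cV[R]_dy -> 'M[R]_(m, q)) (L : R) a b :
  (forall x y x' y' z, enorm ((H x y - H x' y') *m z) <=
     L * enorm (col_mx (x - x') (y - y')) * enorm z) ->
  measurable_fun setT (fun t => H (stx (s t)) (sty (s t)) a b).
Proof.
move=> hH; apply: (@measurable_lip2 _ _ _ _ _ (fun x y => H x y a b) L) => // x y x' y'.
have := hH x y x' y' (delta_mx b 0).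
have -> : enorm (delta_mx b 0 : 'cV[R]_q) = 1.
  apply/eqP; rewrite -(eqrXn2 (n := 2)) ?enorm_ge0 // enorm_sq dot_delta mxE !eqxx.
  by rewrite expr1n.
rewrite mulr1; apply: le_trans; apply: le_trans (le_enorm_coord _ a).
rewrite mxE (bigD1 b) //= big1 ?addr0 => [|e eb].
  by rewrite [delta_mx _ _ _ _]mxE !eqxx mulr1 !mxE.
by rewrite [delta_mx _ _ _ _]mxE (negbTE eb) mulr0.
Qed.

Lemma vmeas_mDxs i : vmeas (fun t => mDxs i (s t)).
Proof.
apply: vmeasD; last exact: vmeas_lip2 (f_lipx Hc i) mx_ my_.
by apply: vmeas_mulmx => // a b; exact: cyl_delta (hxy_lip Hc i).
Qed.

Lemma vmeas_mDys i : vmeas (fun t => mDys i (s t)).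
Proof. exact: vmeas_lip2 (g_lip Hc i) mx_ my_. Qed.

Lemma vmeas_mDzs i : vmeas (fun t => mDzs i (s t)).
Proof.
apply: vmeasD; last exact: vmeas_lip2 (f_lipy Hc i) mx_ my_.
by apply: vmeas_mulmx => // a b; exact: cyl_delta (hyy_lip Hc i).
Qed.

Lemma measurable_fP : measurable_fun setT (fun t => fP (s t)).
Proof.
have [[L0 _ _] [h _ _]] := Hl; apply: measurable_continuous_vmeas => //.
exact: gateaux_lip_continuous L0 (Phi_gateaux n0 dy0 Hc Hs Hl) h.
Qed.

Lemma measurable_fG : measurable_fun setT (fun t => fG (s t)).
Proof. by apply: measurable_enorm_sq; exact: vmeas_gradPhi. Qed.

Lemma measurable_fH : measurable_fun setT (fun t => fH (s t)).
Proof. by apply: measurable_enorm_sq; case: ms => _ _ _ _ []. Qed.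

Lemma measurable_fX : measurable_fun setT (fun t => fX (s t)).
Proof.
apply: measurable_enorm_sq; apply: vmeasB; last exact: vmeas_gradPhi.
by apply: vmeas_vavg => i; case: ms => _ _ _ /(_ i) [].
Qed.

Lemma measurable_fM : measurable_fun setT (fun t => fM (s t)).
Proof.
by apply: measurable_avg_sq => i; case: ms => _ _ _ /(_ i) [? _ _ ?] _; exact: vmeasB.
Qed.

Lemma measurable_gS : measurable_fun setT (fun t => gS (s t) (s' t)).
Proof.
apply: measurable_avg_sq => i; apply: vmeasB; last exact: vmeas_mDxs.
by case: ms' => _ _ _ /(_ i) [].
Qed.

Lemma measurable_fY : measurable_fun setT (fun t => fY (s t)).
Proof.
by apply: measurable_enorm_sq; apply: vmeasB => //; have [_ [_ h _]] := Hl; exact: vmeas_lip h mx_.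
Qed.

Lemma measurable_fZ : measurable_fun setT (fun t => fZ (s t)).
Proof.
by apply: measurable_enorm_sq; apply: vmeasB => //; have [_ [_ _ h]] := Hl; exact: vmeas_lip h mx_.
Qed.

Lemma measurable_gMy : measurable_fun setT (fun t => gMy (s t) (s' t)).
Proof.
apply: measurable_avg_sq => i; apply: vmeasB; first exact: vmeas_mDys.
by case: ms' => _ _ _ /(_ i) [].
Qed.

Lemma measurable_gMz : measurable_fun setT (fun t => gMz (s t) (s' t)).
Proof.
apply: measurable_avg_sq => i; apply: vmeasB; first exact: vmeas_mDzs.
by case: ms' => _ _ _ /(_ i) [].
Qed.

End Measurable.

Section StepMeasurable.
Context {cu : compressors R n dx} {cl : compressors R n dy} (D : draws pb cu cl).
Context (p : params R) (rd0 : (0 < rounds p)%N) (SL : sampled_losses pb) (FD : fresh_draws D).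
Context (UCu : unbiased_compression cu (omega_u p)) (UCl : unbiased_compression cl (omega_l p)).

Notation S := (@draw_system R n dx dy pb cu cl D).

Definition round_draws k : set (draw_index (n := n)) := [set j | (draw_call j).1.2 = k].

Context {d : measure_display} {T : measurableType d}.
Context (k : nat) (W : T -> past S (round_draws k)) (mW : measurable_fun setT W).
Context (s : T -> state R n dx dy) (ms : mstate s).

Let mx_ : vmeas (fun t => stx (s t)). Proof. by case: ms. Qed.
Let my_ : vmeas (fun t => sty (s t)). Proof. by case: ms. Qed.
Let mz_ : vmeas (fun t => stz (s t)). Proof. by case: ms. Qed.

Let mdraw j d' (T' : measurableType d') (X : Omega D -> T') :
  S j = sigma_of X -> (draw_call j).1.2 = k -> measurable_fun setT (fun t => X (W t)).
Proof.
move=> Sj jk; have mX : measurable_fun setT (X : past S (round_draws k) -> T').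
  exact: measurable_draw Sj jk.
exact: (measurableT_comp mX mW).
Qed.

Let mphi i r : measurable_fun setT (fun t => phi (d := D) (i, k, r) (W t)).
Proof. exact: (@mdraw (inl (inl (i, k, r)))). Qed.
Let mxi i r : measurable_fun setT (fun t => xi (d := D) (i, k, r) (W t)).
Proof. exact: (@mdraw (inl (inr (i, k, r)))). Qed.

Let mF : measurable_fun setT
   (fun q : borel R dx * borel R dy * sampF pb => sampleF q.2 q.1.1 q.1.2).
Proof. by case: SL. Qed.
Let mG : measurable_fun setT
   (fun q : borel R dx * borel R dy * sampG pb => sampleG q.2 q.1.1 q.1.2).
Proof. by case: SL. Qed.
Let sF u : smooth1 (@sampleF R n dx dy pb u). Proof. by case: SL => _ _ []. Qed.
Let sG u : smooth2 (@sampleG R n dx dy pb u). Proof. by case: SL => _ _ []. Qed.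
Let sG1 u : smooth1 (@sampleG R n dx dy pb u). Proof. by case: (sG u). Qed.

Let mDx_ i : vmeas (fun t => Dx p (W t) k (s t) i).
Proof.
apply: vmeasZ; apply: vmeas_sum => r; apply: vmeasD.
  apply: vmeas_mulmx => // a b.
  exact: (measurable_hess_xy mG mx_ my_ (mxi i (val r)) a b sG).
exact: (vmeas_gradx mF mx_ my_ (mphi i (val r)) sF).
Qed.

Let mDz_ i : vmeas (fun t => Dz p (W t) k (s t) i).
Proof.
apply: vmeasZ; apply: vmeas_sum => r; apply: vmeasD.
  apply: vmeas_mulmx => // a b.
  exact: (measurable_hess_yy mG mx_ my_ (mxi i (val r)) a b sG).
exact: (vmeas_grady mF (mphi i (val r)) sF mx_ my_).
Qed.

Let mDy_ i : vmeas (fun t => Dy p (W t) k (s t) i).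
Proof.
apply: vmeasZ; apply: vmeas_sum => r.
exact: (vmeas_grady mG (mxi i (val r)) sG1 mx_ my_).
Qed.

Let mWJ (J : set (draw_index (n := n))) : J `<=` round_draws k ->
  measurable_fun setT (fun t => W t : past S J).
Proof.
move=> Jk; have mid : measurable_fun setT (id : past S (round_draws k) -> past S J).
  exact: (@measurable_past_mono _ _ _ _ J (round_draws k) _ (past S J) id Jk).
exact: (measurableT_comp mid mW).
Qed.

(** Both the state and the draws are read off an arbitrary t. This covers a frozen state with random
    draws, the product of past and round in [markov_le], and the iterates themselves. *)
Lemma mstate_step : mstate (fun t => step p (W t) k (s t)).
Proof.
have [_ _ _ mm [mhh msy msz]] := ms.
have mhx i : vmeas (fun t => (1 - theta p) *: hx (s t) i + theta p *: Dx p (W t) k (s t) i).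
  by have [_ _ _ h] := mm i; apply: vmeasD; exact: vmeasZ.
have mcx i : vmeas (fun t => msc (omega_u p)
    (fun r => compress cu i (seedx (d := D) (i, k, r) (W t))) (rounds p)
    ((1 - theta p) *: hx (s t) i + theta p *: Dx p (W t) k (s t) i - mx (s t) i)).
  have [h _ _ _] := mm i.
  apply: (ucomp_vmeas (W := fun t => W t : past S (seed_drawsx p i k)) (ucomp_x rd0 UCu FD i k)).
    by apply: mWJ => j [r _ ->].
  by apply: vmeasB.
have mcy i : vmeas (fun t => msc (omega_l p)
    (fun r => compress cl i (seedy (d := D) (i, k, r) (W t))) (rounds p)
    (Dy p (W t) k (s t) i - my (s t) i)).
  have [_ h _ _] := mm i.
  apply: (ucomp_vmeas (W := fun t => W t : past S (seed_drawsy p i k)) (ucomp_y rd0 UCl FD i k)).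
    by apply: mWJ => j [r _ ->].
  by apply: vmeasB.
have mcz i : vmeas (fun t => msc (omega_l p)
    (fun r => compress cl i (seedz (d := D) (i, k, r) (W t))) (rounds p)
    (Dz p (W t) k (s t) i - mz (s t) i)).
  have [_ _ h _] := mm i.
  apply: (ucomp_vmeas (W := fun t => W t : past S (seed_drawsz p i k)) (ucomp_z rd0 UCl FD i k)).
    by apply: mWJ => j [r _ ->].
  by apply: vmeasB.
have mzt : vmeas (fun t => stz (s t) - gamma p *: (smz (s t) + vavg (fun i => msc (omega_l p)
    (fun r => compress cl i (seedz (d := D) (i, k, r) (W t))) (rounds p)
    (Dz p (W t) k (s t) i - mz (s t) i)))).
  by apply: vmeasB => //; apply: vmeasZ; apply: vmeasD => //; exact: vmeas_vavg.
split.
- by apply: vmeasB => //; exact: vmeasZ.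
- by apply: vmeasB => //; apply: vmeasZ; apply: vmeasD => //; exact: vmeas_vavg.
- apply: vmeasZf => //; apply: measurable_minr => //.
  by apply: measurable_funM => //; apply: measurable_finv; exact: measurable_enorm.
- move=> i; have [h1 h2 h3 h4] := mm i; split.
  + by apply: vmeasD => //; exact: vmeasZ.
  + by apply: vmeasD => //; exact: vmeasZ.
  + by apply: vmeasD => //; exact: vmeasZ.
  + exact: mhx.
- split.
  + by apply: vmeasD => //; apply: vmeasZ; exact: vmeas_vavg.
  + by apply: vmeasD => //; apply: vmeasZ; exact: vmeas_vavg.
  + by apply: vmeasD => //; apply: vmeasZ; exact: vmeas_vavg.
Qed.

End StepMeasurable.
End Functionals.

(** * One-step inequalities *)

Lemma enorm_sq_le (R : realType) k (u : 'cV[R]_k) (b : R) :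
  enorm u <= b -> enorm u ^+ 2 <= b ^+ 2.
Proof. by move=> ub; rewrite ler_pXn2r ?nnegrE ?(le_trans (enorm_ge0 u) ub) ?enorm_ge0. Qed.

Lemma enorm_sqD_young (R : realType) k (u v : 'cV[R]_k) (a : R) : 0 < a ->
  enorm (u + v) ^+ 2 <= (1 + a) * enorm u ^+ 2 + (1 + a^-1) * enorm v ^+ 2.
Proof.
move=> a0; have := sqr_ge0 (enorm (a *: u - v)).
rewrite enorm_sqB enorm_sqZ dotZl enorm_sqD => h.
have : 0 <= a^-1 * (a ^+ 2 * enorm u ^+ 2 - 2 * (a * dot u v) + enorm v ^+ 2).
  by rewrite mulr_ge0 // invr_ge0 ltW.
suff -> : a^-1 * (a ^+ 2 * enorm u ^+ 2 - 2 * (a * dot u v) + enorm v ^+ 2) =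
  a * enorm u ^+ 2 - 2 * dot u v + a^-1 * enorm v ^+ 2 by lra.
by field; rewrite gt_eqF.
Qed.

(** Projection onto a ball never increases the distance to a point of the ball. For u = 0 the
    quotient r / |u| takes the default value 0, which is harmless because it multiplies u. *)
Lemma enorm_proj_ball (R : realType) k (u v : 'cV[R]_k) (r : R) : enorm v <= r ->
  enorm (Num.min 1 (r / enorm u) *: u - v) <= enorm (u - v).
Proof.
move=> vr; have r0 : 0 <= r := le_trans (enorm_ge0 v) vr.
have [ur|ru] := leP (enorm u) r.
  have [u0|u0] := eqVneq (enorm u) 0.
    by rewrite (enorm_eq0 u0) scaler0.
  rewrite min_l ?scale1r // ler_pdivlMr ?mul1r //.
  by rewrite lt_neqAle eq_sym u0 enorm_ge0.
have u0 : 0 < enorm u by exact: le_lt_trans ru.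
set q := r / enorm u; have q1 : q < 1 by rewrite ltr_pdivrMr ?mul1r.
have q0 : 0 <= q by rewrite divr_ge0 ?enorm_ge0.
have qu : q * enorm u = r by rewrite divfK ?gt_eqF.
rewrite min_r; last exact: ltW.
rewrite -(@ler_pXn2r _ 2) ?nnegrE ?enorm_ge0 //.
rewrite !enorm_sqB enorm_sqZ dotZl.
have uv : dot u v <= enorm u * r.
  by rewrite (le_trans (dot_le _ _)) // ler_wpM2l ?enorm_ge0.
have : (1 - q) * dot u v <= (1 - q) * (enorm u * r) by rewrite ler_wpM2l // subr_ge0 ltW.
move: (enorm u) u0 qu {uv} => a a0 qu h.
have : 0 <= (1 - q) ^+ 2 * a ^+ 2 by rewrite mulr_ge0 ?sqr_ge0.
rewrite -qu in h *; nra.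
Qed.

Lemma enorm_proj_le (R : realType) k (u : 'cV[R]_k) (r : R) : 0 <= r ->
  enorm (Num.min 1 (r / enorm u) *: u) <= r.
Proof.
move=> r0; have q0 : 0 <= Num.min 1 (r / enorm u) by rewrite le_min ler01 divr_ge0 ?enorm_ge0.
rewrite enormZ ger0_norm //; have [->|u0] := eqVneq (enorm u) 0; first by rewrite mulr0.
have u1 : 0 < enorm u by rewrite lt_neqAle eq_sym u0 enorm_ge0.
by rewrite -ler_pdivlMr // ge_min lexx orbT.
Qed.

Lemma sub_via (V : zmodType) (a b e d : V) : a - d = (a - b) + (e - d) + (b - e).
Proof.
by rewrite addrAC [a - b + _]addrA subrK addrA subrK.
Qed.

Lemma enorm_sq_via (R : realType) k (a b e d : 'cV[R]_k) : enorm (a - d) ^+ 2 <=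
  3 * (enorm (a - b) ^+ 2 + enorm (d - e) ^+ 2 + enorm (b - e) ^+ 2).
Proof.
rewrite (sub_via a b e d) (enormBC d e); have := enorm_sqD3 (a - b) (e - d) (b - e); lra.
Qed.

Lemma linear_step_split (R : realType) k (b : R) (z zs A B g w : 'cV[R]_k) :
  z - zs - b *: (A - B) + (- b *: (B + g) + (zs - w)) = z - b *: (A + g) - w.
Proof. by apply/matrixP => q r; rewrite !mxE; ring. Qed.

Lemma momentum_step_split (R : realType) k (t : R) (h g D w : 'cV[R]_k) :
  (1 - t) *: (h - g) + (t *: (D - g) + (g - w)) = (1 - t) *: h + t *: D - w.
Proof. by apply/matrixP => q r; rewrite !mxE; ring. Qed.

Lemma affine_diff (R : realType) k l (H H' : 'M[R]_(k, l)) z z' (a b : 'cV[R]_k) :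
  H *m z + a - (H' *m z' + b) = (H - H') *m z + (a - b) + H' *m (z - z').
Proof.
rewrite mulmxBl mulmxBr; set A := H *m z; set B := H' *m z; set C := H' *m z'.
by move: A B C => A B C; apply/matrixP => q r; rewrite !mxE; ring.
Qed.

Lemma affine_diff0 (R : realType) k l (H H' : 'M[R]_(k, l)) z (a b : 'cV[R]_k) :
  H *m z + a - (H' *m z + b) = (H - H') *m z + (a - b).
Proof. by rewrite affine_diff subrr mulmx0 addr0. Qed.

Section AverageSquares.
Context {R : realType} {n : nat} (n0 : (0 < n)%N) (d : nat).
Implicit Types u v : 'I_n -> 'cV[R]_d.

Lemma avg_sq_le_cst u b : (forall i, enorm (u i) ^+ 2 <= b) -> avg_sq u <= b.
Proof.
move=> ub; rewrite /avg_sq ler_pdivrMl ?ltr0n //.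
have := ler_sum (index_enum 'I_n) (fun i (_ : xpredT i) => ub i).
by rewrite sumr_const card_ord mulr_natl.
Qed.

Lemma avg_sq_young u v a : 0 < a ->
  avg_sq (fun i => u i + v i) <= (1 + a) * avg_sq u + (1 + a^-1) * avg_sq v.
Proof.
move=> a0; rewrite /avg_sq ![_ * (n%:R^-1 * _)]mulrCA -mulrDr ler_wpM2l //.
by rewrite !mulr_sumr -big_split ler_sum // => i _; exact: enorm_sqD_young.
Qed.

End AverageSquares.

(** * Drift of the mean gradients and exact steps *)

Section Drift.
Context {R : realType} {n dx dy : nat} (pb : problem R n dx dy) (c : constants R) (p : params R).
Context (n0 : (0 < n)%N) (dx0 : (0 < dx)%N) (dy0 : (0 < dy)%N).
Context (Hc : continuity pb c) (Hs : strong_convexity pb c) (Hl : lipschitz_constants pb c).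
Context (rho_ge : cf c / mug c <= rho p).
Implicit Types s : state R n dx dy.

Notation gb := (gbar pb).
Notation fb := (fbar pb).

Local Opaque ystar zstar Phi grad gradx grady hess_xy hess_yy enorm.

Let rho0 : 0 <= rho p.
Proof. exact: le_trans (le_trans (enorm_ge0 _) (zstar_le n0 dy0 Hc Hs 0)) rho_ge. Qed.

Lemma zstar_rho x : enorm (zstar pb x) <= rho p.
Proof. exact: le_trans (zstar_le n0 dy0 Hc Hs x) rho_ge. Qed.

Lemma L1sq_ge0 : 0 <= L1sq c p. Proof. by rewrite addr_ge0 // ?sqr_ge0 // mulr_ge0 // sqr_ge0. Qed.
Lemma L2sq_ge0 : 0 <= L2sq c p. Proof. by rewrite addr_ge0 // ?sqr_ge0 // mulr_ge0 // sqr_ge0. Qed.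

Let hess_lip_le (L : R) k l (H H' : 'M[R]_(k, l)) (z : 'cV[R]_l) (e : R) :
  enorm ((H - H') *m z) <= L * e * enorm z -> enorm z <= rho p ->
  enorm ((H - H') *m z) ^+ 2 <= L ^+ 2 * rho p ^+ 2 * e ^+ 2.
Proof.
move=> h zr; rewrite (le_trans (enorm_sq_le h)) // !exprMn.
rewrite -mulrA [e ^+ 2 * _]mulrC mulrA ler_wpM2r ?sqr_ge0 // ler_wpM2l ?sqr_ge0 //.
exact: enorm_sq_le.
Qed.

(** The change of the Hessian acts on z, whence the bound |z| <= rho; the change of z is then
    multiplied by the second Hessian, of norm at most Lg. *)
Lemma mDx_lip i x y z x' y' z' : enorm z <= rho p ->
  enorm (mDx (pb := pb) i x y z - mDx (pb := pb) i x' y' z') ^+ 2 <=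
  3 * (L2sq c p * (enorm (x - x') ^+ 2 + enorm (y - y') ^+ 2) + Lg c ^+ 2 * enorm (z - z') ^+ 2).
Proof.
move=> zr; rewrite /mDx.
rewrite affine_diff (le_trans (enorm_sqD3 _ _ _)) // -enorm_col_mx_sq.
have h1 := hess_lip_le (hxy_lip Hc i x y x' y' z) zr.
have h2 := enorm_sq_le (f_lipx Hc i x y x' y'); rewrite exprMn in h2.
have h3 := enorm_sq_le (hxy_bound n0 dy0 Hc i x' y' (z - z')); rewrite exprMn in h3.
move: h1 h2 h3; rewrite /L2sq; move: (enorm (col_mx _ _)) (enorm (z - z')) => e1 e2.
move: (enorm (_ *m z)) (enorm (_ *m (z - z'))) (enorm (gradx _ _ _ - _)) => e3 e4 e5.
lra.
Qed.

Lemma mDz_lip i x y z x' y' z' : enorm z <= rho p ->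
  enorm (mDz (pb := pb) i x y z - mDz (pb := pb) i x' y' z') ^+ 2 <=
  3 * (L1sq c p * (enorm (x - x') ^+ 2 + enorm (y - y') ^+ 2) + Lg c ^+ 2 * enorm (z - z') ^+ 2).
Proof.
move=> zr; rewrite /mDz.
rewrite affine_diff (le_trans (enorm_sqD3 _ _ _)) // -enorm_col_mx_sq.
have h1 := hess_lip_le (hyy_lip Hc i x y x' y' z) zr.
have h2 := enorm_sq_le (f_lipy Hc i x y x' y'); rewrite exprMn in h2.
have h3 := enorm_sq_le (hyy_bound n0 dy0 Hc i x' y' (z - z')); rewrite exprMn in h3.
move: h1 h2 h3; rewrite /L1sq; move: (enorm (col_mx _ _)) (enorm (z - z')) => e1 e2.
move: (enorm (_ *m z)) (enorm (_ *m (z - z'))) (enorm (grady _ _ _ - _)) => e3 e4 e5.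
lra.
Qed.

Lemma sty_drift s s' : enorm (sty s - sty s') ^+ 2 <=
  3 * (fY pb s + fY pb s' + Lys c ^+ 2 * enorm (stx s - stx s') ^+ 2).
Proof.
have [_ [_ h _]] := Hl.
rewrite (le_trans (enorm_sq_via _ (ystar pb (stx s)) (ystar pb (stx s')) _)) //.
by rewrite ler_wpM2l // lerD2l -exprMn enorm_sq_le.
Qed.

Lemma stz_drift s s' : enorm (stz s - stz s') ^+ 2 <=
  3 * (fZ pb s + fZ pb s' + Lzs c ^+ 2 * enorm (stx s - stx s') ^+ 2).
Proof.
have [_ [_ _ h]] := Hl.
rewrite (le_trans (enorm_sq_via _ (zstar pb (stx s)) (zstar pb (stx s')) _)) //.
by rewrite ler_wpM2l // lerD2l -exprMn enorm_sq_le.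
Qed.

Lemma mDxs_drift i s s' : enorm (stz s) <= rho p ->
  enorm (mDxs pb i s - mDxs pb i s') ^+ 2 <=
  3 * L5sq c p * enorm (stx s - stx s') ^+ 2 + 9 * L2sq c p * (fY pb s + fY pb s')
    + 9 * Lg c ^+ 2 * (fZ pb s + fZ pb s').
Proof.
move=> zr; rewrite (le_trans (mDx_lip i (stx s) (sty s) (stx s') (sty s') (stz s') zr)) //.
have h1 := ler_wpM2l L2sq_ge0 (sty_drift s s').
have h2 := ler_wpM2l (sqr_ge0 (Lg c)) (stz_drift s s').
move: h1 h2; rewrite /L5sq; move: (fY pb s) (fY pb s') (fZ pb s) (fZ pb s').
move: (enorm (sty s - _)) (enorm (stz s - _)) (enorm (stx s - _)) => ey ez ex y y' z z'.
lra.
Qed.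

Lemma mDzs_drift i s s' : enorm (stz s) <= rho p ->
  enorm (mDzs pb i s - mDzs pb i s') ^+ 2 <=
  3 * L4sq c p * enorm (stx s - stx s') ^+ 2 + 9 * L1sq c p * (fY pb s + fY pb s')
    + 9 * Lg c ^+ 2 * (fZ pb s + fZ pb s').
Proof.
move=> zr; rewrite (le_trans (mDz_lip i (stx s) (sty s) (stx s') (sty s') (stz s') zr)) //.
have h1 := ler_wpM2l L1sq_ge0 (sty_drift s s').
have h2 := ler_wpM2l (sqr_ge0 (Lg c)) (stz_drift s s').
move: h1 h2; rewrite /L4sq; move: (fY pb s) (fY pb s') (fZ pb s) (fZ pb s').
move: (enorm (sty s - _)) (enorm (stz s - _)) (enorm (stx s - _)) => ey ez ex y y' z z'.
lra.
Qed.

Lemma mDys_drift i s s' : enorm (mDys pb i s - mDys pb i s') ^+ 2 <=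
  L3sq c * enorm (stx s - stx s') ^+ 2 + 3 * Lg c ^+ 2 * (fY pb s + fY pb s').
Proof.
have h := enorm_sq_le (g_lip Hc i (stx s) (sty s) (stx s') (sty s')).
rewrite exprMn enorm_col_mx_sq in h.
have h1 := ler_wpM2l (sqr_ge0 (Lg c)) (sty_drift s s').
rewrite (le_trans h) //; move: h1; rewrite /L3sq; move: (fY pb s) (fY pb s').
move: (enorm (sty s - _)) (enorm (stx s - _)) => ey ex y y'.
lra.
Qed.

Lemma vavg_mDy x y : vavg (fun i => mDy (pb := pb) i x y) = grady gb x y.
Proof. exact: esym (grady_avg x y (g_smooth1 Hc)). Qed.

Lemma vavg_mDz x y z : vavg (fun i => mDz (pb := pb) i x y z) =
  hess_yy gb x y *m z + grady fb x y.
Proof.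
have e1 : hess_yy gb x y *m z = _ := hess_yy_avg x y z (g_smooth2 Hc).
have e2 : grady fb x y = _ := grady_avg x y (f_smooth1 Hc).
rewrite e1 e2; exact: vavgD.
Qed.

Lemma vavg_mDx x y z : vavg (fun i => mDx (pb := pb) i x y z) =
  hess_xy gb x y *m z + gradx fb x y.
Proof.
have e1 : hess_xy gb x y *m z = _ := hess_xy_avg x y z (g_smooth2 Hc).
have e2 : gradx fb x y = _ := gradx_avg x y (f_smooth1 Hc).
rewrite e1 e2; exact: vavgD.
Qed.

(** The gradient of Phi is the same average of worker gradients taken at [ystar] and [zstar], so the
    bias of the direction is a Lipschitz difference. *)
Lemma vavg_mDxs_err s : enorm (stz s) <= rho p ->
  enorm (vavg (fun i => mDxs pb i s) - grad (Phi pb) (stx s)) ^+ 2 <=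
  3 * (L2sq c p * fY pb s + Lg c ^+ 2 * fZ pb s).
Proof.
move=> zr; rewrite (grad_Phi n0 dy0 Hc Hs Hl) [gradx _ _ _ + _]addrC -vavg_mDx -vavgB.
rewrite (le_trans (vavg_sq_le n0 _)) // -/(avg_sq _) avg_sq_le_cst // => i.
rewrite (le_trans (mDx_lip i (stx s) (sty s) (stx s) (ystar pb (stx s)) (zstar pb (stx s)) zr)) //.
by rewrite subrr enorm0 expr0n /= add0r.
Qed.

(* The bias of the linear system solved by z, seen from its exact solution. *)
Lemma zstar_residual s :
  enorm (hess_yy gb (stx s) (sty s) *m zstar pb (stx s) + grady fb (stx s) (sty s)) ^+ 2 <=
  2 * L1sq c p * fY pb s.
Proof.
set x := stx s; set y := sty s; set z := zstar pb x.
have e0 : vavg (fun i => mDz (pb := pb) i x (ystar pb x) z) = 0.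
  by rewrite vavg_mDz (zstar_eq n0 dy0 Hc Hs) addNr.
rewrite -vavg_mDz -[vavg _]subr0 -[X in _ - X]e0 -vavgB.
rewrite (le_trans (vavg_sq_le n0 _)) // -/(avg_sq _) avg_sq_le_cst // => i; rewrite /mDz.
rewrite affine_diff0 (le_trans (enorm_sqD2 _ _)) //.
have h1 := hess_lip_le (hyy_lip Hc i x y x (ystar pb x) z) (zstar_rho x).
have h2 := enorm_sq_le (f_lipy Hc i x y x (ystar pb x)); rewrite exprMn in h2.
have hc : enorm (col_mx (x - x) (y - ystar pb x)) = enorm (y - ystar pb x).
  by rewrite (subrr x) enorm_col_mx0.
rewrite hc in h1 h2; rewrite /L1sq /fY -/x -/y.
move: h1 h2; move: (enorm (y - ystar pb x)) => e1.
set A := hess_yy _ _ _ - _; set B := grady _ _ _ - _.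
move: (enorm (A *m z)) (enorm B) => e2 e3; lra.
Qed.

Section Moves.
Context (x' : 'cV[R]_dx) (s : state R n dx dy) (xE : x' = stx s - alpha p *: hhat s).

Let dxE : enorm (stx s - x') ^+ 2 = alpha p ^+ 2 * fH s.
Proof. by rewrite xE opprB addrC subrK enorm_sqZ. Qed.

(** Contraction towards the lower-level solution at x, followed by the displacement of that solution
    when x moves; [enorm_young] is used with parameter b mu. *)
Lemma y_move b : 0 < b -> b <= 2 / (mug c + Lg c) ->
  enorm (sty s - b *: grady gb (stx s) (sty s) - ystar pb x') ^+ 2 <=
  (1 - b * mug c) * fY pb s + Lys c ^+ 2 / (b * mug c) * (alpha p ^+ 2 * fH s).
Proof.
move=> b0 bL; have hb : 0 <= b <= 2 / (mug c + Lg c) by rewrite ltW.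
have m0 := mug_gt0 Hs; have t0 : 0 < b * mug c by rewrite mulr_gt0.
have t1 : 0 < b * mug c <= 1 by rewrite t0 (step_le1 n0 dy0 Hc Hs hb).
set ys := ystar pb (stx s).
have hu := gb_contraction n0 dy0 Hc Hs (stx s) hb (sty s) ys.
rewrite (grady_ystar n0 Hc Hs) scaler0 subr0 in hu.
have := enorm_young (ys - ystar pb x') t1 hu.
rewrite addrA subrK => /le_trans; apply; rewrite /fY -/ys lerD2l.
have [_ [_ h _]] := Hl; have h1 := enorm_sq_le (h (stx s) x'); rewrite exprMn dxE in h1.
by rewrite [_ / (_ * mug c)]mulrC -[leRHS]mulrA ler_wpM2l // invr_ge0 ltW.
Qed.

(** Around z = [zstar pb (stx s)] the step is the contraction I - b H, perturbed by b times the
    residual that y leaves in the linear system, and followed by the motion of [zstar]. The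
    coefficient 4 b L1 / mu is 2 b^2 * 2 L1 / (b mu). *)
Lemma z_move b : 0 < b -> b <= 2 / (mug c + Lg c) ->
  enorm (stz s - b *: (hess_yy gb (stx s) (sty s) *m stz s + grady fb (stx s) (sty s))
         - zstar pb x') ^+ 2 <=
  (1 - b * mug c) * fZ pb s + 4 * b * L1sq c p / mug c * fY pb s
    + 2 * Lzs c ^+ 2 / (b * mug c) * (alpha p ^+ 2 * fH s).
Proof.
move=> b0 bL; have hb : 0 <= b <= 2 / (mug c + Lg c) by rewrite ltW.
have m0 := mug_gt0 Hs; have t0 : 0 < b * mug c by rewrite mulr_gt0.
have t1 : 0 < b * mug c <= 1 by rewrite t0 (step_le1 n0 dy0 Hc Hs hb).
have he := zstar_residual s.
set H := hess_yy gb (stx s) (sty s) in he *; set g := grady fb (stx s) (sty s) in he *.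
set zs := zstar pb (stx s) in he *; set e := H *m zs + g in he *.
have hu := hyy_contraction n0 dy0 Hc Hs (stx s) (sty s) hb (stz s - zs).
rewrite -/H in hu.
have := enorm_young (- b *: e + (zs - zstar pb x')) t1 hu.
have -> : stz s - zs - b *: (H *m (stz s - zs)) + (- b *: e + (zs - zstar pb x')) =
    stz s - b *: (H *m stz s + g) - zstar pb x'.
  by rewrite /e mulmxBr; exact: linear_step_split.
move=> /le_trans; apply; rewrite -addrA; apply: lerD => //.
have [_ [_ _ h]] := Hl; have h1 := enorm_sq_le (h (stx s) x'); rewrite exprMn dxE in h1.
have h2 := enorm_sqD2 (- b *: e) (zs - zstar pb x'); rewrite enorm_sqZ sqrrN in h2.
have h3 : b ^+ 2 * enorm e ^+ 2 <= b ^+ 2 * (2 * L1sq c p * fY pb s).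
  by rewrite ler_wpM2l ?sqr_ge0.
rewrite -/zs in h1; rewrite ler_pdivrMl //.
rewrite [leRHS](_ : _ = 4 * (b ^+ 2 * (L1sq c p * fY pb s)) + 2 * (Lzs c ^+ 2 * (alpha p ^+ 2 * fH s))).
  clear hu he; clearbody e; apply: (le_trans h2); move: h1 h3.
  move: (enorm e) (enorm (zs - zstar pb x')) (fY pb s) (fH s) => e2 e1 y h'; lra.
by field; rewrite gt_eqF //= gt_eqF.
Qed.

(** The momentum error contracts by 1 - t; t times the bias of the new directions and the motion of
    the gradient of Phi are its two perturbations. *)
Lemma x_move (h' : 'cV[R]_dx) t : 0 < t <= 1 -> enorm (stz s) <= rho p ->
  h' = (1 - t) *: vavg (hx s) + t *: vavg (fun i => mDxs pb i s) ->
  enorm (h' - grad (Phi pb) x') ^+ 2 <=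
  (1 - t) * fX pb s + 6 * t * (L2sq c p * fY pb s + Lg c ^+ 2 * fZ pb s)
    + 2 * LPhi c ^+ 2 / t * (alpha p ^+ 2 * fH s).
Proof.
move=> t01 zr ->; have /andP[t0 t1] := t01; set D := vavg (fun i => mDxs pb i s); set g := grad (Phi pb) (stx s).
have hu : enorm ((1 - t) *: (vavg (hx s) - g)) <= (1 - t) * enorm (vavg (hx s) - g).
  by rewrite enormZ ger0_norm // subr_ge0.
have := enorm_young (t *: (D - g) + (g - grad (Phi pb) x')) t01 hu.
rewrite momentum_step_split.
move=> /le_trans; apply; rewrite /fX -/g -addrA lerD2l.
have [_ [h _ _]] := Hl; have h1 := enorm_sq_le (h (stx s) x'); rewrite exprMn dxE -/g in h1.
have h3 := ler_wpM2l (sqr_ge0 t) (vavg_mDxs_err zr); rewrite -/D -/g in h3.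
clear hu; move: (grad (Phi pb) x') h1 h3 => w h1 h3; clearbody g D.
have h2 := enorm_sqD2 (t *: (D - g)) (g - w); rewrite enorm_sqZ in h2.
rewrite ler_pdivrMl //.
rewrite [leRHS](_ : _ = 6 * (t ^+ 2 * (L2sq c p * fY pb s + Lg c ^+ 2 * fZ pb s))
   + 2 * (LPhi c ^+ 2 * (alpha p ^+ 2 * fH s))).
  apply: (le_trans h2); move: h1 h3.
  move: (enorm (D - g)) (enorm (g - w)) (fY pb s) (fZ pb s) (fH s).
  by move=> e2 e1 y z k; lra.
by field; rewrite gt_eqF.
Qed.

(** - <g, h> is half of |h - g|^2 - |g|^2 - |h|^2. The restriction on alpha leaves a quarter of
    alpha |h|^2, kept to absorb the drifts later, and h - g splits into the momentum error and the
    compression lag mx - hx. *)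
Lemma Phi_move : 0 < alpha p -> alpha p * (2 * LPhi c) <= 1 -> hhat s = vavg (mx s) ->
  Phi pb x' + alpha p / 2 * fG pb s + alpha p / 4 * fH s <=
  fP pb s + alpha p * fX pb s + alpha p * fM s.
Proof.
move=> a0 aL hE; set g := grad (Phi pb) (stx s).
have h1 := Phi_descent n0 dy0 Hc Hs Hl (stx s) (alpha p *: hhat s).
rewrite -xE dotZr enorm_sqZ -/g in h1.
have h2 : LPhi c / 2 * (alpha p ^+ 2 * enorm (hhat s) ^+ 2) <= alpha p / 4 * enorm (hhat s) ^+ 2.
  have := ler_wpM2r (mulr_ge0 (ltW a0) (sqr_ge0 (enorm (hhat s)))) aL; lra.
have h3 : enorm (hhat s - g) ^+ 2 <= 2 * fX pb s + 2 * fM s.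
  have -> : hhat s - g = (vavg (hx s) - g) + vavg (fun i => mx s i - hx s i).
    by rewrite vavgB hE [RHS]addrC addrA subrK.
  have h4 := vavg_sq_le n0 (fun i => mx s i - hx s i).
  rewrite (le_trans (enorm_sqD2 _ _)) // /fX /fM -/g lerD // ler_wpM2l //.
rewrite enorm_sqB dotC in h3.
have h5 := ler_wpM2l (ltW a0) h3.
move: h1 h2 h5; rewrite /fP /fG /fH -/g; move: (enorm g) (enorm (hhat s)) (dot g (hhat s)).
move: (fX pb s) (fM s) (Phi pb (stx s)) (Phi pb x') => X M q q' e1 e2 e3; lra.
Qed.

End Moves.

(** The target gradients move from s to s'. Young's parameter a is left to the caller, to be matched
    with the contraction of the quantity tracked: theta here, delta_l / 2 for the two memories
    below. *)
Lemma gS_drift s s' a : 0 < a -> enorm (stz s) <= rho p ->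
  gS pb s' s' <= (1 + a) * gS pb s s' + (1 + a^-1) *
    (3 * L5sq c p * enorm (stx s - stx s') ^+ 2 + 9 * L2sq c p * (fY pb s + fY pb s')
    + 9 * Lg c ^+ 2 * (fZ pb s + fZ pb s')).
Proof.
move=> a0 zr.
have := avg_sq_young (fun i => hx s' i - mDxs pb i s) (fun i => mDxs pb i s - mDxs pb i s') a0.
under eq_fun do rewrite addrA subrK; move=> /le_trans; apply; rewrite lerD2l.
rewrite ler_wpM2l ?addr_ge0 ?invr_ge0 ?(ltW a0) //.
apply: (avg_sq_le_cst n0) => i; exact (mDxs_drift i s' zr).
Qed.

Lemma gMy_drift s s' a : 0 < a ->
  gMy pb s' s' <= (1 + a) * gMy pb s s' + (1 + a^-1) *
    (L3sq c * enorm (stx s - stx s') ^+ 2 + 3 * Lg c ^+ 2 * (fY pb s + fY pb s')).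
Proof.
move=> a0.
have := avg_sq_young (fun i => mDys pb i s - my s' i) (fun i => mDys pb i s' - mDys pb i s) a0.
rewrite (_ : (fun i => mDys pb i s - my s' i + (mDys pb i s' - mDys pb i s)) = (fun i => mDys pb i s' - my s' i)); last first.
  by apply/funext => i; rewrite addrC addrA subrK.
move=> /le_trans; apply; rewrite lerD2l.
rewrite ler_wpM2l ?addr_ge0 ?invr_ge0 ?(ltW a0) //.
apply: (avg_sq_le_cst n0) => i.
by rewrite (enormBC (mDys pb i s')) (mDys_drift).
Qed.

Lemma gMz_drift s s' a : 0 < a -> enorm (stz s) <= rho p ->
  gMz pb s' s' <= (1 + a) * gMz pb s s' + (1 + a^-1) *
    (3 * L4sq c p * enorm (stx s - stx s') ^+ 2 + 9 * L1sq c p * (fY pb s + fY pb s')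
    + 9 * Lg c ^+ 2 * (fZ pb s + fZ pb s')).
Proof.
move=> a0 zr.
have := avg_sq_young (fun i => mDzs pb i s - mz s' i) (fun i => mDzs pb i s' - mDzs pb i s) a0.
rewrite (_ : (fun i => mDzs pb i s - mz s' i + (mDzs pb i s' - mDzs pb i s)) = (fun i => mDzs pb i s' - mz s' i)); last first.
  by apply/funext => i; rewrite addrC addrA subrK.
move=> /le_trans; apply; rewrite lerD2l.
rewrite ler_wpM2l ?addr_ge0 ?invr_ge0 ?(ltW a0) //.
apply: (avg_sq_le_cst n0) => i.
by rewrite (enormBC (mDzs pb i s')) (mDzs_drift _ _ zr).
Qed.

End Drift.

Section NoiseBounds.
Context {R : realType} {d : measure_display} {T : measurableType d} {I : choiceType}.
Context (S : I -> set_system T) (P : probability T R).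
Context (ST : forall i, S i setT) (Sm : forall i, S i `<=` measurable).

Lemma sqint_affine_noise (J : set I) k (N : T -> 'cV[R]_k) v (a : 'cV[R]_k) (b : R) :
  noise S P J N v -> (sqint P (fun w => a + b *: N w)%R <= (enorm a ^+ 2 + b ^+ 2 * v)%:E)%E.
Proof.
move=> /(noiseZ ST Sm b) nN; have mN := noise_vmeas ST Sm nN; have fN := noise_lty nN.
by case: nN => _ N0 N2; rewrite sqint_shift // EFinD leeD2l.
Qed.

Lemma integral_avg_sq_le n k (u : 'I_n -> T -> 'cV[R]_k) (b : 'I_n -> R) :
  (forall i, vmeas (u i)) -> (forall i, sqint P (u i) <= (b i)%:E)%E ->
  (\int[P]_w (avg_sq (fun i => u i w))%:E <= (n%:R^-1 * \sum_i b i)%:E)%E.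
Proof.
move=> mu ub; rewrite /avg_sq.
under eq_integral do rewrite EFinM -sumEFin.
rewrite ge0_integralZl_EFin //.
- rewrite EFinM lee_wpmul2l ?lee_fin // ge0_integral_sum //.
  + by rewrite -sumEFin; apply: lee_sum => i _; exact: ub.
  + by move=> i; apply/measurable_EFinP; exact: measurable_enorm_sq.
  + by move=> i w _; rewrite lee_fin sqr_ge0.
- by move=> w _; rewrite sume_ge0 // => i _; rewrite lee_fin sqr_ge0.
- apply: emeasurable_sum => i; apply/measurable_EFinP; exact: measurable_enorm_sq.
Qed.

End NoiseBounds.

Lemma noisy_step_split (R : realType) k (t : R) (y a b g u : 'cV[R]_k) :
  y - t *: (a + b) - u = y - t *: g - u + - t *: (b + a - g).
Proof. by apply/matrixP => q r; rewrite !mxE; ring. Qed.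

(** * Expected one-step bounds at a fixed state *)

Section OneStep.
Context {R : realType} {n dx dy : nat} {pb : problem R n dx dy}.
Context {cu : compressors R n dx} {cl : compressors R n dy} (D : draws pb cu cl).
Context (c : constants R) (sigma : R) (p : params R).
Context (n0 : (0 < n)%N) (dx0 : (0 < dx)%N) (dy0 : (0 < dy)%N) (rd0 : (0 < rounds p)%N).
Context (Hc : continuity pb c) (Hs : strong_convexity pb c) (Hl : lipschitz_constants pb c).
Context (SL : sampled_losses pb) (sg0 : 0 <= sigma) (SN : stochastic_noise pb sigma).
Context (UCu : unbiased_compression cu (omega_u p)) (UCl : unbiased_compression cl (omega_l p)).
Context (FD : fresh_draws D).
Context (rho_ge : cf c / mug c <= rho p).
Context (dlE : delta_l p = (1 + tom_l p)^-1) (duE : delta_u p = (1 + tom_u p)^-1).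

Notation S := (@draw_system R n dx dy pb cu cl D).
Notation P := (Pr D).

(** The invariant of reachable states. The server's copies equal the averages of the workers'
    memories, so adding the average compressed message to them gives an unbiased estimate of the
    average gradient. *)
Definition consistent (s : state R n dx dy) :=
  [/\ enorm (stz s) <= rho p, hhat s = vavg (mx s), smy s = vavg (my s) & smz s = vavg (mz s)].

Let rho0 : 0 <= rho p.
Proof. exact: le_trans (enorm_ge0 _) (zstar_rho n0 dy0 Hc Hs rho_ge 0). Qed.

Lemma consistent_step w k s : consistent s -> consistent (step (D := D) p w k s).
Proof.
case=> zr hE yE zE; split => /=.
- exact: enorm_proj_le.
- by rewrite hE vavgD vavgZ.
- by rewrite yE vavgD vavgZ.
- by rewrite zE vavgD vavgZ.
Qed.

Context (k : nat) (s : state R n dx dy) (cs : consistent s).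

Notation s1 := (fun w => step (D := D) p w k s).
Notation cy i w := (msc (omega_l p) (fun r => compress cl i (seedy (d := D) (i, k, r) w))
                  (rounds p) (Dy p w k s i - my s i)).
Notation cz i w := (msc (omega_l p) (fun r => compress cl i (seedz (d := D) (i, k, r) w))
                  (rounds p) (Dz p w k s i - mz s i)).

Let zr : enorm (stz s) <= rho p. Proof. by case: cs. Qed.

Let tl0 : 0 <= tom_l p. Proof. exact: tomega_ge0 (omega_l_ge0 UCl) _. Qed.
Let tu0 : 0 <= tom_u p. Proof. exact: tomega_ge0 (omega_u_ge0 UCu) _. Qed.

Let sI j : setI_closed (S j). Proof. exact: draw_setI. Qed.
Let sT j : S j setT. Proof. exact: draw_setT. Qed.
Let sM j : S j `<=` measurable. Proof. exact: draw_measurable. Qed.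
Let sInd := draw_indep FD.

Lemma mstate_step1 : mstate s1.
Proof.
have mid := @measurable_id_past _ _ _ S sT sM (round_draws (n := n) k).
exact: (mstate_step rd0 SL FD UCu UCl mid (mstate_cst s)).
Qed.

Let nDx i : noise S P (data_draws i k) (fun w => Dx p w k s i - mDxs pb i s) (tsig1sq sigma p).
Proof. exact: (noise_Dx rd0 SL SN FD zr i k (s := s)). Qed.
Let nDz i : noise S P (data_draws i k) (fun w => Dz p w k s i - mDzs pb i s) (tsig1sq sigma p).
Proof. exact: (noise_Dz rd0 SL SN FD zr i k (s := s)). Qed.
Let nDy i : noise S P (data_draws i k) (fun w => Dy p w k s i - mDys pb i s) (tsigsq sigma p).
Proof. exact: (noise_Dy rd0 SL SN FD i k (s := s)). Qed.

Let data_worker i : data_draws i k `<=` worker_draws (n := n) i k.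
Proof. by move=> j []. Qed.

Let nNy i : noise S P (worker_draws i k) (fun w => cy i w + my s i - mDys pb i s)
  ((1 + tom_l p) * tsigsq sigma p + tom_l p * enorm (mDys pb i s - my s i) ^+ 2).
Proof.
have := noise_compressed_estimate sI sT sM sInd (data_seedy p i k) tl0
  (ucomp_y rd0 UCl FD i k) (my s i) (nDy i).
by apply: noise_mono => //; exact: seedy_worker.
Qed.

Let nNz i : noise S P (worker_draws i k) (fun w => cz i w + mz s i - mDzs pb i s)
  ((1 + tom_l p) * tsig1sq sigma p + tom_l p * enorm (mDzs pb i s - mz s i) ^+ 2).
Proof.
have := noise_compressed_estimate sI sT sM sInd (data_seedz p i k) tl0
  (ucomp_z rd0 UCl FD i k) (mz s i) (nDz i).
by apply: noise_mono => //; exact: seedz_worker.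
Qed.

Let avg_cst (v : R) : n%:R^-1 * \sum_(i < n) v = v.
Proof. by rewrite sumr_const card_ord -[v *+ n]mulr_natl mulKf // pnatr_eq0 -lt0n. Qed.

(** h is updated with uncompressed gradients, so the noise enters only through theta^2 times a
    variance averaged over n independent workers. *)
Lemma step_fX : 0 < theta p <= 1 ->
  (\int[P]_w (fX pb (s1 w))%:E <= ((1 - theta p) * fX pb s
    + 6 * theta p * (L2sq c p * fY pb s + Lg c ^+ 2 * fZ pb s)
    + 2 * LPhi c ^+ 2 / theta p * (alpha p ^+ 2 * fH s)
    + theta p ^+ 2 * (tsig1sq sigma p / n%:R))%:E)%E.
Proof.
move=> t01; pose h' := (1 - theta p) *: vavg (hx s) + theta p *: vavg (fun i => mDxs pb i s).
have nN := noise_vavg FD (fun i => noise_mono (@data_worker i) (lexx _) (nDx i)).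
have h2 := sqint_affine_noise sT sM (h' - grad (Phi pb) (stx s - alpha p *: hhat s)) (theta p) nN.
have h1 := x_move n0 dy0 Hc Hs Hl (x' := stx s - alpha p *: hhat s) erefl t01 zr (h' := h') erefl.
rewrite avg_cst [n%:R^-1 * _]mulrC in h2.
rewrite -(lerD2r (theta p ^+ 2 * (tsig1sq sigma p / n%:R))) -lee_fin in h1.
apply: le_trans h1; apply: le_trans h2; rewrite le_eqVlt; apply/orP; left; apply/eqP.
apply: eq_sqint => w; rewrite vavgB /= vavgD !vavgZ /h'.
move: (grad _ _) (vavg _) (vavg _) (vavg _) => g a b e.
by apply/matrixP => q r; rewrite !mxE; ring.
Qed.

(** The new lag mx - hx is the scaled compressed difference minus the difference itself; since
    delta_u = 1 / (1 + tomega_u), it has the form treated in [sqint_compressed_update]. *)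
Lemma step_fM : (\int[P]_w (fM (s1 w))%:E <=
  ((1 + tom_u p)^-1 * ((tom_u p + 2^-1) * fM s
     + tom_u p * (1 + 2 * tom_u p) * (theta p ^+ 2 * gS pb s s)
     + tom_u p * (theta p ^+ 2 * tsig1sq sigma p)))%:E)%E.
Proof.
pose a i := (1 - theta p) *: hx s i + theta p *: mDxs pb i s - mx s i.
have u1 : 0 < 1 + tom_u p by rewrite ltr_wpDr.
(* Young's inequality multiplied through by [tom_u p], so that the value 0 is covered. After
   division by 1 + [tom_u p] the first weight is below 1, which gives the contraction of the lag. *)
have ab i : tom_u p * enorm (a i) ^+ 2 <= (tom_u p + 2^-1) * enorm (mx s i - hx s i) ^+ 2 +
    tom_u p * (1 + 2 * tom_u p) * (theta p ^+ 2 * enorm (hx s i - mDxs pb i s) ^+ 2).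
  have -> : a i = - ((mx s i - hx s i) + theta p *: (hx s i - mDxs pb i s)).
    rewrite /a; move: (mDxs pb i s) (hx s i) (mx s i) => u h m.
    by apply/matrixP => q r; rewrite !mxE; ring.
  move: (mx s i - hx s i) (hx s i - mDxs pb i s) => u v.
  have := sqr_ge0 (enorm (u - (2 * tom_u p) *: (theta p *: v))).
  rewrite enormN enorm_sqB enorm_sqD !enorm_sqZ !dotZr.
  move: (enorm u) (enorm v) (dot u v) => e1 e2 e3; lra.
have h1 i : (sqint P (fun w => (mx (s1 w) i - hx (s1 w) i)%R) <=
    (tom_u p / (1 + tom_u p) * (enorm (a i) ^+ 2 + theta p ^+ 2 * tsig1sq sigma p))%:E)%E.
  have := sqint_compressed_update sI sT sM sInd (data_seedx p i k) tu0
    (ucomp_x rd0 UCu FD i k) (nDx i) (a i) (theta p).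
  apply: le_trans; rewrite le_eqVlt; apply/orP; left; apply/eqP; apply: eq_sqint => w /=.
  have VE : (1 - theta p) *: hx s i + theta p *: Dx p w k s i - mx s i =
      a i + theta p *: (Dx p w k s i - mDxs pb i s).
    rewrite /a; move: (Dx p w k s i) (mDxs pb i s) (hx s i) (mx s i) => x u h m.
    by apply/matrixP => q r; rewrite !mxE; ring.
  rewrite VE duE -VE; move: (msc _ _ _ _) => C.
  move: (Dx p w k s i) (hx s i) (mx s i) => x h m.
  by apply/matrixP => q r; rewrite !mxE; ring.
have mu i : vmeas (fun w => mx (s1 w) i - hx (s1 w) i).
  by have [_ _ _ /(_ i) [h _ _ h'] _] := mstate_step1; exact: vmeasB.
apply: le_trans (integral_avg_sq_le mu h1) _; rewrite lee_fin.
apply: (@le_trans _ _ (n%:R^-1 * \sum_i ((1 + tom_u p)^-1 * ((tom_u p + 2^-1) * enorm (mx s i - hx s i) ^+ 2 +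
    tom_u p * (1 + 2 * tom_u p) * (theta p ^+ 2 * enorm (hx s i - mDxs pb i s) ^+ 2)
    + tom_u p * (theta p ^+ 2 * tsig1sq sigma p))))).
  rewrite ler_wpM2l // ler_sum // => i _.
  rewrite [tom_u p / _]mulrC -[leLHS]mulrA ler_wpM2l ?invr_ge0 ?(ltW u1) //.
  by rewrite mulrDr lerD2r.
rewrite -mulr_sumr mulrCA ler_wpM2l ?invr_ge0 ?(ltW u1) //.
rewrite le_eqVlt; apply/orP; left; apply/eqP; rewrite !big_split /=.
move: (tsig1sq sigma p) => v; rewrite -!mulr_sumr !(mulrDr n%:R^-1).
rewrite -[X in _ = _ + _ * (_ * X)](avg_cst v) /fM /gS /avg_sq.
move: (\sum_(i < n) v) (\sum_i enorm (mx s i - hx s i) ^+ 2).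
by move: (\sum_i enorm (hx s i - mDxs pb i s) ^+ 2) => a1 a2 a3; ring.
Qed.

Lemma step_gS : (\int[P]_w (gS pb s (s1 w))%:E <=
  ((1 - theta p) ^+ 2 * gS pb s s + theta p ^+ 2 * tsig1sq sigma p)%:E)%E.
Proof.
have h1 i : (sqint P (fun w => (hx (s1 w) i - mDxs pb i s)%R) <=
    ((1 - theta p) ^+ 2 * enorm (hx s i - mDxs pb i s) ^+ 2 + theta p ^+ 2 * tsig1sq sigma p)%:E)%E.
  have := sqint_affine_noise sT sM ((1 - theta p) *: (hx s i - mDxs pb i s)) (theta p) (nDx i).
  rewrite enorm_sqZ; apply: le_trans; rewrite le_eqVlt; apply/orP; left; apply/eqP.
  apply: eq_sqint => w /=; move: (Dx p w k s i) (mDxs pb i s) (hx s i) => x u h.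
  by apply/matrixP => q r; rewrite !mxE; ring.
have mu i : vmeas (fun w => hx (s1 w) i - mDxs pb i s).
  by have [_ _ _ /(_ i) [_ _ _ h'] _] := mstate_step1; exact: vmeasB.
apply: le_trans (integral_avg_sq_le mu h1) _; rewrite lee_fin.
by rewrite big_split /= -mulr_sumr mulrDr avg_cst mulrCA.
Qed.

(** The reason for delta_l = 1 / (1 + tomega_l): the bias part (1 - delta_l)^2 a and the compression
    variance delta_l^2 tomega_l a combine into (1 - delta_l) a. *)
Let dl_id (a v : R) : (1 - delta_l p) ^+ 2 * a + delta_l p ^+ 2 * ((1 + tom_l p) * v + tom_l p * a) =
  (1 - delta_l p) * a + delta_l p * v.
Proof. by rewrite dlE; field; rewrite gt_eqF // ltr_wpDr. Qed.

Lemma step_gMy : (\int[P]_w (gMy pb s (s1 w))%:E <=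
  ((1 - delta_l p) * gMy pb s s + delta_l p * tsigsq sigma p)%:E)%E.
Proof.
have h1 i : (sqint P (fun w => (mDys pb i s - my (s1 w) i)%R) <=
    ((1 - delta_l p) * enorm (mDys pb i s - my s i) ^+ 2 + delta_l p * tsigsq sigma p)%:E)%E.
  have := sqint_affine_noise sT sM ((1 - delta_l p) *: (mDys pb i s - my s i)) (- delta_l p) (nNy i).
  rewrite enorm_sqZ sqrrN dl_id; apply: le_trans; rewrite le_eqVlt; apply/orP; left; apply/eqP.
  apply: eq_sqint => w; rewrite (_ : my (s1 w) i = my s i + delta_l p *: cy i w) //.
  move: (cy i w) (mDys pb i s) (my s i) => x u h.
  by apply/matrixP => q r; rewrite !mxE; ring.
have mu i : vmeas (fun w => mDys pb i s - my (s1 w) i).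
  by have [_ _ _ /(_ i) [_ h' _ _] _] := mstate_step1; exact: vmeasB.
apply: le_trans (integral_avg_sq_le mu h1) _; rewrite lee_fin.
by rewrite big_split /= -mulr_sumr mulrDr avg_cst mulrCA.
Qed.

Lemma step_gMz : (\int[P]_w (gMz pb s (s1 w))%:E <=
  ((1 - delta_l p) * gMz pb s s + delta_l p * tsig1sq sigma p)%:E)%E.
Proof.
have h1 i : (sqint P (fun w => (mDzs pb i s - mz (s1 w) i)%R) <=
    ((1 - delta_l p) * enorm (mDzs pb i s - mz s i) ^+ 2 + delta_l p * tsig1sq sigma p)%:E)%E.
  have := sqint_affine_noise sT sM ((1 - delta_l p) *: (mDzs pb i s - mz s i)) (- delta_l p) (nNz i).
  rewrite enorm_sqZ sqrrN dl_id; apply: le_trans; rewrite le_eqVlt; apply/orP; left; apply/eqP.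
  apply: eq_sqint => w; rewrite (_ : mz (s1 w) i = mz s i + delta_l p *: cz i w) //.
  move: (cz i w) (mDzs pb i s) (mz s i) => x u h.
  by apply/matrixP => q r; rewrite !mxE; ring.
have mu i : vmeas (fun w => mDzs pb i s - mz (s1 w) i).
  by have [_ _ _ /(_ i) [_ _ h' _] _] := mstate_step1; exact: vmeasB.
apply: le_trans (integral_avg_sq_le mu h1) _; rewrite lee_fin.
by rewrite big_split /= -mulr_sumr mulrDr avg_cst mulrCA.
Qed.

Let vavg_var (v : R) (u : 'I_n -> R) :
  n%:R^-1 * (n%:R^-1 * \sum_i ((1 + tom_l p) * v + tom_l p * u i)) =
  (1 + tom_l p) * v / n%:R + tom_l p / n%:R * (n%:R^-1 * \sum_i u i).
Proof.
rewrite big_split /= -[\sum_i tom_l p * u i]mulr_sumr (mulrDr n%:R^-1 (\sum_(i < n) _)) avg_cst.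
by ring.
Qed.

Lemma step_fY : 0 < beta p -> beta p <= 2 / (mug c + Lg c) ->
  (\int[P]_w (fY pb (s1 w))%:E <= ((1 - beta p * mug c) * fY pb s
    + Lys c ^+ 2 / (beta p * mug c) * (alpha p ^+ 2 * fH s)
    + beta p ^+ 2 * ((1 + tom_l p) * tsigsq sigma p / n%:R + tom_l p / n%:R * gMy pb s s))%:E)%E.
Proof.
move=> b0 bL; have [_ _ yE _] := cs.
have h1 := y_move n0 dy0 Hc Hs Hl (x' := stx s - alpha p *: hhat s) erefl b0 bL.
have nN := noise_vavg FD nNy; rewrite vavg_var in nN.
have h2 := sqint_affine_noise sT sM (sty s - beta p *: grady (gbar pb) (stx s) (sty s)
   - ystar pb (stx s - alpha p *: hhat s)) (- beta p) nN.
rewrite sqrrN in h2.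
rewrite -(lerD2r (beta p ^+ 2 * ((1 + tom_l p) * tsigsq sigma p / n%:R + tom_l p / n%:R * gMy pb s s))) -lee_fin in h1.
apply: le_trans h1; apply: le_trans h2; rewrite le_eqVlt; apply/orP; left; apply/eqP.
apply: eq_sqint => w; rewrite /= vavgB vavgD (vavg_mDy Hc) yE.
exact: noisy_step_split.
Qed.

Lemma step_fZ : 0 < gamma p -> gamma p <= 2 / (mug c + Lg c) ->
  (\int[P]_w (fZ pb (s1 w))%:E <= ((1 - gamma p * mug c) * fZ pb s
    + 4 * gamma p * L1sq c p / mug c * fY pb s
    + 2 * Lzs c ^+ 2 / (gamma p * mug c) * (alpha p ^+ 2 * fH s)
    + gamma p ^+ 2 * ((1 + tom_l p) * tsig1sq sigma p / n%:R + tom_l p / n%:R * gMz pb s s))%:E)%E.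
Proof.
move=> b0 bL; have [_ _ _ zE] := cs.
have h1 := z_move n0 dy0 Hc Hs Hl rho_ge (x' := stx s - alpha p *: hhat s) erefl b0 bL.
have nN := noise_vavg FD nNz; rewrite vavg_var in nN.
set a := _ - zstar _ _ in h1.
have h2 := sqint_affine_noise sT sM a (- gamma p) nN.
rewrite sqrrN in h2.
rewrite -(lerD2r (gamma p ^+ 2 * ((1 + tom_l p) * tsig1sq sigma p / n%:R + tom_l p / n%:R * gMz pb s s))) -lee_fin in h1.
apply: le_trans h1; apply: le_trans h2; apply: le_sqint.
- have [h _ h' _ _] := mstate_step1; apply: vmeasB => //.
  by have [_ [_ _ hz]] := Hl; exact: vmeas_lip hz h.
- by have mN := noise_vmeas sT sM nN; apply: vmeasD => //; exact: vmeasZ.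
(* [zstar] lies in the ball, by the lower bound on rho, so the projection can only bring z closer to
   it. *)
move=> w; apply: le_trans (enorm_proj_ball _ (zstar_rho n0 dy0 Hc Hs rho_ge _)) _.
rewrite le_eqVlt; apply/orP; left; apply/eqP; congr enorm.
rewrite /a vavgB vavgD (vavg_mDz Hc) zE.
exact: noisy_step_split.
Qed.

End OneStep.

(** * Expectations along the iterates *)

Section HasExpectation.
Context {R : realType} {d : measure_display} {T : measurableType d} (P : probability T R).
Implicit Types (f g : T -> R) (u v : R).

(** The expectation is finite and given as a real number, so the recursions can be derived among
    reals. *)
Definition hasE f v :=
  [/\ measurable_fun setT f, forall w, 0 <= f w & (\int[P]_w (f w)%:E = v%:E)%E].

Lemma hasE_ge0 f v : hasE f v -> 0 <= v.
Proof. by case=> _ f0 fv; rewrite -lee_fin -fv; apply: integral_ge0 => w _; rewrite lee_fin. Qed.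

Lemma hasE_cst v : 0 <= v -> hasE (fun _ => v) v.
Proof. by move=> v0; split => //; rewrite integral_EFin_cst. Qed.

Lemma hasED f g u v : hasE f u -> hasE g v -> hasE (fun w => f w + g w) (u + v).
Proof.
move=> [mf f0 fu] [mg g0 gv]; split; first exact: measurable_funD.
  by move=> w; rewrite addr_ge0.
under eq_integral do rewrite EFinD.
by rewrite ge0_integralD ?fu ?gv //; [move=> w _; rewrite lee_fin|exact/measurable_EFinP|
  move=> w _; rewrite lee_fin|exact/measurable_EFinP].
Qed.

Lemma hasEZ a f u : 0 <= a -> hasE f u -> hasE (fun w => a * f w) (a * u).
Proof.
move=> a0 [mf f0 fu]; split; first exact: measurable_funM.
  by move=> w; rewrite mulr_ge0.
under eq_integral do rewrite EFinM.
by rewrite ge0_integralZl_EFin ?fu //; [move=> w _; rewrite lee_fin|exact/measurable_EFinP].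
Qed.

Lemma hasE_le f g u v : hasE f u -> hasE g v -> (forall w, f w <= g w) -> u <= v.
Proof.
move=> [mf f0 fu] [mg g0 gv] fg; rewrite -lee_fin -fu -gv; apply: ge0_le_integral => //.
- by move=> w _; rewrite lee_fin.
- exact/measurable_EFinP.
- exact/measurable_EFinP.
- by move=> w _; rewrite lee_fin.
Qed.

Lemma hasE_bounded f v : measurable_fun setT f -> (forall w, 0 <= f w) ->
  (\int[P]_w (f w)%:E <= v%:E)%E ->
  hasE f (fine (\int[P]_w (f w)%:E)) /\ fine (\int[P]_w (f w)%:E) <= v.
Proof.
move=> mf f0 fv; have i0 : (0 <= \int[P]_w (f w)%:E)%E.
  by apply: integral_ge0 => w _; rewrite lee_fin.
have fi : (\int[P]_w (f w)%:E)%E \is a fin_num.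
  by rewrite ge0_fin_numE // (le_lt_trans fv) // ltry.
by split; [split => //; rewrite fineK|rewrite -lee_fin fineK].
Qed.

Lemma hasE_dom f g v : measurable_fun setT f -> (forall w, 0 <= f w) ->
  hasE g v -> (forall w, f w <= g w) ->
  hasE f (fine (\int[P]_w (f w)%:E)) /\ fine (\int[P]_w (f w)%:E) <= v.
Proof.
move=> mf f0 [mg g0 gv] fg; apply: hasE_bounded => //; rewrite -gv; apply: ge0_le_integral => //.
- by move=> w _; rewrite lee_fin.
- exact/measurable_EFinP.
- exact/measurable_EFinP.
- by move=> w _; rewrite lee_fin.
Qed.

End HasExpectation.

Section MarkovLift.
Context {R : realType} {n dx dy : nat} {pb : problem R n dx dy}.
Context {cu : compressors R n dx} {cl : compressors R n dy} (D : draws pb cu cl).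
Context (c : constants R) (sigma : R) (p : params R) (ini : inits R n dx dy).
Context (n0 : (0 < n)%N) (dx0 : (0 < dx)%N) (dy0 : (0 < dy)%N) (rd0 : (0 < rounds p)%N).
Context (Hc : continuity pb c) (Hs : strong_convexity pb c) (Hl : lipschitz_constants pb c).
Context (SL : sampled_losses pb) (sg0 : 0 <= sigma) (SN : stochastic_noise pb sigma).
Context (UCu : unbiased_compression cu (omega_u p)) (UCl : unbiased_compression cl (omega_l p)).
Context (FD : fresh_draws D).
Context (rho_ge : cf c / mug c <= rho p) (z0_le : enorm (z0 ini) <= rho p).

Notation S := (@draw_system R n dx dy pb cu cl D).
Notation P := (Pr D).
Notation it w k := (iterate (D := D) p ini w k).

Lemma mstate_comp d d' (T : measurableType d) (T' : measurableType d')
    (s : T -> state R n dx dy) (g : T' -> T) :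
  measurable_fun setT g -> mstate s -> mstate (fun t => s (g t)).
Proof.
move=> mg [h1 h2 h3 h4 [h5 h6 h7]].
have comp k (X : T -> 'cV[R]_k) : vmeas X -> vmeas (fun t => X (g t)).
  by move=> mX j; exact: (measurableT_comp (mX j) mg).
split; [exact: (comp _ _ h1)|exact: (comp _ _ h2)|exact: (comp _ _ h3)| |
  by split; [exact: (comp _ _ h5)|exact: (comp _ _ h6)|exact: (comp _ _ h7)]].
by move=> i; have [a1 a2 a3 a4] := h4 i; split; [exact: (comp _ _ a1)|exact: (comp _ _ a2)|
  exact: (comp _ _ a3)|exact: (comp _ _ a4)].
Qed.

Definition draws_before k : set (draw_index (n := n)) := [set j | ((draw_call j).1.2 < k)%N].

Let sT j : S j setT. Proof. exact: draw_setT. Qed.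
Let sI j : setI_closed (S j). Proof. exact: draw_setI. Qed.
Let sM j : S j `<=` measurable. Proof. exact: draw_measurable. Qed.

(** The iterate k reads only draws of rounds before k; each induction step enlarges the
    sigma-algebra by one round. This is what makes it independent of the draws of round k. *)
Lemma mstate_iterate_past k : mstate (fun w : past S (draws_before k) => it w k).
Proof.
elim: k => [|k IH] /=; first exact: mstate_cst.
have sub1 : draws_before k `<=` draws_before k.+1 by move=> j /ltnW.
have sub2 : round_draws (n := n) k `<=` draws_before k.+1.
  by move=> j /= jk; rewrite /draws_before /= jk.
have m1 : measurable_fun setT (id : past S (draws_before k.+1) -> past S (draws_before k)).
  exact: (@measurable_past_mono _ _ _ _ _ _ _ (past S (draws_before k)) id sub1).
have m2 : measurable_fun setT (id : past S (draws_before k.+1) -> past S (round_draws (n := n) k)).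
  exact: (@measurable_past_mono _ _ _ _ _ _ _ (past S (round_draws (n := n) k)) id sub2).
exact: (mstate_step rd0 SL FD UCu UCl m2 (mstate_comp m1 IH)).
Qed.

Lemma mstate_iterate k : mstate (fun w : Omega D => it w k).
Proof.
have mid := @measurable_id_past _ _ _ S sT sM (draws_before k).
exact: (mstate_comp mid (mstate_iterate_past k)).
Qed.

Lemma consistent_iterate w k : consistent p (it w k).
Proof.
elim: k => [|k IH] /=; first by split.
exact: consistent_step.
Qed.

(* The draws of round [k] are independent of the iterate they act on, so a bound
   proved with that iterate frozen holds on average. *)
Lemma markov_le (psi : state R n dx dy -> state R n dx dy -> R) (b : state R n dx dy -> R) k :
  (forall d (T : measurableType d) (s s' : T -> state R n dx dy), mstate s -> mstate s' ->
     measurable_fun setT (fun t => psi (s t) (s' t))) ->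
  (forall s s', 0 <= psi s s') ->
  measurable_fun setT (fun w => b (it w k)) ->
  (forall s, consistent p s -> (\int[P]_w (psi s (step (D := D) p w k s))%:E <= (b s)%:E)%E) ->
  (\int[P]_w (psi (it w k) (it w k.+1))%:E <= \int[P]_w (b (it w k))%:E)%E.
Proof.
move=> mpsi psi0 mb le_b.
have dis : draws_before k `&` round_draws (n := n) k = set0.
  by apply/seteqP; split => // j [] /=; rewrite /draws_before /= => + jk; rewrite jk ltnn.
pose Psi (q : past S (draws_before k) * past S (round_draws (n := n) k)) : \bar R :=
  (psi (it q.1 k) (step (D := D) p q.2 k (it q.1 k)))%:E.
have m1 : mstate (fun q : past S (draws_before k) * past S (round_draws (n := n) k) => it q.1 k).
  exact: (mstate_comp measurable_fst (mstate_iterate_past k)).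
have := integral_freeze_le sI sT sM (draw_indep FD) dis (psi := Psi)
  (g := fun w => (b (it w k))%:E).
apply => //.
- apply/measurable_EFinP; apply: mpsi => //.
  exact: (mstate_step rd0 SL FD UCu UCl measurable_snd m1).
- by move=> q; rewrite lee_fin.
- exact/measurable_EFinP.
- by move=> w; exact: (le_b _ (consistent_iterate w k)).
Qed.

End MarkovLift.

Section DiagonalFunctionals.
Context {R : realType} {n dx dy : nat} (pb : problem R n dx dy).
Implicit Types s : state R n dx dy.

Definition fS s := gS pb s s.
Definition fMy s := gMy pb s s.
Definition fMz s := gMz pb s s.

End DiagonalFunctionals.

(** * Recursions of the expected errors *)

Section ExpectedRecursions.
Context {R : realType} {n dx dy : nat} {pb : problem R n dx dy}.
Context {cu : compressors R n dx} {cl : compressors R n dy} (D : draws pb cu cl).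
Context (c : constants R) (sigma : R) (p : params R) (ini : inits R n dx dy).
Context (n0 : (0 < n)%N) (dx0 : (0 < dx)%N) (dy0 : (0 < dy)%N) (rd0 : (0 < rounds p)%N).
Context (Hc : continuity pb c) (Hs : strong_convexity pb c) (Hl : lipschitz_constants pb c).
Context (SL : sampled_losses pb) (sg0 : 0 <= sigma) (SN : stochastic_noise pb sigma).
Context (UCu : unbiased_compression cu (omega_u p)) (UCl : unbiased_compression cl (omega_l p)).
Context (FD : fresh_draws D).
Context (rho_ge : cf c / mug c <= rho p) (z0_le : enorm (z0 ini) <= rho p).
Context (dlE : delta_l p = (1 + tom_l p)^-1) (duE : delta_u p = (1 + tom_u p)^-1).
Context (Phi0 : forall x, 0 <= Phi pb x).
Context (a0 : 0 < alpha p) (b0 : 0 < beta p) (g0 : 0 < gamma p) (t01 : 0 < theta p <= 1).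
Context (aL : alpha p * (2 * LPhi c) <= 1).
Context (bL : beta p <= 2 / (mug c + Lg c)) (gL : gamma p <= 2 / (mug c + Lg c)).

Notation P := (Pr D).
Notation it w k := (iterate (D := D) p ini w k).

Definition Ev (F : state R n dx dy -> R) k : R := fine (\int[P]_w (F (it w k))%:E).

Notation hasEv F k := (hasE P (fun w => F (it w k)) (Ev F k)).

Let tl0 : 0 <= tom_l p. Proof. exact: tomega_ge0 (omega_l_ge0 UCl) _. Qed.
Let tu0 : 0 <= tom_u p. Proof. exact: tomega_ge0 (omega_u_ge0 UCu) _. Qed.
Let s0 : 0 <= tsigsq sigma p. Proof. by rewrite divr_ge0 ?sqr_ge0. Qed.
Let s10 : 0 <= tsig1sq sigma p.
Proof. by rewrite divr_ge0 // mulr_ge0 ?sqr_ge0 // addr_ge0 ?sqr_ge0. Qed.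
Let t0 : 0 < theta p. Proof. by case/andP: t01. Qed.
Let t1 : 0 <= 1 - theta p. Proof. by rewrite subr_ge0; case/andP: t01. Qed.
Let mu0 : 0 < mug c. Proof. exact: mug_gt0 Hs. Qed.
Let dl0 : 0 < delta_l p. Proof. by rewrite dlE invr_gt0 ltr_wpDr. Qed.
Let dl1 : 0 <= 1 - delta_l p.
Proof. by rewrite dlE subr_ge0 invf_le1 ?ltr_wpDr // lerDl. Qed.
Let bmu : 0 <= 1 - beta p * mug c.
Proof. by rewrite subr_ge0 (step_le1 n0 dy0 Hc Hs) // ltW. Qed.
Let gmu : 0 <= 1 - gamma p * mug c.
Proof. by rewrite subr_ge0 (step_le1 n0 dy0 Hc Hs) // ltW. Qed.
Let L1_0 : 0 <= L1sq c p. Proof. exact: L1sq_ge0. Qed.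
Let L2_0 : 0 <= L2sq c p. Proof. exact: L2sq_ge0. Qed.
Let Lg2_0 : 0 <= Lg c ^+ 2. Proof. exact: sqr_ge0. Qed.
Let a2_0 : 0 <= alpha p ^+ 2. Proof. exact: sqr_ge0. Qed.
Let L3_0 : 0 <= L3sq c.
Proof. by rewrite mulr_ge0 ?sqr_ge0 // addr_ge0 // mulr_ge0 ?sqr_ge0. Qed.
Let Lext (L : R) : 0 <= L -> 0 <= L * (1 + 3 * Lys c ^+ 2) + 3 * Lg c ^+ 2 * Lzs c ^+ 2.
Proof.
move=> L0; apply: addr_ge0; apply: mulr_ge0 => //; rewrite ?sqr_ge0 //.
  by rewrite addr_ge0 // mulr_ge0 ?sqr_ge0.
by rewrite mulr_ge0.
Qed.
Let L4_0 : 0 <= L4sq c p. Proof. exact: Lext. Qed.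
Let L5_0 : 0 <= L5sq c p. Proof. exact: Lext. Qed.
Let n_0 : 0 <= (n%:R^-1 : R). Proof. by rewrite invr_ge0. Qed.

Let mit k := mstate_iterate ini rd0 SL UCu UCl FD k.
Let cit w k : consistent p (it w k).
Proof. exact: (consistent_iterate n0 dy0 Hc Hs rho_ge z0_le). Qed.

Let sq0 d (u : 'cV[R]_d) : 0 <= enorm u ^+ 2. Proof. exact: sqr_ge0. Qed.

(** Real-valued form of [markov_le]: a bound at frozen states yields both the finiteness of the
    expectation after the step and the bound on it. [psi] may compare the new state with the old
    one, as the memory functionals require. *)
Let lift (psi : state R n dx dy -> state R n dx dy -> R) (b : state R n dx dy -> R) k v :
  (forall d (T : measurableType d) (s s' : T -> state R n dx dy), mstate s -> mstate s' ->
     measurable_fun setT (fun t => psi (s t) (s' t))) ->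
  (forall s s', 0 <= psi s s') ->
  (forall s, consistent p s -> (\int[P]_w (psi s (step (D := D) p w k s))%:E <= (b s)%:E)%E) ->
  hasE P (fun w => b (it w k)) v ->
  hasE P (fun w => psi (it w k) (it w k.+1))
    (fine (\int[P]_w (psi (it w k) (it w k.+1))%:E)) /\
  fine (\int[P]_w (psi (it w k) (it w k.+1))%:E) <= v.
Proof.
move=> mpsi psi0 hb [mb _ bv]; apply: hasE_bounded => //.
  by apply: mpsi; exact: mit.
rewrite -bv.
exact: (markov_le n0 dy0 rd0 Hc Hs SL UCu UCl FD rho_ge z0_le mpsi psi0 mb hb).
Qed.

(** The induction hypothesis that makes all expectations real. [fG] and [fH] are recovered at the
    same k from the listed ones, through the descent inequality. *)
Definition finite_moments k :=
  [/\ [/\ hasEv (fP pb) k, hasEv (fX pb) k, hasEv (@fM R n dx dy) k & hasEv (fS pb) k],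
      hasEv (fY pb) k, hasEv (fZ pb) k, hasEv (fMy pb) k & hasEv (fMz pb) k].

Section Step.
Context (k : nat) (Fk : finite_moments k).

Let hP : hasEv (fP pb) k. Proof. by case: Fk => [[]]. Qed.
Let hX : hasEv (fX pb) k. Proof. by case: Fk => [[]]. Qed.
Let hM : hasEv (@fM R n dx dy) k. Proof. by case: Fk => [[]]. Qed.
Let hS : hasEv (fS pb) k. Proof. by case: Fk => [[]]. Qed.
Let hY : hasEv (fY pb) k. Proof. by case: Fk. Qed.
Let hZ : hasEv (fZ pb) k. Proof. by case: Fk. Qed.
Let hMy : hasEv (fMy pb) k. Proof. by case: Fk. Qed.
Let hMz : hasEv (fMz pb) k. Proof. by case: Fk. Qed.

Let hPXM := hasED (hasED hP (hasEZ (ltW a0) hX)) (hasEZ (ltW a0) hM).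

Let move_le w : fP pb (it w k.+1) + alpha p / 2 * fG pb (it w k) + alpha p / 4 * fH (it w k) <=
  fP pb (it w k) + alpha p * fX pb (it w k) + alpha p * fM (it w k).
Proof.
have [_ hE _ _] := cit w k.
exact: (Phi_move n0 dy0 Hc Hs Hl (x' := stx (it w k.+1)) erefl a0 aL hE).
Qed.

Let a2g : 0 <= alpha p / 2. Proof. by rewrite divr_ge0 // ltW. Qed.
Let a4g : 0 <= alpha p / 4. Proof. by rewrite divr_ge0 // ltW. Qed.

(** Since Phi is nonnegative, the descent inequality dominates |grad Phi|^2 pointwise by a
    combination of Phi and the two direction errors, all of finite mean. *)
Lemma moment_fG : hasEv (fG pb) k.
Proof.
have a2i : 0 <= (alpha p / 2)^-1 by rewrite invr_ge0.
have mG := measurable_fG Hl (mit k).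
have [//|w|//] := hasE_dom mG _ (hasEZ a2i hPXM); first by move=> w; exact: sq0.
rewrite ler_pdivlMl ?divr_gt0 //; apply: le_trans (move_le w).
rewrite -addrA [leRHS]addrCA lerDl addr_ge0 //; first exact: Phi0.
by rewrite mulr_ge0 // sq0.
Qed.

Lemma moment_fH : hasEv (@fH R n dx dy) k.
Proof.
have a2i : 0 <= (alpha p / 4)^-1 by rewrite invr_ge0.
have mG := measurable_fH (mit k).
have [//|w|//] := hasE_dom mG _ (hasEZ a2i hPXM); first by move=> w; exact: sq0.
rewrite ler_pdivlMl ?divr_gt0 //; apply: le_trans (move_le w).
rewrite lerDr addr_ge0 //; first exact: Phi0.
by rewrite mulr_ge0 // sq0.
Qed.

Let hG := moment_fG.
Let hH := moment_fH.

Let moment_fP1 : hasEv (fP pb) k.+1.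
Proof.
have mG := measurable_fP n0 dy0 Hc Hs Hl (mit k.+1).
have [//|w|//] := hasE_dom mG _ hPXM; first by move=> w; exact: Phi0.
apply: le_trans (move_le w).
by rewrite -addrA lerDl addr_ge0 // mulr_ge0 // sq0.
Qed.

Lemma rec_P : Ev (fP pb) k.+1 + alpha p / 2 * Ev (fG pb) k + alpha p / 4 * Ev (@fH R n dx dy) k <=
  Ev (fP pb) k + alpha p * Ev (fX pb) k + alpha p * Ev (@fM R n dx dy) k.
Proof.
exact: (hasE_le (hasED (hasED moment_fP1 (hasEZ a2g hG)) (hasEZ a4g hH)) hPXM move_le).
Qed.

Let XX : hasEv (fX pb) k.+1 /\ Ev (fX pb) k.+1 <= (1 - theta p) * Ev (fX pb) k
    + 6 * theta p * (L2sq c p * Ev (fY pb) k + Lg c ^+ 2 * Ev (fZ pb) k)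
    + 2 * LPhi c ^+ 2 / theta p * (alpha p ^+ 2 * Ev (@fH R n dx dy) k)
    + theta p ^+ 2 * (tsig1sq sigma p / n%:R).
Proof.
have c1 : 0 <= 6 * theta p by rewrite mulr_ge0 // ltW.
have c2 : 0 <= 2 * LPhi c ^+ 2 / theta p by rewrite divr_ge0 ?(ltW t0) // mulr_ge0 ?sqr_ge0.
have c3 : 0 <= theta p ^+ 2 * (tsig1sq sigma p / n%:R) by rewrite mulr_ge0 ?sqr_ge0 // mulr_ge0.
apply: (lift (psi := fun _ s' => fX pb s') _ _
  (fun s cs => step_fX n0 dy0 rd0 Hc Hs Hl SL SN FD k cs t01)).
- by move=> d T s s' _ ms'; exact: (measurable_fX Hl ms').
- by move=> _ s'; exact: sq0.
exact: (hasED (hasED (hasED (hasEZ t1 hX) (hasEZ c1 (hasED (hasEZ L2_0 hY) (hasEZ Lg2_0 hZ))))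
  (hasEZ c2 (hasEZ a2_0 hH))) (hasE_cst P c3)).
Qed.

Let MM : hasEv (@fM R n dx dy) k.+1 /\ Ev (@fM R n dx dy) k.+1 <=
  (1 + tom_u p)^-1 * ((tom_u p + 2^-1) * Ev (@fM R n dx dy) k
     + tom_u p * (1 + 2 * tom_u p) * (theta p ^+ 2 * Ev (fS pb) k)
     + tom_u p * (theta p ^+ 2 * tsig1sq sigma p)).
Proof.
have c1 : 0 <= (1 + tom_u p)^-1 by rewrite invr_ge0 addr_ge0.
have c2 : 0 <= tom_u p + 2^-1 by rewrite addr_ge0.
have c3 : 0 <= tom_u p * (1 + 2 * tom_u p) by rewrite mulr_ge0 // addr_ge0 // mulr_ge0.
have c4 : 0 <= tom_u p * (theta p ^+ 2 * tsig1sq sigma p) by rewrite mulr_ge0 // mulr_ge0 // sqr_ge0.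
apply: (lift (psi := fun _ s' => fM s') _ _
  (fun s cs => step_fM n0 rd0 SL SN UCu UCl FD duE k cs)).
- by move=> d T s s' _ ms'; exact: (measurable_fM ms').
- by move=> _ s'; exact: avg_sq_ge0.
exact: (hasEZ c1 (hasED (hasED (hasEZ c2 hM) (hasEZ c3 (hasEZ (sqr_ge0 _) hS))) (hasE_cst P c4))).
Qed.

Let YY : hasEv (fY pb) k.+1 /\ Ev (fY pb) k.+1 <= (1 - beta p * mug c) * Ev (fY pb) k
    + Lys c ^+ 2 / (beta p * mug c) * (alpha p ^+ 2 * Ev (@fH R n dx dy) k)
    + beta p ^+ 2 * ((1 + tom_l p) * tsigsq sigma p / n%:R + tom_l p / n%:R * Ev (fMy pb) k).
Proof.
have c2 : 0 <= Lys c ^+ 2 / (beta p * mug c).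
  by rewrite divr_ge0 ?sqr_ge0 // ltW // mulr_gt0.
have c3 : 0 <= (1 + tom_l p) * tsigsq sigma p / n%:R by rewrite mulr_ge0 // mulr_ge0 // addr_ge0.
have c4 : 0 <= tom_l p / n%:R by rewrite mulr_ge0.
apply: (lift (psi := fun _ s' => fY pb s') _ _
  (fun s cs => step_fY n0 dy0 rd0 Hc Hs Hl SL SN UCl FD k cs b0 bL)).
- by move=> d T s s' _ ms'; exact: (measurable_fY Hl ms').
- by move=> _ s'; exact: sq0.
exact: (hasED (hasED (hasEZ bmu hY) (hasEZ c2 (hasEZ a2_0 hH)))
  (hasEZ (sqr_ge0 _) (hasED (hasE_cst P c3) (hasEZ c4 hMy)))).
Qed.

Let ZZ : hasEv (fZ pb) k.+1 /\ Ev (fZ pb) k.+1 <= (1 - gamma p * mug c) * Ev (fZ pb) k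
    + 4 * gamma p * L1sq c p / mug c * Ev (fY pb) k
    + 2 * Lzs c ^+ 2 / (gamma p * mug c) * (alpha p ^+ 2 * Ev (@fH R n dx dy) k)
    + gamma p ^+ 2 * ((1 + tom_l p) * tsig1sq sigma p / n%:R + tom_l p / n%:R * Ev (fMz pb) k).
Proof.
have c1 : 0 <= 4 * gamma p * L1sq c p / mug c.
  apply: divr_ge0; last exact: ltW.
  by rewrite mulr_ge0 // mulr_ge0 // ltW.
have c2 : 0 <= 2 * Lzs c ^+ 2 / (gamma p * mug c).
  apply: divr_ge0; last by apply: ltW; exact: mulr_gt0.
  by rewrite mulr_ge0 // sqr_ge0.
have c3 : 0 <= (1 + tom_l p) * tsig1sq sigma p / n%:R by rewrite mulr_ge0 // mulr_ge0 // addr_ge0.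
have c4 : 0 <= tom_l p / n%:R by rewrite mulr_ge0.
apply: (lift (psi := fun _ s' => fZ pb s') _ _
  (fun s cs => step_fZ n0 dy0 rd0 Hc Hs Hl SL SN UCu UCl FD rho_ge k cs g0 gL)).
- by move=> d T s s' _ ms'; exact: (measurable_fZ Hl ms').
- by move=> _ s'; exact: sq0.
exact: (hasED (hasED (hasED (hasEZ gmu hZ) (hasEZ c1 hY)) (hasEZ c2 (hasEZ a2_0 hH)))
  (hasEZ (sqr_ge0 _) (hasED (hasE_cst P c3) (hasEZ c4 hMz)))).
Qed.

Let drift_x w : enorm (stx (it w k) - stx (it w k.+1)) ^+ 2 = alpha p ^+ 2 * fH (it w k).
Proof. by rewrite /= opprB addrC subrK enorm_sqZ. Qed.

Let zit w : enorm (stz (it w k)) <= rho p. Proof. by have [] := cit w k. Qed.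

(** Two stages: the fresh draws control the new h against the gradients of the old state, then
    [gS_drift] with parameter theta moves the gradients. The drift involves y and z at k + 1, hence
    the use of [YY] and [ZZ]. *)
Let SS : hasEv (fS pb) k.+1 /\ Ev (fS pb) k.+1 <=
  (1 + theta p) * ((1 - theta p) ^+ 2 * Ev (fS pb) k + theta p ^+ 2 * tsig1sq sigma p)
  + (1 + (theta p)^-1) * (3 * L5sq c p * (alpha p ^+ 2 * Ev (@fH R n dx dy) k)
     + 9 * L2sq c p * (Ev (fY pb) k + Ev (fY pb) k.+1)
     + 9 * Lg c ^+ 2 * (Ev (fZ pb) k + Ev (fZ pb) k.+1)).
Proof.
have c1 : 0 <= theta p ^+ 2 * tsig1sq sigma p by rewrite mulr_ge0 ?sqr_ge0.
have [hS1 lS1] : _ /\ _ := lift (psi := gS pb)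
  (fun d T s s' ms ms' => measurable_gS Hc ms ms') (fun s s' => avg_sq_ge0 _)
  (fun s cs => step_gS n0 rd0 SL SN UCu UCl FD k cs)
  (hasED (hasEZ (sqr_ge0 (1 - theta p)) hS) (hasE_cst P c1)).
have c2 : 0 <= 1 + theta p by rewrite addr_ge0 // ltW.
have c3 : 0 <= 1 + (theta p)^-1 by rewrite addr_ge0 // invr_ge0 ltW.
have c5 : 0 <= 3 * L5sq c p by rewrite mulr_ge0.
have c6 : 0 <= 9 * L2sq c p by rewrite mulr_ge0.
have c7 : 0 <= 9 * Lg c ^+ 2 by rewrite mulr_ge0.
have [hY1 _] := YY; have [hZ1 _] := ZZ.
have hb := hasED (hasEZ c2 hS1) (hasEZ c3 (hasED (hasED (hasEZ c5 (hasEZ a2_0 hH))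
  (hasEZ c6 (hasED hY hY1))) (hasEZ c7 (hasED hZ hZ1)))).
have mS1 : measurable_fun setT (fun w => (fS pb) (it w k.+1)).
  exact: (measurable_gS Hc (mit k.+1) (mit k.+1)).
have [|w|h1 h2] := hasE_dom mS1 _ hb; first by move=> w; exact: avg_sq_ge0.
  by rewrite -drift_x; exact: (gS_drift n0 dy0 Hc Hl _ t0 (zit w)).
split=> //; apply: le_trans h2 _; rewrite lerD2r ler_wpM2l //.
Qed.

Let d20 : 0 < delta_l p / 2. Proof. by rewrite divr_gt0. Qed.

(** The two stages of [SS], with Young's parameter delta_l / 2 so that half of the contraction
    survives. *)
Let YMy : hasEv (fMy pb) k.+1 /\ Ev (fMy pb) k.+1 <=
  (1 + delta_l p / 2) * ((1 - delta_l p) * Ev (fMy pb) k + delta_l p * tsigsq sigma p)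
  + (1 + (delta_l p / 2)^-1) * (L3sq c * (alpha p ^+ 2 * Ev (@fH R n dx dy) k)
     + 3 * Lg c ^+ 2 * (Ev (fY pb) k + Ev (fY pb) k.+1)).
Proof.
have c1 : 0 <= delta_l p * tsigsq sigma p by rewrite mulr_ge0 // ltW.
have [hS1 lS1] : _ /\ _ := lift (psi := gMy pb)
  (fun d T s s' ms ms' => measurable_gMy Hc ms ms') (fun s s' => avg_sq_ge0 _)
  (fun s _ => step_gMy n0 rd0 SL SN UCu UCl FD dlE k s)
  (hasED (hasEZ dl1 hMy) (hasE_cst P c1)).
have c2 : 0 <= 1 + delta_l p / 2 by rewrite addr_ge0 // ltW.
have c3 : 0 <= 1 + (delta_l p / 2)^-1 by rewrite addr_ge0 // invr_ge0 ltW.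
have c7 : 0 <= 3 * Lg c ^+ 2 by rewrite mulr_ge0.
have [hY1 _] := YY.
have hb := hasED (hasEZ c2 hS1) (hasEZ c3 (hasED (hasEZ L3_0 (hasEZ a2_0 hH))
  (hasEZ c7 (hasED hY hY1)))).
have mS1 : measurable_fun setT (fun w => (fMy pb) (it w k.+1)).
  exact: (measurable_gMy Hc (mit k.+1) (mit k.+1)).
have [|w|h1 h2] := hasE_dom mS1 _ hb; first by move=> w; exact: avg_sq_ge0.
  by rewrite -drift_x; exact: (gMy_drift n0 Hc Hl _ _ d20).
split=> //; apply: le_trans h2 _; rewrite lerD2r ler_wpM2l //.
Qed.

Let ZMz : hasEv (fMz pb) k.+1 /\ Ev (fMz pb) k.+1 <=
  (1 + delta_l p / 2) * ((1 - delta_l p) * Ev (fMz pb) k + delta_l p * tsig1sq sigma p)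
  + (1 + (delta_l p / 2)^-1) * (3 * L4sq c p * (alpha p ^+ 2 * Ev (@fH R n dx dy) k)
     + 9 * L1sq c p * (Ev (fY pb) k + Ev (fY pb) k.+1)
     + 9 * Lg c ^+ 2 * (Ev (fZ pb) k + Ev (fZ pb) k.+1)).
Proof.
have c1 : 0 <= delta_l p * tsig1sq sigma p by rewrite mulr_ge0 // ltW.
have [hS1 lS1] : _ /\ _ := lift (psi := gMz pb)
  (fun d T s s' ms ms' => measurable_gMz Hc ms ms') (fun s s' => avg_sq_ge0 _)
  (fun s cs => step_gMz n0 rd0 SL SN UCu UCl FD dlE k cs)
  (hasED (hasEZ dl1 hMz) (hasE_cst P c1)).
have c2 : 0 <= 1 + delta_l p / 2 by rewrite addr_ge0 // ltW.
have c3 : 0 <= 1 + (delta_l p / 2)^-1 by rewrite addr_ge0 // invr_ge0 ltW.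
have c5 : 0 <= 3 * L4sq c p by rewrite mulr_ge0.
have c6 : 0 <= 9 * L1sq c p by rewrite mulr_ge0.
have c7 : 0 <= 9 * Lg c ^+ 2 by rewrite mulr_ge0.
have [hY1 _] := YY; have [hZ1 _] := ZZ.
have hb := hasED (hasEZ c2 hS1) (hasEZ c3 (hasED (hasED (hasEZ c5 (hasEZ a2_0 hH))
  (hasEZ c6 (hasED hY hY1))) (hasEZ c7 (hasED hZ hZ1)))).
have mS1 : measurable_fun setT (fun w => (fMz pb) (it w k.+1)).
  exact: (measurable_gMz Hc (mit k.+1) (mit k.+1)).
have [|w|h1 h2] := hasE_dom mS1 _ hb; first by move=> w; exact: avg_sq_ge0.
  by rewrite -drift_x; exact: (gMz_drift n0 dy0 Hc Hl _ d20 (zit w)).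
split=> //; apply: le_trans h2 _; rewrite lerD2r ler_wpM2l //.
Qed.

Definition rec_X := XX.2.
Definition rec_M := MM.2.
Definition rec_Y := YY.2.
Definition rec_Z := ZZ.2.
Definition rec_S := SS.2.
Definition rec_My := YMy.2.
Definition rec_Mz := ZMz.2.

Lemma finite_moments_step : finite_moments k.+1.
Proof. exact (And5 (And4 moment_fP1 XX.1 MM.1 SS.1) YY.1 ZZ.1 YMy.1 ZMz.1). Qed.

End Step.

Let it0 w : it w 0 = init_state ini. Proof. by []. Qed.

Let hasE0 (F : state R n dx dy -> R) : (forall s, 0 <= F s) -> hasEv F 0.
Proof. by move=> F0; rewrite /Ev /= integral_EFin_cst; exact: hasE_cst. Qed.

Lemma finite_moments_all k : finite_moments k.
Proof.
elim: k => [|k IH]; last exact: finite_moments_step.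
split; [split|..]; apply: hasE0 => s.
- exact: Phi0.
- exact: sq0.
- exact: avg_sq_ge0.
- exact: avg_sq_ge0.
- exact: sq0.
- exact: sq0.
- exact: avg_sq_ge0.
- exact: avg_sq_ge0.
Qed.

Lemma Ev0 (F : state R n dx dy -> R) : Ev F 0 = F (init_state ini).
Proof. by rewrite /Ev /= integral_EFin_cst. Qed.

End ExpectedRecursions.

(** * Summation of the recursions *)

Section RealRecursions.
Context {R : realFieldType}.

Definition psum (f : nat -> R) K : R := \sum_(k < K) f k.

Lemma psum0 f : psum f 0 = 0. Proof. by rewrite /psum big_ord0. Qed.
Lemma psumS f K : psum f K.+1 = psum f K + f K. Proof. by rewrite /psum big_ord_recr. Qed.
Lemma psum_ge0 f K : (forall k, 0 <= f k) -> 0 <= psum f K.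
Proof. by move=> f0; rewrite sumr_ge0. Qed.

Context (P G H X M S Y Z My Mz : nat -> R).
Context (P_0 : forall k, 0 <= P k) (H_0 : forall k, 0 <= H k) (X_0 : forall k, 0 <= X k).
Context (M_0 : forall k, 0 <= M k) (S_0 : forall k, 0 <= S k) (Y_0 : forall k, 0 <= Y k).
Context (Z_0 : forall k, 0 <= Z k) (My_0 : forall k, 0 <= My k) (Mz_0 : forall k, 0 <= Mz k).
Context (a b g t mu nn tl tu d s s1 Lp Ly Lz Lg2 L1 L2 L3 L4 L5 : R).
Context (a0 : 0 < a) (b0 : 0 < b) (g0 : 0 < g) (t0 : 0 < t) (t1 : t <= 1) (mu0 : 0 < mu).
Context (nn0 : 0 < nn) (tl0 : 0 <= tl) (tu0 : 0 <= tu) (dE : d = (1 + tl)^-1).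
Context (tom : R) (tomE : tom = 1 + 6 * tl * (1 + tl)).
Context (s_0 : 0 <= s) (s1_0 : 0 <= s1) (Lg2_0 : 0 <= Lg2) (L1_0 : 0 <= L1) (L2_0 : 0 <= L2).
Context (L3_0 : 0 <= L3) (L4_0 : 0 <= L4) (L5_0 : 0 <= L5).
Context (bmu : b * mu <= 1) (gmu : g * mu <= 1) (muLg : mu ^+ 2 <= Lg2).

Let A k := a ^+ 2 * H k.
Let A_0 k : 0 <= A k. Proof. by rewrite mulr_ge0 // sqr_ge0. Qed.

Context (rP : forall k, P k.+1 + a / 2 * G k + a / 4 * H k <= P k + a * X k + a * M k).
Context (rX : forall k, X k.+1 <= (1 - t) * X k + 6 * t * (L2 * Y k + Lg2 * Z k)
    + 2 * Lp ^+ 2 / t * (a ^+ 2 * H k) + t ^+ 2 * (s1 / nn)).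
Context (rM : forall k, M k.+1 <= (1 + tu)^-1 * ((tu + 2^-1) * M k
    + tu * (1 + 2 * tu) * (t ^+ 2 * S k) + tu * (t ^+ 2 * s1))).
Context (rS : forall k, S k.+1 <= (1 + t) * ((1 - t) ^+ 2 * S k + t ^+ 2 * s1)
    + (1 + t^-1) * (3 * L5 * (a ^+ 2 * H k) + 9 * L2 * (Y k + Y k.+1) + 9 * Lg2 * (Z k + Z k.+1))).
Context (rY : forall k, Y k.+1 <= (1 - b * mu) * Y k + Ly ^+ 2 / (b * mu) * (a ^+ 2 * H k)
    + b ^+ 2 * ((1 + tl) * s / nn + tl / nn * My k)).
Context (rZ : forall k, Z k.+1 <= (1 - g * mu) * Z k + 4 * g * L1 / mu * Y k
    + 2 * Lz ^+ 2 / (g * mu) * (a ^+ 2 * H k)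
    + g ^+ 2 * ((1 + tl) * s1 / nn + tl / nn * Mz k)).
Context (rMy : forall k, My k.+1 <= (1 + d / 2) * ((1 - d) * My k + d * s)
    + (1 + (d / 2)^-1) * (L3 * (a ^+ 2 * H k) + 3 * Lg2 * (Y k + Y k.+1))).
Context (rMz : forall k, Mz k.+1 <= (1 + d / 2) * ((1 - d) * Mz k + d * s1)
    + (1 + (d / 2)^-1) * (3 * L4 * (a ^+ 2 * H k) + 9 * L1 * (Y k + Y k.+1)
       + 9 * Lg2 * (Z k + Z k.+1))).

Let Kr K : (K.+1%:R : R) = K%:R + 1. Proof. by rewrite -natr1. Qed.

(** Telescoping of Phi, with the nonnegative final value dropped. The term [psum H K / 2] is the
    reservoir that later absorbs every drift. *)
Lemma sum_G K : psum G K + psum H K / 2 <= 2 * P 0 / a + 2 * psum X K + 2 * psum M K.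
Proof.
suff : P K + a / 2 * psum G K + a / 4 * psum H K <= P 0 + a * psum X K + a * psum M K.
  move=> h; have := P_0 K; move: h => /[swap] pk h.
  have : a * (psum G K + psum H K / 2) <= a * (2 * P 0 / a + 2 * psum X K + 2 * psum M K).
    rewrite [leRHS](_ : _ = 2 * (P 0 + a * psum X K + a * psum M K)); first by lra.
    by field; rewrite gt_eqF.
  by rewrite ler_pM2l.
elim: K => [|K IH]; first by rewrite !psum0; lra.
by rewrite !psumS; have := rP K; lra.
Qed.

Lemma sum_X K : psum X K <= X 0 / t + 6 * (L2 * psum Y K + Lg2 * psum Z K)
    + 2 * Lp ^+ 2 / t ^+ 2 * psum A K + t * (s1 / nn) * K%:R.
Proof.
suff : X K + t * psum X K <= X 0 + 6 * t * (L2 * psum Y K + Lg2 * psum Z K)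
    + 2 * Lp ^+ 2 / t * psum A K + t ^+ 2 * (s1 / nn) * K%:R.
  move=> h; have := X_0 K; move: h => /[swap] pk h; rewrite -(ler_pM2l t0).
  rewrite [leRHS](_ : _ = X 0 + 6 * t * (L2 * psum Y K + Lg2 * psum Z K)
    + 2 * Lp ^+ 2 / t * psum A K + t ^+ 2 * (s1 / nn) * K%:R); first by lra.
  by field; rewrite !gt_eqF.
elim: K => [|K IH]; first by rewrite !psum0; lra.
by rewrite !psumS (Kr K) /A; move: (rX K) IH; rewrite /A; lra.
Qed.

(** The lag starts at 0 because m_x = h_x initially. The weights 1 + tu and tu + 1/2 differ by 1/2,
    hence the factor 2. *)
Lemma sum_M K : M 0 = 0 ->
  psum M K <= 2 * tu * ((1 + 2 * tu) * (t ^+ 2 * psum S K) + t ^+ 2 * s1 * K%:R).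
Proof.
move=> M00; have u1 : 0 < 1 + tu by rewrite ltr_wpDr.
have rM' k : (1 + tu) * M k.+1 <= (tu + 2^-1) * M k
    + tu * (1 + 2 * tu) * (t ^+ 2 * S k) + tu * (t ^+ 2 * s1).
  by rewrite -ler_pdivlMl // rM.
suff : (1 + tu) * M K + 2^-1 * psum M K <=
    tu * (1 + 2 * tu) * (t ^+ 2 * psum S K) + tu * (t ^+ 2 * s1) * K%:R.
  by have := mulr_ge0 (ltW u1) (M_0 K); lra.
elim: K => [|K IH]; first by rewrite !psum0 M00; lra.
by rewrite !psumS (Kr K); move: (rM' K) IH; lra.
Qed.

Let sumYS K : psum Y K <= psum Y K.+1. Proof. by rewrite psumS lerDl. Qed.
Let sumZS K : psum Z K <= psum Z K.+1. Proof. by rewrite psumS lerDl. Qed.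

(** Uses (1 + t) (1 - t)^2 <= 1 - t and 1 + 1 / t <= 2 / t. As S at k + 1 sees Y and Z at both k and
    k + 1, their sums run over K + 1 terms. *)
Lemma sum_S K : t ^+ 2 * psum S K <= t * S 0 + 2 * t ^+ 3 * s1 * K%:R
    + 2 * (3 * L5 * psum A K + 18 * L2 * psum Y K.+1 + 18 * Lg2 * psum Z K.+1).
Proof.
have ti : 1 + t^-1 <= 2 / t.
  have : 1 <= t^-1 by rewrite invf_ge1.
  lra.
have rS' k : S k.+1 <= (1 - t) * S k + 2 * t ^+ 2 * s1 +
   2 / t * (3 * L5 * A k + 9 * L2 * (Y k + Y k.+1) + 9 * Lg2 * (Z k + Z k.+1)).
  apply: le_trans (rS k) _; apply: lerD.
    have u0 : 0 <= 1 - t by rewrite subr_ge0.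
    have h1 := mulr_ge0 (mulr_ge0 u0 (sqr_ge0 t)) (S_0 k).
    have h2 := mulr_ge0 u0 (mulr_ge0 (sqr_ge0 t) s1_0).
    lra.
  rewrite ler_wpM2r //; apply: addr_ge0; first apply: addr_ge0.
  - by apply: mulr_ge0; [rewrite mulr_ge0|exact: A_0].
  - by apply: mulr_ge0; [rewrite mulr_ge0|rewrite addr_ge0].
  - by apply: mulr_ge0; [rewrite mulr_ge0|rewrite addr_ge0].
have main : S K + t * psum S K <= S 0 + 2 * t ^+ 2 * s1 * K%:R +
   2 / t * (3 * L5 * psum A K + 9 * L2 * (psum Y K + psum Y K.+1 - Y 0)
    + 9 * Lg2 * (psum Z K + psum Z K.+1 - Z 0)).
  elim: K => [|K IH]; first by rewrite !psumS !psum0; lra.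
  by move: (rS' K) IH; rewrite !psumS (Kr K); lra.
have h : t * (S K + t * psum S K) <= t * S 0 + 2 * t ^+ 3 * s1 * K%:R +
   2 * (3 * L5 * psum A K + 9 * L2 * (psum Y K + psum Y K.+1 - Y 0)
    + 9 * Lg2 * (psum Z K + psum Z K.+1 - Z 0)).
  apply: le_trans (ler_wpM2l (ltW t0) main) _; rewrite le_eqVlt; apply/orP; left; apply/eqP.
  by field; rewrite gt_eqF.
have h1 := mulr_ge0 (ltW t0) (S_0 K).
have h2 := ler_wpM2l L2_0 (sumYS K); have h3 := ler_wpM2l Lg2_0 (sumZS K).
have h4 := mulr_ge0 L2_0 (Y_0 0); have h5 := mulr_ge0 Lg2_0 (Z_0 0).
lra.
Qed.

Let l1 : 0 < 1 + tl. Proof. by rewrite ltr_wpDr. Qed.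
Let d0 : 0 < d. Proof. by rewrite dE invr_gt0. Qed.
Let d1 : d <= 1. Proof. by rewrite dE invf_le1 // lerDl. Qed.
Let d2E : 1 + (d / 2)^-1 = 3 + 2 * tl.
Proof. by rewrite dE; field; rewrite gt_eqF. Qed.

(** Contraction 1 - d with Young's parameter d / 2 still contracts by 1 - d / 2. The factors come
    from dividing by d / 2 = 1 / (2 (1 + tl)). *)
Let momentum (m w : nat -> R) (v : R) K : (forall k, 0 <= m k) -> 0 <= v ->
  (forall k, 0 <= w k) ->
  (forall k, m k.+1 <= (1 + d / 2) * ((1 - d) * m k + d * v) + (1 + (d / 2)^-1) * w k) ->
  psum m K <= 2 * (1 + tl) * m 0 + 3 * v * K%:R + 2 * (1 + tl) * (3 + 2 * tl) * psum w K.
Proof.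
move=> m_0 v0 w0 rm.
have rm' k : m k.+1 <= (1 - d / 2) * m k + 3 / 2 * d * v + (3 + 2 * tl) * w k.
  apply: le_trans (rm k) _; rewrite d2E lerD2r.
  have h1 : 0 <= d ^+ 2 * m k by rewrite mulr_ge0 ?sqr_ge0.
  have h2 : 0 <= (1 - d) * (d * v) by rewrite mulr_ge0 ?subr_ge0 // mulr_ge0 // ltW.
  lra.
have main : m K + d / 2 * psum m K <= m 0 + 3 / 2 * d * v * K%:R + (3 + 2 * tl) * psum w K.
  elim: K => [|K IH]; first by rewrite !psum0; lra.
  by move: (rm' K) IH; rewrite !psumS (Kr K); lra.
have h : 2 * (1 + tl) * (m K + d / 2 * psum m K) <=
    2 * (1 + tl) * (m 0 + 3 / 2 * d * v * K%:R + (3 + 2 * tl) * psum w K).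
  by rewrite ler_wpM2l // mulr_ge0 // ltW.
have e : (1 + tl) * d = 1 by rewrite dE mulfV // gt_eqF.
have h1 := mulr_ge0 (ltW l1) (m_0 K).
have h2 : (1 + tl) * (d * psum m K) = psum m K by rewrite mulrA e mul1r.
have h3 : (1 + tl) * (d * (v * K%:R)) = v * K%:R by rewrite mulrA e mul1r.
lra.
Qed.

Let tom_ge : 2 * (1 + tl) * (3 + 2 * tl) <= 6 * tom.
Proof. rewrite tomE; have := tl0; have := mulr_ge0 tl0 tl0; lra. Qed.
Let tom0 : 1 <= tom. Proof. by rewrite tomE lerDl mulr_ge0 ?(ltW l1) // mulr_ge0. Qed.

Lemma sum_My K : psum My K <= 2 * (1 + tl) * My 0 + 3 * s * K%:R
  + 6 * tom * (L3 * psum A K + 6 * Lg2 * psum Y K.+1).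
Proof.
pose w k := L3 * A k + 3 * Lg2 * (Y k + Y k.+1).
have w0 k : 0 <= w k.
  by apply: addr_ge0; apply: mulr_ge0 => //; rewrite ?mulr_ge0 // addr_ge0.
have := momentum K My_0 s_0 w0 rMy => /le_trans; apply; rewrite lerD2l.
have wE : psum w K <= L3 * psum A K + 6 * Lg2 * psum Y K.+1.
  have : psum w K = L3 * psum A K + 3 * Lg2 * (psum Y K + psum Y K.+1 - Y 0).
    elim: K => [|K IH]; first by rewrite !psumS !psum0; ring.
    by rewrite psumS IH /w !psumS; ring.
  have h2 := ler_wpM2l Lg2_0 (sumYS K); have h4 := mulr_ge0 Lg2_0 (Y_0 0); lra.
have pw := psum_ge0 K w0.
apply: (@le_trans _ _ (6 * tom * psum w K)); first exact: ler_wpM2r.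
by rewrite ler_wpM2l // mulr_ge0 // (le_trans _ tom0).
Qed.

Lemma sum_Mz K : psum Mz K <= 2 * (1 + tl) * Mz 0 + 3 * s1 * K%:R
  + 18 * tom * (L4 * psum A K + 6 * L1 * psum Y K.+1 + 6 * Lg2 * psum Z K.+1).
Proof.
pose w k := 3 * L4 * A k + 9 * L1 * (Y k + Y k.+1) + 9 * Lg2 * (Z k + Z k.+1).
have w0 k : 0 <= w k.
  by apply: addr_ge0; first apply: addr_ge0; apply: mulr_ge0 => //; rewrite ?mulr_ge0 // addr_ge0.
have := momentum K Mz_0 s1_0 w0 rMz => /le_trans; apply; rewrite lerD2l.
have wE : psum w K <= 3 * (L4 * psum A K + 6 * L1 * psum Y K.+1 + 6 * Lg2 * psum Z K.+1).
  have : psum w K = 3 * L4 * psum A K + 9 * L1 * (psum Y K + psum Y K.+1 - Y 0)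
      + 9 * Lg2 * (psum Z K + psum Z K.+1 - Z 0).
    elim: K => [|K IH]; first by rewrite !psumS !psum0; ring.
    by rewrite psumS IH /w !psumS; ring.
  have h2 := ler_wpM2l L1_0 (sumYS K); have h4 := mulr_ge0 L1_0 (Y_0 0).
  have h3 := ler_wpM2l Lg2_0 (sumZS K); have h5 := mulr_ge0 Lg2_0 (Z_0 0); lra.
have pw := psum_ge0 K w0.
apply: (@le_trans _ _ (6 * tom * psum w K)); first exact: ler_wpM2r.
apply: (@le_trans _ _ (6 * tom * (3 * (L4 * psum A K + 6 * L1 * psum Y K.+1 + 6 * Lg2 * psum Z K.+1)))).
  by rewrite ler_wpM2l // mulr_ge0 // (le_trans _ tom0).
by lra.
Qed.

Context (bE : b * (96 * tl * tom * Lg2) <= mu * nn).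
Context (gE : g * (432 * tl * tom * Lg2) <= mu * nn).

(** The memory feeds back 36 tl tom Lg2 b^2 / nn times the sum of Y, which the restriction on b
    bounds by 36/96 = 3/8 of b mu times that sum. The remaining 5/8 is inverted, and the resulting
    factors are rounded up. *)
Lemma sum_Y K : psum Y K.+1 <= 2 * Y 0 / (mu * b)
  + (4 * Ly ^+ 2 / (b ^+ 2 * mu ^+ 2) + 16 * tl * tom * L3 * b / (mu * nn)) * psum A K
  + 4 * (1 + 6 * tl * tom) * b / (mu * nn) * s * K%:R
  + 4 * tl * (1 + 4 * tl) * b / (mu * nn) * My 0.
Proof.
have main : Y K + b * mu * psum Y K <= Y 0 + Ly ^+ 2 / (b * mu) * psum A K
    + b ^+ 2 * ((1 + tl) * s / nn * K%:R + tl / nn * psum My K).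
  elim: K => [|K IH]; first by rewrite !psum0; lra.
  by move: (rY K) IH; rewrite !psumS (Kr K) /A; lra.
set q := b * mu in main *; have q0 : 0 < q by exact: mulr_gt0.
have qY : q * psum Y K.+1 <= Y K + q * psum Y K.
  by rewrite psumS mulrDr addrC lerD2r ler_piMl.
set B := b ^+ 2 / nn; have B0 : 0 <= B by rewrite divr_ge0 ?sqr_ge0 // ltW.
have mainE : b ^+ 2 * ((1 + tl) * s / nn * K%:R + tl / nn * psum My K) =
    B * ((1 + tl) * s * K%:R) + B * tl * psum My K by rewrite /B; ring.
rewrite mainE in main.
have hMy := ler_wpM2l (mulr_ge0 B0 tl0) (sum_My K).
have hY0 := psum_ge0 K.+1 Y_0.
have hab : B * tl * (36 * tom * Lg2 * psum Y K.+1) <= 3 / 8 * (q * psum Y K.+1).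
  have : b / nn * psum Y K.+1 * (b * (96 * tl * tom * Lg2)) <= b / nn * psum Y K.+1 * (mu * nn).
    by rewrite ler_wpM2l // mulr_ge0 // divr_ge0 // ltW.
  have -> : b / nn * psum Y K.+1 * (mu * nn) = q * psum Y K.+1.
    by rewrite /q; field; rewrite gt_eqF.
  by rewrite /B; lra.
have A0 := psum_ge0 K A_0; have K0 : 0 <= (K%:R : R) by [].
have f1 := mulr_ge0 (mulr_ge0 B0 s_0) K0; have f2 := mulr_ge0 tl0 f1.
have tt : 0 <= tom - 1 by rewrite subr_ge0.
have f3 := mulr_ge0 tt f2; have f4 := mulr_ge0 (mulr_ge0 B0 tl0) (My_0 0).
have f5 := mulr_ge0 tl0 f4.
have tom_0 : 0 <= tom by exact: le_trans tom0.
have f6 := mulr_ge0 (mulr_ge0 (mulr_ge0 B0 tl0) tom_0) (mulr_ge0 L3_0 A0).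
have f7 : 0 <= Ly ^+ 2 / q * psum A K by rewrite mulr_ge0 // divr_ge0 ?sqr_ge0 // ltW.
have f8 := Y_0 0.
rewrite -(ler_pM2l q0).
rewrite [leRHS](_ : _ = 2 * Y 0 + 4 * (Ly ^+ 2 / q * psum A K)
   + 16 * (B * tl * tom * (L3 * psum A K)) + 4 * (1 + 6 * tl * tom) * (B * s * K%:R)
   + 4 * (1 + 4 * tl) * (B * tl * My 0)); first by lra.
by rewrite /q /B; field; rewrite !gt_eqF.
Qed.

(** The absorption of [sum_Y] with 108/432 = 1/4. The part of the memory proportional to L1 Y is
    bounded in the same way and joins the coupling 4 g L1 / mu of the linear system to y. *)
Lemma sum_Z K : psum Z K.+1 <= 4 * Z 0 / (mu * g) + 25 * L1 / mu ^+ 2 * psum Y K.+1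
  + (12 * Lz ^+ 2 / (g ^+ 2 * mu ^+ 2) + 72 * tl * tom * L4 * g / (mu * nn)) * psum A K
  + 6 * (1 + 6 * tl * tom) * g / (mu * nn) * s1 * K%:R
  + 6 * tl * (1 + 4 * tl) * g / (mu * nn) * Mz 0.
Proof.
have main : Z K + g * mu * psum Z K <= Z 0 + 4 * g * L1 / mu * psum Y K
    + 2 * Lz ^+ 2 / (g * mu) * psum A K
    + g ^+ 2 * ((1 + tl) * s1 / nn * K%:R + tl / nn * psum Mz K).
  elim: K => [|K IH]; first by rewrite !psum0; lra.
  by move: (rZ K) IH; rewrite !psumS (Kr K) /A; lra.
have c0 : 0 <= 4 * g * L1 / mu by rewrite divr_ge0 ?(ltW mu0) // mulr_ge0 // mulr_ge0 // ltW.
have hYK := ler_wpM2l c0 (sumYS K).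
set q := g * mu in main *; have q0 : 0 < q by exact: mulr_gt0.
have qY : q * psum Z K.+1 <= Z K + q * psum Z K.
  by rewrite psumS mulrDr addrC lerD2r ler_piMl.
set B := g ^+ 2 / nn; have B0 : 0 <= B by rewrite divr_ge0 ?sqr_ge0 // ltW.
have mainE : g ^+ 2 * ((1 + tl) * s1 / nn * K%:R + tl / nn * psum Mz K) =
    B * ((1 + tl) * s1 * K%:R) + B * tl * psum Mz K by rewrite /B; ring.
rewrite mainE in main.
have hMz := ler_wpM2l (mulr_ge0 B0 tl0) (sum_Mz K).
have hZ0 := psum_ge0 K.+1 Z_0; have hY0 := psum_ge0 K.+1 Y_0.
have habg v : 0 <= v -> B * tl * (108 * tom * Lg2 * v) <= 1 / 4 * (q * v).
  move=> v0; have : g / nn * v * (g * (432 * tl * tom * Lg2)) <= g / nn * v * (mu * nn).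
    by rewrite ler_wpM2l // mulr_ge0 // divr_ge0 // ltW.
  have -> : g / nn * v * (mu * nn) = q * v by rewrite /q; field; rewrite gt_eqF.
  by rewrite /B; lra.
have hab := habg _ hZ0.
(* L1 is traded for Lg^2 at the price of a factor L1 / mu^2, since mu <= Lg *)
have habY : B * tl * (108 * tom * L1 * psum Y K.+1) <= 1 / 4 * (g * L1 / mu * psum Y K.+1).
  have LY0 := mulr_ge0 L1_0 hY0.
  have m2 : 0 < mu ^+ 2 by rewrite exprn_gt0.
  have := habg (L1 * psum Y K.+1 / mu ^+ 2); rewrite divr_ge0 ?(ltW m2) // => /(_ isT).
  have -> : q * (L1 * psum Y K.+1 / mu ^+ 2) = g * L1 / mu * psum Y K.+1.
    by rewrite /q; field; rewrite gt_eqF.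
  apply: le_trans; rewrite (ler_wpM2l (mulr_ge0 B0 tl0)) //.
  rewrite [leRHS](_ : _ = 108 * tom * L1 * psum Y K.+1 * (Lg2 / mu ^+ 2)); last by ring.
  rewrite ler_peMr ?ler_pdivlMr ?mul1r //.
  by rewrite mulr_ge0 // mulr_ge0 // mulr_ge0 // (le_trans _ tom0).
have A0 := psum_ge0 K A_0; have K0 : 0 <= (K%:R : R) by [].
have f1 := mulr_ge0 (mulr_ge0 B0 s1_0) K0; have f2 := mulr_ge0 tl0 f1.
have tt : 0 <= tom - 1 by rewrite subr_ge0.
have f3 := mulr_ge0 tt f2; have f4 := mulr_ge0 (mulr_ge0 B0 tl0) (Mz_0 0).
have f5 := mulr_ge0 tl0 f4.
have tom_0 : 0 <= tom by exact: le_trans tom0.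
have f6 := mulr_ge0 (mulr_ge0 (mulr_ge0 B0 tl0) tom_0) (mulr_ge0 L4_0 A0).
have f7 : 0 <= Lz ^+ 2 / q * psum A K by rewrite mulr_ge0 // divr_ge0 ?sqr_ge0 // ltW.
have f8 := Z_0 0.
have f9 : 0 <= g * L1 / mu * psum Y K.+1.
  by rewrite mulr_ge0 // divr_ge0 ?(ltW mu0) // mulr_ge0 // ltW.
rewrite -(ler_pM2l q0).
rewrite [leRHS](_ : _ = 4 * Z 0 + 25 * (g * L1 / mu * psum Y K.+1) + 12 * (Lz ^+ 2 / q * psum A K)
   + 72 * (B * tl * tom * (L4 * psum A K)) + 6 * (1 + 6 * tl * tom) * (B * s1 * K%:R)
   + 6 * (1 + 4 * tl) * (B * tl * Mz 0)); first by lra.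
by rewrite /q /B; field; rewrite !gt_eqF.
Qed.

Let tom_u2 := 1 + 36 * tu * (1 + tu).

Context (C : R) (CE : C = 2 * (4 * Lp ^+ 2 / t ^+ 2 + 72 * tu * (1 + tu) * L5
   + 12 * tom_u2 * (L2 + 25 * (Lg2 / mu ^+ 2) * L1)
     * (4 * Ly ^+ 2 / (b ^+ 2 * mu ^+ 2) + 16 * tl * tom * L3 * b / (mu * nn))
   + 12 * tom_u2 * Lg2
     * (12 * Lz ^+ 2 / (g ^+ 2 * mu ^+ 2) + 72 * tl * tom * L4 * g / (mu * nn)))).
Context (aC : a ^+ 2 * C <= 1) (M00 : M 0 = 0).

(** X and M leave c1 (L2 sum Y + Lg2 sum Z) with c1 = 12 tom_u2. Substituting [sum_Z] adds 25 L1 Lg2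
    / mu^2 to the coefficient of sum Y, the origin of 25 kappa^2 L1; [sum_Y] is substituted next.
    The total coefficient of sum A is at most C / 2, and a^2 C <= 1 lets [psum H K / 2] absorb
    it. *)
Lemma sum_G_le K : psum G K <= 2 * P 0 / a + 2 * X 0 / t + 12 * tu * (1 + tu) * t * S 0
  + 24 * tom_u2 * (L2 + 25 * (Lg2 / mu ^+ 2) * L1) * Y 0 / (mu * b)
  + 48 * tom_u2 * Lg2 * Z 0 / (mu * g)
  + 48 * tom_u2 * (1 + 6 * tl * tom) * (L2 + 25 * (Lg2 / mu ^+ 2) * L1) * b / (mu * nn) * s * K%:R
  + (2 * t / nn + 36 * tu * (1 + tu) * t ^+ 2
     + 72 * tom_u2 * (1 + 6 * tl * tom) * Lg2 * g / (mu * nn)) * s1 * K%:R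
  + 48 * tom_u2 * tl * (1 + 4 * tl) * (L2 + 25 * (Lg2 / mu ^+ 2) * L1) * b / (mu * nn) * My 0
  + 72 * tom_u2 * tl * (1 + 4 * tl) * Lg2 * g / (mu * nn) * Mz 0.
Proof.
have hG := sum_G K; have hX := sum_X K; have hM := sum_M K M00; have hS := sum_S K.
have hY := sum_Y K; have hZ := sum_Z K.
have A0 := psum_ge0 K A_0; have K0 : 0 <= (K%:R : R) by [].
have hH : psum A K * C <= psum H K.
  have -> : psum A K = a ^+ 2 * psum H K by rewrite /psum mulr_sumr.
  by rewrite mulrAC ler_piMl // psum_ge0.
have SY0 := psum_ge0 K.+1 Y_0; have SZ0 := psum_ge0 K.+1 Z_0.
have uu0 := mulr_ge0 tu0 tu0.
have hMS : 2 * psum M K <= 12 * tu * (1 + tu) * t * S 0 + 36 * tu * (1 + tu) * t ^+ 2 * s1 * K%:R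
    + 48 * tu * (1 + tu) * L5 * psum A K
    + 12 * (tom_u2 - 1) * (L2 * psum Y K.+1 + Lg2 * psum Z K.+1).
  have c0 : 0 <= 4 * tu * (1 + 2 * tu) by rewrite mulr_ge0 ?mulr_ge0 // addr_ge0 // mulr_ge0.
  have h1 := ler_wpM2l c0 hS.
  have tS := mulr_ge0 (ltW t0) (S_0 0).
  have g1 := mulr_ge0 tu0 tS; have g2 := mulr_ge0 tu0 g1.
  have v0 := mulr_ge0 (mulr_ge0 (sqr_ge0 t) s1_0) K0.
  have g3 := mulr_ge0 tu0 v0; have g4 := mulr_ge0 tu0 g3.
  have t1' : 0 <= 1 - t by rewrite subr_ge0.
  have g5 := mulr_ge0 t1' g3; have g6 := mulr_ge0 t1' g4.
  have g7 := mulr_ge0 tu0 (mulr_ge0 L5_0 A0); have g8 := mulr_ge0 tu0 g7.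
  have g9 := mulr_ge0 tu0 (mulr_ge0 L2_0 SY0); have g10 := mulr_ge0 tu0 g9.
  have g11 := mulr_ge0 tu0 (mulr_ge0 Lg2_0 SZ0); have g12 := mulr_ge0 tu0 g11.
  by rewrite /tom_u2; lra.
have hXX : 2 * psum X K <= 2 * X 0 / t + 12 * (L2 * psum Y K.+1 + Lg2 * psum Z K.+1)
    + 4 * Lp ^+ 2 / t ^+ 2 * psum A K + 2 * t / nn * s1 * K%:R.
  have h1 := ler_wpM2l L2_0 (sumYS K); have h2 := ler_wpM2l Lg2_0 (sumZS K).
  by lra.
have tu2 : 0 <= 12 * tom_u2 by rewrite mulr_ge0 // addr_ge0 // mulr_ge0 ?addr_ge0 // mulr_ge0.
set c1 := 12 * tom_u2 in tu2 *.
have hZ2 := ler_wpM2l (mulr_ge0 tu2 Lg2_0) hZ.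
set L := L2 + 25 * (Lg2 / mu ^+ 2) * L1.
have L_0 : 0 <= L.
  by rewrite addr_ge0 // mulr_ge0 // mulr_ge0 // divr_ge0 // sqr_ge0.
have hY2 := ler_wpM2l (mulr_ge0 tu2 L_0) hY.
have LE : c1 * Lg2 * (25 * L1 / mu ^+ 2 * psum Y K.+1) + c1 * L2 * psum Y K.+1 = c1 * L * psum Y K.+1.
  by rewrite /L; ring.
have CAE : psum A K * C / 2 = 4 * Lp ^+ 2 / t ^+ 2 * psum A K + 72 * tu * (1 + tu) * L5 * psum A K
   + c1 * L * ((4 * Ly ^+ 2 / (b ^+ 2 * mu ^+ 2) + 16 * tl * tom * L3 * b / (mu * nn)) * psum A K)
   + c1 * Lg2 * ((12 * Lz ^+ 2 / (g ^+ 2 * mu ^+ 2) + 72 * tl * tom * L4 * g / (mu * nn)) * psum A K).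
  by rewrite CE /c1 /L; field; rewrite !gt_eqF.
have g7 : 0 <= tu * (1 + tu) * L5 * psum A K by rewrite !mulr_ge0 // addr_ge0.
have tE : 12 * (tom_u2 - 1) = c1 - 12 by rewrite /c1; ring.
rewrite tE in hMS.
set YA := (_ + _) * psum A K in hY2 CAE.
set ZA := (_ + _) * psum A K in hZ2 CAE.
rewrite [leRHS](_ : _ = 2 * P 0 / a + 2 * X 0 / t + 12 * tu * (1 + tu) * t * S 0
  + c1 * L * (2 * Y 0 / (mu * b)) + c1 * Lg2 * (4 * Z 0 / (mu * g))
  + c1 * L * (4 * (1 + 6 * tl * tom) * b / (mu * nn) * s * K%:R)
  + (2 * t / nn * s1 * K%:R + 36 * tu * (1 + tu) * t ^+ 2 * s1 * K%:R
  + c1 * Lg2 * (6 * (1 + 6 * tl * tom) * g / (mu * nn) * s1 * K%:R))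
  + c1 * L * (4 * tl * (1 + 4 * tl) * b / (mu * nn) * My 0)
  + c1 * Lg2 * (6 * tl * (1 + 4 * tl) * g / (mu * nn) * Mz 0)); last by rewrite /c1; ring.
lra.
Qed.

End RealRecursions.

(** * The explicit bound *)

Section Bound.
Context {R : realType} {n dx dy : nat} {pb : problem R n dx dy}.
Context {cu : compressors R n dx} {cl : compressors R n dy} (D : draws pb cu cl).
Context (c : constants R) (sigma : R) (p : params R) (ini : inits R n dx dy).

(** Identifies the initial means E(D) of the statement with the exact gradients at the initial
    state. *)
Lemma mean_vec_noise J k (X : Omega D -> 'cV[R]_k) (m : 'cV[R]_k) v : fresh_draws D ->
  noise (@draw_system R n dx dy pb cu cl D) (Pr D) J (fun w => X w - m) v ->
  mean_vec (D := D) X = m.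
Proof.
move=> FD nX; have mX := noise_vmeas (@draw_setT _ _ _ _ _ _ _ D) (draw_measurable FD) nX.
have fX := noise_lty nX; have [_ X0 _] := nX.
apply/matrixP => j e; rewrite ord1 mxE unlock.
rewrite (_ : (\int[Pr D]_w (X w j 0)%:E)%E = (m j 0)%:E) //.
rewrite -[RHS]add0e -(X0 j) -(integral_EFin_cst (Pr D) (m j 0)) -integralD //.
- by apply: eq_integral => w _; rewrite -EFinD !mxE subrK.
- exact: integrable_coord.
- exact: finite_measure_integrable_cst.
Qed.

Context (st : standing c sigma D p ini).

Let n0 : (0 < n)%N. Proof. by case: st => [[]]. Qed.
Let dx0 : (0 < dx)%N. Proof. by case: st => [[]]. Qed.
Let dy0 : (0 < dy)%N. Proof. by case: st => [[]]. Qed.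
Let rd0 : (0 < rounds p)%N. Proof. by case: st => [[]]. Qed.
Let Hc : continuity pb c. Proof. by case: st => [_ [[]]]. Qed.
Let Hs : strong_convexity pb c. Proof. by case: st => [_ [[]]]. Qed.
Let SL : sampled_losses pb. Proof. by case: st => [_ [[]]]. Qed.
Let sg0 : 0 <= sigma. Proof. by case: st => [_ [[]]]. Qed.
Let SN : stochastic_noise pb sigma. Proof. by case: st => [_ [[]]]. Qed.
Let UCu : unbiased_compression cu (omega_u p). Proof. by case: st => [_ [_ [[]]]]. Qed.
Let UCl : unbiased_compression cl (omega_l p). Proof. by case: st => [_ [_ [[]]]]. Qed.
Let FD : fresh_draws D. Proof. by case: st => [_ [_ [[]]]]. Qed.
Let Hl : lipschitz_constants pb c. Proof. by case: st => [_ [_ [_ []]]]. Qed.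
Let Phi0 : forall x, 0 <= Phi pb x. Proof. by case: st => [_ [_ [_ [_ []]]]]. Qed.
Let a0 : 0 < alpha p. Proof. by case: st => [_ [_ [_ [_ [_ [[]]]]]]]. Qed.
Let b0 : 0 < beta p. Proof. by case: st => [_ [_ [_ [_ [_ [[]]]]]]]. Qed.
Let g0 : 0 < gamma p. Proof. by case: st => [_ [_ [_ [_ [_ [[]]]]]]]. Qed.
Let t01 : 0 < theta p <= 1. Proof. by case: st => [_ [_ [_ [_ [_ [[]]]]]]]. Qed.
Let z0_le : enorm (z0 ini) <= rho p. Proof. by case: st => [_ [_ [_ [_ [_ [_ []]]]]]]. Qed.
Let mh : forall i, mx0 ini i = hx0 ini i. Proof. by case: st => [_ [_ [_ [_ [_ [_ []]]]]]]. Qed.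

Let sT := @draw_setT R n dx dy pb cu cl D.
Let i0 := init_state ini.

Lemma EDx0_mean i : EDx0 D p ini i = mDxs pb i i0.
Proof.
exact: (mean_vec_noise FD (noise_Dx rd0 SL SN FD z0_le i 0 (s := i0) erefl erefl erefl)).
Qed.

Lemma EDz0_mean i : EDz0 D p ini i = mDzs pb i i0.
Proof.
exact: (mean_vec_noise FD (noise_Dz rd0 SL SN FD z0_le i 0 (s := i0) erefl erefl erefl)).
Qed.

Lemma EDy0_mean i : EDy0 D p ini i = mDys pb i i0.
Proof.
exact: (mean_vec_noise FD (noise_Dy rd0 SL SN FD i 0 (s := i0) erefl erefl)).
Qed.

Context (rho_ge : cf c / mug c <= rho p).
Context (bL : beta p <= 2 / (mug c + Lg c)).
Context (bE : beta p * (96 * tom_l p * tom1 p * Lg c ^+ 2) <= mug c * n%:R).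
Context (gL : gamma p <= 1 / Lg c).
Context (gE : gamma p * (432 * tom_l p * tom1 p * Lg c ^+ 2) <= mug c * n%:R).
Context (dlE : delta_l p = (1 + tom_l p)^-1) (duE : delta_u p = (1 + tom_u p)^-1).
Context (aL : alpha p * (2 * LPhi c) <= 1) (aC : alpha p ^+ 2 * C4_inv_sq n c p <= 1).

Lemma avg_sq_grad_le K : (0 < K)%N ->
    (avg_sq_grad D p ini K <=
      (2 * DelPhi pb ini / (K%:R * alpha p)
       + 2 * Delx pb ini / (K%:R * theta p)
       + 12 * tom_u p * (1 + tom_u p) * theta p * Delh D p ini / K%:R
       + 24 * tom2 p * (L2sq c p + 25 * kappa c ^+ 2 * L1sq c p) * Dely pb ini
           / (mug c * K%:R * beta p)
       + 48 * tom2 p * Lg c ^+ 2 * Delz pb ini / (mug c * K%:R * gamma p)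
       + 48 * tom2 p * (1 + 6 * tom_l p * tom1 p)
           * (L2sq c p + 25 * kappa c ^+ 2 * L1sq c p) * beta p
           / (mug c * n%:R) * tsigsq sigma p
       + (2 * theta p / n%:R + 36 * tom_u p * (1 + tom_u p) * theta p ^+ 2
          + 72 * tom2 p * (1 + 6 * tom_l p * tom1 p) * Lg c ^+ 2 * gamma p
              / (mug c * n%:R)) * tsig1sq sigma p
       + 48 * tom2 p * tom_l p * (1 + 4 * tom_l p)
           * (L2sq c p + 25 * kappa c ^+ 2 * L1sq c p) * beta p
           / (mug c * K%:R * n%:R ^+ 2)
           * \sum_i enorm (EDy0 D p ini i - my0 ini i) ^+ 2
       + 72 * tom2 p * tom_l p * (1 + 4 * tom_l p) * Lg c ^+ 2 * gamma p
           / (mug c * K%:R * n%:R ^+ 2)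
           * \sum_i enorm (EDz0 D p ini i - mz0 ini i) ^+ 2)%:E)%E.
Proof.
move=> K0; have m0 := mug_gt0 Hs; have Lg0 := Lg_gt0 n0 dy0 Hc Hs.
have mL := mug_le_Lg n0 dy0 Hc Hs.
have gL' : gamma p <= 2 / (mug c + Lg c).
  apply: le_trans gL _; rewrite ler_pdivlMr ?addr_gt0 // mulrAC ler_pdivrMr //; lra.
have fin := finite_moments_all n0 dy0 rd0 Hc Hs Hl SL SN UCu UCl FD rho_ge z0_le
  dlE duE Phi0 a0 b0 g0 t01 aL bL gL'.
have hG k := moment_fG n0 dy0 rd0 Hc Hs Hl SL UCu UCl FD rho_ge z0_le Phi0 a0 aL (fin k).
have avgE : avg_sq_grad D p ini K = (K%:R^-1 * psum (Ev D p ini (fG pb)) K)%:E.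
  rewrite /avg_sq_grad EFinM -sumEFin; congr (_ * _)%E; apply: eq_bigr => k _.
  by rewrite unlock; have [_ _ h] := hG k; rewrite -h.
rewrite avgE lee_fin; set B := (X in _ <= X).
suff h : psum (Ev D p ini (fG pb)) K <= K%:R * B by rewrite ler_pdivrMl ?ltr0n.
have rP k := rec_P n0 dy0 rd0 Hc Hs Hl SL UCu UCl FD rho_ge z0_le Phi0 a0 aL (fin k).
have rX k := rec_X n0 dy0 rd0 Hc Hs Hl SL SN UCu UCl FD rho_ge z0_le Phi0 a0 t01 aL (fin k).
have rM k := rec_M n0 dy0 rd0 Hc Hs SL SN UCu UCl FD rho_ge z0_le duE (fin k).
have rS k := rec_S n0 dy0 rd0 Hc Hs Hl SL SN UCu UCl FD rho_ge z0_le Phi0 a0 b0 g0 t01 aL bL gL'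
  (fin k).
have rY k := rec_Y n0 dy0 rd0 Hc Hs Hl SL SN UCu UCl FD rho_ge z0_le Phi0 a0 b0 aL bL (fin k).
have rZ k := rec_Z n0 dy0 rd0 Hc Hs Hl SL SN UCu UCl FD rho_ge z0_le Phi0 a0 g0 aL gL' (fin k).
have rMy k := rec_My n0 dy0 rd0 Hc Hs Hl SL SN UCu UCl FD rho_ge z0_le dlE Phi0 a0 b0 aL bL
  (fin k).
have rMz k := rec_Mz n0 dy0 rd0 Hc Hs Hl SL SN UCu UCl FD rho_ge z0_le dlE Phi0 a0 b0 g0 aL bL gL'
  (fin k).
have hH k := moment_fH n0 dy0 rd0 Hc Hs Hl SL UCu UCl FD rho_ge z0_le Phi0 a0 aL (fin k).
have H_0 k := hasE_ge0 (hH k).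
have P_0 k : 0 <= Ev D p ini (fP pb) k by case: (fin k) => -[h _ _ _] _ _ _ _; exact: hasE_ge0 h.
have X_0 k : 0 <= Ev D p ini (fX pb) k by case: (fin k) => -[_ h _ _] _ _ _ _; exact: hasE_ge0 h.
have M_0 k : 0 <= Ev D p ini (@fM R n dx dy) k
  by case: (fin k) => -[_ _ h _] _ _ _ _; exact: hasE_ge0 h.
have S_0 k : 0 <= Ev D p ini (fS pb) k by case: (fin k) => -[_ _ _ h] _ _ _ _; exact: hasE_ge0 h.
have Y_0 k : 0 <= Ev D p ini (fY pb) k by case: (fin k) => _ h _ _ _; exact: hasE_ge0 h.
have Z_0 k : 0 <= Ev D p ini (fZ pb) k by case: (fin k) => _ _ h _ _; exact: hasE_ge0 h.
have My_0 k : 0 <= Ev D p ini (fMy pb) k by case: (fin k) => _ _ _ h _; exact: hasE_ge0 h.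
have Mz_0 k : 0 <= Ev D p ini (fMz pb) k by case: (fin k) => _ _ _ _ h; exact: hasE_ge0 h.
have [t0 t1] := andP t01.
have nn0 : 0 < (n%:R : R) by rewrite ltr0n.
have tl0 : 0 <= tom_l p := tomega_ge0 (omega_l_ge0 UCl) _.
have tu0 : 0 <= tom_u p := tomega_ge0 (omega_u_ge0 UCu) _.
have s_0 : 0 <= tsigsq sigma p by rewrite divr_ge0 ?sqr_ge0.
have s1_0 : 0 <= tsig1sq sigma p.
  by rewrite divr_ge0 // mulr_ge0 ?sqr_ge0 // addr_ge0 ?sqr_ge0.
have L1_0 : 0 <= L1sq c p := L1sq_ge0 c p; have L2_0 : 0 <= L2sq c p := L2sq_ge0 c p.
have Lext (L : R) : 0 <= L -> 0 <= L * (1 + 3 * Lys c ^+ 2) + 3 * Lg c ^+ 2 * Lzs c ^+ 2.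
  move=> L0; apply: addr_ge0; apply: mulr_ge0 => //; rewrite ?sqr_ge0 //.
    by rewrite addr_ge0 // mulr_ge0 ?sqr_ge0.
  by rewrite mulr_ge0 ?sqr_ge0.
have L3_0 : 0 <= L3sq c by rewrite mulr_ge0 ?sqr_ge0 // addr_ge0 // mulr_ge0 ?sqr_ge0.
have bmu : beta p * mug c <= 1 by rewrite (step_le1 n0 dy0 Hc Hs) // ltW.
have gmu : gamma p * mug c <= 1 by rewrite (step_le1 n0 dy0 Hc Hs) // ltW.
have muLg : mug c ^+ 2 <= Lg c ^+ 2 by rewrite ler_pXn2r ?nnegrE // ltW.
have kE : kappa c ^+ 2 = Lg c ^+ 2 / mug c ^+ 2 by rewrite /kappa expr_div_n.
have CE : C4_inv_sq n c p = 2 * (4 * LPhi c ^+ 2 / theta p ^+ 2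
   + 72 * tom_u p * (1 + tom_u p) * L5sq c p
   + 12 * (1 + 36 * tom_u p * (1 + tom_u p)) * (L2sq c p + 25 * (Lg c ^+ 2 / mug c ^+ 2) * L1sq c p)
     * (4 * Lys c ^+ 2 / (beta p ^+ 2 * mug c ^+ 2)
        + 16 * tom_l p * tom1 p * L3sq c * beta p / (mug c * n%:R))
   + 12 * (1 + 36 * tom_u p * (1 + tom_u p)) * Lg c ^+ 2
     * (12 * Lzs c ^+ 2 / (gamma p ^+ 2 * mug c ^+ 2)
        + 72 * tom_l p * tom1 p * L4sq c p * gamma p / (mug c * n%:R))) by rewrite -kE.
have M00 : Ev D p ini (@fM R n dx dy) 0 = 0.
  rewrite Ev0 /fM /avg_sq big1 ?mulr0 // => i _.
  by rewrite /= mh subrr enorm0 expr0n.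
have := sum_G_le P_0 H_0 X_0 M_0 S_0 Y_0 Z_0 My_0 Mz_0 a0 b0 g0 t0 t1 m0 nn0 tl0 tu0 dlE
  (erefl (tom1 p)) s_0 s1_0 (sqr_ge0 (Lg c)) L1_0 L2_0 L3_0 (Lext _ L1_0) (Lext _ L2_0)
  bmu gmu muLg rP rX rM rS rY rZ rMy rMz bE gE CE aC M00 K.
move=> /le_trans; apply; rewrite le_eqVlt; apply/orP; left; apply/eqP.
rewrite !Ev0 -kE /B.
rewrite (_ : fS pb _ = Delh D p ini); last first.
  by rewrite /fS /gS /Delh /avg_sq; congr (_ * _); apply: eq_bigr => i _; rewrite EDx0_mean.
rewrite (_ : fMy pb _ = n%:R^-1 * \sum_i enorm (EDy0 D p ini i - my0 ini i) ^+ 2); last first.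
  by rewrite /fMy /gMy /avg_sq; congr (_ * _); apply: eq_bigr => i _; rewrite EDy0_mean.
rewrite (_ : fMz pb _ = n%:R^-1 * \sum_i enorm (EDz0 D p ini i - mz0 ini i) ^+ 2); last first.
  by rewrite /fMz /gMz /avg_sq; congr (_ * _); apply: eq_bigr => i _; rewrite EDz0_mean.
rewrite (_ : fP pb _ = DelPhi pb ini) // (_ : fX pb _ = Delx pb ini) //.
rewrite (_ : fY pb _ = Dely pb ini) // (_ : fZ pb _ = Delz pb ini) //.
rewrite -/(tom2 p).
move: (\sum_i enorm (EDy0 D p ini i - _) ^+ 2) (\sum_i enorm (EDz0 D p ini i - _) ^+ 2) => u v.
move: (DelPhi pb ini) (Delx pb ini) (Delh D p ini) (Dely pb ini) (Delz pb ini) => d1 d2 d3 d4 d5.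
move: (L2sq c p + _) (tom1 p) (tom2 p) (tom_l p) (tom_u p) (tsigsq sigma p) (tsig1sq sigma p).
move=> e1 e2 e3 e4 e5 e6 e7.
have K1 : 0 < (K%:R : R) by rewrite ltr0n.
by field; rewrite !gt_eqF.
Qed.

End Bound.

(** * Order of convergence *)

Section CompressionRate.
Context {R : realType}.

(** ln (1 + x) <= x at x = -1/2 gives ln 2 >= 1/2, hence ln 4 >= 1. *)
Lemma ln_ge1 (x : R) : 4 <= x -> 1 <= ln x.
Proof.
move=> x4; have h : ln (2^-1 : R) <= - 2^-1.
  by have := @le_ln1Dx R (- 2^-1); rewrite (_ : 1 + - 2^-1 = 2^-1 :> R); [apply; lra|lra].
rewrite lnV ?posrE // in h.
have : ln (2 ^+ 2 : R) <= ln x by rewrite ler_ln ?posrE //; lra.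
rewrite lnXn // mulr2n; lra.
Qed.

(** q = 1 - 1 / (1 + w) <= exp (- 1 / (1 + w)), so r >= 4 (1 + w) ln a gives q^r <= a^-4. The spare
    factor 1 / a pays for w in the first entry of the maximum and for 1 / (1 - q^r) in the
    second. *)
Lemma tomega_le (w a : R) (r : nat) : 0 <= w -> 4 * (1 + w) <= a ->
  4 * (1 + w) * ln a <= r%:R -> tomega w r <= (a ^+ 3)^-1.
Proof.
move=> w0 wa hr; have w1 : 0 < 1 + w by rewrite ltr_wpDr.
have a4 : 4 <= a by lra.
have a0 : 0 < a by lra.
rewrite /tomega; set q := w / (1 + w).
have q0 : 0 <= q by rewrite divr_ge0 // ltW.
have qe : q <= expR (- (1 + w)^-1).
  rewrite (_ : q = 1 + - (1 + w)^-1); first exact: expR_ge1Dx.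
  by rewrite /q; field; rewrite gt_eqF.
have qr : q ^+ r <= (a ^+ 4)^-1.
  apply: (@le_trans _ _ (expR (- (1 + w)^-1) ^+ r)).
    by rewrite lerXn2r ?nnegrE ?expR_ge0.
  rewrite -expRM_natr (_ : (a ^+ 4)^-1 = expR (- (4 * ln a))); last first.
    by rewrite expRN mulrC expRM_natr lnK ?posrE.
  by rewrite ler_expR mulNr lerN2 ler_pdivlMl // mulrA [_ * 4]mulrC.
have p3 : 0 < a ^+ 3 by rewrite exprn_gt0.
have p4 : 0 < a ^+ 4 by rewrite exprn_gt0.
have i4 : (a ^+ 4)^-1 = (a ^+ 3)^-1 * a^-1 by rewrite exprS invfM mulrC.
have ai : 0 < a^-1 by rewrite invr_gt0.
have ai4 : a^-1 <= 4^-1 by rewrite lef_pV2 ?posrE.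
have i3 : 0 < (a ^+ 3)^-1 by rewrite invr_gt0.
have i31 : (a ^+ 3)^-1 <= 1.
  by rewrite invf_le1 // exprn_ege1 //; lra.
rewrite ge_max; apply/andP; split.
  apply: (@le_trans _ _ (w * (a ^+ 4)^-1)); first by rewrite ler_wpM2l.
  rewrite i4 mulrCA ler_piMr ?(ltW i3) // ler_pdivrMr // mul1r; lra.
have q4 : q ^+ r <= 4^-1 by apply: (le_trans qr); rewrite i4; nra.
have d0 : 0 < 1 - q ^+ r by lra.
rewrite ler_pdivrMr //; apply: (le_trans qr); rewrite i4 ler_wpM2l ?(ltW i3) //; lra.
Qed.

End CompressionRate.

(** a <= (1 + a)^2; using 1 + a instead of the root of a keeps the order constants free of roots. *)
Lemma sqrt_le_linear (R : rcfType) (e a u : R) : 0 <= a -> 0 <= u -> e <= a * u ^+ 2 ->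
  Num.sqrt e <= (1 + a) * u.
Proof.
move=> a0 u0 eau; have au : 0 <= (1 + a) * u by rewrite mulr_ge0 // addr_ge0.
rewrite -[leRHS]ger0_norm // -sqrtr_sqr ler_wsqrtr // (le_trans eau) //.
have h := mulr_ge0 (mulr_ge0 a0 (sqr_ge0 u)) a0; have h' := sqr_ge0 u.
have h2 := mulr_ge0 a0 (sqr_ge0 u).
lra.
Qed.

(* A step size b <= 1 / sqrt e balances a noise level X proportional to e. *)
Lemma step_noise_le (R : rcfType) (b e d X z : R) : 0 <= e -> b * Num.sqrt e <= 1 ->
  0 <= b -> 0 <= d -> X <= e * d -> Num.sqrt e <= z -> b * X <= z * d.
Proof.
move=> e0 be b0 d0 Xe ez; apply: (le_trans (ler_wpM2l b0 Xe)).
rewrite -{1}(sqr_sqrtr e0) expr2 !mulrA ler_wpM2r // (le_trans _ ez) //.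
by rewrite ler_piMl // sqrtr_ge0.
Qed.

(** * Orders of the chosen step sizes *)

Section OrderBound.
Context {R : realType}.
Context (mu L LP Ly Lz L1 L2 L3 L4 L5 r1 q : R).

Definition coupling := L2 + 25 * (L / mu) ^+ 2 * L1.

(* With tl, tu <= 1, [beta_order] (1 + u) dominates 1 / beta, and likewise for gamma, theta;
   [C4_order] (1 + u)^2 dominates 1 / C4^2. *)
Definition beta_order := (mu + L) / 2 + 1248 * L ^+ 2 / mu + (1 + 10 * q) + (1 + 158 * q).
Definition gamma_order := L + 5616 * L ^+ 2 / mu + (1 + 8 * q) + (1 + 79 * r1 * q).
Definition theta_order := 1 + (1 + 12 * q) + (1 + r1 * q) + (1 + 72 * r1 * q).
Definition step_order := beta_order + gamma_order + theta_order + 2 / (mu + L) + 1 / L.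
Definition C4_order := 2 * (4 * LP ^+ 2 * step_order ^+ 2 + 144 * L5
  + 876 * coupling * (4 * Ly ^+ 2 / mu ^+ 2 * step_order ^+ 2 + 208 * L3 * step_order / mu)
  + 876 * L ^+ 2 * (12 * Lz ^+ 2 / mu ^+ 2 * step_order ^+ 2 + 936 * L4 * step_order / mu)).
Definition order_const :=
  step_order + (2 * LP + (1 + C4_order)) + coupling / mu + L ^+ 2 / mu.

Context (mu0 : 0 < mu) (L0 : 0 < L) (LP0 : 0 < LP) (L1_0 : 0 <= L1) (L2_0 : 0 <= L2).
Context (L3_0 : 0 <= L3) (L4_0 : 0 <= L4) (L5_0 : 0 <= L5) (r1_1 : 1 <= r1) (q1 : 1 <= q).

Context (n K tl tu D u s t1 t2 C a b g t dP dx dh dy dz dmy dmz : R).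
Context (n1 : 1 <= n) (K0 : 0 < K) (tl0 : 0 <= tl) (tl1 : tl <= 1) (tu0 : 0 <= tu) (tu1 : tu <= 1).
Context (D0 : 0 < D) (u0 : 0 < u) (s0 : 0 < s) (u2E : u ^+ 2 * (n * D) = K * s).
Context (ntu : n * tu <= 2 * u).
Context (t1E : t1 = 1 + 6 * tl * (1 + tl)) (t2E : t2 = 1 + 36 * tu * (1 + tu)).
Context (dPD : dP <= D) (dx0 : 0 < dx) (dxD : dx <= D) (dh0 : 0 <= dh) (dhD : dh <= D).
Context (dP0 : 0 <= dP) (dy0 : 0 < dy) (dyD : dy <= D) (dz0 : 0 < dz) (dzD : dz <= D).
Context (dmy0 : 0 <= dmy) (dmyD : dmy <= D) (dmz0 : 0 <= dmz) (dmzD : dmz <= D).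
Context (Dx : D <= q * dx) (Dy : D <= q * dy) (Dz : D <= q * dz).
Context (bE : b = ((mu + L) / 2 + 96 * tl * t1 * L ^+ 2 / (mu * n)
  + Num.sqrt (2 * tl * (1 + 4 * tl) * dmy / (n * dy))
  + Num.sqrt (2 * K * s * (1 + 6 * tl * t1) / (n * dy)))^-1).
Context (gE : g = (L + 432 * tl * t1 * L ^+ 2 / (mu * n)
  + Num.sqrt (3 * tl * (1 + 4 * tl) * dmz / (2 * n * dz))
  + Num.sqrt (K * (r1 * s) * (1 + 6 * tl * t1) / (n * dz)))^-1).
Context (tE : t = (1 + Num.sqrt (6 * tu * (1 + tu) * dh / dx)
  + Num.sqrt (K * (r1 * s) / (n * dx))
  + (18 * tu * (1 + tu) * K * (r1 * s) / dx) `^ (3^-1))^-1).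
Context (CE : C = 2 * (4 * LP ^+ 2 / t ^+ 2 + 72 * tu * (1 + tu) * L5
  + 12 * t2 * coupling * (4 * Ly ^+ 2 / (b ^+ 2 * mu ^+ 2) + 16 * tl * t1 * L3 * b / (mu * n))
  + 12 * t2 * L ^+ 2 * (12 * Lz ^+ 2 / (g ^+ 2 * mu ^+ 2) + 72 * tl * t1 * L4 * g / (mu * n)))).
Context (aE : a = (2 * LP + Num.sqrt C)^-1).

Let n0 : 0 < n. Proof. exact: lt_le_trans n1. Qed.
Let r10 : 0 < r1. Proof. exact: lt_le_trans r1_1. Qed.
Let q0 : 0 < q. Proof. exact: lt_le_trans q1. Qed.
Let muL0 : 0 < mu + L. Proof. exact: addr_gt0. Qed.
Let Lmu0 : 0 <= L ^+ 2 / mu. Proof. by rewrite divr_ge0 ?sqr_ge0 // ltW. Qed.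
Let tl2 : 0 <= tl * tl. Proof. exact: mulr_ge0. Qed.
Let tl2' : tl * tl <= tl. Proof. by rewrite ler_piMl. Qed.
Let t1_ge : 1 <= t1. Proof. by rewrite t1E; move: tl0 tl1 tl2 tl2'; lra. Qed.
Let t1_le : t1 <= 13. Proof. by rewrite t1E; move: tl0 tl1 tl2 tl2'; lra. Qed.
(** 13 = 1 + 6 * 2 bounds t1 once tl <= 1. It is the source of 1248 = 96 * 13 and 5616 = 432 * 13,
    and of 79 = 1 + 6 * 13 in the noise terms. *)
Let tlt1 : tl * t1 <= 13.
Proof. by rewrite -[13]mul1r ler_pM // (le_trans _ t1_ge). Qed.
Let tlt1_0 : 0 <= tl * t1. Proof. by rewrite mulr_ge0 // (le_trans _ t1_ge). Qed.
Let tu2 : 0 <= tu * tu. Proof. exact: mulr_ge0. Qed.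
Let tu2' : tu * tu <= tu. Proof. by rewrite ler_piMl. Qed.
Let t2_ge : 1 <= t2. Proof. by rewrite t2E; move: tu0 tu1 tu2 tu2'; lra. Qed.
Let t2_le : t2 <= 73. Proof. by rewrite t2E; move: tu0 tu1 tu2 tu2'; lra. Qed.
Let c_0 : 0 <= coupling.
Proof. by rewrite addr_ge0 // mulr_ge0 // mulr_ge0 // sqr_ge0. Qed.

(** The step sizes divide by initial errors y; D <= q y turns any quotient of a multiple of D by
    such an error into a multiple of q. *)
Let frac_le (x y e k : R) : 0 < y -> D <= q * y -> 0 <= x -> x <= k * D -> e = x / (n * y) -> e <= k * q.
Proof.
move=> y0 Dy' x0 xk ->; rewrite ler_pdivrMr ?mulr_gt0 //.
have k0 : 0 <= k by rewrite -(pmulr_lge0 k D0) (le_trans x0).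
apply: (le_trans xk); rewrite -mulrA; apply: ler_wpM2l => //.
by apply: (le_trans Dy'); rewrite ler_wpM2l ?(ltW q0) // ler_peMl ?(ltW y0).
Qed.

(** K s = u^2 n D, so noise divided by n y becomes a multiple of u^2. *)
Let noise_frac_le (y e k f : R) : 0 < y -> D <= q * y -> 0 <= f -> f <= k ->
  e = K * s * f / (n * y) -> e <= k * q * u ^+ 2.
Proof.
move=> y0 Dy' f0 fk ->; rewrite ler_pdivrMr ?mulr_gt0 // -u2E.
have h : f * D <= k * (q * y) by apply: ler_pM => //; exact: ltW.
have h2 : 0 <= u ^+ 2 * n by rewrite mulr_ge0 ?sqr_ge0 // ltW.
have := ler_wpM2l h2 h; lra.
Qed.

Let eb1 := 2 * tl * (1 + 4 * tl) * dmy / (n * dy).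
Let eb2 := 2 * K * s * (1 + 6 * tl * t1) / (n * dy).
Let eg1 := 3 * tl * (1 + 4 * tl) * dmz / (2 * n * dz).
Let eg2 := K * (r1 * s) * (1 + 6 * tl * t1) / (n * dz).
Let et1 := 6 * tu * (1 + tu) * dh / dx.
Let et2 := K * (r1 * s) / (n * dx).
Let et3 := 18 * tu * (1 + tu) * K * (r1 * s) / dx.
Let bb := 96 * tl * t1 * L ^+ 2 / (mu * n).
Let gg := 432 * tl * t1 * L ^+ 2 / (mu * n).

Let const_le (e k : R) : 0 <= k -> e <= k -> Num.sqrt e <= 1 + k.
Proof. by move=> k0 ek; have := @sqrt_le_linear R e k 1 k0 ler01; rewrite expr1n !mulr1; apply. Qed.

Let lin_frac (k : R) : 0 <= k -> k * (tl * t1) * L ^+ 2 / (mu * n) <= k * 13 * (L ^+ 2 / mu).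
Proof.
move=> k0; rewrite [leLHS](_ : _ = k * (tl * t1) * (L ^+ 2 / mu) * n^-1); last first.
  by field; rewrite !gt_eqF.
have ni : n^-1 <= 1 by rewrite invf_le1.
apply: (@le_trans _ _ (k * (tl * t1) * (L ^+ 2 / mu))).
  by rewrite ler_piMr // mulr_ge0 // mulr_ge0.
by rewrite ler_wpM2r // ler_wpM2l.
Qed.

Let tlf : 0 <= tl * (1 + 4 * tl). Proof. by rewrite mulr_ge0 // addr_ge0 // mulr_ge0. Qed.
Let tlf5 : tl * (1 + 4 * tl) <= 5. Proof. move: tl1 tl2'; lra. Qed.
Let tuf : 0 <= tu * (1 + tu). Proof. by rewrite mulr_ge0 // addr_ge0. Qed.
Let tuf2 : tu * (1 + tu) <= 2. Proof. move: tu1 tu2'; lra. Qed.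

Let sb1 : Num.sqrt eb1 <= 1 + 10 * q.
Proof.
apply: const_le; first by rewrite mulr_ge0 // ltW.
apply: (frac_le dy0 Dy _ _ (erefl _)); first by rewrite mulr_ge0 // -mulrA mulr_ge0.
by apply: ler_pM => //; rewrite -mulrA; [rewrite mulr_ge0|move: tlf5; lra].
Qed.

Let sb2 : Num.sqrt eb2 <= (1 + 158 * q) * u.
Proof.
apply: sqrt_le_linear; [by rewrite mulr_ge0 // ltW|exact: ltW|].
apply: (@noise_frac_le dy _ _ (2 * (1 + 6 * tl * t1))) => //.
- by rewrite mulr_ge0 // addr_ge0 // -mulrA mulr_ge0.
- by have := tlt1; lra.
- by rewrite /eb2; field; rewrite !gt_eqF.
Qed.

Let sg1 : Num.sqrt eg1 <= 1 + 8 * q.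
Proof.
apply: const_le; first by rewrite mulr_ge0 // ltW.
apply: (@frac_le (3 / 2 * (tl * (1 + 4 * tl)) * dmz) dz) => //.
- by rewrite mulr_ge0 // mulr_ge0.
- apply: ler_pM => //; first by rewrite mulr_ge0.
  by move: tlf5; lra.
- by rewrite /eg1; field; rewrite !gt_eqF.
Qed.

Let sg2 : Num.sqrt eg2 <= (1 + 79 * r1 * q) * u.
Proof.
apply: sqrt_le_linear; [by rewrite !mulr_ge0 // ltW|exact: ltW|].
apply: (@noise_frac_le dz _ _ (r1 * (1 + 6 * tl * t1))) => //.
- by rewrite mulr_ge0 ?(ltW r10) // addr_ge0 // -mulrA mulr_ge0.
- by rewrite mulrC ler_wpM2r ?(ltW r10) //; have := tlt1; lra.
- by rewrite /eg2; field; rewrite !gt_eqF.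
Qed.

Let st1 : Num.sqrt et1 <= 1 + 12 * q.
Proof.
apply: const_le; first by rewrite mulr_ge0 // ltW.
rewrite /et1 ler_pdivrMr // -[12 * _ * _]mulrA.
have h : dh <= q * dx := le_trans dhD Dx.
rewrite -[6 * _ * _]mulrA; apply: ler_pM => //; first by rewrite mulr_ge0.
  by move: tuf2; lra.
Qed.

Let st2 : Num.sqrt et2 <= (1 + r1 * q) * u.
Proof.
apply: sqrt_le_linear; [by rewrite !mulr_ge0 // ltW|exact: ltW|].
apply: (@noise_frac_le dx _ _ r1) => //; first exact: ltW.
by rewrite /et2; field; rewrite !gt_eqF.
Qed.

Let et3_0 : 0 <= et3.
Proof.
have rs : 0 <= r1 * s by rewrite mulr_ge0 // ltW.
rewrite /et3 divr_ge0 ?(ltW dx0) // mulr_ge0 // mulr_ge0 ?(ltW K0) //.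
by rewrite -mulrA mulr_ge0.
Qed.

Let y := et3 `^ (3^-1).
Let y0 : 0 <= y. Proof. exact: powR_ge0. Qed.
Let y3 : y ^+ 3 = et3.
Proof. by rewrite /y -powR_mulrn ?powR_ge0 // -powRrM mulVf ?powRr1. Qed.

(** K s = u^2 n D together with n tu <= 2 u extracts a third power of u from [et3], with constant 18
    * 2 * 2 = 72; finally k <= (1 + k)^3. *)
Let y_le : y <= (1 + 72 * r1 * q) * u.
Proof.
have k0 : 0 <= 72 * r1 * q by rewrite !mulr_ge0 // ltW.
have yu : 0 <= (1 + 72 * r1 * q) * u by rewrite mulr_ge0 ?(ltW u0) // addr_ge0.
rewrite -(@ler_pXn2r _ 3) ?nnegrE // y3 exprMn.
have e3 : et3 <= 72 * r1 * q * u ^+ 3.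
  rewrite /et3 ler_pdivrMr //.
  have h1 : tu * (1 + tu) <= 2 * tu by move: tu2'; lra.
  have h2 : 18 * tu * (1 + tu) * K * (r1 * s) = 18 * r1 * (tu * (1 + tu)) * (u ^+ 2 * (n * D)).
    by rewrite u2E; ring.
  rewrite h2; have un : 0 <= u ^+ 2 * (n * D) by rewrite u2E mulr_ge0 // ltW.
  apply: (@le_trans _ _ (18 * r1 * (2 * tu) * (u ^+ 2 * (n * D)))).
    by rewrite ler_wpM2r // ler_wpM2l // mulr_ge0 // ltW.
  have h3 : (n * tu) * D <= (2 * u) * (q * dx).
    by apply: ler_pM => //; [rewrite mulr_ge0 // ltW|exact: ltW].
  have ru : 0 <= 36 * r1 * u ^+ 2 by rewrite mulr_ge0 ?sqr_ge0 // mulr_ge0 // ltW.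
  have := ler_wpM2l ru h3; lra.
apply: (le_trans e3); rewrite ler_wpM2r ?exprn_ge0 ?(ltW u0) //.
have := mulr_ge0 k0 k0; have := mulr_ge0 k0 (mulr_ge0 k0 k0); move: k0.
by move: (72 * r1 * q) => k k0 k3 k2; lra.
Qed.

Let bb0 : 0 <= bb.
Proof.
apply: divr_ge0; last by rewrite mulr_ge0 // ltW.
rewrite -(mulrA _ tl t1); apply: mulr_ge0; last exact: sqr_ge0.
exact: mulr_ge0 (ler0n _ _) tlt1_0.
Qed.
Let gg0 : 0 <= gg.
Proof.
apply: divr_ge0; last by rewrite mulr_ge0 // ltW.
rewrite -(mulrA _ tl t1); apply: mulr_ge0; last exact: sqr_ge0.
exact: mulr_ge0 (ler0n _ _) tlt1_0.
Qed.

(** A step size is the inverse of a sum, so its product with each summand is at most 1. The constant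
    summands give admissibility, the square roots the noise estimates. *)
Let parts (x1 x2 x3 x4 z : R) : 0 < x1 -> 0 <= x2 -> 0 <= x3 -> 0 <= x4 -> z = (x1 + x2 + x3 + x4)^-1 ->
  [/\ 0 < z, z * x1 <= 1, z * x2 <= 1, z * x3 <= 1 & z * x4 <= 1].
Proof.
move=> h1 h2 h3 h4 ->; have h : 0 < x1 + x2 + x3 + x4 by rewrite !ltr_wpDr.
split; first by rewrite invr_gt0.
all: by rewrite ler_pdivrMl // mulr1; lra.
Qed.

Let muL2 : 0 < (mu + L) / 2. Proof. by rewrite divr_gt0. Qed.
Let bP := parts muL2 bb0 (sqrtr_ge0 eb1) (sqrtr_ge0 eb2) bE.
Let gP := parts L0 gg0 (sqrtr_ge0 eg1) (sqrtr_ge0 eg2) gE.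
Let tP := parts ltr01 (sqrtr_ge0 et1) (sqrtr_ge0 et2) y0 tE.

Lemma beta_admissible : b <= 2 / (mu + L) /\ b * (96 * tl * t1 * L ^+ 2) <= mu * n.
Proof.
have [h0 h1 h2 _ _] := bP; split; first by rewrite ler_pdivlMr //; lra.
by move: h2; rewrite /bb mulrA ler_pdivrMr ?mulr_gt0 // mul1r.
Qed.

Lemma gamma_admissible : g <= 1 / L /\ g * (432 * tl * t1 * L ^+ 2) <= mu * n.
Proof.
have [h0 h1 h2 _ _] := gP; split; first by rewrite ler_pdivlMr.
by move: h2; rewrite /gg mulrA ler_pdivrMr ?mulr_gt0 // mul1r.
Qed.

Let step0 : 1 <= step_order.
Proof.
have h : 0 <= 2 / (mu + L) + 1 / L by rewrite addr_ge0 // divr_ge0 // ltW.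
have h1 := mulr_ge0 (ltW r10) (ltW q0).
rewrite /step_order /beta_order /gamma_order /theta_order.
move: h h1 Lmu0 mu0 L0 (ltW q0); lra.
Qed.

Let order_sum (x1 x2 x3 x4 z k1 k2 k3 k4 : R) : z = (x1 + x2 + x3 + x4)^-1 ->
  x1 <= k1 -> x2 <= k2 -> x3 <= k3 -> x4 <= k4 * u -> 0 <= k1 -> 0 <= k2 -> 0 <= k3 -> 0 <= k4 ->
  k1 + k2 + k3 + k4 <= step_order -> z^-1 <= step_order * (1 + u).
Proof.
move=> -> h1 h2 h3 h4 g1 g2 g3 g4 h; rewrite invrK.
apply: (@le_trans _ _ ((k1 + k2 + k3 + k4) * (1 + u))); last first.
  by rewrite ler_wpM2r // addr_ge0 // ltW.
have a1 := mulr_ge0 g1 (ltW u0); have a2 := mulr_ge0 g2 (ltW u0).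
have a3 := mulr_ge0 g3 (ltW u0); lra.
Qed.

Let order_b : b^-1 <= step_order * (1 + u).
Proof.
have h : 0 <= 2 / (mu + L) + 1 / L by rewrite addr_ge0 // divr_ge0 // ltW.
have h1 := mulr_ge0 (ltW r10) (ltW q0).
have hb : bb <= 1248 * L ^+ 2 / mu.
  have -> : bb = 96 * (tl * t1) * L ^+ 2 / (mu * n) by rewrite /bb (mulrA 96).
  apply: (le_trans (lin_frac (ler0n _ 96))).
  by rewrite -[1248 * _ / _]mulrA; apply: ler_wpM2r => //; lra.
apply: (order_sum bE (lexx _) hb sb1 sb2); first exact: ltW.
- by rewrite -mulrA; exact: mulr_ge0 (ler0n _ _) Lmu0.
- by rewrite addr_ge0 // mulr_ge0 // ltW.
- by rewrite addr_ge0 // mulr_ge0 // ltW.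
rewrite /step_order /beta_order /gamma_order /theta_order.
move: h h1 Lmu0 mu0 L0 (ltW q0); lra.
Qed.

Let order_g : g^-1 <= step_order * (1 + u).
Proof.
have h : 0 <= 2 / (mu + L) + 1 / L by rewrite addr_ge0 // divr_ge0 // ltW.
have h1 := mulr_ge0 (ltW r10) (ltW q0).
have hb : gg <= 5616 * L ^+ 2 / mu.
  have -> : gg = 432 * (tl * t1) * L ^+ 2 / (mu * n) by rewrite /gg (mulrA 432).
  apply: (le_trans (lin_frac (ler0n _ 432))).
  by rewrite -[5616 * _ / _]mulrA; apply: ler_wpM2r => //; lra.
apply: (order_sum gE (lexx _) hb sg1 sg2); first exact: ltW.
- by rewrite -mulrA; exact: mulr_ge0 (ler0n _ _) Lmu0.
- by rewrite addr_ge0 // mulr_ge0 // ltW.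
- by rewrite -mulrA; exact: addr_ge0 ler01 (mulr_ge0 (ler0n _ _) h1).
rewrite /step_order /beta_order /gamma_order /theta_order.
move: h h1 Lmu0 mu0 L0 (ltW q0); lra.
Qed.

Let order_t : t^-1 <= step_order * (1 + u).
Proof.
have h : 0 <= 2 / (mu + L) + 1 / L by rewrite addr_ge0 // divr_ge0 // ltW.
have h1 := mulr_ge0 (ltW r10) (ltW q0).
(* [order_sum] has one slot linear in u: the two noise terms of theta share it, and the third slot
   is filled with 0. *)
have tE' : t = (1 + Num.sqrt et1 + 0 + (Num.sqrt et2 + y))^-1 by rewrite tE addr0 addrA.
have hs : Num.sqrt et2 + y <= ((1 + r1 * q) + (1 + 72 * r1 * q)) * u.
  by rewrite mulrDl lerD.
apply: (order_sum tE' (lexx _) st1 (lexx _) hs) => //.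
- by rewrite addr_ge0 // mulr_ge0 // ltW.
- by rewrite -mulrA; exact: addr_ge0 (addr_ge0 ler01 h1) (addr_ge0 ler01 (mulr_ge0 (ler0n _ _) h1)).
rewrite /step_order /beta_order /gamma_order /theta_order.
move: h h1 Lmu0 mu0 L0 (ltW q0); lra.
Qed.

Lemma theta_le1 : t <= 1.
Proof. by have [_ h _ _ _] := tP; rewrite mulr1 in h. Qed.

Let b_le : b <= step_order.
Proof.
have [h _] := beta_admissible; apply: (le_trans h).
have h2 : 0 <= 1 / L by rewrite divr_ge0 // ltW.
have h1 := mulr_ge0 (ltW r10) (ltW q0).
rewrite /step_order /beta_order /gamma_order /theta_order.
move: h2 h1 Lmu0 mu0 L0 (ltW q0); lra.
Qed.

Let g_le : g <= step_order.
Proof.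
have [h _] := gamma_admissible; apply: (le_trans h).
have h2 : 0 <= 2 / (mu + L) by rewrite divr_ge0 // ltW.
have h1 := mulr_ge0 (ltW r10) (ltW q0).
rewrite /step_order /beta_order /gamma_order /theta_order.
move: h2 h1 Lmu0 mu0 L0 (ltW q0); lra.
Qed.

Let Dd (k d : R) : 0 <= k -> d <= D -> k * d <= k * D.
Proof. by move=> k0 dD; apply: ler_wpM2l. Qed.

Let noise_b : b * (K * s / n) <= step_order * u * D.
Proof.
have [h0 _ _ _ h4] := bP.
have e0 : 0 <= eb2.
  apply: divr_ge0; last by apply: ltW; exact: mulr_gt0.
  apply: mulr_ge0; first by apply: mulr_ge0; [apply: mulr_ge0|]; exact: ltW.
  by rewrite -mulrA; exact: addr_ge0 ler01 (mulr_ge0 (ler0n _ _) tlt1_0).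
have X : K * s / n <= eb2 * dy.
  have -> : eb2 * dy = 2 * (1 + 6 * (tl * t1)) * (K * s / n) by rewrite /eb2; field; rewrite !gt_eqF.
  rewrite ler_peMl //; last by move: tlt1_0; lra.
  by apply: divr_ge0; [apply: mulr_ge0|]; exact: ltW.
apply: (le_trans (step_noise_le e0 h4 (ltW h0) (ltW dy0) X sb2)).
have k0 : 0 <= (1 + 158 * q) * u.
  apply: mulr_ge0; last exact: ltW.
  exact: addr_ge0 ler01 (mulr_ge0 (ler0n _ _) (ltW q0)).
apply: (le_trans (Dd k0 dyD)); apply: ler_wpM2r; first exact: ltW.
apply: ler_wpM2r; first exact: ltW.
have h : 0 <= 2 / (mu + L) + 1 / L by rewrite addr_ge0 // divr_ge0 // ltW.
have h1 := mulr_ge0 (ltW r10) (ltW q0).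
rewrite /step_order /beta_order /gamma_order /theta_order.
move: h h1 Lmu0 mu0 L0 (ltW q0); lra.
Qed.

Let noise_g : g * (K * (r1 * s) / n) <= step_order * u * D.
Proof.
have [h0 _ _ _ h4] := gP.
have rs : 0 <= K * (r1 * s) by apply: mulr_ge0; [|apply: mulr_ge0]; exact: ltW.
have e0 : 0 <= eg2.
  apply: divr_ge0; last by apply: ltW; exact: mulr_gt0.
  apply: mulr_ge0; first exact: rs.
  by rewrite -mulrA; exact: addr_ge0 ler01 (mulr_ge0 (ler0n _ _) tlt1_0).
have X : K * (r1 * s) / n <= eg2 * dz.
  have -> : eg2 * dz = (1 + 6 * (tl * t1)) * (K * (r1 * s) / n).
    by rewrite /eg2; field; rewrite !gt_eqF.
  rewrite ler_peMl //; last by move: tlt1_0; lra.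
  by apply: divr_ge0; last exact: ltW.
apply: (le_trans (step_noise_le e0 h4 (ltW h0) (ltW dz0) X sg2)).
have h1 := mulr_ge0 (ltW r10) (ltW q0).
have k0 : 0 <= (1 + 79 * r1 * q) * u.
  apply: mulr_ge0; last exact: ltW.
  by rewrite -mulrA; exact: addr_ge0 ler01 (mulr_ge0 (ler0n _ _) h1).
apply: (le_trans (Dd k0 dzD)); apply: ler_wpM2r; first exact: ltW.
apply: ler_wpM2r; first exact: ltW.
have h : 0 <= 2 / (mu + L) + 1 / L by rewrite addr_ge0 // divr_ge0 // ltW.
rewrite /step_order /beta_order /gamma_order /theta_order.
move: h h1 Lmu0 mu0 L0 (ltW q0); lra.
Qed.

Let noise_t : t * (K * (r1 * s) / n) <= step_order * u * D.
Proof.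
have [h0 _ _ h4 _] := tP.
have rs : 0 <= K * (r1 * s) by apply: mulr_ge0; [|apply: mulr_ge0]; exact: ltW.
have e0 : 0 <= et2.
  by apply: divr_ge0; last by apply: ltW; exact: mulr_gt0.
have X : K * (r1 * s) / n <= et2 * dx.
  have -> : et2 * dx = K * (r1 * s) / n by rewrite /et2; field; rewrite !gt_eqF.
  exact: lexx.
apply: (le_trans (step_noise_le e0 h4 (ltW h0) (ltW dx0) X st2)).
have h1 := mulr_ge0 (ltW r10) (ltW q0).
have k0 : 0 <= (1 + r1 * q) * u.
  apply: mulr_ge0; last exact: ltW.
  exact: addr_ge0 ler01 h1.
apply: (le_trans (Dd k0 dxD)); apply: ler_wpM2r; first exact: ltW.
apply: ler_wpM2r; first exact: ltW.
have h : 0 <= 2 / (mu + L) + 1 / L by rewrite addr_ge0 // divr_ge0 // ltW.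
rewrite /step_order /beta_order /gamma_order /theta_order.
move: h h1 Lmu0 mu0 L0 (ltW q0); lra.
Qed.

(** The left side is y^3 t^2 dx = y (t y)^2 dx with t y <= 1: the cube root in theta balances a
    variance that enters with theta^2. *)
Let noise_cube : 18 * (tu * (1 + tu)) * (K * (r1 * s)) * t ^+ 2 <= step_order * u * D.
Proof.
have [h0 _ _ _ h4] := tP.
have -> : 18 * (tu * (1 + tu)) * (K * (r1 * s)) * t ^+ 2 = y * (t * y) ^+ 2 * dx.
  rewrite (_ : y * (t * y) ^+ 2 * dx = y ^+ 3 * (t ^+ 2 * dx)); last by ring.
  by rewrite y3 /et3; field; rewrite gt_eqF.
have ty0 : 0 <= t * y by apply: mulr_ge0; first exact: ltW.
have ty : (t * y) ^+ 2 <= 1 by rewrite expr_le1.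
have h1 := mulr_ge0 (ltW r10) (ltW q0).
have k0 : 0 <= (1 + 72 * r1 * q) * u.
  apply: mulr_ge0; last exact: ltW.
  by rewrite -mulrA; exact: addr_ge0 ler01 (mulr_ge0 (ler0n _ _) h1).
apply: (@le_trans _ _ ((1 + 72 * r1 * q) * u * dx)).
  apply: ler_wpM2r; first exact: ltW.
  by apply: le_trans y_le; rewrite ler_piMr.
apply: (le_trans (Dd k0 dxD)); apply: ler_wpM2r; first exact: ltW.
apply: ler_wpM2r; first exact: ltW.
have h : 0 <= 2 / (mu + L) + 1 / L by rewrite addr_ge0 // divr_ge0 // ltW.
rewrite /step_order /beta_order /gamma_order /theta_order.
move: h h1 Lmu0 mu0 L0 (ltW q0); lra.
Qed.

Lemma step_orders : [/\ 1 <= step_order, b^-1 <= step_order * (1 + u),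
  g^-1 <= step_order * (1 + u) & t^-1 <= step_order * (1 + u)] /\
  [/\ b <= step_order, g <= step_order, 0 < b, 0 < g & 0 < t].
Proof.
split; first by split; [exact: step0|exact: order_b|exact: order_g|exact: order_t].
by have [h _ _ _ _] := bP; have [h' _ _ _ _] := gP; have [h'' _ _ _ _] := tP; split;
  [exact: b_le|exact: g_le|exact: h|exact: h'|exact: h''].
Qed.

Lemma noise_orders : [/\ b * (K * s / n) <= step_order * u * D,
  g * (K * (r1 * s) / n) <= step_order * u * D, t * (K * (r1 * s) / n) <= step_order * u * D &
  18 * (tu * (1 + tu)) * (K * (r1 * s)) * t ^+ 2 <= step_order * u * D].
Proof. exact (And4 noise_b noise_g noise_t noise_cube). Qed.

End OrderBound.

Section ProductBounds.
Context {R : realType}.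

(* [900 * 900] over-estimates the sum of the numerical constants of the nine terms; it is
   kept as a product because numerals are unary. *)
Lemma rhs_order (mu L2c cc m n K D u tl tu t1 t2 a b g t s s1 dP dx dh dy dz dmy dmz : R) :
  0 < mu -> 0 <= L2c -> 0 <= cc -> 1 <= m -> cc / mu <= m -> L2c / mu <= m ->
  1 <= n -> 0 < K -> 0 <= D -> 0 <= u ->
  0 <= tl * (1 + 4 * tl) <= 5 -> 0 <= tl * t1 <= 13 -> 0 <= tu -> tu * (1 + tu) <= 2 ->
  0 <= t2 <= 73 -> 0 < a -> 0 < b -> 0 < g -> 0 < t <= 1 -> 0 <= s -> 0 <= s1 ->
  a^-1 <= m * (1 + u) -> b^-1 <= m * (1 + u) -> g^-1 <= m * (1 + u) -> t^-1 <= m * (1 + u) ->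
  b <= m -> g <= m -> b * (K * s / n) <= m * u * D -> g * (K * s1 / n) <= m * u * D ->
  t * (K * s1 / n) <= m * u * D -> 18 * (tu * (1 + tu)) * (K * s1) * t ^+ 2 <= m * u * D ->
  0 <= dP <= D -> 0 <= dx <= D -> 0 <= dh <= D -> 0 <= dy <= D -> 0 <= dz <= D ->
  0 <= dmy <= D -> 0 <= dmz <= D ->
  2 * dP / (K * a) + 2 * dx / (K * t) + 12 * tu * (1 + tu) * t * dh / K
  + 24 * t2 * cc * dy / (mu * K * b) + 48 * t2 * L2c * dz / (mu * K * g)
  + 48 * t2 * (1 + 6 * tl * t1) * cc * b / (mu * n) * s
  + (2 * t / n + 36 * tu * (1 + tu) * t ^+ 2
     + 72 * t2 * (1 + 6 * tl * t1) * L2c * g / (mu * n)) * s1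
  + 48 * t2 * tl * (1 + 4 * tl) * cc * b / (mu * K * n ^+ 2) * (n * dmy)
  + 72 * t2 * tl * (1 + 4 * tl) * L2c * g / (mu * K * n ^+ 2) * (n * dmz)
  <= 900 * 900 * m ^+ 2 * (D / K * (1 + u)).
Proof.
move=> mu0 L0 c0 m1 cm Lm n1 K0 D0 u0 /andP[tf0 tf5] /andP[tt0 tt] tu0 tuf /andP[t20 t273].
move=> a0 b0 g0 /andP[t0 t1'] s0 s10 am bm gm tm bm' gm' nb ng nt nu /andP[dP0 dPD] /andP[dx0 dxD].
move=> /andP[dh0 dhD] /andP[dy0 dyD] /andP[dz0 dzD] /andP[dmy0 dmyD] /andP[dmz0 dmzD].
have n0 : 0 < n by exact: lt_le_trans n1.
have m0 : 0 <= m by exact: le_trans m1.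
set W := D * (m * (1 + u)).
have W0 : 0 <= W by rewrite mulr_ge0 // mulr_ge0 // addr_ge0.
have V0 : 0 <= D * (1 + u) by rewrite mulr_ge0 // addr_ge0.
have q1 : dP * a^-1 <= W by apply: ler_pM => //; rewrite invr_ge0 ltW.
have q2 : dx * t^-1 <= W by apply: ler_pM => //; rewrite invr_ge0 ltW.
have tuf0 : 0 <= tu * (1 + tu) by rewrite mulr_ge0 // addr_ge0.
have q3 : tu * (1 + tu) * (t * dh) <= 2 * W.
  apply: ler_pM => //; first by rewrite mulr_ge0 // ltW.
  apply: (@le_trans _ _ (1 * D)); first by apply: ler_pM => //; exact: ltW.
  rewrite mul1r ler_peMr //; apply: (@le_trans _ _ (1 * 1)); first by rewrite mulr1.
  by apply: ler_pM => //; rewrite lerDl.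
have c'0 : 0 <= cc / mu by rewrite divr_ge0 // ltW.
have L'0 : 0 <= L2c / mu by rewrite divr_ge0 // ltW.
have q4 : t2 * (cc / mu * (dy * b^-1)) <= 73 * (m * W).
  have i0 : 0 <= b^-1 by rewrite invr_ge0 ltW.
  have i1 : dy * b^-1 <= W by exact: ler_pM.
  have i2 : 0 <= dy * b^-1 by exact: mulr_ge0.
  have i3 : cc / mu * (dy * b^-1) <= m * W by exact: ler_pM.
  by apply: ler_pM => //; exact: mulr_ge0.
have q5 : t2 * (L2c / mu * (dz * g^-1)) <= 73 * (m * W).
  have i0 : 0 <= g^-1 by rewrite invr_ge0 ltW.
  have i1 : dz * g^-1 <= W by exact: ler_pM.
  have i2 : 0 <= dz * g^-1 by exact: mulr_ge0.
  have i3 : L2c / mu * (dz * g^-1) <= m * W by exact: ler_pM.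
  by apply: ler_pM => //; exact: mulr_ge0.
have uW : m * u * D <= W.
  have := mulr_ge0 m0 D0; rewrite /W; lra.
have f0 : 0 <= 1 + 6 * (tl * t1) by rewrite addr_ge0 // mulr_ge0.
have f79 : 1 + 6 * (tl * t1) <= 79 by lra.
have q6 : t2 * ((1 + 6 * (tl * t1)) * (cc / mu * (b * (K * s / n)))) <= 73 * (79 * (m * W)).
  have i2 : 0 <= b * (K * s / n).
    by apply: mulr_ge0; [exact: ltW|apply: divr_ge0; [apply: mulr_ge0|]] => //; exact: ltW.
  have i3 : cc / mu * (b * (K * s / n)) <= m * W by apply: ler_pM => //; exact: le_trans uW.
  have i4 : 0 <= cc / mu * (b * (K * s / n)) by exact: mulr_ge0.
  have i5 := ler_pM f0 i4 f79 i3.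
  by apply: ler_pM => //; exact: mulr_ge0.
have q7 : t2 * ((1 + 6 * (tl * t1)) * (L2c / mu * (g * (K * s1 / n)))) <= 73 * (79 * (m * W)).
  have i2 : 0 <= g * (K * s1 / n).
    by apply: mulr_ge0; [exact: ltW|apply: divr_ge0; [apply: mulr_ge0|]] => //; exact: ltW.
  have i3 : L2c / mu * (g * (K * s1 / n)) <= m * W by apply: ler_pM => //; exact: le_trans uW.
  have i4 : 0 <= L2c / mu * (g * (K * s1 / n)) by exact: mulr_ge0.
  have i5 := ler_pM f0 i4 f79 i3.
  by apply: ler_pM => //; exact: mulr_ge0.
have n1' : n^-1 <= 1 by rewrite invf_le1.
have ni0 : 0 <= n^-1 by rewrite invr_ge0 ltW.
have dn (z d : R) : 0 < z -> z <= m -> 0 <= d -> d <= D -> 0 <= z * (d / n) <= W.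
  move=> z0 zm d0 dD; have h : d / n <= D * (1 + u).
    by apply: ler_pM => //; apply: (le_trans n1'); rewrite lerDl.
  have h0 : 0 <= d / n by exact: divr_ge0 d0 (ltW n0).
  by rewrite mulr_ge0 ?(ltW z0) //= /W [leRHS]mulrCA; apply: ler_pM => //; exact: ltW.
have q8 : t2 * ((tl * (1 + 4 * tl)) * (cc / mu * (b * (dmy / n)))) <= 73 * (5 * (m * W)).
  have /andP[i2 i1] := dn _ _ b0 bm' dmy0 dmyD.
  have i3 := ler_pM c'0 i2 cm i1; have i4 := mulr_ge0 c'0 i2.
  have i5 := ler_pM tf0 i4 tf5 i3; have i6 := mulr_ge0 tf0 i4.
  exact: ler_pM t20 i6 t273 i5.
have q9 : t2 * ((tl * (1 + 4 * tl)) * (L2c / mu * (g * (dmz / n)))) <= 73 * (5 * (m * W)).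
  have /andP[i2 i1] := dn _ _ g0 gm' dmz0 dmzD.
  have i3 := ler_pM L'0 i2 Lm i1; have i4 := mulr_ge0 L'0 i2.
  have i5 := ler_pM tf0 i4 tf5 i3; have i6 := mulr_ge0 tf0 i4.
  exact: ler_pM t20 i6 t273 i5.
have Wm : W <= m * W by rewrite ler_peMl.
have ki : 0 <= K^-1 by rewrite invr_ge0 ltW.
rewrite [leRHS](_ : _ = 900 * 900 * (m * W) * K^-1); last by rewrite /W; ring.
rewrite [leLHS](_ : _ = (2 * (dP * a^-1) + 2 * (dx * t^-1) + 12 * (tu * (1 + tu) * (t * dh))
  + 24 * (t2 * (cc / mu * (dy * b^-1))) + 48 * (t2 * (L2c / mu * (dz * g^-1)))
  + 48 * (t2 * ((1 + 6 * (tl * t1)) * (cc / mu * (b * (K * s / n)))))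
  + (2 * (t * (K * s1 / n)) + 2 * (18 * (tu * (1 + tu)) * (K * s1) * t ^+ 2)
     + 72 * (t2 * ((1 + 6 * (tl * t1)) * (L2c / mu * (g * (K * s1 / n))))))
  + 48 * (t2 * ((tl * (1 + 4 * tl)) * (cc / mu * (b * (dmy / n)))))
  + 72 * (t2 * ((tl * (1 + 4 * tl)) * (L2c / mu * (g * (dmz / n)))))) * K^-1); last first.
  by field; rewrite !gt_eqF.
apply: ler_wpM2r => //; move: q1 q2 q3 q4 q5 q6 q7 q8 q9 uW nt nu Wm.
move: (dP * a^-1) (dx * t^-1) (tu * (1 + tu) * (t * dh)) (t2 * (cc / mu * (dy * b^-1)))
  (t2 * (L2c / mu * (dz * g^-1)))
  (t2 * ((1 + 6 * (tl * t1)) * (cc / mu * (b * (K * s / n)))))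
  (t2 * ((1 + 6 * (tl * t1)) * (L2c / mu * (g * (K * s1 / n)))))
  (t2 * (tl * (1 + 4 * tl) * (cc / mu * (b * (dmy / n)))))
  (t2 * (tl * (1 + 4 * tl) * (L2c / mu * (g * (dmz / n)))))
  (t * (K * s1 / n)) (18 * (tu * (1 + tu)) * (K * s1) * t ^+ 2) (m * u * D) (m * W).
move=> x1 x2 x3 x4 x5 x6 x7 x8 x9 x10 x11 x12 x13; lra.
Qed.

(** The inverse squares of the steps cost w^2, and the other terms are padded to the same order by w
    >= 1; so 1 / C4 is of order w like the other inverse steps. Here 876 = 12 * 73, 208 = 16 * 13
    and 936 = 72 * 13. *)
Lemma C4_order_le (mu L2c LP Ly Lz cc L3 L4 L5 m n w tl tu t1 t2 b g t : R) :
  0 < mu -> 0 <= L2c -> 0 <= cc -> 0 <= L3 -> 0 <= L4 -> 0 <= L5 -> 1 <= n -> 1 <= w -> 0 <= m ->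
  0 <= tl * t1 <= 13 -> 0 <= tu * (1 + tu) <= 2 -> 0 <= t2 <= 73 -> 0 < b -> 0 < g -> 0 < t ->
  b^-1 <= m * w -> g^-1 <= m * w -> t^-1 <= m * w -> b <= m -> g <= m ->
  2 * (4 * LP ^+ 2 / t ^+ 2 + 72 * tu * (1 + tu) * L5
  + 12 * t2 * cc * (4 * Ly ^+ 2 / (b ^+ 2 * mu ^+ 2) + 16 * tl * t1 * L3 * b / (mu * n))
  + 12 * t2 * L2c * (12 * Lz ^+ 2 / (g ^+ 2 * mu ^+ 2) + 72 * tl * t1 * L4 * g / (mu * n)))
  <= 2 * (4 * LP ^+ 2 * m ^+ 2 + 144 * L5
  + 876 * cc * (4 * Ly ^+ 2 / mu ^+ 2 * m ^+ 2 + 208 * L3 * m / mu)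
  + 876 * L2c * (12 * Lz ^+ 2 / mu ^+ 2 * m ^+ 2 + 936 * L4 * m / mu)) * w ^+ 2.
Proof.
move=> mu0 L0 c0 L30 L40 L50 n1 w1 m0 /andP[tt0 tt] /andP[tu0 tu2] /andP[t20 t273].
move=> b0 g0 t0 bm gm tm bm' gm'.
have w0 : 0 <= w by exact: le_trans w1.
have w2 : 1 <= w ^+ 2 by rewrite exprn_ege1.
have n0 : 0 < n by exact: lt_le_trans n1.
have n1' : n^-1 <= 1 by rewrite invf_le1.
have ni0 : 0 <= n^-1 by rewrite invr_ge0 ltW.
have sqi (z : R) : 0 < z -> z^-1 <= m * w -> 0 <= (z^-1) ^+ 2 <= m ^+ 2 * w ^+ 2.
  by move=> z0 zm; rewrite sqr_ge0 -exprMn ler_pXn2r ?nnegrE ?invr_ge0 ?(ltW z0) // mulr_ge0.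
have inner (Lc Lq z kk : R) : 0 < z -> z^-1 <= m * w -> z <= m -> 0 <= Lq -> 0 <= Lc -> 0 <= kk ->
  0 <= Lc / mu ^+ 2 * (z^-1) ^+ 2 + kk * (tl * t1 * (Lq * (z / mu) * n^-1)) <=
  (Lc / mu ^+ 2 * m ^+ 2 + kk * (13 * (Lq * (m / mu)))) * w ^+ 2.
  move=> z0 zm zm' Lq0 Lc0 kk0; have /andP[s0 sm] := sqi z z0 zm.
  have k0 : 0 <= Lc / mu ^+ 2 by rewrite divr_ge0 // sqr_ge0.
  have zi0 : 0 <= z / mu by rewrite divr_ge0 // ltW.
  have h0 : 0 <= Lq * (z / mu) by exact: mulr_ge0.
  have h1 : Lq * (z / mu) <= Lq * (m / mu).
    by apply: ler_wpM2l => //; apply: ler_wpM2r => //; rewrite invr_ge0 ltW.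
  have h2 : Lq * (z / mu) * n^-1 <= Lq * (m / mu) * w ^+ 2.
    by apply: ler_pM => //; exact: le_trans w2.
  have h3 : 0 <= Lq * (z / mu) * n^-1 by exact: mulr_ge0.
  apply/andP; split.
    by apply: addr_ge0; apply: mulr_ge0 => //; exact: mulr_ge0.
  rewrite mulrDl; apply: lerD.
    by rewrite -[leRHS]mulrA; apply: ler_wpM2l.
  rewrite -[leRHS]mulrA; apply: ler_wpM2l => //; rewrite -[leRHS]mulrA; exact: ler_pM.
have /andP[y0 yb] := inner (4 * Ly ^+ 2) L3 b 16 b0 bm bm' L30 (mulr_ge0 (ler0n _ _) (sqr_ge0 _)) (ler0n _ _).
have /andP[z0 zb] := inner (12 * Lz ^+ 2) L4 g 72 g0 gm gm' L40 (mulr_ge0 (ler0n _ _) (sqr_ge0 _)) (ler0n _ _).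
have h1 := ler_pM t20 (mulr_ge0 c0 y0) t273 (ler_wpM2l c0 yb).
have h2 := ler_pM t20 (mulr_ge0 L0 z0) t273 (ler_wpM2l L0 zb).
have /andP[s0 sm] := sqi t t0 tm; have h3 := ler_wpM2l (sqr_ge0 LP) sm.
have h4 : tu * (1 + tu) * L5 <= 2 * (L5 * w ^+ 2).
  by apply: ler_pM => //; rewrite ler_peMr.
rewrite [leLHS](_ : _ = 2 * (4 * (LP ^+ 2 * (t^-1) ^+ 2) + 72 * (tu * (1 + tu) * L5)
  + 12 * (t2 * (cc * (4 * Ly ^+ 2 / mu ^+ 2 * (b^-1) ^+ 2 + 16 * (tl * t1 * (L3 * (b / mu) * n^-1)))))
  + 12 * (t2 * (L2c * (12 * Lz ^+ 2 / mu ^+ 2 * (g^-1) ^+ 2 + 72 * (tl * t1 * (L4 * (g / mu) * n^-1))))))).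
  by move: h1 h2 h3 h4; lra.
by field; rewrite !gt_eqF.
Qed.

End ProductBounds.

Section Rates.
Context {R : realType} {n dx dy : nat} {pb : problem R n dx dy}.
Context {cu : compressors R n dx} {cl : compressors R n dy} (D : draws pb cu cl).
Context (c : constants R) (sigma : R) (p : params R) (ini : inits R n dx dy).

Lemma Del_ge : [/\ DelPhi pb ini <= Del D p ini, Delx pb ini <= Del D p ini,
    Delh D p ini <= Del D p ini & Dely pb ini <= Del D p ini] /\
  [/\ Delz pb ini <= Del D p ini, Delmy D p ini <= Del D p ini & Delmz D p ini <= Del D p ini].
Proof. by rewrite /Del !big_cons big_nil; split; split; rewrite !le_max lexx ?orbT. Qed.

Context (st : standing c sigma D p ini).

Let n0 : (0 < n)%N. Proof. by case: st => [[]]. Qed.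
Let dy0 : (0 < dy)%N. Proof. by case: st => [[]]. Qed.
Let rd0 : (0 < rounds p)%N. Proof. by case: st => [[]]. Qed.
Let UCu : unbiased_compression cu (omega_u p). Proof. by case: st => [_ [_ [[]]]]. Qed.
Let UCl : unbiased_compression cl (omega_l p). Proof. by case: st => [_ [_ [[]]]]. Qed.

Lemma standing_constants : [/\ 0 < mug c, 0 < Lg c, 0 < LPhi c & mug c <= Lg c].
Proof.
have Hc : continuity pb c by case: st => [_ [[]]].
have Hs : strong_convexity pb c by case: st => [_ [[]]].
have [[h _ _] _] : lipschitz_constants pb c by case: st => [_ [_ [_ []]]].
by split; [exact: mug_gt0 Hs|exact: Lg_gt0 n0 dy0 Hc Hs|exact: h|exact: mug_le_Lg n0 dy0 Hc Hs].
Qed.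

Lemma tom_l_ge0 : 0 <= tom_l p. Proof. exact: tomega_ge0 (omega_l_ge0 UCl) _. Qed.
Lemma tom_u_ge0 : 0 <= tom_u p. Proof. exact: tomega_ge0 (omega_u_ge0 UCu) _. Qed.

(** For negative x the square root is 0 by default, so [C4_inv_sq] can be compared with its root
    without a discussion of sign. *)
Lemma le_sqr_sqrt (x : R) : x <= Num.sqrt x ^+ 2.
Proof. by have [x0|/ltW x0] := leP 0 x; [rewrite sqr_sqrtr|apply: (le_trans x0); exact: sqr_ge0]. Qed.

End Rates.

(** The multiplied form covers both cases: for b = 0 the infinite bound reads x * 0 <= a. *)
Lemma bound_div_le (R : realType) (x a b : R) : 0 <= a -> 0 <= b ->
  (x%:E <= bound_div a b)%E -> x * b <= a.
Proof.
move=> a0 b0; rewrite /bound_div; case: eqP => [->|/eqP bn]; first by rewrite mulr0.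
by rewrite lee_fin ler_pdivlMr // lt_neqAle eq_sym bn.
Qed.

(** * The convergence rate *)

Section ConvergenceOrder.
Context {R : realType} (c : constants R) (ratio : R).

(** With rho = C_f / mu_g all problem constants become functions of [c], so the final factor can be
    fixed before the problem, n and K. *)
Let rho1 := 1 + (cf c / mug c) ^+ 2.
Let L1v := Lf c ^+ 2 + Lgyy c ^+ 2 * (cf c / mug c) ^+ 2.
Let L2v := Lf c ^+ 2 + Lgxy c ^+ 2 * (cf c / mug c) ^+ 2.
Let L4v := L1v * (1 + 3 * Lys c ^+ 2) + 3 * Lg c ^+ 2 * Lzs c ^+ 2.
Let L5v := L2v * (1 + 3 * Lys c ^+ 2) + 3 * Lg c ^+ 2 * Lzs c ^+ 2.

Definition rate_const : R := order_const (mug c) (Lg c) (LPhi c) (Lys c) (Lzs c)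
  L1v L2v (L3sq c) L4v L5v rho1 ratio.

(** 900 * 900 comes from [rhs_order] and 5 from [rounds_le]; the added 1 makes positivity
    immediate. *)
Definition rate_factor : R := 1 + 5 * (900 * 900) * rate_const ^+ 2.

Lemma rate_factor_gt0 : 0 < rate_factor.
Proof.
exact (ltr_pwDl ltr01 (mulr_ge0 (mulr_ge0 (ler0n _ 5) (mulr_ge0 (ler0n _ 900) (ler0n _ 900)))
  (sqr_ge0 rate_const))).
Qed.

Context (m0 : 0 < mug c) (Lg0 : 0 < Lg c) (LP0 : 0 < LPhi c) (ratio1 : 1 <= ratio).
Context (n dx dy : nat) (pb : problem R n dx dy).
Context (cu : compressors R n dx) (cl : compressors R n dy) (D : draws pb cu cl).
Context (sigma : R) (p : params R) (ini : inits R n dx dy) (K : nat).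
Context (st : standing c sigma D p ini) (K0 : (0 < K)%N) (sg0 : 0 < sigma).
Context (Dx0 : 0 < Delx pb ini) (Dy0 : 0 < Dely pb ini) (Dz0 : 0 < Delz pb ini).
Context (rx : Del D p ini <= ratio * Delx pb ini) (ry : Del D p ini <= ratio * Dely pb ini).
Context (rz : Del D p ini <= ratio * Delz pb ini).
Context (roundsE : (rounds p)%:Z = Num.ceil (4 * (1 + omega_u p + omega_l p)
                              * ln (log_arg sigma D p ini))).
Context (alphaE : alpha p = (2 * LPhi c + (C4 n c p)^-1)^-1) (rhoE : rho p = cf c / mug c).
Context (dlE : delta_l p = 1 / (1 + tom_l p)) (duE : delta_u p = 1 / (1 + tom_u p)).
Context (betaE : beta p =
      ((mug c + Lg c) / 2 + 96 * tom_l p * tom1 p * Lg c ^+ 2 / (mug c * n%:R)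
       + Num.sqrt (2 * tom_l p * (1 + 4 * tom_l p) * Delmy D p ini
                   / (n%:R * Dely pb ini))
       + Num.sqrt (2 * K%:R * tsigsq sigma p * (1 + 6 * tom_l p * tom1 p)
                   / (n%:R * Dely pb ini)))^-1).
Context (gammaE : gamma p =
      (Lg c + 432 * tom_l p * tom1 p * Lg c ^+ 2 / (mug c * n%:R)
       + Num.sqrt (3 * tom_l p * (1 + 4 * tom_l p) * Delmz D p ini
                   / (2 * n%:R * Delz pb ini))
       + Num.sqrt (K%:R * tsig1sq sigma p * (1 + 6 * tom_l p * tom1 p)
                   / (n%:R * Delz pb ini)))^-1).
Context (thetaE : theta p =
      (1 + Num.sqrt (6 * tom_u p * (1 + tom_u p) * Delh D p ini / Delx pb ini)
       + Num.sqrt (K%:R * tsig1sq sigma p / (n%:R * Delx pb ini))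
       + (18 * tom_u p * (1 + tom_u p) * K%:R * tsig1sq sigma p / Delx pb ini)
           `^ (3^-1))^-1).

Let arg := log_arg sigma D p ini.
Let Dd := Del D p ini.
Let wu0 : 0 <= omega_u p. Proof. by case: st => [_ [_ [[[]]]]]. Qed.
Let wl0 : 0 <= omega_l p. Proof. by case: st => [_ [_ [[_ []]]]]. Qed.
Let n0 : (0 < n)%N. Proof. by case: st => [[]]. Qed.
Let rd0 : (0 < rounds p)%N. Proof. by case: st => [[]]. Qed.
Let n1 : 1 <= (n%:R : R). Proof. by rewrite ler1n. Qed.
Let nn0 : 0 < (n%:R : R). Proof. by rewrite ltr0n. Qed.
Let Kr0 : 0 < (K%:R : R). Proof. by rewrite ltr0n. Qed.
Let K1 : 1 <= (K%:R : R). Proof. by rewrite ler1n. Qed.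
Let rr0 : 0 < ((rounds p)%:R : R). Proof. by rewrite ltr0n. Qed.
Let s2 : 0 < sigma ^+ 2. Proof. by rewrite exprn_gt0. Qed.
Let Dd0 : 0 < Dd. Proof. by have [[_ h _ _] _] := Del_ge D p ini; exact: lt_le_trans Dx0 h. Qed.

Let extra0 : 0 <= (1 + omega_u p) ^+ 2 * Dd * n%:R ^+ 3 / sigma ^+ 2.
Proof.
apply: divr_ge0; last exact: ltW.
by apply: mulr_ge0; [apply: mulr_ge0; [exact: sqr_ge0|exact: ltW]|exact: exprn_ge0].
Qed.

Let arg_ge : 4 * (1 + omega_u p + omega_l p) <= arg. Proof. by rewrite /arg /log_arg lerDl. Qed.
Let arg4 : 4 <= arg. Proof. by move: arg_ge wu0 wl0; lra. Qed.
Let arg0 : 0 < arg. Proof. by move: arg4; lra. Qed.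
Let ln1 : 1 <= ln arg. Proof. exact: ln_ge1. Qed.

Let arg_snr : Dd * n%:R ^+ 3 <= arg * sigma ^+ 2.
Proof.
rewrite -ler_pdivrMr //; apply: (@le_trans _ _ ((1 + omega_u p) ^+ 2 * Dd * n%:R ^+ 3 / sigma ^+ 2)).
  apply: ler_wpM2r; first by rewrite invr_ge0 ltW.
  apply: ler_wpM2r; first exact: exprn_ge0.
  by rewrite ler_peMl ?(ltW Dd0) // exprn_ege1 // lerDl.
by rewrite /arg /log_arg lerDr mulr_ge0 // addr_ge0 // addr_ge0.
Qed.

Let W := 1 + omega_u p + omega_l p.
Let W1 : 1 <= W. Proof. by rewrite /W -addrA lerDl addr_ge0. Qed.

Let rounds_ge : 4 * W * ln arg <= (rounds p)%:R.
Proof. by have := ceil_ge (4 * W * ln arg); rewrite -roundsE. Qed.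

(** The ceiling adds at most 1, and 1 <= W ln arg. *)
Let rounds_le : (rounds p)%:R <= 5 * W * ln arg.
Proof.
have := ceilB1_lt (4 * W * ln arg); rewrite -roundsE rmorphB /= => h.
have h2 : 1 <= W * ln arg by rewrite -[1]mulr1 ler_pM.
by move: h h2; rewrite -[(rounds p)%:Z%:~R]/((rounds p)%:R); lra.
Qed.

Let tl_le : tom_l p <= (arg ^+ 3)^-1.
Proof.
apply: tomega_le => //; first by move: arg_ge wu0; lra.
apply: le_trans rounds_ge; apply: ler_wpM2r; first by move: ln1; lra.
by rewrite /W; move: wu0; lra.
Qed.

Let tu_le : tom_u p <= (arg ^+ 3)^-1.
Proof.
apply: tomega_le => //; first by move: arg_ge wl0; lra.
apply: le_trans rounds_ge; apply: ler_wpM2r; first by move: ln1; lra.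
by rewrite /W; move: wl0; lra.
Qed.

Let arg3 : 1 <= arg ^+ 3. Proof. by rewrite exprn_ege1 //; move: arg4; lra. Qed.
Let arg3i : (arg ^+ 3)^-1 <= 1.
Proof. by rewrite invf_le1 //; exact: lt_le_trans arg3. Qed.
Let tl0 : 0 <= tom_l p. Proof. exact: tom_l_ge0 st. Qed.
Let tu0 : 0 <= tom_u p. Proof. exact: tom_u_ge0 st. Qed.
Let tl1 : tom_l p <= 1. Proof. exact: le_trans tl_le arg3i. Qed.
Let tu1 : tom_u p <= 1. Proof. exact: le_trans tu_le arg3i. Qed.

Let s := tsigsq sigma p.
Let sr : s * (rounds p)%:R = sigma ^+ 2. Proof. by rewrite /s /tsigsq divfK // gt_eqF. Qed.
Let s0 : 0 < s. Proof. by rewrite divr_gt0. Qed.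
Let s1E : tsig1sq sigma p = rho1 * s.
Proof. by rewrite /tsig1sq /s /tsigsq /rho1 rhoE; ring. Qed.

Let nD0 : 0 < n%:R * Dd. Proof. exact: mulr_gt0. Qed.

(* The noise to signal ratio: (Delta / K) u is the leading term of the rate. *)
Let u := Num.sqrt (K%:R * s / (n%:R * Dd)).
Let u2 : u ^+ 2 = K%:R * s / (n%:R * Dd).
Proof. by rewrite sqr_sqrtr // divr_ge0 ?(ltW nD0) // mulr_ge0 // ltW. Qed.
Let u2E : u ^+ 2 * (n%:R * Dd) = K%:R * s. Proof. by rewrite u2 divfK // gt_eqF. Qed.
Let u0 : 0 < u. Proof. by rewrite sqrtr_gt0 divr_gt0 // mulr_gt0. Qed.

(** The term in n^3 of the logarithm's argument serves here: D n^3 <= arg sigma^2. Also R <= 5 W ln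
    arg <= 5/4 arg^2. After squaring and multiplying by n D R, the left side is at most tu^2 (5/4)
    arg^3 sigma^2 <= (5/4) sigma^2, while the right side is 4 K sigma^2. *)
Let ntu : n%:R * tom_u p <= 2 * u.
Proof.
have h0 : 0 <= n%:R * tom_u p by rewrite mulr_ge0.
rewrite -(@ler_pXn2r _ 2) ?nnegrE //; last by rewrite mulr_ge0 // ltW.
rewrite !exprMn -(ler_pM2r (mulr_gt0 nD0 rr0)).
have -> : 2 ^+ 2 * u ^+ 2 * (n%:R * Dd * (rounds p)%:R) = 4 * K%:R * sigma ^+ 2.
  transitivity (4 * (u ^+ 2 * (n%:R * Dd)) * (rounds p)%:R); first by ring.
  by rewrite u2E -sr; ring.
have ra : (rounds p)%:R <= 5 / 4 * arg ^+ 2.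
  apply: (le_trans rounds_le); have lna : ln arg <= arg := ltW (ln_sublinear arg0).
  have := ler_pM (le_trans ler01 W1) (le_trans ler01 ln1) (_ : W <= arg / 4) lna.
  have Wa : W <= arg / 4 by move: arg_ge; rewrite /W; lra.
  by move=> /(_ Wa); lra.
have h1 := ler_pM (ltW (mulr_gt0 Dd0 (exprn_gt0 3 nn0))) (ltW rr0) arg_snr ra.
have t2 : tom_u p ^+ 2 * (arg ^+ 3) <= 1.
  have a3 : 0 < arg ^+ 3 by exact: lt_le_trans arg3.
  have h : tom_u p * arg ^+ 3 <= 1 by move: tu_le; rewrite -[_^-1]div1r ler_pdivlMr.
  by rewrite expr2 -mulrA -[1]mulr1 ler_pM // mulr_ge0 // ltW.
have h2 := ler_wpM2l (sqr_ge0 (tom_u p)) h1.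
have h3 : 0 <= sigma ^+ 2 * (1 - tom_u p ^+ 2 * arg ^+ 3) by rewrite mulr_ge0 ?(ltW s2) // subr_ge0.
have h4 : 0 <= (K%:R - 1) * sigma ^+ 2 by rewrite mulr_ge0 ?(ltW s2) // subr_ge0.
have h5 := ltW s2.
have e1 : n%:R ^+ 2 * tom_u p ^+ 2 * (n%:R * Dd * (rounds p)%:R) =
  tom_u p ^+ 2 * (Dd * n%:R ^+ 3 * (rounds p)%:R) by ring.
rewrite e1; apply: (le_trans h2).
move: (tom_u p) arg h3 h4 h5 => tt aa h3 h4 h5; lra.
Qed.

Let r11 : 1 <= rho1. Proof. by rewrite /rho1 lerDl sqr_ge0. Qed.
Let L1_0 : 0 <= L1v. Proof. by rewrite addr_ge0 ?sqr_ge0 // mulr_ge0 // sqr_ge0. Qed.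
Let L2_0 : 0 <= L2v. Proof. by rewrite addr_ge0 ?sqr_ge0 // mulr_ge0 // sqr_ge0. Qed.
Let Lext (L : R) : 0 <= L -> 0 <= L * (1 + 3 * Lys c ^+ 2) + 3 * Lg c ^+ 2 * Lzs c ^+ 2.
Proof.
move=> Lp; apply: addr_ge0; apply: mulr_ge0 => //; rewrite ?sqr_ge0 //.
  by rewrite addr_ge0 // mulr_ge0 ?sqr_ge0.
by rewrite mulr_ge0 ?sqr_ge0.
Qed.
Let L3_0 : 0 <= L3sq c.
Proof. by rewrite mulr_ge0 ?sqr_ge0 // addr_ge0 // mulr_ge0 ?sqr_ge0. Qed.
Let L4_0 : 0 <= L4v. Proof. exact: Lext. Qed.
Let L5_0 : 0 <= L5v. Proof. exact: Lext. Qed.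

Let L1E : L1sq c p = L1v. Proof. by rewrite /L1sq rhoE. Qed.
Let L2E : L2sq c p = L2v. Proof. by rewrite /L2sq rhoE. Qed.
Let L4E : L4sq c p = L4v. Proof. by rewrite /L4sq L1E. Qed.
Let L5E : L5sq c p = L5v. Proof. by rewrite /L5sq L2E. Qed.
Let cE : L2sq c p + 25 * kappa c ^+ 2 * L1sq c p = coupling (mug c) (Lg c) L1v L2v.
Proof. by rewrite L1E L2E. Qed.

Let M := step_order (mug c) (Lg c) rho1 ratio.

Let betaE' : beta p =
      ((mug c + Lg c) / 2 + 96 * tom_l p * tom1 p * Lg c ^+ 2 / (mug c * n%:R)
       + Num.sqrt (2 * tom_l p * (1 + 4 * tom_l p) * Delmy D p ini / (n%:R * Dely pb ini))
       + Num.sqrt (2 * K%:R * s * (1 + 6 * tom_l p * tom1 p) / (n%:R * Dely pb ini)))^-1.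
Proof. exact: betaE. Qed.

Let gammaE' : gamma p =
      (Lg c + 432 * tom_l p * tom1 p * Lg c ^+ 2 / (mug c * n%:R)
       + Num.sqrt (3 * tom_l p * (1 + 4 * tom_l p) * Delmz D p ini / (2 * n%:R * Delz pb ini))
       + Num.sqrt (K%:R * (rho1 * s) * (1 + 6 * tom_l p * tom1 p) / (n%:R * Delz pb ini)))^-1.
Proof. by rewrite gammaE s1E. Qed.

Let thetaE' : theta p =
      (1 + Num.sqrt (6 * tom_u p * (1 + tom_u p) * Delh D p ini / Delx pb ini)
       + Num.sqrt (K%:R * (rho1 * s) / (n%:R * Delx pb ini))
       + (18 * tom_u p * (1 + tom_u p) * K%:R * (rho1 * s) / Delx pb ini) `^ (3^-1))^-1.
Proof. by rewrite thetaE s1E. Qed.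

Let t1E : tom1 p = 1 + 6 * tom_l p * (1 + tom_l p). Proof. by []. Qed.
Let t2E : tom2 p = 1 + 36 * tom_u p * (1 + tom_u p). Proof. by []. Qed.

Let avg0 d (v : 'I_n -> 'cV[R]_d) : 0 <= n%:R^-1 * \sum_i enorm (v i) ^+ 2.
Proof. exact: avg_sq_ge0. Qed.

Let orders : [/\ 1 <= M, (beta p)^-1 <= M * (1 + u),
    (gamma p)^-1 <= M * (1 + u) & (theta p)^-1 <= M * (1 + u)] /\
  [/\ beta p <= M, gamma p <= M, 0 < beta p, 0 < gamma p & 0 < theta p].
Proof.
have [[_ _ hh _] [_ hmy hmz]] := Del_ge D p ini.
exact: (step_orders m0 Lg0 r11 ratio1 n1 Kr0 tl0 tl1 tu0 tu1 Dd0 u0 s0 u2E ntu t1E Dx0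
  (avg0 _) hh Dy0 Dz0 (avg0 _) hmy (avg0 _) hmz rx ry rz betaE' gammaE' thetaE').
Qed.

Let noises : [/\ beta p * (K%:R * s / n%:R) <= M * u * Dd,
  gamma p * (K%:R * (rho1 * s) / n%:R) <= M * u * Dd,
  theta p * (K%:R * (rho1 * s) / n%:R) <= M * u * Dd &
  18 * (tom_u p * (1 + tom_u p)) * (K%:R * (rho1 * s)) * theta p ^+ 2 <= M * u * Dd].
Proof.
have [[_ hx hh hy] [hz hmy hmz]] := Del_ge D p ini.
exact: (noise_orders m0 Lg0 r11 ratio1 n1 Kr0 tl0 tl1 tu0 tu1 Dd0 u0 s0 u2E ntu t1E Dx0 hx
  Dy0 hy Dz0 hz rx ry rz betaE' gammaE' thetaE').
Qed.

Let SC := Num.sqrt (C4_inv_sq n c p).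
Let aE : alpha p = (2 * LPhi c + SC)^-1. Proof. by rewrite alphaE /C4 invrK. Qed.
Let SC0 : 0 <= SC. Proof. exact: sqrtr_ge0. Qed.
Let ai0 : 0 < 2 * LPhi c + SC. Proof. by rewrite ltr_wpDr // mulr_gt0. Qed.

Let aL : alpha p * (2 * LPhi c) <= 1.
Proof. by rewrite aE ler_pdivrMl // mulr1 lerDl. Qed.

Let aC : alpha p ^+ 2 * C4_inv_sq n c p <= 1.
Proof.
apply: (@le_trans _ _ ((alpha p * SC) ^+ 2)).
  by rewrite exprMn ler_wpM2l ?sqr_ge0 // le_sqr_sqrt.
have h : alpha p * SC <= 1 by rewrite aE ler_pdivrMl // mulr1 lerDr mulr_ge0 // ltW.
by rewrite expr_le1 // mulr_ge0 // aE invr_ge0 ltW.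
Qed.

Let cpl := coupling (mug c) (Lg c) L1v L2v.
Let cpl0 : 0 <= cpl.
Proof. by apply: addr_ge0 => //; apply: mulr_ge0 => //; apply: mulr_ge0 => //; exact: sqr_ge0. Qed.

Let tlt1 : 0 <= tom_l p * tom1 p <= 13.
Proof.
have h2 := mulr_ge0 tl0 tl0; have h3 : tom_l p * tom_l p <= 1 by rewrite -[1]mulr1 ler_pM.
have h1 : 0 <= tom1 p <= 13 by rewrite t1E; apply/andP; move: tl0 tl1 h2 h3; split; lra.
by case/andP: h1 => h1 h4; rewrite mulr_ge0 //= -[13]mul1r ler_pM.
Qed.

Let tuf : 0 <= tom_u p * (1 + tom_u p) <= 2.
Proof.
have h2 := mulr_ge0 tu0 tu0; have h3 : tom_u p * tom_u p <= 1 by rewrite -[1]mulr1 ler_pM.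
by apply/andP; move: tu0 tu1 h2 h3; split; lra.
Qed.

Let t2_le : 0 <= tom2 p <= 73.
Proof. by rewrite t2E; case/andP: tuf => h1 h2; apply/andP; split; lra. Qed.

Let CO := C4_order (mug c) (Lg c) (LPhi c) (Lys c) (Lzs c) L1v L2v (L3sq c) L4v L5v rho1 ratio.

Let M0 : 0 <= M. Proof. by have [[h _ _ _] _] := orders; exact: le_trans h. Qed.

Let CO0 : 0 <= CO.
Proof.
have sq (z : R) : 0 <= z ^+ 2 by exact: sqr_ge0.
have mi : 0 <= (mug c)^-1 by rewrite invr_ge0 ltW.
have m2i : 0 <= (mug c ^+ 2)^-1 by rewrite invr_ge0.
have in0 (a : R) L kk k2 : 0 <= L -> 0 <= kk -> 0 <= k2 ->
    0 <= kk * a ^+ 2 / mug c ^+ 2 * M ^+ 2 + k2 * L * M / mug c.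
  move=> Lp kp k2p; apply: addr_ge0; first by apply: mulr_ge0 => //; do 2! apply: mulr_ge0 => //.
  by do 3! apply: mulr_ge0 => //.
have i1 := in0 (Lys c) _ _ _ L3_0 (ler0n _ 4) (ler0n _ 208).
have i2 := in0 (Lzs c) _ _ _ L4_0 (ler0n _ 12) (ler0n _ 936).
have j1 := mulr_ge0 (mulr_ge0 (ler0n R 876) cpl0) i1.
have j2 := mulr_ge0 (mulr_ge0 (ler0n R 876) (sq (Lg c))) i2.
have j3 := mulr_ge0 (mulr_ge0 (ler0n R 4) (sq (LPhi c))) (sq M).
have j4 := mulr_ge0 (ler0n R 144) L5_0.
rewrite /CO /C4_order -/M -/cpl; apply: mulr_ge0 (ler0n R 2) _.
exact (addr_ge0 (addr_ge0 (addr_ge0 j3 j4) j1) j2).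
Qed.

Let alpha_order : (alpha p)^-1 <= (2 * LPhi c + (1 + CO)) * (1 + u).
Proof.
have [[M1 ob og ot] [bM gM b0 g0 t0]] := orders.
have u1 : 1 <= 1 + u by rewrite lerDl ltW.
have hC : C4_inv_sq n c p <= CO * (1 + u) ^+ 2.
  rewrite /C4_inv_sq cE L4E L5E.
  exact: (C4_order_le (LPhi c) (Lys c) (Lzs c) m0 (sqr_ge0 (Lg c)) cpl0 L3_0 L4_0 L5_0 n1 u1 M0
    tlt1 tuf t2_le b0 g0 t0 ob og ot bM gM).
have u10 : 0 <= 1 + u by exact: le_trans u1.
have hS := sqrt_le_linear CO0 u10 hC.
rewrite aE invrK [leRHS]mulrDl; apply: lerD; last exact: hS.
by rewrite ler_peMr // mulr_ge0 // ltW.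
Qed.

(** [rhs_order] bounds everything by a multiple of (Delta / K) (1 + u). As T = K R, (Delta / K) u is
    exactly the statistical term, and Delta / K = R Delta / T becomes the second term through R <= 5
    W ln arg. *)
Lemma convergence_order :
  (avg_sq_grad D p ini K <= (rate_factor *
    (Num.sqrt Dd * sigma / Num.sqrt (n%:R * (K * rounds p)%:R)
     + W * Dd * ln arg / (K * rounds p)%:R))%:E)%E.
Proof.
have [[M1 ob og ot] [bM gM b0 g0 t0]] := orders; have [nb ng nt nu] := noises.
have [hb1 hb2] := beta_admissible m0 Lg0 n1 tl0 tl1 t1E betaE'.
have [hg1 hg2] := gamma_admissible m0 Lg0 n1 tl0 tl1 t1E gammaE'.
have rho_ge : cf c / mug c <= rho p by rewrite rhoE.
have dlE' : delta_l p = (1 + tom_l p)^-1 by rewrite dlE div1r.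
have duE' : delta_u p = (1 + tom_u p)^-1 by rewrite duE div1r.
apply: (le_trans (avg_sq_grad_le st rho_ge hb1 hb2 hg1 hg2 dlE' duE' aL aC K0)).
rewrite lee_fin cE s1E.
have sumE (d : nat) (v : 'I_n -> 'cV[R]_d) :
    \sum_i enorm (v i) ^+ 2 = n%:R * (n%:R^-1 * \sum_i enorm (v i) ^+ 2).
  by rewrite mulVKf // gt_eqF.
rewrite (sumE _ (fun i => EDy0 D p ini i - _)) (sumE _ (fun i => EDz0 D p ini i - _)).
rewrite -[n%:R^-1 * \sum_i enorm (EDy0 D p ini i - _) ^+ 2]/(Delmy D p ini).
rewrite -[n%:R^-1 * \sum_i enorm (EDz0 D p ini i - _) ^+ 2]/(Delmz D p ini).
have mu1 : 0 <= cpl / mug c by rewrite divr_ge0 // ltW.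
have mu2 : 0 <= Lg c ^+ 2 / mug c by rewrite divr_ge0 ?sqr_ge0 // ltW.
have LP1 : 0 <= 2 * LPhi c + (1 + CO) by rewrite addr_ge0 ?addr_ge0 // mulr_ge0 // ltW.
have rcE : rate_const = M + (2 * LPhi c + (1 + CO)) + cpl / mug c + Lg c ^+ 2 / mug c by [].
have rc1 : 1 <= rate_const by rewrite rcE; lra.
have rcM : M <= rate_const by rewrite rcE; lra.
have u10 : 0 <= 1 + u by rewrite addr_ge0 // ltW.
have up z : z <= M * (1 + u) -> z <= rate_const * (1 + u).
  by move=> h; apply: (le_trans h); exact: ler_wpM2r.
have upn z : z <= M * u * Dd -> z <= rate_const * u * Dd.
  move=> h; apply: (le_trans h); apply: ler_wpM2r; first exact: ltW.
  by apply: ler_wpM2r => //; exact: ltW.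
have [[hP hx hh hy] [hz hmy hmz]] := Del_ge D p ini.
have rng x : 0 <= x -> x <= Dd -> 0 <= x <= Dd by move=> -> ->.
have P0 : 0 <= DelPhi pb ini by case: st => [_ [_ [_ [_ [h _]]]]]; exact: h.
have rs0 : 0 <= rho1 * s by apply: mulr_ge0; [exact: le_trans r11|exact: ltW].
have tfl : 0 <= tom_l p * (1 + 4 * tom_l p) <= 5.
  have h3 : tom_l p * tom_l p <= 1 by rewrite -[1]mulr1 ler_pM.
  rewrite mulr_ge0 ?addr_ge0 ?mulr_ge0 //=; move: tl1 h3; lra.
have th1 : 0 < theta p <= 1 by rewrite t0 (theta_le1 thetaE').
have a0 : 0 < alpha p by rewrite aE invr_gt0.
have ha : (alpha p)^-1 <= rate_const * (1 + u).
  apply: (le_trans alpha_order); apply: ler_wpM2r => //; rewrite rcE; lra.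
have c1 : cpl / mug c <= rate_const by rewrite rcE; lra.
have c2 : Lg c ^+ 2 / mug c <= rate_const by rewrite rcE; lra.
have /andP[_ tuf2] := tuf.
have := rhs_order m0 (sqr_ge0 (Lg c)) cpl0 rc1 c1 c2 n1 Kr0 (ltW Dd0) (ltW u0) tfl tlt1 tu0 tuf2
  t2_le a0 b0 g0 th1 (ltW s0) rs0 ha (up _ ob) (up _ og) (up _ ot) (le_trans bM rcM) (le_trans gM rcM)
  (upn _ nb) (upn _ ng) (upn _ nt) (upn _ nu) (rng _ P0 hP) (rng _ (ltW Dx0) hx)
  (rng _ (avg0 _) hh) (rng _ (ltW Dy0) hy) (rng _ (ltW Dz0) hz) (rng _ (avg0 _) hmy)
  (rng _ (avg0 _) hmz).
move=> /le_trans; apply.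
have T0 : 0 < ((K * rounds p)%:R : R) by rewrite natrM mulr_gt0.
have e1 : Dd / K%:R * u = Num.sqrt Dd * sigma / Num.sqrt (n%:R * (K * rounds p)%:R).
  apply/eqP; rewrite -(eqrXn2 (n := 2)) //; last 2 first.
  - by apply: mulr_ge0; [apply: divr_ge0|]; exact: ltW.
  - by apply: divr_ge0; [apply: mulr_ge0; [exact: sqrtr_ge0|exact: ltW]|exact: sqrtr_ge0].
  have nT : 0 <= n%:R * (K * rounds p)%:R :> R by apply: ltW; exact: mulr_gt0.
  rewrite exprMn u2 !exprMn !exprVn (sqr_sqrtr (ltW Dd0)) (sqr_sqrtr nT) -sr natrM.
  by apply/eqP; field; rewrite !gt_eqF.
have e2 : Dd / K%:R <= 5 * (W * Dd * ln arg / (K * rounds p)%:R).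
  rewrite (_ : 5 * _ = 5 * W * ln arg * (Dd / (K * rounds p)%:R)); last by ring.
  apply: (@le_trans _ _ ((rounds p)%:R * (Dd / (K * rounds p)%:R))).
    by rewrite natrM le_eqVlt; apply/orP; left; apply/eqP; field; rewrite !gt_eqF.
  by apply: ler_wpM2r => //; apply: divr_ge0; exact: ltW.
have e3 : 0 <= Num.sqrt Dd * sigma / Num.sqrt (n%:R * (K * rounds p)%:R).
  by apply: divr_ge0; [apply: mulr_ge0; [exact: sqrtr_ge0|exact: ltW]|exact: sqrtr_ge0].
rewrite (mulrDr (Dd / K%:R)) mulr1 e1.
have h : Dd / K%:R + Num.sqrt Dd * sigma / Num.sqrt (n%:R * (K * rounds p)%:R) <=
  5 * (Num.sqrt Dd * sigma / Num.sqrt (n%:R * (K * rounds p)%:R)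
     + W * Dd * ln arg / (K * rounds p)%:R).
  by move: e2 e3; lra.
have k0 : 0 <= 900 * 900 * rate_const ^+ 2 :=
  mulr_ge0 (mulr_ge0 (ler0n _ _) (ler0n _ _)) (sqr_ge0 _).
apply: (le_trans (ler_wpM2l k0 h)).
have X0 := le_trans (addr_ge0 (divr_ge0 (ltW Dd0) (ltW Kr0)) e3) h.
rewrite pmulr_rge0 // in X0; move: X0.
move: (Num.sqrt Dd * sigma / _ + _) => X X0; rewrite /rate_factor [leRHS]mulrDl mul1r.
have -> : 900 * 900 * rate_const ^+ 2 * (5 * X) = 5 * (900 * 900) * rate_const ^+ 2 * X.
  by move: rate_const (900 * 900) => r k; ring.
by rewrite lerDr.
Qed.

End ConvergenceOrder.

(** In the second part the constant A of the order is fixed before n, the problem, sigma and K; it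
    depends on [c] and [ratio]. [ratio] makes Delta comparable with the three initial errors that
    the step sizes divide by. The logarithmic factor is written out as the logarithm of [log_arg],
    in which K does not occur. *)
Theorem theoremC5 (R : realType) :
  (forall (n dx dy : nat) (pb : problem R n dx dy)
      (cu : compressors R n dx) (cl : compressors R n dy) (D : draws pb cu cl)
      (c : constants R) (sigma : R) (p : params R) (ini : inits R n dx dy)
      (K : nat),
    standing c sigma D p ini ->
    (0 < K)%N ->
    cf c / mug c <= rho p ->
    ((beta p)%:E < mine (2 / (mug c + Lg c))%:E
        (bound_div (mug c * n%:R) (96 * tom_l p * tom1 p * Lg c ^+ 2)))%E ->
    ((gamma p)%:E <= mine (1 / Lg c)%:E
        (bound_div (mug c * n%:R) (432 * tom_l p * tom1 p * Lg c ^+ 2)))%E ->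
    delta_l p = (1 + tom_l p)^-1 ->
    delta_u p = (1 + tom_u p)^-1 ->
    alpha p <= Num.min (1 / (2 * LPhi c)) (C4 n c p) ->
    (avg_sq_grad D p ini K <=
      (2 * DelPhi pb ini / (K%:R * alpha p)
       + 2 * Delx pb ini / (K%:R * theta p)
       + 12 * tom_u p * (1 + tom_u p) * theta p * Delh D p ini / K%:R
       + 24 * tom2 p * (L2sq c p + 25 * kappa c ^+ 2 * L1sq c p) * Dely pb ini
           / (mug c * K%:R * beta p)
       + 48 * tom2 p * Lg c ^+ 2 * Delz pb ini / (mug c * K%:R * gamma p)
       + 48 * tom2 p * (1 + 6 * tom_l p * tom1 p)
           * (L2sq c p + 25 * kappa c ^+ 2 * L1sq c p) * beta p
           / (mug c * n%:R) * tsigsq sigma p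
       + (2 * theta p / n%:R + 36 * tom_u p * (1 + tom_u p) * theta p ^+ 2
          + 72 * tom2 p * (1 + 6 * tom_l p * tom1 p) * Lg c ^+ 2 * gamma p
              / (mug c * n%:R)) * tsig1sq sigma p
       + 48 * tom2 p * tom_l p * (1 + 4 * tom_l p)
           * (L2sq c p + 25 * kappa c ^+ 2 * L1sq c p) * beta p
           / (mug c * K%:R * n%:R ^+ 2)
           * \sum_i enorm (EDy0 D p ini i - my0 ini i) ^+ 2
       + 72 * tom2 p * tom_l p * (1 + 4 * tom_l p) * Lg c ^+ 2 * gamma p
           / (mug c * K%:R * n%:R ^+ 2)
           * \sum_i enorm (EDz0 D p ini i - mz0 ini i) ^+ 2)%:E)%E)
  /\
  (forall (c : constants R) (ratio : R), exists A : R, 0 < A /\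
    forall (n dx dy : nat) (pb : problem R n dx dy)
      (cu : compressors R n dx) (cl : compressors R n dy) (D : draws pb cu cl)
      (sigma : R) (p : params R) (ini : inits R n dx dy) (K : nat),
    standing c sigma D p ini ->
    (0 < K)%N ->
    0 < sigma ->
    [/\ 0 < Delx pb ini, 0 < Dely pb ini & 0 < Delz pb ini] ->
    [/\ Del D p ini <= ratio * Delx pb ini, Del D p ini <= ratio * Dely pb ini
      & Del D p ini <= ratio * Delz pb ini] ->
    (rounds p)%:Z = Num.ceil (4 * (1 + omega_u p + omega_l p)
                              * ln (log_arg sigma D p ini)) ->
    alpha p = (2 * LPhi c + (C4 n c p)^-1)^-1 ->
    rho p = cf c / mug c ->
    delta_l p = 1 / (1 + tom_l p) ->
    delta_u p = 1 / (1 + tom_u p) ->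
    beta p =
      ((mug c + Lg c) / 2 + 96 * tom_l p * tom1 p * Lg c ^+ 2 / (mug c * n%:R)
       + Num.sqrt (2 * tom_l p * (1 + 4 * tom_l p) * Delmy D p ini
                   / (n%:R * Dely pb ini))
       + Num.sqrt (2 * K%:R * tsigsq sigma p * (1 + 6 * tom_l p * tom1 p)
                   / (n%:R * Dely pb ini)))^-1 ->
    gamma p =
      (Lg c + 432 * tom_l p * tom1 p * Lg c ^+ 2 / (mug c * n%:R)
       + Num.sqrt (3 * tom_l p * (1 + 4 * tom_l p) * Delmz D p ini
                   / (2 * n%:R * Delz pb ini))
       + Num.sqrt (K%:R * tsig1sq sigma p * (1 + 6 * tom_l p * tom1 p)
                   / (n%:R * Delz pb ini)))^-1 ->
    theta p =
      (1 + Num.sqrt (6 * tom_u p * (1 + tom_u p) * Delh D p ini / Delx pb ini)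
       + Num.sqrt (K%:R * tsig1sq sigma p / (n%:R * Delx pb ini))
       + (18 * tom_u p * (1 + tom_u p) * K%:R * tsig1sq sigma p / Delx pb ini)
           `^ (3^-1))^-1 ->
    let T : R := (K * rounds p)%:R in
    (avg_sq_grad D p ini K <=
      (A * (Num.sqrt (Del D p ini) * sigma / Num.sqrt (n%:R * T)
            + (1 + omega_u p + omega_l p) * Del D p ini
                * ln (log_arg sigma D p ini) / T))%:E)%E).
Proof.
split.
  move=> n dx dy pb cu cl D c sigma p ini K st K0 rho_ge hb hg dlE duE ha.
  have [m0 L0 P0 _] := standing_constants st; have tl0 := tom_l_ge0 st.
  have a0 : 0 < alpha p by case: st => [_ [_ [_ [_ [_ [[]]]]]]].
  have t1 : 0 <= tom1 p.
    by rewrite addr_ge0 // mulr_ge0 // ?addr_ge0 // mulr_ge0.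
  have mn : 0 <= mug c * n%:R by rewrite mulr_ge0 // ltW.
  have tt (k : R) : 0 <= k -> 0 <= k * tom_l p * tom1 p * Lg c ^+ 2.
    by move=> k0; rewrite mulr_ge0 ?sqr_ge0 // mulr_ge0 // mulr_ge0.
  move: hb; rewrite lt_min => /andP[b1 b2].
  move: hg; rewrite le_min => /andP[g1 g2].
  move: ha; rewrite le_min => /andP[a1 a2].
  apply: (avg_sq_grad_le st rho_ge _ _ _ _ dlE duE _ _ K0).
  - by move: b1; rewrite lte_fin => /ltW.
  - exact: (bound_div_le mn (tt _ (ler0n _ _)) (ltW b2)).
  - by move: g1; rewrite lee_fin.
  - exact: (bound_div_le mn (tt _ (ler0n _ _)) g2).
  - by move: a1; rewrite ler_pdivlMr // mulr_gt0.
  (* Inversion sends 0 to 0, so the positivity of [alpha p], which is at most [C4], shows that the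
     root is nonzero. *)
  have C0 : 0 < Num.sqrt (C4_inv_sq n c p) by rewrite -invr_gt0; exact: lt_le_trans a2.
  have h : alpha p * Num.sqrt (C4_inv_sq n c p) <= 1.
    by move: a2; rewrite /C4 -[_^-1]div1r ler_pdivlMr.
  rewrite -[C4_inv_sq n c p]sqr_sqrtr; last by apply: ltW; rewrite -sqrtr_gt0.
  by rewrite -exprMn expr_le1 // mulr_ge0 // ltW.
move=> c ratio.
exists (rate_factor c ratio); split; first exact: rate_factor_gt0.
move=> n dx dy pb cu cl D sigma p ini K st K0 sg0 [Dx0 Dy0 Dz0] [rx ry rz].
move=> rE aE rhoE dlE duE bE gE tE.
have [m0 L0 P0 _] := standing_constants st.
(* Delta is at least Delta_x > 0 and at most [ratio] times it. *)
have ratio1 : 1 <= ratio.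
  have [[_ h _ _] _] := Del_ge D p ini.
  by rewrite -(ler_pM2r Dx0) mul1r (le_trans h).
exact: (convergence_order m0 L0 P0 ratio1 st K0 sg0 Dx0 Dy0 Dz0 rx ry rz rE aE rhoE dlE duE
  bE gE tE).
Qed.
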